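(* Let $M,N$ be positive integers with $MN\ge 2$, let $\Omega\subset\mathbf{C}$ be a domain, and let \[ H(z,y_1,y_2)=\alpha_{M+1,0}(z)\,y_1^{M+1}+\alpha_{0,N+1}(z)\,y_2^{N+1}+\sum_{(i,j)\in I}\alpha_{ij}(z)\,y_1^iy_2^j, \qquad I=\{(i,j)\in\mathbf{N}^2:\ i(N+1)+j(M+1)<(N+1)(M+1)\}, \] where all $\alpha_{ij}$ are analytic on $\Omega$. Consider the Hamiltonian system \[ y_1'=\frac{\partial H}{\partial y_2}=(N+1)\alpha_{0,N+1}(z)y_2^N+\sum_{(i,j)\in I}j\alpha_{ij}(z)y_1^iy_2^{j-1},\qquad y_2'=-\frac{\partial H}{\partial y_1}=-(M+1)\alpha_{M+1,0}(z)y_1^M-\sum_{(i,j)\in I}i\alpha_{ij}(z)y_1^{i-1}y_2^{j}. \] Let $\Phi=\{z_0\in\Omega:\alpha_{M+1,0}(z_0)=0\}\cup\{z_0\in\Omega:\alpha_{0,N+1}(z_0)=0\}$. Suppose that at every point $z_0\in\Omega\setminus\Phi$ the system admits formal series solutions \[ y_1(z)=\sum_{k=-N-1}^{\infty}c_{1,k}(z-z_0)^{\frac{k}{MN-1}},\qquad y_2(z)=\sum_{k=-M-1}^{\infty}c_{2,k}(z-z_0)^{\frac{k}{MN-1}} \] for every pair of values $(c_{1,-N-1},c_{2,-M-1})$ satisfying \[ c_{1,-N-1}^{MN-1}=-\left(\alpha_{0,N+1}(z_0)\,\alpha_{M+1,0}(z_0)^N\,(MN-1)^{N+1}\right)^{-1},\qquad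 c_{2,-M-1}=(MN-1)\,\alpha_{M+1,0}(z_0)\,c_{1,-N-1}^M. \] Let $\gamma\subset\Omega$ be a curve of finite length with endpoint $z_\infty\in\Omega\setminus\Phi$ such that a solution $(y_1,y_2)$ of the system can be analytically continued along $\gamma$ up to, but not including, $z_\infty$ (and cannot be analytically continued to $z_\infty$). Then, with $d=\gcd\{M+1,N+1,MN-1\}$, the solution is represented near $z_\infty$ by series \[ y_1(z)=\sum_{k=-\frac{N+1}{d}}^{\infty}C_{1,k}(z-z_\infty)^{\frac{kd}{MN-1}},\qquad y_2(z)=\sum_{k=-\frac{M+1}{d}}^{\infty}C_{2,k}(z-z_\infty)^{\frac{kd}{MN-1}}, \] convergent in some punctured, branched neighbourhood of $z_\infty$.
   Context: $\mathbf{N}$ includes $0$. A formal series solution means a formal series in powers of $(z-z_0)^{1/(MN-1)}$ which, after expanding the coefficients $\alpha_{ij}$ in Taylor series at $z_0$, satisfies the system identically as formal series. Singularities at points of $\Omega\setminus\Phi$ are called movable. *)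

(* Defs.v *)
From HB Require Import structures.
From mathcomp Require Import all_boot all_order all_algebra.
From mathcomp Require Import complex.
From mathcomp Require Import all_classical all_reals all_analysis.
Set Implicit Arguments. Unset Strict Implicit. Unset Printing Implicit Defensive.
Import Order.TTheory GRing.Theory Num.Theory.
Import numFieldNormedType.Exports.
Local Open Scope ring_scope.
Local Open Scope classical_set_scope.

(* The complex plane, as a normed module over itself (so that [is_derive z 1 f]
   is the complex derivative). Norms `|z| are (real, nonnegative) elements of C. *)
Definition Cx (R : realType) := (R[i])^o.

Section Defs.
Variable R : realType.
Local Notation C := (Cx R).

Definition cdisk (z0 r : C) : set C := [set z | `|z - z0| < r].

Definition cdomain (O : set C) := [/\ open O, connected O & O !=set0].

Definition taylor_at (f : C -> C) (z0 : C) (t : nat -> C) :=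
  exists2 r : C, 0 < r & forall z, `|z - z0| < r ->
    series (fun m => t m * (z - z0) ^+ m) @ \oo --> f z.

Definition analytic_on (O : set C) (f : C -> C) :=
  forall z0, O z0 -> exists t, taylor_at f z0 t.

Definition inI (M N i j : nat) : bool :=
  (i * N.+1 + j * M.+1 < N.+1 * M.+1)%N.

(* indices of coefficients actually present in H *)
Definition inS (M N i j : nat) : bool :=
  [|| inI M N i j, (i == M.+1) && (j == 0%N) | (i == 0%N) && (j == N.+1)].

Definition rhs1 (M N : nat) (alpha : nat -> nat -> C -> C) (z y1 y2 : C) : C :=
  N.+1%:R * alpha 0%N N.+1 z * y2 ^+ N +
  \sum_(i < M.+2) \sum_(j < N.+2 | inI M N i j)
     j%:R * alpha i j z * y1 ^+ i * y2 ^+ (j - 1).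

Definition rhs2 (M N : nat) (alpha : nat -> nat -> C -> C) (z y1 y2 : C) : C :=
  - (M.+1%:R * alpha M.+1 0%N z * y1 ^+ M) -
  \sum_(i < M.+2) \sum_(j < N.+2 | inI M N i j)
     i%:R * alpha i j z * y1 ^+ (i - 1) * y2 ^+ j.

Definition is_solution (M N : nat) (alpha : nat -> nat -> C -> C)
    (y1 y2 : C -> C) (U : set C) :=
  forall z, U z ->
    is_derive z (1 : C) y1 (rhs1 M N alpha z (y1 z) (y2 z)) /\
    is_derive z (1 : C) y2 (rhs2 M N alpha z (y1 z) (y2 z)).

(* ---------- formal Laurent series in s = (z - z0)^(1/p) ---------- *)
(* (v, c) represents s^(-v) * sum_(n >= 0) c_n s^n *)
Definition fls := (nat * (nat -> C))%type.

Definition fcoef (f : fls) (k : int) : C :=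
  match (k + (f.1)%:Z)%R with Posz n => f.2 n | Negz _ => 0 end.

Definition feq (f g : fls) := forall k : int, fcoef f k = fcoef g k.

Definition fzero : fls := (0%N, fun _ => 0).
Definition fone : fls := (0%N, fun n => if n == 0%N then 1 else 0).
Definition fadd (f g : fls) : fls :=
  let m := maxn f.1 g.1 in
  (m, fun n => fcoef f (n%:Z - m%:Z) + fcoef g (n%:Z - m%:Z)).
Definition fscale (a : C) (f : fls) : fls := (f.1, fun n => a * f.2 n).
Definition fmul (f g : fls) : fls :=
  ((f.1 + g.1)%N, fun n => \sum_(k < n.+1) f.2 k * g.2 (n - k)%N).
Definition fpow (f : fls) (n : nat) : fls := iter n (fmul f) fone.

(* d/dz, where z - z0 = s^p : d/dz s^k = (k/p) s^(k-p) *)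
Definition fderiv (p : nat) (f : fls) : fls :=
  ((f.1 + p)%N, fun n => f.2 n * ((n%:Z - (f.1)%:Z)%:~R / p%:R)).

(* the Taylor series sum_m t_m (z-z0)^m = sum_m t_m s^(m p) as a formal series *)
Definition ftaylor (p : nat) (t : nat -> C) : fls :=
  (0%N, fun n => if (p %| n)%N then t (n %/ p)%N else 0).

(* formal right-hand sides, t i j = Taylor coefficients of alpha i j at z0 *)
Definition frhs1 (M N p : nat) (t : nat -> nat -> nat -> C) (y1 y2 : fls) : fls :=
  fadd (fscale N.+1%:R (fmul (ftaylor p (t 0%N N.+1)) (fpow y2 N)))
    (\big[fadd/fzero]_(i < M.+2) \big[fadd/fzero]_(j < N.+2 | inI M N i j)
       fscale j%:R (fmul (ftaylor p (t i j)) (fmul (fpow y1 i) (fpow y2 (j - 1))))).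

Definition frhs2 (M N p : nat) (t : nat -> nat -> nat -> C) (y1 y2 : fls) : fls :=
  fadd (fscale (- M.+1%:R) (fmul (ftaylor p (t M.+1 0%N)) (fpow y1 M)))
    (\big[fadd/fzero]_(i < M.+2) \big[fadd/fzero]_(j < N.+2 | inI M N i j)
       fscale (- i%:R) (fmul (ftaylor p (t i j)) (fmul (fpow y1 (i - 1)) (fpow y2 j)))).

Definition formal_solution (M N p : nat) (t : nat -> nat -> nat -> C)
    (y1 y2 : fls) :=
  feq (fderiv p y1) (frhs1 M N p t y1 y2) /\ feq (fderiv p y2) (frhs2 M N p t y1 y2).

Definition finite_length (g : R -> C) :=
  exists L : C, forall (n : nat) (s : nat -> R),
    (forall k, (k <= n)%N -> 0 <= s k <= 1) ->
    (forall k, (k < n)%N -> s k <= s k.+1) ->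
    \sum_(k < n) `|g (s k.+1) - g (s k)| <= L.

(* analytic continuation of a solution along g on [0,1): function elements
   (disk of centre g t and radius r t, solution (f1 t, f2 t)) *)
Definition continuation_upto (M N : nat) (alpha : nat -> nat -> C -> C)
    (O : set C) (g : R -> C) (r : R -> C) (f1 f2 : R -> C -> C) :=
  (forall t, 0 <= t < 1 ->
     [/\ 0 < r t, cdisk (g t) (r t) `<=` O &
         is_solution M N alpha (f1 t) (f2 t) (cdisk (g t) (r t))]) /\
  (forall t, 0 <= t < 1 -> exists2 del : R, 0 < del & forall s, 0 <= s < 1 ->
     `|s - t| < del -> `|g s - g t| < r t /\
     forall z, `|z - g s| < r s -> `|z - g t| < r t ->
       f1 s z = f1 t z /\ f2 s z = f2 t z).

Definition continues_to_end (M N : nat) (alpha : nat -> nat -> C -> C)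
    (O : set C) (g : R -> C) (r : R -> C) (f1 f2 : R -> C -> C) :=
  exists (rho : C) (h1 h2 : C -> C),
    [/\ 0 < rho, cdisk (g 1) rho `<=` O,
        is_solution M N alpha h1 h2 (cdisk (g 1) rho) &
        exists2 del : R, 0 < del & forall s, 0 <= s < 1 -> 1 - del < s ->
          `|g s - g 1| < rho /\
          forall z, `|z - g s| < r s -> `|z - g 1| < rho ->
            f1 s z = h1 z /\ f2 s z = h2 z].

End Defs.

(* Main.v *)
(** Give y1 weight N+1 and y2 weight M+1. Along solutions H' = H_z, and subtracting Laurent
    polynomials of lower weight from H one reaches W = H + G with W' = P W + Q, where P and Q
    have weight at most 0. The only obstruction, at weight MN-1, is the one that produces
    logarithms; it is excluded by inserting the series solutions of the hypothesis, which
    converge by a Briot-Bouquet argument. A solution that cannot be continued is unbounded at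
    the end of the path, and a Gronwall estimate along the path, for W where the top weight part
    of H is relatively small and for H elsewhere, shows that W stays bounded. Hence
    y1^(M+1) / y2^(N+1) converges, and by connectedness so does its d-th root
    y1^((M+1)/d) / y2^((N+1)/d). The series solutions at the end point with this limit have one
    free parameter, on which the limit of W depends affinely; choose it so that this limit is a
    cluster value of W along the path. Read the variable w of the series off a monomial of
    weight -d in (y1, y2). The deviations of z from z1 + w^q, q = (MN-1)/d, and of W from its
    value on the series then satisfy a linear differential inequality and have 0 as a cluster
    value, so they vanish identically. *)
Require Import Defs.
From HB Require Import structures.
From mathcomp Require Import all_boot all_order all_algebra all_field.
From mathcomp Require Import complex.
From mathcomp Require Import all_classical all_reals all_analysis.
From mathcomp Require Import ring lra zify.
Import Order.TTheory GRing.Theory Num.Theory.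
Import numFieldNormedType.Exports.
Local Open Scope ring_scope.
Local Open Scope classical_set_scope.
Set Implicit Arguments. Unset Strict Implicit. Unset Printing Implicit Defensive.

(** Weight MN-1 shapes the argument: a monomial of weight n is removed by dividing by n-(MN-1). What
    survives there is a combination of d monomials with coefficients k_l(z), l < d. On a series
    solution at z0 with leading coefficients (c1, c2) it becomes, up to a nonzero factor, the sum of
    the k_l(z0) tau^l, where tau = c1^a1 / c2^b1, a1 = (M+1)/d and b1 = (N+1)/d. Every d-th root tau
    of -alpha_{0,N+1}/alpha_{M+1,0} occurs, so the formal solutions at z0 give d independent
    conditions, and their presence at all points off Phi makes the k_l vanish identically. The path
    is merely rectifiable, so differential inequalities are stated as bounds of increments by arc
    length. The uniqueness arguments use them from late parameters back to earlier ones, which is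
    why a cluster value can replace a limit at the end point. In the comparison with the series both
    y1 and y2 tend to infinity, so z and W serve as coordinates: the monomial of weight -d fixes w,
    and the identity for W divided by y2^(N+1) recovers the remaining quotient. *)

Section NormC.
Variable R : realType.
Local Notation C := (Cx R).

Implicit Types x y z w : C.

(** The norm [|z|] is an element of C; the real-valued modulus puts all estimates in an ordered
    field, where [lra] and [nra] apply. *)
Definition nm (z : C) : R := Normc.normc z.
Definition rc (x : R) : C := real_complex R x.

Lemma nmE (z : C) : `|z| = rc (nm z). Proof. by []. Qed.
Lemma nm_ge0 z : 0 <= nm z.
Proof. by rewrite -ler0c; exact: (normr_ge0 (z : R[i])). Qed.
Lemma nm0 : nm 0 = 0. Proof. exact: Normc.normc0. Qed.
Lemma nm1 : nm 1 = 1. Proof. exact: Normc.normc1. Qed.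
Lemma nmM x y : nm (x * y) = nm x * nm y. Proof. exact: Normc.normcM. Qed.
Lemma nmV x : nm x^-1 = (nm x)^-1. Proof. exact: Normc.normcV. Qed.
Lemma nmN x : nm (- x) = nm x. Proof. exact: normcN. Qed.
Lemma nmD x y : nm (x + y) <= nm x + nm y. Proof. exact: le_normcD. Qed.
Lemma nmB x y : nm (x - y) <= nm x + nm y.
Proof. by rewrite -(nmN y); exact: nmD. Qed.
Lemma nmBC x y : nm (x - y) = nm (y - x). Proof. by rewrite -nmN opprB. Qed.
Lemma nm_eq0 x : (nm x == 0) = (x == 0).
Proof. by apply/eqP/eqP => [/Normc.eq0_normc|->]; rewrite ?nm0. Qed.
Lemma nm_gt0 x : (0 < nm x) = (x != 0).
Proof. by rewrite lt0r nm_ge0 andbT nm_eq0. Qed.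
Lemma nmX x n : nm (x ^+ n) = nm x ^+ n.
Proof. by elim: n => [|n IH]; rewrite ?expr0 ?nm1 // !exprS nmM IH. Qed.
Lemma nmXz x (n : int) : nm (x ^ n) = nm x ^ n.
Proof. by case: n => n; rewrite ?NegzE -?exprnP -?exprnN ?nmV nmX. Qed.
Lemma nm_rc (a : R) : nm (rc a) = `|a|.
Proof. by rewrite /nm /rc /= expr0n /= addr0 sqrtr_sqr. Qed.
Lemma nm_nat n : nm n%:R = n%:R.
Proof. by rewrite -(rmorph_nat (real_complex R)) nm_rc ger0_norm. Qed.
Lemma nmD3 x y z : nm (x - z) <= nm (x - y) + nm (y - z).
Proof. by rewrite -[x - z](subrKA y) nmD. Qed.
Lemma nm_sub x y : nm x - nm y <= nm (x - y).
Proof. by rewrite lerBlDr -{1}(subrK y x); exact: nmD. Qed.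
Lemma nm_dist x y : `|nm x - nm y| <= nm (x - y).
Proof.
rewrite ler_norml nm_sub andbT.
have := nm_sub y x; rewrite nmBC; lra.
Qed.
Lemma nm_sum (I : Type) (s : seq I) (P : pred I) (F : I -> C) :
  nm (\sum_(i <- s | P i) F i) <= \sum_(i <- s | P i) nm (F i).
Proof.
apply: (big_ind2 (fun x (y : R) => nm x <= y)) => //; first by rewrite nm0.
by move=> x1 x2 y1 y2 h1 h2; apply: le_trans (nmD _ _) _; exact: lerD.
Qed.
Lemma nmRe x : `|complex.Re x| <= nm x.
Proof. by rewrite -lecR; exact: (normc_ge_Re x). Qed.
Lemma nmIm x : `|complex.Im x| <= nm x.
Proof.
have -> : nm x = nm (x * 'i%C).
  by rewrite nmM /nm /= expr0n /= add0r expr1n sqrtr1 mulr1.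
have <- : `|complex.Re (x * 'i%C)| = `|complex.Im x| by rewrite ReiNIm normrN.
exact: nmRe.
Qed.
Lemma nm_ReIm x : nm x <= `|complex.Re x| + `|complex.Im x|.
Proof.
rewrite {1}(complexE x); apply: le_trans (nmD _ _) _.
rewrite nmM (nm_rc (complex.Re x)) (nm_rc (complex.Im x)).
by rewrite /nm /= expr0n /= add0r expr1n sqrtr1 mul1r.
Qed.
Lemma lt0C (x : C) : 0 < x -> exists2 e : R, 0 < e & x = rc e.
Proof.
move=> x0; exists (nm x); first by rewrite nm_gt0 gt_eqF.
by rewrite -nmE gtr0_norm.
Qed.
Lemma rc_gt0 (e : R) : (0 < rc e) = (0 < e). Proof. exact: (ltcR 0 e). Qed.
Lemma nm_lt x (e : R) : (`|x| < rc e) = (nm x < e). Proof. exact: ltcR. Qed.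

Lemma nearCP (z : C) (P : C -> Prop) :
  (\forall w \near z, P w) <-> exists2 e : R, 0 < e & forall w, nm (w - z) < e -> P w.
Proof.
split=> [/nbhs_ballP[e /= e0 H]|[e e0 H]].
  have [d d0 de] := lt0C e0; exists d => // w wd; apply: H.
  by rewrite /ball /= -normrN opprB de nm_lt.
apply/nbhs_ballP; exists (rc e) => /=; first by rewrite rc_gt0.
move=> w; rewrite /ball /= -normrN opprB nm_lt; exact: H.
Qed.

Lemma cvgCP (T : Type) (F : set_system T) (FF : Filter F) (f : T -> C) (l : C) :
  f @ F --> l <-> forall e : R, 0 < e -> \forall x \near F, nm (f x - l) < e.
Proof.
split=> [H e e0|H].
  have : nbhs l (fun w => nm (w - l) < e) by apply/nearCP; exists e.
  by move/H.
by move=> A /nearCP[e e0 HA]; apply: filterS (H e e0) => x; exact: HA.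
Qed.
End NormC.

(** * Complex derivatives *)

Section Der.
Variable R : realType.
Local Notation C := (Cx R).
Implicit Types (f g : C -> C) (z w l : C).

(** Neighbourhoods with an explicit real radius, equivalent to [\near] by [nearCP]. *)
Definition nr z (P : C -> Prop) :=
  exists2 e : R, 0 < e & forall w, nm (w - z) < e -> P w.
Lemma nrW z (P : C -> Prop) : (forall w, P w) -> nr z P.
Proof. by move=> H; exists 1. Qed.
Lemma nrS z (P Q : C -> Prop) : (forall w, P w -> Q w) -> nr z P -> nr z Q.
Proof. by move=> PQ [e e0 H]; exists e => // w /H /PQ. Qed.
Lemma nrI z (P Q : C -> Prop) : nr z P -> nr z Q -> nr z (fun w => P w /\ Q w).
Proof.
move=> [e e0 HP] [d d0 HQ]; exists (Num.min e d); first by rewrite lt_min e0.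
by move=> w; rewrite lt_min => /andP[/HP ? /HQ ?].
Qed.
Lemma nrS2 z (P Q S : C -> Prop) : (forall w, P w -> Q w -> S w) ->
  nr z P -> nr z Q -> nr z S.
Proof. by move=> H hP hQ; apply: nrS (nrI hP hQ) => w [/H]; apply. Qed.
Lemma nr_at z (P : C -> Prop) : nr z P -> P z.
Proof. by case=> e e0; apply; rewrite subrr nm0. Qed.
Lemma nr_lt z (e : R) : 0 < e -> nr z (fun w => nm (w - z) < e).
Proof. by move=> e0; exists e. Qed.
Lemma nr_nr z (P : C -> Prop) : nr z P -> nr z (fun w => nr w P).
Proof.
move=> [e e0 H]; exists e => // w hw; exists (e - nm (w - z)); first lra.
move=> v hv; apply: H; have := nmD3 v w z; lra.
Qed.

Definition ctn f z := forall e : R, 0 < e -> nr z (fun w => nm (f w - f z) < e).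

Lemma ctn_cst (c : C) z : ctn (fun=> c) z.
Proof. by move=> e e0; apply: nrW => w; rewrite subrr nm0. Qed.
Lemma ctn_id z : ctn id z. Proof. by move=> e e0; exists e. Qed.
Lemma ctnD f g z : ctn f z -> ctn g z -> ctn (fun w => f w + g w) z.
Proof.
move=> cf cg e e0; have e2 : 0 < e / 2 by lra.
apply: nrS2 (cf _ e2) (cg _ e2) => w h1 h2.
have -> : f w + g w - (f z + g z) = (f w - f z) + (g w - g z) by ring.
have := nmD (f w - f z) (g w - g z); lra.
Qed.
Lemma ctnN f z : ctn f z -> ctn (fun w => - f w) z.
Proof. by move=> cf e e0; apply: nrS (cf e e0) => w; rewrite -opprD nmN. Qed.
Lemma ctnB f g z : ctn f z -> ctn g z -> ctn (fun w => f w - g w) z.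
Proof. by move=> cf /ctnN; exact: ctnD. Qed.
Lemma ctnM f g z : ctn f z -> ctn g z -> ctn (fun w => f w * g w) z.
Proof.
move=> cf cg e e0.
pose K := nm (f z) + nm (g z) + 1.
have K0 : 0 < K by rewrite /K; have := nm_ge0 (f z); have := nm_ge0 (g z); lra.
pose d := Num.min 1 (e / (2 * K)).
have d0 : 0 < d by rewrite lt_min ltr01 divr_gt0 // mulr_gt0.
have dK : d * (2 * K) <= e by rewrite -ler_pdivlMr ?mulr_gt0 // /d ge_min lexx orbT.
have d1 : d <= 1 by rewrite /d ge_min lexx.
apply: nrS2 (cf _ d0) (cg _ d0) => w h1 h2.
have -> : f w * g w - f z * g z = (f w - f z) * (g w - g z) + (f w - f z) * g z
  + f z * (g w - g z) by ring.
have a := nmD ((f w - f z) * (g w - g z) + (f w - f z) * g z) (f z * (g w - g z)).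
have b := nmD ((f w - f z) * (g w - g z)) ((f w - f z) * g z).
move: a b; rewrite !nmM.
have := nm_ge0 (f z); have := nm_ge0 (g z); have := nm_ge0 (f w - f z);
have := nm_ge0 (g w - g z).
move: h1 h2 dK; rewrite /K; set A := nm (f w - f z); set B := nm (g w - g z).
set F := nm (f z); set G := nm (g z) => h1 h2 dK B0 A0 G0 F0 a b.
have : A * B <= d * 1 by apply: ler_pM => //; lra.
have : A * G <= d * G by rewrite ler_wpM2r //; lra.
have : F * B <= F * d by rewrite ler_wpM2l //; lra.
nra.
Qed.
Lemma ctn_near f z (P : C -> Prop) : ctn f z -> nr (f z) P -> nr z (fun w => P (f w)).
Proof. by move=> cf [e e0 H]; apply: nrS (cf e e0) => w; exact: H. Qed.
Lemma ctn_comp f g z : ctn f z -> ctn g (f z) -> ctn (fun w => g (f w)) z.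
Proof. move=> cf cg e e0; exact: (ctn_near cf (cg e e0)). Qed.
Lemma ctn_ext f g z : nr z (fun w => f w = g w) -> ctn f z -> ctn g z.
Proof.
move=> e cf d d0; have e0 := nr_at e.
by apply: nrS2 e (cf d d0) => w <-; rewrite e0.
Qed.
Lemma ctn_close f z (e : R) : ctn f z -> 0 < e -> nr z (fun w => nm (f w - f z) < e).
Proof. by move=> cf e0; exact: cf. Qed.
Lemma ctn_nm_lt f z (k : R) : ctn f z -> nm (f z) < k -> nr z (fun w => nm (f w) < k).
Proof.
move=> cf fk; have e0 : 0 < k - nm (f z) by lra.
apply: nrS (cf _ e0) => w; have := nm_sub (f w) (f z); lra.
Qed.
Lemma ctn_nm_gt f z (k : R) : ctn f z -> k < nm (f z) -> nr z (fun w => k < nm (f w)).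
Proof.
move=> cf fk; have e0 : 0 < nm (f z) - k by lra.
apply: nrS (cf _ e0) => w; rewrite nmBC; have := nm_sub (f z) (f w); lra.
Qed.
Lemma ctn_neq0 f z : ctn f z -> f z != 0 -> nr z (fun w => f w != 0).
Proof.
move=> cf; rewrite -nm_gt0 => f0.
by apply: nrS (ctn_nm_gt cf f0) => w; rewrite nm_gt0.
Qed.
Lemma ctnV f z : f z != 0 -> ctn f z -> ctn (fun w => (f w)^-1) z.
Proof.
move=> f0 cf e e0; have n0 : 0 < nm (f z) by rewrite nm_gt0.
have h0 : nm (f z) / 2 < nm (f z) by lra.
have d0 : 0 < e * (nm (f z) / 2) * nm (f z) by rewrite !mulr_gt0 //; lra.
apply: nrS2 (ctn_nm_gt cf h0) (cf _ d0) => w h1 h2.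
have fw : f w != 0 by rewrite -nm_gt0; lra.
have -> : (f w)^-1 - (f z)^-1 = - (f w - f z) / (f w * f z).
  by field; rewrite fw f0.
rewrite nmM nmV nmN nmM ltr_pdivrMr; last by rewrite mulr_gt0 // nm_gt0.
apply: (lt_le_trans h2); rewrite -mulrA ler_pM2l // ler_pM2r //; lra.
Qed.

(* Caratheodory's form of the derivative. *)
Definition der f z l := exists2 phi : C -> C, ctn phi z &
  phi z = l /\ nr z (fun w => f w = f z + (w - z) * phi w).

Lemma der_ctn f z l : der f z l -> ctn f z.
Proof.
case=> phi cphi [_ /[dup] e /nr_at e0].
apply: (@ctn_ext (fun w => f z + (w - z) * phi w)).
  by apply: nrS e => w ->.
apply: ctnD; first exact: ctn_cst.
apply: ctnM => //; apply: ctnB; [exact: ctn_id|exact: ctn_cst].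
Qed.

Lemma der_ext f g z l : nr z (fun w => f w = g w) -> der f z l -> der g z l.
Proof.
move=> e [phi cphi [pz H]]; exists phi => //; split=> //.
have <- := nr_at e.
by apply: nrS2 e H => w <-.
Qed.
Lemma der_eq f z l l' : l = l' -> der f z l -> der f z l'. Proof. by move->. Qed.

Lemma der_cst (c : C) z : der (fun=> c) z 0.
Proof.
exists (fun=> 0); first exact: ctn_cst.
by split=> //; apply: nrW => w; rewrite mulr0 addr0.
Qed.
Lemma der_id z : der id z 1.
Proof.
exists (fun=> 1); first exact: ctn_cst.
by split=> //; apply: nrW => w; rewrite mulr1 addrC subrK.
Qed.
Lemma derD f g z l m : der f z l -> der g z m -> der (fun w => f w + g w) z (l + m).
Proof.
move=> [phi cp [pz ep]] [psi cq [qz eq]].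
exists (fun w => phi w + psi w); first exact: ctnD.
split; first by rewrite pz qz.
by apply: nrS2 ep eq => w -> ->; ring.
Qed.
Lemma derM f g z l m : der f z l -> der g z m ->
  der (fun w => f w * g w) z (l * g z + f z * m).
Proof.
move=> df dg; have cg := der_ctn dg; case: dg => psi cq [qz eq].
case: df => phi cp [pz ep].
exists (fun w => phi w * g w + f z * psi w).
  by apply: ctnD; apply: ctnM => //; exact: ctn_cst.
split; first by rewrite pz qz.
apply: nrS2 ep eq => w ew hg.
have -> : f w * g w = f z * g z + (f w - f z) * g w + f z * (g w - g z) by ring.
by rewrite {1}ew [in X in f z * (X - _)]hg; ring.
Qed.
Lemma derZ (c : C) f z l : der f z l -> der (fun w => c * f w) z (c * l).
Proof.
by move=> df; have := derM (der_cst c z) df; apply: der_eq; rewrite mul0r add0r.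
Qed.
Lemma derN f z l : der f z l -> der (fun w => - f w) z (- l).
Proof.
move=> /(derZ (-1)); rewrite mulN1r; apply: der_ext.
by apply: nrW => w; rewrite mulN1r.
Qed.
Lemma derB f g z l m : der f z l -> der g z m -> der (fun w => f w - g w) z (l - m).
Proof. by move=> df dg; exact: (derD df (derN dg)). Qed.
Lemma der_comp f g z l m : der f z l -> der g (f z) m ->
  der (fun w => g (f w)) z (m * l).
Proof.
move=> df [psi cq [qz eq]]; have cf := der_ctn df.
case: df => phi cp [pz ep].
exists (fun w => psi (f w) * phi w).
  by apply: ctnM => //; exact: ctn_comp.
split; first by rewrite pz qz.
have eq' := ctn_near cf eq.
apply: nrS2 ep eq' => w ef ->; rewrite {1}ef; ring.
Qed.
Lemma derV f z l : f z != 0 -> der f z l ->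
  der (fun w => (f w)^-1) z (- l / (f z) ^+ 2).
Proof.
move=> f0 df; have cf := der_ctn df; case: (df) => phi cp [pz ep].
exists (fun w => - phi w * ((f w)^-1 * (f z)^-1)).
  apply: ctnM; first exact: ctnN.
  by apply: ctnM; [exact: ctnV|exact: ctn_cst].
split; first by rewrite pz -invfM -expr2.
apply: nrS2 ep (ctn_neq0 cf f0) => w ew fw.
have e1 : phi w * (w - z) = f w - f z by rewrite ew; ring.
have -> : (w - z) * (- phi w * ((f w)^-1 * (f z)^-1)) = - (f w - f z) / (f w * f z).
  by rewrite -e1; field; rewrite fw f0.
by field; rewrite fw f0.
Qed.
Lemma derX f z l n : der f z l -> der (fun w => f w ^+ n) z (n%:R * f z ^+ (n - 1) * l).
Proof.
move=> df; elim: n => [|n IH].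
  by rewrite !mul0r; exact: der_cst.
have := derM df IH; rewrite subn1 /= => H.
apply: der_eq (der_ext _ H); last by apply: nrW => w; rewrite exprS.
case: n {IH H} => [|n]; first by rewrite !mul0r mulr0 addr0 expr0 !mul1r mulr1.
rewrite subn1 /= [n.+2%:R]mulrSr [f z ^+ n.+1]exprS; ring.
Qed.
Lemma derXz f z l (n : int) : f z != 0 -> der f z l ->
  der (fun w => f w ^ n) z (n%:~R * f z ^ (n - 1) * l).
Proof.
move=> f0 df; case: n => n.
  apply: der_eq (derX n df); case: n => [|n]; first by rewrite !mul0r.
  by rewrite subn1 /= -addn1 PoszD addrK -exprnP -pmulrn.
have fn0 : f z ^+ n.+1 != 0 by rewrite expf_neq0.
apply: (@der_ext (fun w => (f w ^+ n.+1)^-1)); first by apply: nrW => w; rewrite NegzE -exprnN.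
have := derX n.+1 df => /(derV (f := fun w => f w ^+ n.+1) fn0).
apply: der_eq.
rewrite NegzE -opprD -PoszD addn1 subn1 /= -exprnN mulrNz -pmulrn.
have -> : f z ^+ n.+1 ^+ 2 = f z ^+ n * f z ^+ n.+2 by rewrite -exprM -exprD; congr (_ ^+ _); lia.
have := expf_neq0 n f0; have := expf_neq0 n.+2 f0.
by move: (f z ^+ n) (f z ^+ n.+2) => A B B0 A0; field; rewrite A0 B0.
Qed.
Lemma der_unique f z l m : der f z l -> der f z m -> l = m.
Proof.
move=> [phi cp [pz ep]] [psi cq [qz eq]].
apply/eqP; rewrite -subr_eq0 -nm_eq0; apply/negPn/negP => n0.
have e0 : 0 < nm (l - m) by rewrite lt0r n0 nm_ge0.
have := ctn_close (ctnD cp (ctnN cq)) e0.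
have [d1 d10 H1] := ep; have [d2 d20 H2] := eq.
move=> [d3 d30 H3].
pose d := Num.min d1 (Num.min d2 d3) / 2.
have d0 : 0 < d by rewrite divr_gt0 // !lt_min d10 d20 d30.
have dd : d < Num.min d1 (Num.min d2 d3).
  by rewrite ltr_pdivrMr // ltr_pMr ?ltr1n // !lt_min d10 d20 d30.
move: dd; rewrite !lt_min => /and3P[dd1 dd2 dd3].
pose w := z + rc d.
have wz : w - z = rc d by rewrite /w addrC addKr.
have nw : nm (w - z) = d by rewrite wz nm_rc gtr0_norm.
have := H1 w; have := H2 w; have := H3 w; rewrite nw => /(_ dd3) + /(_ dd2) h2 /(_ dd1) h1.
have wz0 : w - z != 0 by rewrite -nm_gt0 nw.
have -> : phi w = psi w by apply: (mulfI wz0); apply: (addrI (f z)); rewrite -h1 -h2.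
by rewrite pz qz subrr sub0r nmN ltxx.
Qed.

Lemma der_lip f z l (k : R) : der f z l -> nm l < k ->
  nr z (fun w => nm (f w - f z) <= k * nm (w - z)).
Proof.
move=> [phi cp [pz ep]] lk.
have := ctn_nm_lt cp; rewrite pz => /(_ _ lk) H.
apply: nrS2 ep H => w -> hw.
by rewrite addrC addKr nmM mulrC ler_wpM2r ?nm_ge0 // ltW.
Qed.

(** The form in which power series are differentiated: the second-order remainders of the terms add
    up to a quadratic one. *)
Lemma der_quad f z l (k : R) :
  nr z (fun w => nm (f w - f z - l * (w - z)) <= k * nm (w - z) ^+ 2) -> der f z l.
Proof.
move=> H; pose phi w := if w == z then l else (f w - f z) / (w - z).
exists phi; last first.
  split; first by rewrite /phi eqxx.
  apply: nrW => w; rewrite /phi; case: eqP => [->|/eqP wz].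
    by rewrite subrr mul0r addr0.
  by rewrite mulrCA divff ?mulr1 ?subr_eq0 // addrC subrK.
move=> e e0; rewrite {2}/phi eqxx.
pose k' := `|k| + 1; have k0 : 0 < k' by rewrite /k' ltr_pwDr.
have d0 : 0 < e / k' by exact: divr_gt0.
apply: nrS2 H (@nr_lt z _ d0) => w Hw wd.
rewrite /phi; case: eqP => [_|/eqP wz]; first by rewrite subrr nm0.
have wz0 : w - z != 0 by rewrite subr_eq0.
move: Hw.
have -> : (f w - f z) / (w - z) - l = (f w - f z - l * (w - z)) / (w - z).
  by rewrite [RHS]mulrBl -mulrA divff // mulr1.
rewrite nmM nmV ltr_pdivrMr ?nm_gt0 // => h; apply: le_lt_trans h _.
rewrite expr2 mulrA ltr_pM2r ?nm_gt0 //.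
apply: (@le_lt_trans _ _ (k' * nm (w - z))).
  by rewrite ler_wpM2r ?nm_ge0 // /k'; apply: le_trans (ler_norm _) _; rewrite lerDl.
by rewrite mulrC -ltr_pdivlMr.
Qed.

Lemma is_derive_der f z l : is_derive z (1 : C) f l <-> der f z l.
Proof.
split.
- move=> [dv dl].
  pose phi w := if w == z then l else (f w - f z) / (w - z).
  exists phi; last first.
    split; first by rewrite /phi eqxx.
    apply: nrW => w; rewrite /phi; case: eqP => [->|/eqP wz].
      by rewrite subrr mul0r addr0.
    by rewrite mulrCA divff ?mulr1 ?subr_eq0 // addrC subrK.
  have H : h^-1 *: ((f \o shift z) (h *: (1 : C)) - f z) @[h --> (0 : (R[i] : numFieldType))^'] --> l.
    by rewrite -dl; exact: dv.
  move=> e e0; move/cvgCP: H => /(_ e e0).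
  rewrite /phi eqxx.
  move=> /nbhs_ballP[d0' /= /lt0C[d d0 ->] Hd].
  exists d => // w wd; case: eqP => [_|/eqP wz]; first by rewrite subrr nm0.
  have := Hd (w - z).
  rewrite /ball /= sub0r normrN nm_lt subr_eq0 => /(_ wd wz).
  by rewrite /= /GRing.scale /= mulr1 subrK [X in nm (X - _)]mulrC.
- move=> [phi cp [pz ep]].
  have H : h^-1 *: ((f \o shift z) (h *: (1 : C)) - f z) @[h --> (0 : (R[i] : numFieldType))^'] --> l.
    apply/cvgCP => e e0.
    have := ctn_close cp e0; rewrite pz => -[d1 d10 H1].
    move: ep => [d2 d20 H2].
    apply/nbhs_ballP; exists (rc (Num.min d1 d2)) => /=; first by rewrite rc_gt0 lt_min d10.
    move=> h; rewrite /ball /= sub0r normrN nm_lt lt_min => /andP[h1 h2] h0.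
    rewrite /= /GRing.scale /= mulr1.
    have E : h + z - z = h by rewrite addrK.
    rewrite (H2 (h + z)) ?E //.
    rewrite [f z + _ - _]addrAC subrr add0r mulrA mulVf // mul1r.
    by apply: H1; rewrite E.
  have cv : cvg (h^-1 *: ((f \o shift z) (h *: (1 : C)) - f z) @[h --> (0 : (R[i] : numFieldType))^']).
    by apply/cvg_ex; exists l.
  split; first exact: cv.
  exact: (cvg_lim (@norm_hausdorff _ _) H).
Qed.
End Der.

(** * Gronwall estimates along a path *)

Section PathGronwall.
Variable R : realType.
Local Notation C := (Cx R).
Implicit Types (a b s t c e : R).

(** Relative neighbourhoods in [a, b], so that the end points need no separate treatment. *)
Definition pnr a b t (P : R -> Prop) :=
  exists2 e : R, 0 < e & forall s, a <= s <= b -> `|s - t| < e -> P s.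

Lemma pnrS a b t (P Q : R -> Prop) : (forall s, P s -> Q s) -> pnr a b t P -> pnr a b t Q.
Proof. by move=> PQ [e e0 H]; exists e => // s s1 s2; apply/PQ/H. Qed.
Lemma pnrS2 a b t (P Q S : R -> Prop) : (forall s, P s -> Q s -> S s) ->
  pnr a b t P -> pnr a b t Q -> pnr a b t S.
Proof.
move=> H [e e0 HP] [d d0 HQ]; exists (Num.min e d); first by rewrite lt_min e0.
move=> s ss; rewrite lt_min => /andP[s1 s2]; apply: H; [exact: HP|exact: HQ].
Qed.
Lemma pnr_sub a b a' b' t (P : R -> Prop) : a <= a' -> b' <= b ->
  pnr a b t P -> pnr a' b' t P.
Proof. move=> aa bb [e e0 H]; exists e => // s /andP[s1 s2]; apply: H; lra. Qed.

(** There is no derivative to integrate. The supremum c of the parameters up to which the bound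
    holds satisfies it too, by the local bound to the left of c, and the local bound to the right
    would carry it past any c < b. *)
Lemma path_increment a b (Psi V : R -> R) : a <= b ->
  (forall s t, a <= s -> s <= t -> t <= b -> V s <= V t) ->
  (forall t, a <= t <= b -> pnr a b t (fun s => `|Psi s - Psi t| <= `|V s - V t|)) ->
  Psi b - Psi a <= V b - V a.
Proof.
move=> ab mV H.
pose S := [set t | a <= t <= b /\ Psi t - Psi a <= V t - V a].
have Sa : S a by split; [rewrite lexx|rewrite !subrr].
have S0 : S !=set0 by exists a.
have Sb : has_sup S by split => //; exists b => t [/andP[]].
pose c := sup S.
have ac : a <= c by apply: sup_upper_bound.
have cb : c <= b by apply: ge_sup => // t [/andP[]].
have [e e0 He] : pnr a b c (fun s => `|Psi s - Psi c| <= `|V s - V c|) by apply: H; rewrite ac.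
have Sc : Psi c - Psi a <= V c - V a.
  have [s Ss sc] : exists2 s, S s & c - e < s by apply: sup_adherent.
  have sc' : s <= c by apply: sup_upper_bound.
  case: Ss => /andP[s1 s2] s3.
  have h : `|Psi s - Psi c| <= `|V s - V c|.
    apply: He; first by rewrite s1.
    by rewrite ltr_norml; apply/andP; split; lra.
  have h1 := mV s c s1 sc' cb.
  have h2 : Psi c - Psi s <= `|Psi s - Psi c| by rewrite distrC ler_norm.
  have h3 : `|V s - V c| = V c - V s by rewrite distrC ger0_norm // subr_ge0.
  lra.
have [//|cb'] := eqVneq c b; first by move=> <-.
have clt : c < b by rewrite lt_neqAle cb'.
pose s := Num.min b (c + e / 2).
have sb : s <= b by rewrite /s ge_min lexx.
have se : s <= c + e / 2 by rewrite /s ge_min lexx orbT.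
have cs : c < s by rewrite /s lt_min clt; lra.
have h : `|Psi s - Psi c| <= `|V s - V c|.
  apply: He; first by apply/andP; split; lra.
  by rewrite ltr_norml; apply/andP; split; lra.
have h1 := mV c s ac (ltW cs) sb.
have h2 : Psi s - Psi c <= `|Psi s - Psi c| by rewrite ler_norm.
have h3 : `|V s - V c| = V s - V c by rewrite ger0_norm // subr_ge0.
have Ss : S s by split; [apply/andP; split; lra|lra].
have : s <= c by apply: sup_upper_bound.
lra.
Qed.

Lemma path_lip a b (Psi V : R -> R) : a <= b ->
  (forall s t, a <= s -> s <= t -> t <= b -> V s <= V t) ->
  (forall t, a <= t <= b -> pnr a b t (fun s => `|Psi s - Psi t| <= `|V s - V t|)) ->
  `|Psi b - Psi a| <= V b - V a.
Proof.
move=> ab mV H; rewrite ler_norml; apply/andP; split; last exact: path_increment.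
have := @path_increment a b (fun s => - Psi s) V ab mV.
have H' t : a <= t <= b -> pnr a b t (fun s => `|- Psi s - - Psi t| <= `|V s - V t|).
  by move=> /H; apply: pnrS => s; rewrite -opprD normrN.
move=> /(_ H'); lra.
Qed.

(** [V] stands for arc length. Only its increments enter the estimates; continuity is carried by
    [g]. *)
Definition tame_path a b (g : R -> C) (V : R -> R) :=
  [/\ a <= b,
     forall s t, a <= s -> s <= t -> t <= b -> nm (g t - g s) <= V t - V s &
     forall t, a <= t <= b -> forall e, 0 < e -> pnr a b t (fun s => nm (g s - g t) < e)].

Lemma tame_dist a b g V : tame_path a b g V -> forall s t, a <= s <= b -> a <= t <= b ->
  nm (g s - g t) <= `|V s - V t|.
Proof.
move=> [ab gV _] s t /andP[s1 s2] /andP[t1 t2]; case: (lerP s t) => st.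
  by rewrite nmBC distrC; apply: le_trans (ler_norm _); exact: gV.
by apply: le_trans (ler_norm _); apply: gV => //; exact: ltW.
Qed.
Lemma tame_sub a b a' b' g V : a <= a' -> a' <= b' -> b' <= b ->
  tame_path a b g V -> tame_path a' b' g V.
Proof.
move=> aa ab bb [h1 h2 h3]; split=> //.
- by move=> s t s1 s2 s3; apply: h2; lra.
- move=> t /andP[t1 t2] e e0; apply: (pnr_sub aa bb); apply: h3 => //; lra.
Qed.
Lemma tame_near a b g V t (P : C -> Prop) : tame_path a b g V -> a <= t <= b ->
  nr (g t) P -> pnr a b t (fun s => P (g s)).
Proof. move=> [_ _ gc] tt [e e0 H]; apply: pnrS (gc t tt e e0) => s; exact: H. Qed.

Lemma path_lip_nm a b g V (Psi : R -> R) (K : R) : tame_path a b g V -> 0 <= K ->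
  (forall t, a <= t <= b -> pnr a b t (fun s => `|Psi s - Psi t| <= K * nm (g s - g t))) ->
  `|Psi b - Psi a| <= K * (V b - V a).
Proof.
move=> gV K0 H; have [ab g1 _] := gV; rewrite mulrBr.
apply: (@path_lip a b Psi (fun t => K * V t)) => // [s t s1 s2 s3|t tt].
  rewrite ler_wpM2l //; have := g1 s t s1 s2 s3; have := nm_ge0 (g t - g s); lra.
have [e e0 He] := H t tt; exists e => // s ss se.
apply: (le_trans (He s ss se)); rewrite -mulrBr normrM (ger0_norm K0) ler_wpM2l //.
exact: (tame_dist gV).
Qed.

Lemma ln_sub_le (x y : R) : 0 < x -> 0 < y -> ln x - ln y <= (x - y) / y.
Proof.
move=> x0 y0; rewrite -ln_div ?posrE //.
have -> : x / y = 1 + (x - y) / y by field; rewrite gt_eqF.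
apply: le_ln1Dx; rewrite ltr_pdivlMr //; lra.
Qed.
Lemma ln_dist_le (x y k : R) : 0 < x -> 0 < y -> `|x - y| <= k * y -> k <= 1 / 2 ->
  `|ln x - ln y| <= 2 * k.
Proof.
move=> x0 y0 xy k2.
have ky : k * y <= 1 / 2 * y by rewrite ler_wpM2r // ltW.
have x1 := ler_norm (x - y); have x2 := ler_norm (y - x); rewrite distrC in x2.
have k0 : 0 <= k by rewrite -(pmulr_lge0 _ y0); apply: le_trans xy.
have h1 := ln_sub_le x0 y0; have h2 := ln_sub_le y0 x0.
have h3 : (x - y) / y <= k by rewrite ler_pdivrMr //; lra.
have h4 : (y - x) / x <= 2 * k.
  rewrite ler_pdivrMr //; have : k * (y / 2) <= k * x by rewrite ler_wpM2l //; lra.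
  lra.
by rewrite ler_norml; apply/andP; split; lra.
Qed.

(** The local bound says that ln(phi + c) moves at rate at most 2K along the path, so it integrates
    by [path_lip_nm]; c > 0 keeps the logarithm defined at zeros of phi. Boundedness of W uses the
    forward inequality, the uniqueness arguments at the end point use the backward one. *)
Lemma path_gronwall a b g V (phi : R -> R) (K c : R) : tame_path a b g V ->
  0 <= K -> 0 < c -> (forall t, a <= t <= b -> 0 <= phi t) ->
  (forall t, a <= t <= b ->
     pnr a b t (fun s => `|phi s - phi t| <= K * (phi t + c) * nm (g s - g t))) ->
  phi a + c <= (phi b + c) * expR (2 * K * (V b - V a)) /\
  phi b + c <= (phi a + c) * expR (2 * K * (V b - V a)).
Proof.
move=> gV K0 c0 p0 H; have [ab g1 gc] := gV.
have pp t : a <= t <= b -> 0 < phi t + c by move=> /p0; lra.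
have L : `|ln (phi b + c) - ln (phi a + c)| <= 2 * K * (V b - V a).
  apply: (@path_lip_nm a b g V (fun t => ln (phi t + c))) => //; first by rewrite mulr_ge0.
  move=> t tt.
  (* Within this distance the relative increment of phi + c is at most 1/2, the range of
     [ln_dist_le]. *)
  have k10 : 0 < 1 / (2 * (K + 1)) by rewrite divr_gt0 //; lra.
  have [e e0 He] := H t tt; have [d d0 Hd] := gc t tt _ k10.
  exists (Num.min e d); first by rewrite lt_min e0.
  move=> s ss; rewrite lt_min => /andP[se sd].
  have := He s ss se; have := Hd s ss sd; rewrite ltr_pdivlMr; last lra.
  move=> h1 h2; rewrite -mulrA; apply: ln_dist_le; [exact: pp|exact: pp| |].
    by rewrite [_ - _](_ : _ = phi s - phi t); [lra|ring].
  have := nm_ge0 (g s - g t); nra.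
have eL : expR (ln (phi a + c)) = phi a + c by rewrite lnK // posrE pp // lexx.
have eR : expR (ln (phi b + c)) = phi b + c by rewrite lnK // posrE pp // lexx ab.
move: L; rewrite ler_norml => /andP[L1 L2].
split.
- by rewrite -{1}eL -eR -expRD ler_expR; lra.
- by rewrite -{1}eR -eL -expRD ler_expR; lra.
Qed.

Lemma segment_tame (z0 z1 : C) :
  tame_path 0 1 (fun s => z0 + rc s * (z1 - z0)) (fun s => s * nm (z1 - z0)).
Proof.
have E s t : z0 + rc s * (z1 - z0) - (z0 + rc t * (z1 - z0)) = rc (s - t) * (z1 - z0).
  by rewrite /rc rmorphB /=; ring.
split=> //.
- by move=> s t s0 st t1; rewrite E nmM nm_rc ger0_norm ?subr_ge0 // mulrBl.
- move=> t t01 e e0; have d0 : 0 < e / (nm (z1 - z0) + 1).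
    by rewrite divr_gt0 // ltr_wpDl ?nm_ge0.
  exists (e / (nm (z1 - z0) + 1)) => // s s01.
  rewrite ltr_pdivlMr; last by rewrite ltr_wpDl ?nm_ge0.
  rewrite E nmM nm_rc => h; apply: le_lt_trans h; rewrite ler_wpM2l //; lra.
Qed.

Lemma mean_value (f l : C -> C) (z0 z1 : C) (K : R) :
  (forall s, 0 <= s <= 1 -> let z := z0 + rc s * (z1 - z0) in
     der f z (l z) /\ nm (l z) <= K) ->
  nm (f z1 - f z0) <= K * nm (z1 - z0).
Proof.
move=> H; have gV := segment_tame z0 z1.
have E0 : z0 + rc 0 * (z1 - z0) = z0 by rewrite /rc rmorph0 mul0r addr0.
have E1 : z0 + rc 1 * (z1 - z0) = z1 by rewrite /rc rmorph1 mul1r addrC subrK.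
have K0 : 0 <= K.
  have [|_] := H 0; first by rewrite lexx ler01.
  by apply: le_trans; exact: nm_ge0.
(* [der_lip] needs a constant strictly above the modulus of the derivative; the slack d disappears
   as e tends to 0. *)
apply/ler_addgt0Pr => e e0.
pose d := e / (nm (z1 - z0) + 1).
have n0 := nm_ge0 (z1 - z0).
have d0 : 0 < d by rewrite divr_gt0 //; lra.
have dn : d * nm (z1 - z0) <= e.
  by rewrite /d mulrAC ler_pdivrMr ?ler_wpM2l //; lra.
have := @path_lip_nm 0 1 _ _ (fun s => nm (f (z0 + rc s * (z1 - z0)) - f z0)) (K + d) gV.
rewrite E0 E1 subrr nm0 subr0 mul1r mul0r subr0 ger0_norm ?nm_ge0 // => P.
apply: (@le_trans _ _ ((K + d) * nm (z1 - z0))); last lra.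
apply: P => [|t t01]; first lra.
have [df lK] := H t t01.
have lK' : nm (l (z0 + rc t * (z1 - z0))) < K + d by lra.
apply: pnrS (tame_near gV t01 (der_lip df lK')) => s h.
apply: le_trans (nm_dist _ _) _.
rewrite [X in nm X](_ : _ = f (z0 + rc s * (z1 - z0)) - f (z0 + rc t * (z1 - z0))) //.
ring.
Qed.
End PathGronwall.

(** * Power series and analytic functions *)

Section PowerSeries.
Variable R : realType.
Local Notation C := (Cx R).
Implicit Types (u v c d : nat -> C) (l m w z : C) (K r : R).

Definition cvto u l := forall e : R, 0 < e -> exists N, forall n, (N <= n)%N -> nm (u n - l) < e.

Lemma cvtoP u l : u @ \oo --> l <-> cvto u l.
Proof.
split=> [/cvgCP H e /H [N _ HN]|H]; first by exists N => n Nn; exact: HN.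
by apply/cvgCP => e /H[N HN]; exists N => // n Nn; exact: HN.
Qed.
Lemma cvto_limn u l : cvto u l -> limn u = l.
Proof. by move/cvtoP => h; exact: (cvg_lim (@norm_hausdorff _ _) h). Qed.
Lemma cvto_unique u l m : cvto u l -> cvto u m -> l = m.
Proof. by move=> /cvto_limn <- /cvto_limn <-. Qed.
Lemma cvtoD u v l m : cvto u l -> cvto v m -> cvto (fun n => u n + v n) (l + m).
Proof.
move=> hu hv e e0; have e2 : 0 < e / 2 by lra.
have [N HN] := hu _ e2; have [N' HN'] := hv _ e2; exists (maxn N N') => n.
rewrite geq_max => /andP[/HN h1 /HN' h2].
have -> : u n + v n - (l + m) = (u n - l) + (v n - m) by ring.
have := nmD (u n - l) (v n - m); lra.
Qed.
Lemma cvtoZ u l (a : C) : cvto u l -> cvto (fun n => a * u n) (a * l).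
Proof.
move=> hu e e0; have a0 : 0 < nm a + 1 by have := nm_ge0 a; lra.
have [|N HN] := hu (e / (nm a + 1)); first exact: divr_gt0.
exists N => n /HN; rewrite -mulrBr nmM ltr_pdivlMr // => h.
have := nm_ge0 (u n - l); nra.
Qed.
Lemma cvto_le u l K : (forall n, nm (u n) <= K) -> cvto u l -> nm l <= K.
Proof.
move=> uK hu; apply/ler_addgt0Pr => e /hu[N /(_ N (leqnn N))].
rewrite nmBC; have := nm_sub l (u N); have := uK N; lra.
Qed.
Lemma cvto_small u l (f : nat -> R) (k : R) : (forall n, nm (u n - l) <= k * f n) ->
  f @ \oo --> (0 : R) -> cvto u l.
Proof.
move=> H f0 e e0; have k0 : 0 < `|k| + 1 by rewrite ltr_wpDl.
have : \forall n \near \oo, `|f n| < e / (`|k| + 1).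
  by move/cvgr0Pnorm_lt : f0; apply; exact: divr_gt0.
move=> [N _ HN]; exists N => n Nn; apply: le_lt_trans (H n) _.
have := HN n Nn; rewrite /= ltr_pdivlMr // => h; apply: le_lt_trans h.
apply: le_trans (ler_norm _) _; rewrite normrM mulrC ler_wpM2l //; lra.
Qed.
Lemma cvto_eq u v l : (forall n, u n = v n) -> cvto u l -> cvto v l.
Proof. by move=> e h d /h[N HN]; exists N => n; rewrite -e; exact: HN. Qed.

(** Real and imaginary parts are dominated by a geometric series; the tail bound passes to the limit
    from finite blocks. *)
Lemma series_cvto (a : nat -> C) K (x : R) : 0 <= x < 1 ->
  (forall n, nm (a n) <= K * x ^+ n) ->
  exists2 l, cvto (fun n => \sum_(k < n) a k) l &
    forall n, nm (l - \sum_(k < n) a k) <= K * x ^+ n / (1 - x).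
Proof.
move=> /andP[x0 x1] aK.
have K0 : 0 <= K by have := aK 0%N; rewrite expr0 mulr1; apply: le_trans; exact: nm_ge0.
have geo : cvgn (series (fun n => K * x ^+ n)).
  by apply: is_cvg_geometric_series; rewrite ger0_norm.
have rl (b : nat -> R) : (forall n, `|b n| <= K * x ^+ n) -> cvgn (series b).
  move=> bK; apply: normed_cvg.
  by apply: series_le_cvg geo => n //=; rewrite mulr_ge0 // exprn_ge0.
have cre : cvgn (series (fun n => complex.Re (a n))).
  by apply: rl => n; apply: le_trans (nmRe _) _.
have cim : cvgn (series (fun n => complex.Im (a n))).
  by apply: rl => n; apply: le_trans (nmIm _) _.
pose l : C := Complex (limn (series (fun n => complex.Re (a n))))
                      (limn (series (fun n => complex.Im (a n)))).
have Re_sum n : complex.Re (\sum_(k < n) a k) = \sum_(k < n) complex.Re (a k).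
  elim: n => [|n IH]; first by rewrite !big_ord0.
  by rewrite !big_ord_recr /= -IH; case: (\sum_(i < n) a i); case: (a n).
have Im_sum n : complex.Im (\sum_(k < n) a k) = \sum_(k < n) complex.Im (a k).
  elim: n => [|n IH]; first by rewrite !big_ord0.
  by rewrite !big_ord_recr /= -IH; case: (\sum_(i < n) a i); case: (a n).
have ReB (p q : C) : complex.Re (p - q) = complex.Re p - complex.Re q by case: p; case: q.
have ImB (p q : C) : complex.Im (p - q) = complex.Im p - complex.Im q by case: p; case: q.
have cl : cvto (fun n => \sum_(k < n) a k) l.
  move=> e e0; have e2 : 0 < e / 2 by lra.
  move/cvgrPdist_lt: (cre) => /(_ _ e2)[N _ HN].
  move/cvgrPdist_lt: (cim) => /(_ _ e2)[N' _ HN'].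
  exists (maxn N N') => n; rewrite geq_max => /andP[/HN + /HN'] /=.
  rewrite ![series _ n]big_mkord => h1 h2; apply: le_lt_trans (nm_ReIm _) _.
  by rewrite ReB ImB Re_sum Im_sum distrC [X in _ + X]distrC /=; lra.
exists l => // n.
have tail (m : nat) : nm (\sum_(k < n + m) a k - \sum_(k < n) a k) <= K * x ^+ n / (1 - x).
  rewrite big_split_ord /= addrAC subrr add0r.
  apply: (@le_trans _ _ (\sum_(i < m) K * x ^+ n * x ^+ i)).
    apply: le_trans (nm_sum _ _ _) _; apply: ler_sum => i _.
    by rewrite -mulrA -exprD.
  rewrite -mulr_sumr; apply: ler_wpM2l; first by rewrite mulr_ge0 // exprn_ge0.
  have x10 : 0 < 1 - x by lra.
  rewrite -[leRHS]mul1r ler_pdivlMr //.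
  have -> : (\sum_(i < m) x ^+ i) * (1 - x) = 1 - x ^+ m by rewrite -[RHS]opprB subrX1; ring.
  by have := exprn_ge0 m x0; lra.
apply: (@cvto_le (fun m : nat => \sum_(k < n + m) a k - \sum_(k < n) a k)) => //.
move=> e /cl[N HN]; exists N => m Nm.
have := HN (n + m)%N (leq_trans Nm (leq_addl _ _)).
by rewrite opprB addrA subrK.
Qed.

(** A total function: where the series diverges the value is whatever [limn] returns, so identities
    are claimed only near 0. *)
Definition psum c w : C := limn (series (fun n => c n * w ^+ n)).
(** Cauchy estimates; [r] is the inverse of a radius, so that enlarging it weakens the bound. *)
Definition gb K r c := forall n, nm (c n) <= K * r ^+ n.
Definition geo c := exists K r, [/\ 0 <= K, 0 < r & gb K r c].

Lemma gb_term K r c w n : gb K r c -> nm (c n * w ^+ n) <= K * (r * nm w) ^+ n.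
Proof. by move=> h; rewrite nmM nmX exprMn mulrA ler_wpM2r // exprn_ge0 // nm_ge0. Qed.
Lemma gb_ge0 K r c : gb K r c -> 0 <= K.
Proof. by move=> /(_ 0%N); rewrite expr0 mulr1; apply: le_trans; exact: nm_ge0. Qed.
Lemma gb_mono K r K' r' c : K <= K' -> 0 <= r -> r <= r' -> gb K r c -> gb K' r' c.
Proof.
move=> kk r0 rr h n; apply: le_trans (h n) _; apply: ler_pM => //.
- exact: gb_ge0 h.
- exact: exprn_ge0.
- by apply: lerXn2r => //; rewrite nnegrE //; exact: le_trans rr.
Qed.

Lemma psum_spec K r c w : 0 < r -> gb K r c -> r * nm w < 1 ->
  cvto (fun n => \sum_(k < n) c k * w ^+ k) (psum c w) /\
  forall n, nm (psum c w - \sum_(k < n) c k * w ^+ k) <= K * (r * nm w) ^+ n / (1 - r * nm w).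
Proof.
move=> r0 h rw.
have [||l hl ht] := @series_cvto (fun k => c k * w ^+ k) K (r * nm w).
- by rewrite rw mulr_ge0 ?nm_ge0 // ltW.
- by move=> n; exact: gb_term.
suff -> : psum c w = l by split.
rewrite /psum; apply: cvto_limn; apply: cvto_eq hl => n; by rewrite /series /= big_mkord.
Qed.
Lemma psum_cvgn K r c w : 0 < r -> gb K r c -> r * nm w < 1 ->
  cvgn (series (fun n => c n * w ^+ n)).
Proof.
move=> r0 h rw; have [h1 _] := psum_spec r0 h rw.
apply/cvg_ex; exists (psum c w); apply/cvtoP; apply: cvto_eq h1 => n.
by rewrite /series /= big_mkord.
Qed.
Lemma psum_eq c w l : cvto (fun n => \sum_(k < n) c k * w ^+ k) l -> psum c w = l.
Proof.
move=> h; rewrite /psum; apply: cvto_limn; apply: cvto_eq h => n.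
by rewrite /series /= big_mkord.
Qed.

Lemma cvto0 (x : R) : 0 <= x < 1 -> (fun n => x ^+ n) @ \oo --> (0 : R).
Proof. by move=> /andP[x0 x1]; apply: cvg_expr; rewrite ger0_norm. Qed.

Lemma psum0 c : psum c 0 = c 0%N.
Proof.
apply: psum_eq => e e0; exists 1%N => -[//|n] _.
rewrite big_ord_recl expr0 mulr1 big1 ?addr0 ?subrr ?nm0 // => i _.
by rewrite exprS mul0r mulr0.
Qed.

Lemma psumD c d w : geo c -> geo d -> exists2 rho : R, 0 < rho & forall w, nm w < rho ->
  psum (fun n => c n + d n) w = psum c w + psum d w.
Proof.
move=> [K [r [K0 r0 hc]]] [K' [r' [K0' r0' hd]]].
exists (Num.min r^-1 r'^-1); first by rewrite lt_min !invr_gt0 r0.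
move=> {}w; rewrite lt_min => /andP[w1 w2].
have e1 : r * nm w < 1 by rewrite mulrC -ltr_pdivlMr // div1r.
have e2 : r' * nm w < 1 by rewrite mulrC -ltr_pdivlMr // div1r.
have [h1 _] := psum_spec r0 hc e1; have [h2 _] := psum_spec r0' hd e2.
apply: psum_eq; apply: cvto_eq (cvtoD h1 h2) => n.
by rewrite -big_split /=; apply: eq_bigr => i _; rewrite mulrDl.
Qed.

Lemma gbD K r c K' r' d : 0 < r -> 0 < r' -> gb K r c -> gb K' r' d ->
  gb (K + K') (r + r') (fun n => c n + d n).
Proof.
move=> r0 r0' h h' n; apply: le_trans (nmD _ _) _; rewrite mulrDl.
apply: lerD.
- by apply: (gb_mono (K := K) (r := r)) => //; [exact: ltW|lra].
- by apply: (gb_mono (K := K') (r := r')) => //; [exact: ltW|lra].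
Qed.
Lemma geoD c d : geo c -> geo d -> geo (fun n => c n + d n).
Proof.
move=> [K [r [K0 r0 hc]]] [K' [r' [K0' r0' hd]]].
by exists (K + K'), (r + r'); split; [exact: addr_ge0|exact: addr_gt0|exact: gbD].
Qed.

Definition conv c d n : C := \sum_(k < n.+1) c k * d (n - k)%N.

(** Trades a factor n+1 for a doubled ratio, which keeps Cauchy products and derivatives within
    [geo]. *)
Lemma natX2 (n : nat) : (n.+1%:R : R) <= 2 ^+ n.
Proof. by rewrite -natrX ler_nat; elim: n => // n IH; rewrite expnS; lia. Qed.

Lemma gb_conv K r c K' r' d : 0 < r -> 0 < r' -> gb K r c -> gb K' r' d ->
  gb (K * K') (2 * (r + r')) (conv c d).
Proof.
move=> r0 r0' h h' n; rewrite /conv.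
apply: le_trans (nm_sum _ _ _) _.
have K0 := gb_ge0 h; have K0' := gb_ge0 h'.
have rr : 0 < r + r' by lra.
have b i : (i <= n)%N -> nm (c i * d (n - i)%N) <= K * K' * (r + r') ^+ n.
  move=> ni; rewrite nmM -{2}(subnKC ni) exprD mulrACA; apply: ler_pM; rewrite ?nm_ge0 //.
  - by apply: (gb_mono (K := K) (r := r)) => //; [exact: ltW|lra].
  - by apply: (gb_mono (K := K') (r := r')) => //; [exact: ltW|lra].
apply: (@le_trans _ _ (\sum_(k < n.+1) K * K' * (r + r') ^+ n)).
  by apply: ler_sum => i _; apply: b; rewrite -ltnS.
rewrite sumr_const card_ord -[leLHS]mulr_natr exprMn.
have := natX2 n; have : 0 <= K * K' * (r + r') ^+ n by rewrite !mulr_ge0 // exprn_ge0 // ltW.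
move=> X0 hn; rewrite [leRHS]mulrCA [leRHS]mulrC; exact: ler_wpM2l.
Qed.
Lemma geo_conv c d : geo c -> geo d -> geo (conv c d).
Proof.
move=> [K [r [K0 r0 hc]]] [K' [r' [K0' r0' hd]]].
exists (K * K'), (2 * (r + r')); split; [exact: mulr_ge0| |exact: gb_conv].
by rewrite mulr_gt0 // addr_gt0.
Qed.

Lemma conv_partial c d w n : \sum_(m < n) conv c d m * w ^+ m =
  \sum_(i < n) c i * w ^+ i * \sum_(j < n - i) d j * w ^+ j.
Proof.
elim: n => [|n IH]; first by rewrite !big_ord0.
rewrite big_ord_recr /= IH [RHS]big_ord_recr /= subSnn big_ord1 expr0 mulr1.
rewrite [X in _ = X + _](_ : _ = \sum_(i < n) (c i * w ^+ i * \sum_(j < n - i) d j * w ^+ j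
     + c i * d (n - i)%N * w ^+ n)).
  rewrite big_split /= -addrA; congr (_ + _).
  rewrite /conv big_ord_recr /= subnn mulrDl mulr_suml; congr (_ + _); ring.
apply: eq_bigr => i _; rewrite subSn 1?ltnW // big_ord_recr /= mulrDr; congr (_ + _).
rewrite mulrACA -exprD subnKC 1?ltnW //; ring.
Qed.

Lemma psumM c d : geo c -> geo d -> exists2 rho : R, 0 < rho & forall w, nm w < rho ->
  psum (conv c d) w = psum c w * psum d w.
Proof.
move=> [K1 [r1 [K10 r10 hc1]]] [K2 [r2 [K20 r20 hd2]]].
pose r := r1 + r2; have r0 : 0 < r by rewrite addr_gt0.
have hc : gb K1 r c by apply: gb_mono hc1 => //; rewrite ?ltW // /r; lra.
have hd : gb K2 r d by apply: gb_mono hd2 => //; rewrite ?ltW // /r; lra.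
exists (r^-1 / 2 / 2); first by rewrite !divr_gt0 // invr_gt0.
move=> w hw; pose x := r * nm w.
have x0 : 0 <= x by rewrite mulr_ge0 ?nm_ge0 // ltW.
have x4 : x < 1 / 4.
  by rewrite /x mulrC -ltr_pdivlMr //; apply: lt_le_trans hw _; rewrite le_eqVlt; apply/orP; left; apply/eqP; field; rewrite gt_eqF.
have x1 : x < 1 by lra.
have [h1 t1] := psum_spec r0 hc x1; have [h2 t2] := psum_spec r0 hd x1.
apply: psum_eq.
(* Each of the n terms of the difference is a tail of d against a term of c, at most a constant
   times x^n; together they are at most a constant times (2x)^n, and x < 1/4. *)
have H : cvto (fun n => \sum_(m < n) conv c d m * w ^+ m - psum d w * \sum_(k < n) c k * w ^+ k) 0.
  apply: (@cvto_small _ _ (fun n => (2 * x) ^+ n) (K1 * K2 / (1 - x))); last first.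
    by apply: cvto0; apply/andP; split; lra.
  move=> n; rewrite subr0 conv_partial mulr_sumr -sumrB.
  apply: le_trans (nm_sum _ _ _) _.
  apply: (@le_trans _ _ (\sum_(i < n) K1 * K2 / (1 - x) * x ^+ n)).
    apply: ler_sum => i _; rewrite [psum d w * _]mulrC -mulrBr nmM nmBC.
    have -> : K1 * K2 / (1 - x) * x ^+ n = (K1 * x ^+ i) * (K2 * x ^+ (n - i) / (1 - x)).
      by rewrite -[in LHS](subnKC (ltnW (ltn_ord i))) exprD; ring.
    by apply: ler_pM; rewrite ?nm_ge0 ?gb_term //; exact: t2.
  rewrite sumr_const card_ord -[leLHS]mulr_natr [(2 * x) ^+ n]exprMn -mulrA [X in _ * X <= _]mulrC.
  apply: ler_wpM2l; first by rewrite divr_ge0 ?mulr_ge0 //; lra.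
  apply: ler_wpM2r; first exact: exprn_ge0.
  by apply: le_trans (natX2 n); rewrite ler_nat.
have := cvtoD H (cvtoZ (psum d w) h1); rewrite add0r mulrC; apply: cvto_eq => n; ring.
Qed.

Lemma psumS c w : geo c -> exists2 rho : R, 0 < rho & forall w, nm w < rho ->
  psum c w = c 0%N + w * psum (fun n => c n.+1) w.
Proof.
move=> [K [r [K0 r0 hc]]]; exists r^-1; first by rewrite invr_gt0.
move=> {}w hw; have rw : r * nm w < 1 by rewrite mulrC -ltr_pdivlMr // div1r.
have hc' : gb (K * r) r (fun n => c n.+1).
  by move=> n; rewrite -mulrA -exprS; exact: hc.
have [h1 _] := psum_spec r0 hc' rw.
apply: psum_eq => e e0; have [N HN] := cvtoZ w h1 e0.
exists N.+1 => -[//|n] Nn; rewrite big_ord_recl expr0 mulr1.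
have := HN n Nn; rewrite mulr_sumr.
rewrite (eq_bigr (fun i : 'I_n => c (lift ord0 i) * w ^+ lift ord0 i)).
  by rewrite opprD addrACA subrr add0r.
by move=> i _; rewrite lift0 exprS; ring.
Qed.

Lemma geoS c : geo c -> geo (fun n => c n.+1).
Proof.
move=> [K [r [K0 r0 hc]]]; exists (K * r), r; split => //; first by rewrite mulr_ge0 // ltW.
by move=> n; rewrite -mulrA -exprS; exact: hc.
Qed.
End PowerSeries.

Section PowerSeries2.
Variable R : realType.
Local Notation C := (Cx R).
Implicit Types (u v c d : nat -> C) (l m w z : C) (K r : R).

(** Course-of-values recursion: entry n of the iterates of [F] no longer changes from the (n+1)-st
    iterate on. *)
Lemma rec_exists (T : Type) (x0 : T) (F : (nat -> T) -> nat -> T) :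
  (forall (u v : nat -> T) n, (forall k, (k < n)%N -> u k = v k) -> F u n = F v n) ->
  exists u : nat -> T, forall n, u n = F u n.
Proof.
move=> loc; pose U (m : nat) := iter m F (fun=> x0).
have st (m n : nat) : (n < m)%N -> U m n = U n.+1 n.
  elim/ltn_ind: n m => n IH [//|m]; rewrite ltnS => nm.
  rewrite /U /= -/(U m) -/(U n); apply: loc => k kn.
  by rewrite (IH k kn m (leq_trans kn nm)) (IH k kn n kn).
exists (fun n => U n.+1 n) => n; rewrite {1}/U /= -/(U n); apply: loc => k kn.
exact: st.
Qed.

Lemma conv_inv c : c 0%N != 0 -> geo c ->
  exists2 e, geo e & forall n, conv c e n = if n == 0%N then 1 else 0.
Proof.
move=> c0 [K [r [K0 r0 hc]]].
pose F (e : nat -> C) n : C := (c 0%N)^-1 *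
  ((if n == 0%N then 1 else 0) - \sum_(k < n) c k.+1 * e (n - k.+1)%N).
have [|e eE] := @rec_exists C 0 F.
  move=> u v n H; rewrite /F; congr (_ * (_ - _)); apply: eq_bigr => k _; congr (_ * _).
  by apply: H; have := ltn_ord k; lia.
exists e; last first.
  move=> n; rewrite /conv big_ord_recl subn0 eE /F mulrA divff // mul1r.
  exact: subrK.
pose a := nm (c 0%N)^-1; have a0 : 0 < a by rewrite /a nm_gt0 invr_eq0.
(* Chosen so that L - r = r a K: the sum in the induction is then exactly L^(n+1) - r^(n+1). *)
pose L := r * (1 + a * K).
have aK : 0 <= a * K by rewrite mulr_ge0 // ltW.
have L0 : 0 < L by rewrite /L mulr_gt0 //; lra.
exists a, L; split => //; first exact: ltW.
elim/ltn_ind => n IH.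
rewrite eE /F nmM -/a; apply: ler_wpM2l; first exact: ltW.
case: n IH => [|n] IH; first by rewrite big_ord0 subr0 nm1 expr0.
rewrite sub0r nmN; apply: le_trans (nm_sum _ _ _) _.
have s (i : 'I_n.+1) : nm (c i.+1 * e (n.+1 - i.+1)%N) <= (a * K) * (r ^+ i.+1 * L ^+ (n - i)).
  rewrite nmM; have := hc i.+1; have := IH (n.+1 - i.+1)%N; rewrite subSS.
  move=> /(_ (ltac:(have := ltn_ord i; lia))) h1 h2.
  apply: le_trans (ler_pM _ _ h2 h1) _; rewrite ?nm_ge0 //.
  by rewrite le_eqVlt; apply/orP; left; apply/eqP; ring.
apply: le_trans (ler_sum _ (fun i _ => s i)) _; rewrite -mulr_sumr.
have -> : \sum_(i < n.+1) r ^+ i.+1 * L ^+ (n - i) =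
   r * \sum_(i < n.+1) L ^+ (n.+1.-1 - i) * r ^+ i.
  by rewrite mulr_sumr; apply: eq_bigr => i _; rewrite exprS; ring.
have E : L ^+ n.+1 - r ^+ n.+1 = r * (a * K) * \sum_(i < n.+1) L ^+ (n.+1.-1 - i) * r ^+ i.
  by rewrite subrXX /L; congr (_ * _); ring.
have -> : a * K * (r * \sum_(i < n.+1) L ^+ (n.+1.-1 - i) * r ^+ i) = L ^+ n.+1 - r ^+ n.+1.
  by rewrite E; ring.
have := exprn_ge0 n.+1 (ltW r0); lra.
Qed.

Lemma psum_delta w : psum (fun n => if n == 0%N then 1 else 0 : C) w = 1.
Proof.
apply: psum_eq => e e0; exists 1%N => -[//|n] _.
rewrite big_ord_recl expr0 mulr1 big1 ?addr0 ?subrr ?nm0 // => i _.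
by rewrite mul0r.
Qed.

Definition dcoef c n : C := n.+1%:R * c n.+1.

Lemma geo_dcoef c : geo c -> geo (dcoef c).
Proof.
move=> [K [r [K0 r0 hc]]]; exists (K * r), (2 * r); split.
- by rewrite mulr_ge0 // ltW.
- by rewrite mulr_gt0.
move=> n; rewrite /dcoef nmM nm_nat exprMn.
have h := hc n.+1; rewrite exprS in h.
apply: le_trans (ler_pM _ _ (natX2 R n) h) _; rewrite ?nm_ge0 //.
by rewrite le_eqVlt; apply/orP; left; apply/eqP; ring.
Qed.

(** Multiplied through by rho^2 to stay free of division. For rho = 1/(8r), as in [psum_der], r
    times 4 rho is 1/2 and the remainders sum geometrically. *)
Lemma expr_taylor2 (w h : C) (rho : R) k : nm w <= rho -> nm h <= rho ->
  nm ((w + h) ^+ k.+1 - w ^+ k.+1 - k.+1%:R * w ^+ k * h) * rho ^+ 2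
    <= nm h ^+ 2 * (4 * rho) ^+ k.+1.
Proof.
move=> wr hr; have r0 : 0 <= rho := le_trans (nm_ge0 _) wr.
elim: k => [|k IH].
  rewrite !expr1 expr0 mulr1 mul1r [X in nm X](_ : _ = 0); last by ring.
  by rewrite nm0 mul0r mulr_ge0 // ?exprn_ge0 ?nm_ge0 // mulr_ge0.
have -> : (w + h) ^+ k.+2 - w ^+ k.+2 - k.+2%:R * w ^+ k.+1 * h =
  (w + h) * ((w + h) ^+ k.+1 - w ^+ k.+1 - k.+1%:R * w ^+ k * h) + k.+1%:R * w ^+ k * h ^+ 2.
  by rewrite !exprS (mulrS _ k.+1); ring.
set T := (w + h) ^+ k.+1 - _ - _ in IH *.
apply: (@le_trans _ _ ((2 * rho) * (nm T * rho ^+ 2) + k.+1%:R * rho ^+ k * nm h ^+ 2 * rho ^+ 2)).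
  rewrite mulrA -mulrDl; apply: ler_wpM2r; first exact: exprn_ge0.
  apply: le_trans (nmD _ _) _; rewrite !nmM nm_nat !nmX -expr2; apply: lerD.
    by apply: ler_wpM2r; [exact: nm_ge0|apply: le_trans (nmD _ _) _; lra].
  apply: ler_wpM2r; first by rewrite exprn_ge0 // nm_ge0.
  by apply: ler_wpM2l => //; apply: lerXn2r => //; rewrite nnegrE nm_ge0.
apply: (@le_trans _ _ ((2 * rho) * (nm h ^+ 2 * (4 * rho) ^+ k.+1) +
    2 ^+ k * rho ^+ k * nm h ^+ 2 * rho ^+ 2)).
  apply: lerD; first by apply: ler_wpM2l => //; exact: mulr_ge0.
  apply: ler_wpM2r; first exact: exprn_ge0.
  apply: ler_wpM2r; first by rewrite exprn_ge0 // nm_ge0.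
  by apply: ler_wpM2r; [exact: exprn_ge0|exact: natX2].
have -> : (2 * rho) * (nm h ^+ 2 * (4 * rho) ^+ k.+1) + 2 ^+ k * rho ^+ k * nm h ^+ 2 * rho ^+ 2
  = nm h ^+ 2 * (rho ^+ k.+2 * (2 * 4 ^+ k.+1 + 2 ^+ k)) by rewrite !exprMn !exprS; ring.
apply: ler_wpM2l; first by rewrite exprn_ge0 // nm_ge0.
rewrite exprMn [leRHS]mulrC; apply: ler_wpM2l; first exact: exprn_ge0.
have : 2 ^+ k <= 4 ^+ k :> R by apply: lerXn2r; rewrite ?nnegrE //; lra.
have : 0 <= 4 ^+ k :> R by exact: exprn_ge0.
rewrite !exprS; lra.
Qed.

Lemma psum_der c : geo c -> exists2 rho : R, 0 < rho & forall w, nm w < rho ->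
  der (psum c) w (psum (dcoef c) w).
Proof.
move=> [K [r [K0 r0 hc]]]; pose rho := (8 * r)^-1.
have rho0 : 0 < rho by rewrite invr_gt0 mulr_gt0.
have rrho : r * rho = 1 / 8 by rewrite /rho; field; rewrite gt_eqF.
exists rho => // w wr.
have hd : gb (K * r) (2 * r) (dcoef c).
  move=> n; rewrite /dcoef nmM nm_nat exprMn.
  have h := hc n.+1; rewrite exprS in h.
  apply: le_trans (ler_pM _ _ (natX2 R n) h) _; rewrite ?nm_ge0 //.
  by rewrite le_eqVlt; apply/orP; left; apply/eqP; ring.
have small x (k : R) : nm x <= 2 * rho -> 0 < k -> k <= 2 -> k * r * nm x < 1.
  move=> xr k0 k2; have := nm_ge0 x.
  have : k * r * nm x <= 2 * r * (2 * rho).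
    by apply: ler_pM; rewrite ?nm_ge0 // ?mulr_ge0 ?(ltW r0) ?(ltW k0) // ler_wpM2r // ltW.
  lra.
apply: (@der_quad _ _ _ _ (2 * K / rho ^+ 2)).
apply: nrS (@nr_lt _ w _ rho0) => x xw; pose h := x - w.
have xE : x = w + h by rewrite /h addrC subrK.
have xr : nm x <= 2 * rho.
  by have := nmD w h; rewrite -xE -/h; move: xw; rewrite -/h; lra.
have s1 : r * nm x < 1 by have := small x 1 xr; rewrite mul1r; apply; lra.
have wr2 : nm w <= 2 * rho by lra.
have s2 : r * nm w < 1 by have := small w 1 wr2; rewrite mul1r; apply; lra.
have s3 : 2 * r * nm w < 1 by apply: small => //; lra.
have [a1 _] := psum_spec r0 hc s1; have [a2 _] := psum_spec r0 hc s2.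
have r20 : 0 < 2 * r by rewrite mulr_gt0.
have [a3 _] := psum_spec r20 hd s3.
have B := cvtoD (cvtoD a1 (cvtoZ (-1) a2)) (cvtoZ (- h) a3).
have -> : psum c x - psum c w - psum (dcoef c) w * (x - w) = psum c x + -1 * psum c w + - h * psum (dcoef c) w.
  by rewrite -/h mulN1r mulNr [psum (dcoef c) w * h]mulrC.
rewrite -/h.
have B' : cvto (fun n => \sum_(k < n.+1) c k * x ^+ k + -1 * (\sum_(k < n.+1) c k * w ^+ k)
     + - h * \sum_(k < n) dcoef c k * w ^+ k) (psum c x + -1 * psum c w + - h * psum (dcoef c) w).
  apply: cvtoD; last exact: cvtoZ.
  have sh l (a : nat -> C) : cvto a l -> cvto (fun n => a n.+1) l.
    by move=> H e /H[N HN]; exists N => n Nn; apply: HN; exact: leqW.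
  by apply: (sh _ (fun n => \sum_(k < n) c k * x ^+ k + -1 * (\sum_(k < n) c k * w ^+ k)));
    apply: cvtoD => //; exact: cvtoZ.
apply: cvto_le B' => n.
rewrite !big_ord_recl !expr0 !mulr1 mulN1r opprD addrACA subrr add0r mulNr.
rewrite -!sumrN mulr_sumr -sumrN -!big_split /=.
apply: le_trans (nm_sum _ _ _) _.
have r2 : 0 < rho ^+ 2 by exact: exprn_gt0.
apply: (@le_trans _ _ (\sum_(i < n) K / rho ^+ 2 * nm h ^+ 2 * (1 / 2) ^+ i.+1)).
  apply: ler_sum => i _; rewrite /bump leq0n add1n.
  have -> : c i.+1 * x ^+ i.+1 + - (c i.+1 * w ^+ i.+1) + - (h * (dcoef c i * w ^+ i)) =
     c i.+1 * ((w + h) ^+ i.+1 - w ^+ i.+1 - i.+1%:R * w ^+ i * h).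
    by rewrite -xE /dcoef; ring.
  have T := @expr_taylor2 w h rho i (ltW wr) (ltW xw).
  rewrite nmM; apply: (@le_trans _ _ (K * r ^+ i.+1 * (nm h ^+ 2 * (4 * rho) ^+ i.+1 / rho ^+ 2))).
    by apply: ler_pM; rewrite ?nm_ge0 // ler_pdivlMr.
  have -> : (1 / 2) ^+ i.+1 = r ^+ i.+1 * (4 * rho) ^+ i.+1 :> R.
    by rewrite -exprMn; congr (_ ^+ _); rewrite mulrCA rrho; field.
  by rewrite le_eqVlt; apply/orP; left; apply/eqP; ring.
rewrite -mulr_sumr; have -> : 2 * K / rho ^+ 2 * nm h ^+ 2 = K / rho ^+ 2 * nm h ^+ 2 * 2 by ring.
apply: ler_wpM2l; first by rewrite mulr_ge0 ?exprn_ge0 ?nm_ge0 // divr_ge0 // ltW.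
have -> : \sum_(i < n) (1 / 2) ^+ i.+1 = 1 - (1 / 2) ^+ n :> R.
  elim: (n) => [|m IH]; first by rewrite big_ord0 expr0 subrr.
  by rewrite big_ord_recr /= IH exprS; field.
have : 0 <= (1 / 2) ^+ n :> R by exact: exprn_ge0.
lra.
Qed.

(* Coefficients of c(w^q). *)
Definition dil (q : nat) c n : C := if (q %| n)%N then c (n %/ q)%N else 0.

Lemma psum_dil q c : (0 < q)%N -> geo c -> exists2 rho : R, 0 < rho & forall w, nm w < rho ->
  psum (dil q c) w = psum c (w ^+ q).
Proof.
move=> q0 [K [r [K0 r0 hc]]].
pose r' := r + 1; have r1 : 1 <= r' by rewrite /r'; lra.
have r0' : 0 < r' by lra.
have hc' : gb K r' c by apply: gb_mono hc => //; rewrite /r'; lra.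
have hd : gb K r' (dil q c).
  move=> n; rewrite /dil; case: ifP => _; last by rewrite nm0 mulr_ge0 // exprn_ge0 // ltW.
  apply: le_trans (hc' _) _; apply: ler_wpM2l => //.
  by apply: ler_weXn2l => //; exact: leq_div.
exists r'^-1; first by rewrite invr_gt0.
move=> w hw; have rw : r' * nm w < 1 by rewrite mulrC -ltr_pdivlMr // div1r.
have w1 : nm w <= 1 by apply: le_trans (ltW hw) _; by rewrite invf_le1.
have rwq : r' * nm (w ^+ q) < 1.
  apply: le_lt_trans rw; apply: ler_wpM2l; first exact: ltW.
  by rewrite nmX -[leRHS]expr1 ler_wiXn2l // nm_ge0.
have [h1 _] := psum_spec r0' hd rw; have [h2 _] := psum_spec r0' hc' rwq.
apply: cvto_unique h2 => e /h1[N HN]; exists N => n Nn.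
have := HN (n * q)%N (leq_trans Nn (leq_pmulr _ q0)).
suff -> : \sum_(k < n * q) dil q c k * w ^+ k = \sum_(k < n) c k * (w ^+ q) ^+ k by [].
elim: (n) => [|m IH]; first by rewrite mul0n !big_ord0.
rewrite big_ord_recr /= -IH mulSn addnC big_split_ord /=; congr (_ + _).
case: q q0 {hd hw rw rwq h1 HN IH} => // q _.
rewrite big_ord_recl addn0 /dil dvdn_mull // mulnK // -exprM [(q.+1 * m)%N]mulnC.
rewrite big1 ?addr0 // => i _; rewrite /= /bump leq0n add1n dvdn_addr ?dvdn_mull //.
by rewrite gtnNdvd ?mul0r // ltnS.
Qed.

Lemma geo_dil q c : (0 < q)%N -> geo c -> geo (dil q c).
Proof.
move=> q0 [K [r [K0 r0 hc]]].
exists K, (r + 1); split => //; first lra.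
move=> n; rewrite /dil; case: ifP => _; last by rewrite nm0 mulr_ge0 // exprn_ge0 //; lra.
have hc' : gb K (r + 1) c by apply: gb_mono hc => //; lra.
apply: le_trans (hc' _) _; apply: ler_wpM2l => //.
by apply: ler_weXn2l; [lra|exact: leq_div].
Qed.

Lemma taylor_geo (f : C -> C) z t : taylor_at f z t ->
  geo t /\ exists2 rho : R, 0 < rho & forall x, nm (x - z) < rho -> f x = psum t (x - z).
Proof.
move=> [r' /lt0C[r r0 ->] H].
have H' x : nm (x - z) < r -> cvto (fun n => \sum_(k < n) t k * (x - z) ^+ k) (f x).
  rewrite -nm_lt => /H /cvtoP; apply: cvto_eq => n; by rewrite /series /= big_mkord.
split; last by exists r => // x /H' h; rewrite (psum_eq h).
pose x := z + rc (r / 2).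
have xz : x - z = rc (r / 2) by rewrite /x addrC addKr.
have r20 : 0 < r / 2 by lra.
have nx : nm (x - z) = r / 2 by rewrite xz nm_rc gtr0_norm.
have [|N HN] := H' x _ 1 ltr01; first by rewrite nx; lra.
(* A term is the difference of two partial sums that both lie within 1 of the limit. *)
have B n : (N <= n)%N -> nm (t n) * (r / 2) ^+ n <= 2.
  move=> Nn; have h1 := HN n Nn; have h2 := HN n.+1 (leqW Nn).
  rewrite -nx -nmX -nmM.
  have -> : t n * (x - z) ^+ n = (\sum_(k < n.+1) t k * (x - z) ^+ k - f x) -
    (\sum_(k < n) t k * (x - z) ^+ k - f x) by rewrite big_ord_recr /=; ring.
  by have := nmB (\sum_(k < n.+1) t k * (x - z) ^+ k - f x) (\sum_(k < n) t k * (x - z) ^+ k - f x); lra.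
pose S := \sum_(k < N) nm (t k) * (r / 2) ^+ k.
have pos n : 0 <= nm (t n) * (r / 2) ^+ n by rewrite mulr_ge0 ?nm_ge0 // exprn_ge0 // ltW.
have S0 : 0 <= S by apply: sumr_ge0.
have BS n : nm (t n) * (r / 2) ^+ n <= S + 2.
  case: (ltnP n N) => nN; last by have := B n nN; lra.
  rewrite /S (bigD1 (Ordinal nN)) //=.
  have : 0 <= \sum_(i < N | i != Ordinal nN) nm (t i) * (r / 2) ^+ i by exact: sumr_ge0.
  lra.
exists (S + 2), (r / 2)^-1; split; [lra|by rewrite invr_gt0|] => n.
by rewrite exprVn ler_pdivlMr ?exprn_gt0.
Qed.
End PowerSeries2.

Section Analytic.
Variable R : realType.
Local Notation C := (Cx R).
Implicit Types (f g : C -> C) (c d : nat -> C) (w z : C).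

Definition ana z f := exists2 c, geo c & nr z (fun x => f x = psum c (x - z)).
(** The derivative as a total function, 0 where there is none, so that derived coefficients can be
    written down without proofs of differentiability. *)
Definition dv f z : C := xget 0 (der f z).

Lemma dvE f z l : der f z l -> dv f z = l.
Proof. by move=> h; apply: (der_unique (f := f) (z := z)) => //; exact: (xgetI 0 h). Qed.

Lemma ana_ext z f g : nr z (fun x => f x = g x) -> ana z f -> ana z g.
Proof. by move=> h [c cg hc]; exists c => //; apply: nrS2 h hc => x ->. Qed.
Lemma nr_shift z (P : C -> Prop) (e : R) : 0 < e -> (forall w, nm w < e -> P w) ->
  nr z (fun x => P (x - z)).
Proof. by move=> e0 H; exists e => // x /H. Qed.
Lemma ana_cst z (a : C) : ana z (fun=> a).
Proof.
exists (fun n => if n == 0%N then a else 0).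
  exists (nm a), 1; split; rewrite ?nm_ge0 // => n; rewrite expr1n mulr1.
  by case: ifP => _; rewrite ?nm0 ?nm_ge0.
apply: nrW => x; apply/esym/psum_eq => e e0; exists 1%N => -[//|n] _.
rewrite big_ord_recl expr0 mulr1 big1 ?addr0 ?subrr ?nm0 // => i _.
by rewrite mul0r.
Qed.
Lemma ana_id z : ana z id.
Proof.
exists (fun n => if n == 0%N then z else if n == 1%N then 1 else 0).
  exists (nm z + 1), 1; split=> //; first by rewrite addr_ge0 ?nm_ge0.
  by move=> n; rewrite expr1n mulr1; case: ifP => _; [|case: ifP => _]; rewrite ?nm0 ?nm1; have := nm_ge0 z; lra.
apply: nrW => x; apply/esym/psum_eq => e e0; exists 2%N => -[//|[//|n]] _.
rewrite !big_ord_recl /= expr0 expr1 mulr1 mul1r big1 ?addr0 => [|i _]; last by rewrite mul0r.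
by rewrite [z + _]addrC subrK subrr nm0.
Qed.
Lemma anaD z f g : ana z f -> ana z g -> ana z (fun x => f x + g x).
Proof.
move=> [c cg hc] [d dg hd]; exists (fun n => c n + d n); first exact: geoD.
have [rho r0 H] := psumD 0 cg dg.
have := nr_shift z r0 H; apply: nrS2 (nrI hc hd) => x [-> ->] h; exact/esym.
Qed.
Lemma anaM z f g : ana z f -> ana z g -> ana z (fun x => f x * g x).
Proof.
move=> [c cg hc] [d dg hd]; exists (conv c d); first exact: geo_conv.
have [rho r0 H] := psumM cg dg.
have := nr_shift z r0 H; apply: nrS2 (nrI hc hd) => x [-> ->] h; exact/esym.
Qed.
Lemma anaZ z (a : C) f : ana z f -> ana z (fun x => a * f x).
Proof. exact: anaM (ana_cst z a). Qed.
Lemma anaN z f : ana z f -> ana z (fun x => - f x).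
Proof. by move=> /(anaZ (-1)); apply: ana_ext; apply: nrW => x; rewrite mulN1r. Qed.
Lemma anaB z f g : ana z f -> ana z g -> ana z (fun x => f x - g x).
Proof. by move=> h1 /anaN; exact: anaD. Qed.
Lemma anaX z f n : ana z f -> ana z (fun x => f x ^+ n).
Proof.
move=> h; elim: n => [|n IH]; first exact: ana_cst.
by apply: ana_ext (anaM h IH); apply: nrW => x; rewrite exprS.
Qed.
Lemma ana_sum z (I : Type) (s : seq I) (P : pred I) (F : I -> C -> C) :
  (forall i, P i -> ana z (F i)) -> ana z (fun x => \sum_(i <- s | P i) F i x).
Proof.
move=> H; elim: s => [|i s IH].
  by apply: ana_ext (ana_cst z 0); apply: nrW => x; rewrite big_nil.
case Pi: (P i).
  by apply: ana_ext (anaD (H i Pi) IH); apply: nrW => x; rewrite big_cons Pi.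
by apply: ana_ext IH; apply: nrW => x; rewrite big_cons Pi.
Qed.
Lemma ana0 z f c : nr z (fun x => f x = psum c (x - z)) -> f z = c 0%N.
Proof. by move/nr_at ->; rewrite subrr psum0. Qed.
Lemma anaV z f : f z != 0 -> ana z f -> ana z (fun x => (f x)^-1).
Proof.
move=> f0 [c cg hc]; have c0 : c 0%N != 0 by rewrite -(ana0 hc).
have [e eg ce] := conv_inv c0 cg; exists e => //.
have [rho r0 H] := psumM cg eg.
have := nr_shift z r0 H; apply: nrS2 hc => x ->.
rewrite (_ : conv c e = (fun n => if n == 0%N then 1 else 0 : C)); last exact/funext.
rewrite psum_delta => h.
have p0 : psum c (x - z) != 0 by apply/eqP => p; move: h; rewrite p mul0r => /eqP; rewrite oner_eq0.
by apply: (mulfI p0); rewrite -h divff.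
Qed.
Lemma anaXz z f (n : int) : f z != 0 -> ana z f -> ana z (fun x => f x ^ n).
Proof.
move=> f0 h; case: n => n; first exact: anaX.
apply: (@ana_ext _ (fun x => (f x ^+ n.+1)^-1)); first by apply: nrW => x; rewrite NegzE -exprnN.
by apply: anaV; [rewrite expf_neq0|exact: anaX].
Qed.

Lemma der_shift f (a x l : C) : der f (x - a) l -> der (fun y => f (y - a)) x l.
Proof.
move=> h; have hs : der (fun y => y - a) x 1.
  by have := derB (der_id x) (der_cst a x); rewrite subr0.
by have := der_comp hs h; rewrite mulr1.
Qed.
Lemma ana_dv z f : ana z f -> nr z (fun x => der f x (dv f x)) /\ ana z (dv f).
Proof.
move=> [c cg hc]; have [rho r0 H] := psum_der cg.
have H' : nr z (fun x => der f x (psum (dcoef c) (x - z))).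
  have := nr_shift z r0 H; apply: nrS2 (nr_nr hc) => x h1 h2.
  apply: der_ext (der_shift h2).
  by apply: nrS h1 => y ->.
split; first by apply: nrS H' => x h; rewrite (dvE h).
by exists (dcoef c); [exact: geo_dcoef|apply: nrS H' => x /dvE].
Qed.
Lemma ana_ctn z f : ana z f -> ctn f z.
Proof. by case/ana_dv => /nr_at /der_ctn. Qed.

(** Used to read the coefficient functions in the branched variable w. *)
Lemma ana_pow z f (q : nat) : (0 < q)%N -> ana z f -> ana 0 (fun w => f (z + w ^+ q)).
Proof.
move=> q0 [c cg hc]; exists (dil q c); first exact: geo_dil.
have [rho r0 H] := psum_dil q0 cg.
have cp : ctn (fun w : C => z + w ^+ q) 0.
  apply: ctnD; first exact: ctn_cst.
  exact: der_ctn (derX q (der_id 0)).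
have hc' : nr (z + 0 ^+ q) (fun x => f x = psum c (x - z)).
  by rewrite expr0n; case: q q0 {H cp} => // q _; rewrite addr0.
have := nr_shift 0 r0 H; apply: nrS2 (ctn_near cp hc') => w ->.
have -> : z + w ^+ q - z = w ^+ q by rewrite addrAC subrr add0r.
by rewrite (subr0 w) => ->.
Qed.
Lemma ana_div f : ana 0 f -> f 0 = 0 -> exists2 g, ana 0 g & nr 0 (fun w => f w = w * g w).
Proof.
move=> [c cg hc] f0; exists (psum (fun n => c n.+1)).
  by exists (fun n => c n.+1); [exact: geoS|apply: nrW => x; rewrite subr0].
have [rho r0 H] := psumS 0 cg.
have c0 : c 0%N = 0 by rewrite -(ana0 hc).
have := nr_shift 0 r0 H; apply: nrS2 hc => w -> ->.
by rewrite (subr0 w) c0 add0r.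
Qed.
Lemma taylor_ana z f t : taylor_at f z t -> ana z f.
Proof.
move=> /taylor_geo[tg [rho r0 H]]; exists t => //; exists rho => // x; exact: H.
Qed.
End Analytic.

(** * Briot-Bouquet systems *)

Section BriotBouquet.
Variable R : realType.
Local Notation C := (Cx R).
Implicit Types (c d A B : nat -> C) (f : nat -> nat -> nat -> C) (K r T : R).

Definition cdelta (n : nat) : C := if n == 0%N then 1 else 0.
Definition cpow c (i : nat) : nat -> C := iter i (conv c) cdelta.
Definition Pol (I J : nat) f A B (n : nat) : C :=
  \sum_(i < I) \sum_(j < J) conv (f i j) (conv (cpow A i) (cpow B j)) n.
Definition trunc (n : nat) c k : C := if (k < n)%N then c k else 0.

(** First-order perturbation modulo w^(n+1). Products obey the Leibniz rule on such pairs, which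
    isolates how coefficient n of a polynomial expression depends on the n-th unknowns. *)
Definition eqv_upto (n : nat) c c' (a : C) := (forall k, (k < n)%N -> c k = c' k) /\ c n = c' n + a.

Lemma eqv_refl n c : eqv_upto n c c 0. Proof. by split=> //; rewrite addr0. Qed.
Lemma eqv_conv n c c' d d' (a b : C) : (0 < n)%N -> eqv_upto n c c' a -> eqv_upto n d d' b ->
  eqv_upto n (conv c d) (conv c' d') (a * d 0%N + c 0%N * b).
Proof.
move=> n0 [cc ca] [dd da]; split=> [k kn|].
  apply: eq_bigr => i _; congr (_ * _); [apply: cc|apply: dd]; have := ltn_ord i; lia.
case: n n0 cc ca dd da => // n _ cc ca dd da.
rewrite /conv !(big_ord_recl n.+1) !(big_ord_recr n) /= !subn0 /bump !leq0n !add1n !subnn.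
rewrite ca da (cc 0%N) // (dd 0%N) //.
set s1 := \sum_(i < n) _; set s2 := \sum_(i < n) _; have -> : s1 = s2; last by ring.
apply: eq_bigr => i _; congr (_ * _); first by apply: cc; rewrite ltnS.
by apply: dd; rewrite subSS ltnS leq_subr.
Qed.
Lemma conv0 c d : conv c d 0%N = c 0%N * d 0%N.
Proof. by rewrite /conv big_ord1. Qed.
Lemma cpow0 c i : cpow c i 0%N = c 0%N ^+ i.
Proof. by elim: i => [|i IH]; rewrite ?expr0 // exprS -IH; exact: conv0. Qed.
Lemma eqv_cpow n c c' (a : C) i : (0 < n)%N -> eqv_upto n c c' a ->
  eqv_upto n (cpow c i) (cpow c' i) (i%:R * c 0%N ^+ (i - 1) * a).
Proof.
move=> n0 h; elim: i => [|i IH]; first by rewrite !mul0r; exact: eqv_refl.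
have := eqv_conv n0 h IH; rewrite -/(cpow c i.+1) -/(cpow c' i.+1) cpow0.
congr eqv_upto; case: i {IH} => [|i]; first by rewrite !mul0r mulr0 addr0 expr0 !mul1r mulr1.
by rewrite !subn1 /= [i.+2%:R]mulrS exprS; ring.
Qed.
Lemma eqv_sum n (I : nat) (F F' : nat -> nat -> C) (a : nat -> C) :
  (forall i, eqv_upto n (F i) (F' i) (a i)) ->
  eqv_upto n (fun k => \sum_(i < I) F i k) (fun k => \sum_(i < I) F' i k) (\sum_(i < I) a i).
Proof.
move=> H; split=> [k kn|]; first by apply: eq_bigr => i _; apply: (H i).1.
by rewrite -big_split /=; apply: eq_bigr => i _; apply: (H i).2.
Qed.

(** [lin1] and [lin2] are the partial derivatives at (a, b) of the polynomial with coefficients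
    [f i j 0]. *)
Definition lin1 (I J : nat) f (a b : C) : C :=
  \sum_(i < I) \sum_(j < J) f i j 0%N * (i%:R * a ^+ (i - 1) * b ^+ j).
Definition lin2 (I J : nat) f (a b : C) : C :=
  \sum_(i < I) \sum_(j < J) f i j 0%N * (a ^+ i * (j%:R * b ^+ (j - 1))).

Lemma Pol_lin I J f A B A' B' n (a b : C) : (0 < n)%N -> eqv_upto n A A' a -> eqv_upto n B B' b ->
  eqv_upto n (Pol I J f A B) (Pol I J f A' B')
    (lin1 I J f (A 0%N) (B 0%N) * a + lin2 I J f (A 0%N) (B 0%N) * b).
Proof.
move=> n0 hA hB.
pose g i j := f i j 0%N * (i%:R * A 0%N ^+ (i - 1) * a * B 0%N ^+ j + A 0%N ^+ i * (j%:R * B 0%N ^+ (j - 1) * b)).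
have -> : lin1 I J f (A 0%N) (B 0%N) * a + lin2 I J f (A 0%N) (B 0%N) * b =
    \sum_(i < I) \sum_(j < J) g i j.
  rewrite /lin1 /lin2 !mulr_suml -big_split /=; apply: eq_bigr => i _.
  by rewrite !mulr_suml -big_split /=; apply: eq_bigr => j _; rewrite /g; ring.
apply: (@eqv_sum n I (fun i k => \sum_(j < J) conv (f i j) (conv (cpow A i) (cpow B j)) k)
  (fun i k => \sum_(j < J) conv (f i j) (conv (cpow A' i) (cpow B' j)) k)
  (fun i => \sum_(j < J) g i j)) => i.
apply: (@eqv_sum n J (fun j => conv (f i j) (conv (cpow A i) (cpow B j)))
  (fun j => conv (f i j) (conv (cpow A' i) (cpow B' j))) (fun j => g i j)) => j.
have := eqv_conv n0 (eqv_refl n (f i j)) (eqv_conv n0 (eqv_cpow i n0 hA) (eqv_cpow j n0 hB)).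
by rewrite mul0r add0r !cpow0.
Qed.
Lemma eqv_trunc n c : eqv_upto n c (trunc n c) (c n).
Proof. by split=> [k kn|]; rewrite /trunc ?kn // ltnn add0r. Qed.
Lemma Pol_trunc I J f A B n : (0 < n)%N -> Pol I J f A B n =
  Pol I J f (trunc n A) (trunc n B) n + (lin1 I J f (A 0%N) (B 0%N) * A n + lin2 I J f (A 0%N) (B 0%N) * B n).
Proof. by move=> n0; apply: (Pol_lin I J f n0 (eqv_trunc n A) (eqv_trunc n B)).2. Qed.
Lemma Pol_loc I J f A B A' B' n : (forall k, (k <= n)%N -> A k = A' k) ->
  (forall k, (k <= n)%N -> B k = B' k) -> Pol I J f A B n = Pol I J f A' B' n.
Proof.
move=> hA hB.
have h0 : eqv_upto n.+1 A A' (A n.+1 - A' n.+1) by split=> [k|]; [exact: hA|rewrite addrC subrK].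
have h1 : eqv_upto n.+1 B B' (B n.+1 - B' n.+1) by split=> [k|]; [exact: hB|rewrite addrC subrK].
by apply: (Pol_lin I J f _ h0 h1).1.
Qed.

(** With these weights the bounds K r^n [wt n] are stable under Cauchy products, with a constant
    free of n and r; plain geometric bounds lose a factor n+1 at each product. *)
Definition wt (n : nat) : R := (n.+1%:R ^+ 2)^-1.
Lemma wt_gt0 n : 0 < wt n. Proof. by rewrite invr_gt0 exprn_gt0. Qed.
Lemma wt_sum n : \sum_(k < n.+1) wt k <= 2.
Proof.
have : \sum_(k < n.+1) wt k <= 2 - (n.+1%:R)^-1 :> R.
  elim: n => [|n IH]; first by rewrite big_ord1 /wt expr1n invr1; lra.
  rewrite big_ord_recr /=; apply: le_trans (lerD IH (lexx _)) _.
  have a0 : 0 < n.+1%:R :> R by [].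
  have b0 : 0 < n.+2%:R :> R by [].
  have ab : n.+2%:R = n.+1%:R + 1 :> R by rewrite [LHS]mulrSr.
  have ne : n.+1%:R != 0 :> R by rewrite gt_eqF.
  have ne' : n.+2%:R != 0 :> R by rewrite gt_eqF.
  have -> : wt n.+1 = n.+2%:R^-1 * n.+2%:R^-1 by rewrite /wt expr2 invfM.
  have E (x : R) : x != 0 -> x + 1 != 0 -> x^-1 = (x + 1)^-1 + (x + 1)^-1 * x^-1.
    by move=> h1 h2; field; rewrite h1 h2.
  rewrite (E _ ne) -?ab //.
  have : n.+2%:R^-1 * n.+2%:R^-1 <= n.+2%:R^-1 * n.+1%:R^-1 :> R.
    by rewrite ler_wpM2l ?invr_ge0 // lef_pV2 ?posrE // ab; lra.
  move: (n.+2%:R^-1) (n.+1%:R^-1) => u v h; nra.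
have : 0 < n.+1%:R^-1 :> R by rewrite invr_gt0.
by move: (n.+1%:R^-1) => u; move: (\sum_(k < _) _) => v h1 h2; lra.
Qed.
(** For x + y = n + 2, the inequality (x+y)^2 <= 2 (x^2 + y^2) bounds each term by 2 wt(n) (wt(k) +
    wt(n-k)), and the weights sum to at most 2. *)
Lemma wt_conv n : \sum_(k < n.+1) wt k * wt (n - k) <= 8 * wt n.
Proof.
have b (k : 'I_n.+1) : wt k * wt (n - k) <= 2 * wt n * (wt k + wt (n - k)).
  have kn : (k <= n)%N by rewrite -ltnS.
  set x : R := k.+1%:R; set y : R := (n - k).+1%:R.
  have xy : x + y = n.+1%:R + 1.
    by rewrite /x /y -natrD addSn addnS subnKC // [LHS]mulrSr.
  have x0 : 0 < x by []. have y0 : 0 < y by [].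
  rewrite /wt -/x -/y; set N : R := n.+1%:R in xy *.
  have N0 : 0 < N by [].
  have -> : (x ^+ 2)^-1 * (y ^+ 2)^-1 = ((x * y) ^+ 2)^-1 by rewrite [(x * y) ^+ 2]exprMn [RHS]invfM.
  have -> : 2 * (N ^+ 2)^-1 * ((x ^+ 2)^-1 + (y ^+ 2)^-1) = ((x * y) ^+ 2)^-1 * (2 * (x ^+ 2 + y ^+ 2) / N ^+ 2).
    by field; rewrite !gt_eqF.
  rewrite -[leLHS]mulr1; apply: ler_wpM2l; first by rewrite invr_ge0 exprn_ge0 // mulr_ge0 // ltW.
  rewrite ler_pdivlMr ?exprn_gt0 // mul1r.
  have : N ^+ 2 <= (x + y) ^+ 2 by apply: lerXn2r; rewrite ?nnegrE ?xy ?ltW //; lra.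
  have := sqr_ge0 (x - y); rewrite sqrrB sqrrD; lra.
apply: le_trans (ler_sum _ (fun k _ => b k)) _.
rewrite -mulr_sumr big_split /= [X in _ + X](_ : _ = \sum_(k < n.+1) wt k); last first.
  rewrite (reindex_inj rev_ord_inj) /=; apply: eq_bigr => i _; rewrite subSS subKn //.
  by rewrite -ltnS.
have := wt_sum n; have := wt_gt0 n; nra.
Qed.

Definition mb K r c := forall n, nm (c n) <= K * (r ^+ n * wt n).
Lemma mb_ge0 K r c : mb K r c -> 0 <= K.
Proof.
move=> /(_ 0%N); rewrite /wt expr0 expr1n invr1 !mulr1; apply: le_trans; exact: nm_ge0.
Qed.
Lemma mb_conv K r c K' d : 0 <= r -> mb K r c -> mb K' r d -> mb (8 * (K * K')) r (conv c d).
Proof.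
move=> r0 h h' n; apply: le_trans (nm_sum _ _ _) _.
have K0 := mb_ge0 h; have K0' := mb_ge0 h'.
have s (k : 'I_n.+1) : nm (c k * d (n - k)%N) <= K * K' * r ^+ n * (wt k * wt (n - k)).
  have kn : (k <= n)%N by rewrite -ltnS.
  rewrite nmM; apply: le_trans (ler_pM (nm_ge0 _) (nm_ge0 _) (h k) (h' (n - k)%N)) _.
  have -> : r ^+ n = r ^+ k * r ^+ (n - k) by rewrite -exprD subnKC.
  by rewrite le_eqVlt; apply/orP; left; apply/eqP; ring.
apply: le_trans (ler_sum _ (fun k _ => s k)) _; rewrite -mulr_sumr.
apply: le_trans (ler_wpM2l _ (wt_conv n)) _; first by rewrite !mulr_ge0 // exprn_ge0.
by rewrite le_eqVlt; apply/orP; left; apply/eqP; ring.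
Qed.
Lemma mb_cpow K r c i : 0 <= r -> mb K r c -> mb ((8 * K) ^+ i) r (cpow c i).
Proof.
move=> r0 h; elim: i => [|i IH]; last by have := mb_conv r0 h IH; rewrite exprS mulrA.
move=> n; rewrite /= /cdelta expr0 mul1r; case: eqP => [->|_].
  by rewrite nm1 expr0 /wt expr1n invr1 mulr1.
by rewrite nm0 mulr_ge0 ?exprn_ge0 // ltW // wt_gt0.
Qed.
Definition mbc (I J : nat) T K : R := \sum_(i < I) \sum_(j < J) 8 * (T * (8 * ((8 * K) ^+ i * (8 * K) ^+ j))).
Lemma mb_Pol I J f A B T K r : 0 <= r -> (forall i j, (i < I)%N -> (j < J)%N -> mb T r (f i j)) ->
  mb K r A -> mb K r B -> mb (mbc I J T K) r (Pol I J f A B).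
Proof.
move=> r0 hf hA hB n; apply: le_trans (nm_sum _ _ _) _; rewrite /mbc mulr_suml.
apply: ler_sum => i _; apply: le_trans (nm_sum _ _ _) _; rewrite mulr_suml.
apply: ler_sum => j _; apply: mb_conv => //; first exact: hf.
by apply: mb_conv => //; exact: mb_cpow.
Qed.
Lemma gb_mb K r r' c : 0 < r -> 4 * r <= r' -> gb K r c -> mb K r' c.
Proof.
move=> r0 rr h n; apply: le_trans (h n) _; apply: ler_wpM2l; first exact: gb_ge0 h.
rewrite /wt ler_pdivlMr ?exprn_gt0 //.
apply: (@le_trans _ _ ((4 * r) ^+ n)); last first.
  by apply: lerXn2r => //; rewrite nnegrE ?mulr_ge0 ?ltW //; apply: lt_le_trans rr; rewrite mulr_gt0.
rewrite exprMn mulrC; apply: ler_wpM2r; first by rewrite exprn_ge0 // ltW.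
have -> : 4 ^+ n = (2 ^+ n) ^+ 2 :> R by rewrite -exprM mulnC exprM; congr (_ ^+ _); ring.
by apply: lerXn2r; rewrite ?nnegrE ?exprn_ge0 //; exact: natX2.
Qed.

Lemma geo_family (I J : nat) f : (forall i j, (i < I)%N -> (j < J)%N -> geo (f i j)) ->
  exists K r, [/\ 0 <= K, 0 < r & forall i j, (i < I)%N -> (j < J)%N -> gb K r (f i j)].
Proof.
move=> H.
have /choice[g Hg] : forall ij : 'I_I * 'I_J, exists Kr : R * R,
    [/\ 0 <= Kr.1, 0 < Kr.2 & gb Kr.1 Kr.2 (f ij.1 ij.2)].
  by move=> [i j]; have [K [r [K0 r0 h]]] := H i j (ltn_ord i) (ltn_ord j); exists (K, r).
exists (\sum_ij (g ij).1), (1 + \sum_ij (g ij).2).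
have s1 : 0 <= \sum_ij (g ij).2 by apply: sumr_ge0 => ij _; have [_ /ltW] := Hg ij.
split; [by apply: sumr_ge0 => ij _; have [] := Hg ij|lra|].
move=> i j iI jJ; have [K0 r0 h] := Hg (Ordinal iI, Ordinal jJ).
apply: gb_mono h => //; first by rewrite (bigD1 (Ordinal iI, Ordinal jJ)) //= lerDl;
  apply: sumr_ge0 => ij _; have [] := Hg ij.
- exact: ltW.
- rewrite (bigD1 (Ordinal iI, Ordinal jJ)) //=.
  suff : 0 <= \sum_(i0 | i0 != (Ordinal iI, Ordinal jJ)) (g i0).2 by lra.
  by apply: sumr_ge0 => ij _; have [_ /ltW] := Hg ij.
Qed.

(* For large n the factor n on the left beats the linear part, so the bound
   K r^n / (n+1)^2 propagates once r has absorbed the finitely many small n. *)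
Theorem briot_bouquet_converges (I J : nat) f1 f2 (e1 e2 : C) A B :
  (forall i j, (i < I)%N -> (j < J)%N -> geo (f1 i j)) ->
  (forall i j, (i < I)%N -> (j < J)%N -> geo (f2 i j)) ->
  (forall n, (n%:R - e1) * A n = Pol I J f1 A B n) ->
  (forall n, (n%:R - e2) * B n = Pol I J f2 A B n) -> geo A /\ geo B.
Proof.
move=> /geo_family[T1 [t1 [T10 t10 h1]]] /geo_family[T2 [t2 [T20 t20 h2]]] eA eB.
pose S n := nm (A n) + nm (B n).
have S0 n : 0 <= S n by rewrite addr_ge0 ?nm_ge0.
pose K := S 0%N + 1; have K0 : 0 < K by have := S0 0%N; rewrite /K; lra.
set p1 := lin1 I J f1 (A 0%N) (B 0%N); set q1 := lin2 I J f1 (A 0%N) (B 0%N).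
set p2 := lin1 I J f2 (A 0%N) (B 0%N); set q2 := lin2 I J f2 (A 0%N) (B 0%N).
pose L := nm e1 + nm e2 + nm p1 + nm q1 + nm p2 + nm q2.
have L0 : 0 <= L by rewrite !addr_ge0 ?nm_ge0.
pose T := T1 + T2; pose M := mbc I J T K + mbc I J T K + 1.
have T0 : 0 <= T by rewrite addr_ge0.
have C0 : 0 <= mbc I J T K.
  apply: sumr_ge0 => i _; apply: sumr_ge0 => j _.
  by rewrite !mulr_ge0 // exprn_ge0 // mulr_ge0 // ltW.
(* [mbc], hence M and n1, is independent of r; so r can be chosen afterwards, its last summand
   covering the indices below n1. *)
pose n1 := Num.bound (L + L + M / K).
have n1P n : (n1 <= n)%N -> L + L + M / K <= n%:R.
  move=> nn; apply: le_trans (ltW (archi_boundP _)) _.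
    have : 0 <= M / K by rewrite divr_ge0 /M ?ltW //; lra.
    lra.
  by rewrite ler_nat.
pose r := 4 * t1 + 4 * t2 + 1 + \sum_(k < n1) S k / (K * wt k).
have sm : 0 <= \sum_(k < n1) S k / (K * wt k).
  by apply: sumr_ge0 => k _; rewrite divr_ge0 // mulr_ge0 // ltW // wt_gt0.
have r1 : 1 <= r by rewrite /r; lra.
have r0 : 0 <= r by lra.
have hf1 i j : (i < I)%N -> (j < J)%N -> mb T r (f1 i j).
  move=> iI jJ n; have : mb T1 r (f1 i j) by apply: (gb_mb t10) (h1 i j iI jJ); rewrite /r; lra.
  move=> /(_ n) /le_trans; apply; apply: ler_wpM2r; last by rewrite /T; lra.
  by rewrite mulr_ge0 ?exprn_ge0 // ltW // wt_gt0.
have hf2 i j : (i < I)%N -> (j < J)%N -> mb T r (f2 i j).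
  move=> iI jJ n; have : mb T2 r (f2 i j) by apply: (gb_mb t20) (h2 i j iI jJ); rewrite /r; lra.
  move=> /(_ n) /le_trans; apply; apply: ler_wpM2r; last by rewrite /T; lra.
  by rewrite mulr_ge0 ?exprn_ge0 // ltW // wt_gt0.
have key n : S n <= K * (r ^+ n * wt n).
  elim/ltn_ind: n => n IH.
  have [n0|n0] := posnP n.
    by rewrite n0 expr0 /wt expr1n invr1 !mulr1 /K; lra.
  have [nn|nn] := ltnP n n1.
    have w0 : 0 < K * wt n by rewrite mulr_gt0 // wt_gt0.
    rewrite mulrCA -ler_pdivrMr // (@le_trans _ _ r) //; last first.
      by rewrite -[leLHS]expr1; apply: ler_weXn2l.
    rewrite /r (bigD1 (Ordinal nn)) //=.
    have : 0 <= \sum_(i < n1 | i != Ordinal nn) S i / (K * wt i).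
      by apply: sumr_ge0 => k _; rewrite divr_ge0 // mulr_ge0 // ltW // wt_gt0.
    lra.
  have tr c : (forall k, nm (c k) <= S k) -> mb K r (trunc n c).
    move=> hc k; rewrite /trunc; case: ifP => kn; first exact: le_trans (hc k) (IH k kn).
    by rewrite nm0 !mulr_ge0 ?exprn_ge0 // ltW // wt_gt0.
  have hA : mb K r (trunc n A) by apply: tr => k; rewrite /S lerDl nm_ge0.
  have hB : mb K r (trunc n B) by apply: tr => k; rewrite /S lerDr nm_ge0.
  have P1 := mb_Pol r0 hf1 hA hB n; have P2 := mb_Pol r0 hf2 hA hB n.
  set X := r ^+ n * wt n in P1 P2 *; have X0 : 0 < X.
    by rewrite mulr_gt0 ?wt_gt0 // exprn_gt0 //; lra.
  have b1 : n%:R * nm (A n) <= mbc I J T K * X + nm p1 * nm (A n) + nm q1 * nm (B n) + nm e1 * nm (A n).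
    rewrite -(nm_nat R n) -nmM.
    have -> : n%:R * A n = Pol I J f1 (trunc n A) (trunc n B) n + (p1 * A n + q1 * B n) + e1 * A n.
      by rewrite -Pol_trunc // -eA; ring.
    have a1 := nmD (Pol I J f1 (trunc n A) (trunc n B) n + (p1 * A n + q1 * B n)) (e1 * A n).
    have a2 := nmD (Pol I J f1 (trunc n A) (trunc n B) n) (p1 * A n + q1 * B n).
    have a3 := nmD (p1 * A n) (q1 * B n).
    rewrite !nmM in a1 a2 a3; lra.
  have b2 : n%:R * nm (B n) <= mbc I J T K * X + nm p2 * nm (A n) + nm q2 * nm (B n) + nm e2 * nm (B n).
    rewrite -(nm_nat R n) -nmM.
    have -> : n%:R * B n = Pol I J f2 (trunc n A) (trunc n B) n + (p2 * A n + q2 * B n) + e2 * B n.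
      by rewrite -Pol_trunc // -eB; ring.
    have a1 := nmD (Pol I J f2 (trunc n A) (trunc n B) n + (p2 * A n + q2 * B n)) (e2 * B n).
    have a2 := nmD (Pol I J f2 (trunc n A) (trunc n B) n) (p2 * A n + q2 * B n).
    have a3 := nmD (p2 * A n) (q2 * B n).
    rewrite !nmM in a1 a2 a3; lra.
  have LS x y : 0 <= x -> x <= L -> y <= S n -> 0 <= y -> x * y <= L * S n.
    by move=> *; apply: ler_pM.
  have aS : nm (A n) <= S n by rewrite /S lerDl nm_ge0.
  have bS : nm (B n) <= S n by rewrite /S lerDr nm_ge0.
  have b3 : n%:R * S n <= M * X + (L + L) * S n.
    have e (x : R) : 0 <= x -> x * nm (A n) <= x * S n by move=> x0; apply: ler_wpM2l.
    have e' (x : R) : 0 <= x -> x * nm (B n) <= x * S n by move=> x0; apply: ler_wpM2l.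
    have := e _ (nm_ge0 p1); have := e _ (nm_ge0 p2); have := e _ (nm_ge0 e1).
    have := e' _ (nm_ge0 q1); have := e' _ (nm_ge0 q2); have := e' _ (nm_ge0 e2).
    have -> : n%:R * S n = n%:R * nm (A n) + n%:R * nm (B n) by rewrite /S mulrDr.
    have : 0 <= L * S n by exact: mulr_ge0.
    have -> : (L + L) * S n = L * S n + (nm e1 * S n + nm e2 * S n + nm p1 * S n + nm q1 * S n +
        nm p2 * S n + nm q2 * S n) by rewrite mulrDl; congr (_ + _); rewrite /L !mulrDl.
    have -> : M * X = mbc I J T K * X + mbc I J T K * X + X by rewrite /M; ring.
    lra.
  have b4 : M / K * S n <= M * X.
    have := ler_wpM2r (S0 n) (n1P n nn); rewrite [X in X <= _]mulrDl; lra.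
  have Mp : 0 < M by rewrite /M; lra.
  by move: b4; rewrite mulrAC ler_pdivrMr // -mulrA ler_pM2l // mulrC.
split; exists K, r; split => //; rewrite ?ltW //; try lra; move=> n.
- apply: le_trans (le_trans _ (key n)) _; first by rewrite /S lerDl nm_ge0.
  apply: ler_wpM2l; first exact: ltW.
  rewrite ger_pMr ?exprn_gt0 //; last lra.
  by rewrite invf_le1 ?exprn_gt0 // exprn_ege1 // ler1n.
- apply: le_trans (le_trans _ (key n)) _; first by rewrite /S lerDr nm_ge0.
  apply: ler_wpM2l; first exact: ltW.
  rewrite ger_pMr ?exprn_gt0 //; last lra.
  by rewrite invf_le1 ?exprn_gt0 // exprn_ege1 // ler1n.
Qed.
End BriotBouquet.

(** * Briot-Bouquet recursions: resonances and support of the coefficients *)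

Section Recursion.
Variable R : realType.
Local Notation C := (Cx R).
Implicit Types (c d A B : nat -> C) (f : nat -> nat -> nat -> C).

Lemma det2_inj (a b c d x y : C) : a * d - b * c != 0 -> a * x + b * y = 0 -> c * x + d * y = 0 ->
  x = 0 /\ y = 0.
Proof.
move=> D h1 h2; split; apply: (mulfI D); rewrite mulr0.
- have -> : (a * d - b * c) * x = d * (a * x + b * y) - b * (c * x + d * y) by ring.
  by rewrite h1 h2 !mulr0 subrr.
- have -> : (a * d - b * c) * y = a * (c * x + d * y) - c * (a * x + b * y) by ring.
  by rewrite h1 h2 !mulr0 subrr.
Qed.

(** Determinant of the linear system that gives (A n, B n) from the earlier coefficients; its zeros
    in n are the resonances. *)
Definition bbdet (I J : nat) f1 f2 (e1 e2 a b : C) (n : nat) : C :=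
  (n%:R - e1 - lin1 I J f1 a b) * (n%:R - e2 - lin2 I J f2 a b) -
  lin2 I J f1 a b * lin1 I J f2 a b.

Definition bbsol (I J : nat) f1 f2 (e1 e2 : C) A B (n : nat) :=
  (n%:R - e1) * A n = Pol I J f1 A B n /\ (n%:R - e2) * B n = Pol I J f2 A B n.

Lemma bbsol_lin I J f1 f2 e1 e2 A B n : (0 < n)%N ->
  bbsol I J f1 f2 e1 e2 A B n <->
  (n%:R - e1 - lin1 I J f1 (A 0%N) (B 0%N)) * A n + - lin2 I J f1 (A 0%N) (B 0%N) * B n =
     Pol I J f1 (trunc n A) (trunc n B) n /\
  - lin1 I J f2 (A 0%N) (B 0%N) * A n + (n%:R - e2 - lin2 I J f2 (A 0%N) (B 0%N)) * B n =
     Pol I J f2 (trunc n A) (trunc n B) n.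
Proof.
move=> n0; rewrite /bbsol !(Pol_trunc I J _ A B n0).
set P1 := Pol I J f1 _ _ n; set P2 := Pol I J f2 _ _ n.
split=> -[h1 h2]; split.
- by rewrite mulrBl h1; ring.
- by rewrite mulrBl h2; ring.
- by rewrite -h1; ring.
- by rewrite -h2; ring.
Qed.

(** Beyond the last resonance Cramer's rule determines every further coefficient. *)
Lemma bbsol_extend (I J : nat) f1 f2 (e1 e2 : C) A B (n0 : nat) :
  (forall n, (n <= n0)%N -> bbsol I J f1 f2 e1 e2 A B n) ->
  (forall n, (n0 < n)%N -> bbdet I J f1 f2 e1 e2 (A 0%N) (B 0%N) n != 0) ->
  exists A' B', [/\ forall n, (n <= n0)%N -> A' n = A n, forall n, (n <= n0)%N -> B' n = B n &
    forall n, bbsol I J f1 f2 e1 e2 A' B' n].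
Proof.
move=> h hD.
pose a n := n%:R - e1 - lin1 I J f1 (A 0%N) (B 0%N); pose b := - lin2 I J f1 (A 0%N) (B 0%N).
pose c := - lin1 I J f2 (A 0%N) (B 0%N); pose d n := n%:R - e2 - lin2 I J f2 (A 0%N) (B 0%N).
have Dn n : (n0 < n)%N -> a n * d n - b * c != 0.
  by move=> /hD; rewrite /bbdet /b /c mulrNN.
pose F (u : nat -> C * C) n : C * C := if (n <= n0)%N then (A n, B n) else
  let u1 := trunc n (fun k => (u k).1) in let u2 := trunc n (fun k => (u k).2) in
  let R1 := Pol I J f1 u1 u2 n in let R2 := Pol I J f2 u1 u2 n in
  let D := a n * d n - b * c in ((d n * R1 - b * R2) / D, (a n * R2 - c * R1) / D).
have [|u uE] := @rec_exists (C * C)%type (0, 0) F.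
  move=> u v n H; rewrite /F; case: ifP => // _.
  have -> : trunc n (fun k => (u k).1) = trunc n (fun k => (v k).1).
    by apply/funext => k; rewrite /trunc; case: ifP => // /H ->.
  have -> // : trunc n (fun k => (u k).2) = trunc n (fun k => (v k).2).
  by apply/funext => k; rewrite /trunc; case: ifP => // /H ->.
pose A' k := (u k).1; pose B' k := (u k).2.
have EA n : (n <= n0)%N -> A' n = A n by move=> nn; rewrite /A' uE /F nn.
have EB n : (n <= n0)%N -> B' n = B n by move=> nn; rewrite /B' uE /F nn.
exists A', B'; split => // n.
have [nn|nn] := leqP n n0.
  have [h1 h2] := h n nn; rewrite /bbsol (EA n nn) (EB n nn) h1 h2.
  by split; apply: Pol_loc => k kn; rewrite ?EA ?EB //; exact: leq_trans kn nn.
have np : (0 < n)%N by apply: leq_ltn_trans nn.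
apply/(bbsol_lin _ _ _ _ _ _ _ _ np); rewrite (EA 0%N) // (EB 0%N) // -/b -/c -/(a n) -/(d n).
have D0 := Dn n nn.
have E1 : A' n = (d n * Pol I J f1 (trunc n A') (trunc n B') n - b * Pol I J f2 (trunc n A') (trunc n B') n) / (a n * d n - b * c).
  by rewrite {1}/A' uE /F leqNgt nn.
have E2 : B' n = (a n * Pol I J f2 (trunc n A') (trunc n B') n - c * Pol I J f1 (trunc n A') (trunc n B') n) / (a n * d n - b * c).
  by rewrite {1}/B' uE /F leqNgt nn.
by rewrite E1 E2; split; field.
Qed.

Lemma sum_dvd (d m : nat) (F : nat -> C) : (0 < d)%N -> (forall k, ~~ (d %| k)%N -> F k = 0) ->
  \sum_(k < m * d) F k = \sum_(j < m) F (d * j)%N.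
Proof.
move=> d0 H; elim: m => [|m IH]; first by rewrite mul0n !big_ord0.
rewrite big_ord_recr /= -IH mulSn addnC big_split_ord /=; congr (_ + _).
case: d d0 H {IH} => // d _ H.
rewrite big_ord_recl addn0 [(d.+1 * m)%N]mulnC big1 ?addr0 // => i _.
rewrite H //= /bump leq0n add1n dvdn_addr ?dvdn_mull //.
by rewrite gtnNdvd // ltnS.
Qed.
Lemma dilM (d m : nat) c : (0 < d)%N -> dil d c (d * m)%N = c m.
Proof. by move=> d0; rewrite /dil dvdn_mulr // mulKn. Qed.
Lemma conv_dil (d : nat) c e : (0 < d)%N -> conv (dil d c) (dil d e) = dil d (conv c e).
Proof.
move=> d0; apply/funext => n; rewrite {3}/dil; case: ifP => dn.
  have [m ->] : exists m, n = (d * m)%N by exists (n %/ d)%N; rewrite mulnC divnK.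
  rewrite mulKn // /conv big_ord_recr /= subnn.
  rewrite [X in X + _](_ : _ = \sum_(k < m * d) dil d c k * dil d e (d * m - k)%N); last by rewrite mulnC.
  rewrite (@sum_dvd d m (fun k => dil d c k * dil d e (d * m - k)%N) d0); last by move=> k /negbTE kd; rewrite /dil kd mul0r.
  rewrite [RHS]big_ord_recr /= dilM // -[X in dil d e X](muln0 d) dilM // subnn; congr (_ + _).
  by apply: eq_bigr => j _; rewrite -mulnBr !dilM.
rewrite /conv big1 // => k _; rewrite /dil; case: ifP => dk; last by rewrite mul0r.
case: ifP => dk'; last by rewrite mulr0.
have kn : (k <= n)%N by rewrite -ltnS.
by have := dvdn_add dk dk'; rewrite subnKC // dn.
Qed.
Lemma cpow_dil (d : nat) c i : (0 < d)%N -> cpow (dil d c) i = dil d (cpow c i).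
Proof.
move=> d0; elim: i => [|i IH].
  apply/funext => n; rewrite /= /dil /cdelta; case: (eqVneq n 0%N) => [->|n0].
    by rewrite dvdn0 div0n.
  case: ifP => // dn; case: eqP => // h.
  by move: n0; rewrite -(divnK dn) h mul0n.
by rewrite /cpow !iterS -!/(cpow _ i) IH conv_dil.
Qed.
Lemma Pol_dil (d I J : nat) f A B : (0 < d)%N ->
  Pol I J (fun i j => dil d (f i j)) (dil d A) (dil d B) = dil d (Pol I J f A B).
Proof.
move=> d0; apply/funext => n; rewrite /Pol.
under eq_bigr => i _ do under eq_bigr => j _ do rewrite !cpow_dil // !conv_dil //.
rewrite /dil; case: ifP => // _; rewrite big1 // => i _; rewrite big1 //.
Qed.

(** Off the multiples of d the right-hand side built from the earlier coefficients vanishes, and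
    without a resonance there the linear system has only the zero solution. *)
Lemma bbsol_support (d I J : nat) f1 f2 e1 e2 A B : (0 < d)%N ->
  (forall n, bbsol I J (fun i j => dil d (f1 i j)) (fun i j => dil d (f2 i j)) e1 e2 A B n) ->
  (forall n, ~~ (d %| n)%N -> bbdet I J (fun i j => dil d (f1 i j)) (fun i j => dil d (f2 i j))
      e1 e2 (A 0%N) (B 0%N) n != 0) ->
  A = dil d (fun m => A (d * m)%N) /\ B = dil d (fun m => B (d * m)%N).
Proof.
move=> d0 h hD.
have key n : ~~ (d %| n)%N -> A n = 0 /\ B n = 0.
  elim/ltn_ind: n => n IH dn.
  have np : (0 < n)%N by case: n dn {IH} => //; rewrite dvdn0.
  have tr : trunc n A = dil d (fun m => trunc n A (d * m)%N) /\
            trunc n B = dil d (fun m => trunc n B (d * m)%N).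
    by split; apply/funext => k; rewrite /dil; case: ifPn => dk;
      rewrite ?[(d * (k %/ d))%N]mulnC ?divnK // /trunc; case: ifP => // kn;
      have [] := IH k kn dk.
  have := h n => /(bbsol_lin _ _ _ _ _ _ _ _ np).
  rewrite tr.1 tr.2 !Pol_dil // /dil (negbTE dn) => -[h1 h2].
  by apply: (det2_inj _ h1 h2); rewrite mulrNN; exact: hD.
have gen c : (forall n, ~~ (d %| n)%N -> c n = 0) -> c = dil d (fun m => c (d * m)%N).
  move=> H; apply/funext => k; rewrite /dil; case: ifPn => dk; last exact: H.
  by rewrite mulnC divnK.
by split; apply: gen => n /key[].
Qed.
End Recursion.

(** * Inverse functions and uniqueness for polynomial systems *)

Section Inverse.
Variable R : realType.
Local Notation C := (Cx R).
Implicit Types (f g X : C -> C) (c d A B : nat -> C) (w z : C).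

Lemma nr0 (P : C -> Prop) : nr 0 P <-> exists2 rho : R, 0 < rho & forall w, nm w < rho -> P w.
Proof.
by split=> -[e e0 H]; exists e => // w we; apply: H; move: we; rewrite subr0.
Qed.

Lemma nm_segment (z0 z1 : C) (s r : R) : 0 <= s <= 1 -> nm z0 < r -> nm z1 < r ->
  nm (z0 + rc s * (z1 - z0)) < r.
Proof.
move=> /andP[s0 s1] h0 h1.
have -> : z0 + rc s * (z1 - z0) = rc (1 - s) * z0 + rc s * z1 by rewrite /rc rmorphB rmorph1 /=; ring.
apply: le_lt_trans (nmD _ _) _; rewrite !nmM !nm_rc (ger0_norm s0) ger0_norm; last lra.
have [->|sn] := eqVneq s 0; first by rewrite mul0r addr0; lra.
have sp : 0 < s by rewrite lt_neqAle eq_sym sn.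
have : (1 - s) * nm z0 <= (1 - s) * r by rewrite ler_wpM2l //; lra.
have : s * nm z1 < s * r by rewrite ltr_pM2l.
lra.
Qed.
Lemma nm_segment_at (a z0 z1 : C) (s r : R) : 0 <= s <= 1 -> nm (z0 - a) < r -> nm (z1 - a) < r ->
  nm (z0 + rc s * (z1 - z0) - a) < r.
Proof.
move=> s01 h0 h1; have := nm_segment s01 h0 h1.
by rewrite (_ : z0 - a + _ = z0 + rc s * (z1 - z0) - a) //; ring.
Qed.

(** The map phi(w) = w - X(w) is a contraction with factor 1/2 near 0, so w = phi(w) + xi is solved
    by iteration. The same bound gives the two-sided comparison of w with xi and the continuity of
    the inverse. *)
Lemma inverse_function X : ana 0 X -> X 0 = 0 -> dv X 0 = 1 ->
  exists (rho sig : R) (om : C -> C), [/\ 0 < rho, 0 < sig,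
    forall w, nm w < rho -> der X w (dv X w) /\ dv X w != 0 &
    forall xi, nm xi < sig -> [/\ nm (om xi) < rho, nm (om xi) <= 2 * nm xi, nm xi <= 2 * nm (om xi),
      X (om xi) = xi & der om xi (dv X (om xi))^-1]].
Proof.
move=> aX X0 X1; have [dX adX] := ana_dv aX.
have c2 : 0 < 1 / 2 :> R by lra.
have near1 := ctn_close (ana_ctn adX) c2; rewrite X1 in near1.
have /nr0[rho r0 H] := nrI dX near1.
pose phi w := w - X w.
have lip w w' : nm w < rho -> nm w' < rho -> nm (phi w' - phi w) <= 1 / 2 * nm (w' - w).
  move=> h h'; apply: (@mean_value _ phi (fun z => 1 - dv X z)) => s s01 /=.
  have [h1 h2] := H _ (nm_segment s01 h h').
  split; last by rewrite nmBC ltW.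
  by apply: derB => //; exact: der_id.
have Xlip w w' : nm w < rho -> nm w' < rho -> nm (w' - w) <= 2 * nm (X w' - X w).
  move=> h h'; have := lip w w' h h'.
  have -> : w' - w = (phi w' - phi w) + (X w' - X w) by rewrite /phi; ring.
  have := nmD (phi w' - phi w) (X w' - X w); lra.
(* Stated for all xi so that [choice] yields a total inverse; the value 0 outside the disk is
   arbitrary. *)
have sol xi : exists w, nm xi < rho / 4 -> nm w <= 2 * nm xi /\ X w = xi.
  have [xs|] := ltP (nm xi) (rho / 4); last by exists 0.
  pose W := fix W k := match k with O => 0 | k'.+1 => phi (W k') + xi end.
  have p0 : phi 0 = 0 by rewrite /phi X0 subrr.
  have n0 := nm_ge0 xi.
  have H0 : nm (0 : C) < rho by rewrite nm0.
  have Wb k : nm (W k) <= 2 * nm xi.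
    elim: k => [|k IH]; first by rewrite nm0; lra.
    have := lip 0 (W k) H0 (_ : nm (W k) < rho); rewrite p0 !subr0 => /(_ (ltac:(lra))) h.
    rewrite /=; have := nmD (phi (W k)) xi; lra.
  have Wr k : nm (W k) < rho by have := Wb k; lra.
  have Wd k : nm (W k.+1 - W k) <= nm xi * (1 / 2) ^+ k.
    elim: k => [|k IH]; first by rewrite /= p0 add0r subr0 expr0 mulr1.
    have -> : W k.+2 - W k.+1 = phi (W k.+1) - phi (W k) by rewrite /=; ring.
    apply: le_trans (lip _ _ (Wr k) (Wr k.+1)) _; rewrite exprS mulrCA.
    by apply: ler_wpM2l => //; lra.
  have h12 : 0 <= (1 / 2 : R) < 1 by apply/andP; split; lra.
  have [w cw _] := series_cvto (a := fun k => W k.+1 - W k) h12 Wd.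
  have {}cw : cvto W w.
    apply: cvto_eq cw; elim=> [|k IH]; first by rewrite big_ord0.
    by rewrite big_ord_recr /= IH addrC subrK.
  have wb := cvto_le Wb cw.
  exists w => _; split => //.
  have wr : nm w < rho by lra.
  apply/eqP; rewrite -subr_eq0 -nm_eq0; apply/eqP/le_anti; rewrite nm_ge0 andbT.
  apply/ler_addgt0Pr => e e0; rewrite add0r.
  have e3 : 0 < e / 4 by lra.
  have [N HN] := cw _ e3.
  have h1 := HN N (leqnn N); have h2 := HN N.+1 (leqnSn N).
  have h3 := lip _ _ (Wr N) wr.
  have WS : W N.+1 = phi (W N) + xi by [].
  have -> : X w - xi = (w - W N.+1) - (phi w - phi (W N)).
    by rewrite WS; move: (phi (W N)) => v; rewrite /phi; ring.
  have := nmB (w - W N.+1) (phi w - phi (W N)).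
  rewrite (nmBC w (W N.+1)) => h4; rewrite (nmBC w (W N)) in h3; lra.
have /choice[om Hom] := sol.
exists rho, (rho / 4), om; split=> //; first lra.
  move=> w wr; have [h1 h2] := H w wr; split => //.
  by apply: contraTneq h2 => ->; rewrite sub0r nmN nm1 -leNgt; lra.
move=> xi xs; have n0 := nm_ge0 xi.
have [w1 Xw] := Hom xi xs.
have wr : nm (om xi) < rho by lra.
split=> //.
  have H0 : nm (0 : C) < rho by rewrite nm0.
  have := lip _ _ H0 wr; rewrite /phi X0 !subr0 Xw.
  by have := nm_sub xi (om xi); rewrite (nmBC xi); lra.
have [dXw _] := H _ wr.
have near_xi : nr xi (fun xi' => nm xi' < rho / 4).
  have e0 : 0 < rho / 4 - nm xi by lra.
  by apply: nrS (@nr_lt _ xi _ e0) => x; have := nm_sub x xi; lra.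
have com : ctn om xi.
  move=> e e0; have e2 : 0 < e / 2 by lra.
  apply: nrS2 near_xi (@nr_lt _ xi _ e2) => x xs' xe.
  have [w1' Xw'] := Hom x xs'; have n0' := nm_ge0 x.
  have := Xlip (om xi) (om x) wr (_ : nm (om x) < rho); rewrite Xw Xw' => /(_ (ltac:(lra))); lra.
have X'0 : dv X (om xi) != 0.
  have [_ h2] := H _ wr.
  by apply: contraTneq h2 => ->; rewrite sub0r nmN nm1 -leNgt; lra.
case: (dXw) => psi cpsi [psi0 psiE].
exists (fun x => (psi (om x))^-1).
  apply: ctnV; first by rewrite psi0.
  exact: ctn_comp.
split; first by rewrite psi0.
have npsi : nr xi (fun x => psi (om x) != 0).
  by apply: (ctn_neq0 (f := fun x => psi (om x))); [exact: ctn_comp|rewrite psi0].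
have e1 := ctn_near com psiE.
apply: nrS2 (nrI near_xi npsi) e1 => x [xs' px]; have [_ Xw'] := Hom x xs'.
rewrite Xw Xw' => e.
have -> : x - xi = (om x - om xi) * psi (om x) by apply/eqP; rewrite subr_eq addrC; apply/eqP.
by rewrite mulfK // addrC subrK.
Qed.

Lemma psum_sum (I : nat) (F : nat -> nat -> C) : (forall i, (i < I)%N -> geo (F i)) ->
  geo (fun n => \sum_(i < I) F i n) /\
  nr 0 (fun w => psum (fun n => \sum_(i < I) F i n) w = \sum_(i < I) psum (F i) w).
Proof.
elim: I => [|I IH] H.
  have E : (fun n => \sum_(i < 0) F i n) = fun=> 0 by apply/funext => n; rewrite big_ord0.
  rewrite E; split.
    by exists 0, 1; split=> // n; rewrite nm0 mul0r.
  apply: nrW => w; rewrite big_ord0; apply: psum_eq => e e0; exists 0%N => n _.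
  by rewrite big1 ?subrr ?nm0 // => i _; rewrite mul0r.
have [g1 n1] := IH (fun i iI => H i (ltnW iI)).
have gI := H I (ltnSn I).
have E : (fun n => \sum_(i < I.+1) F i n) = fun n => \sum_(i < I) F i n + F I n.
  by apply/funext => n; rewrite big_ord_recr.
rewrite E; split; first exact: geoD.
have /nr0 h := psumD 0 g1 gI.
by apply: nrS2 n1 h => w h1 ->; rewrite big_ord_recr /= h1.
Qed.
Lemma psum_cpow c i : geo c -> geo (cpow c i) /\ nr 0 (fun w => psum (cpow c i) w = psum c w ^+ i).
Proof.
move=> cg; elim: i => [|i [g1 n1]].
  split; last by apply: nrW => w; rewrite expr0; exact: psum_delta.
  exists 1, 1; split=> // n; rewrite /cpow /= /cdelta expr1n mulr1.
  by case: ifP; rewrite ?nm1 ?nm0.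
split; first exact: geo_conv.
have /nr0 h := psumM cg g1.
by apply: nrS2 n1 h => w h1 h2; rewrite exprS -h1 -h2.
Qed.
Lemma psum_Pol (I J : nat) (f : nat -> nat -> nat -> C) A B : geo A -> geo B ->
  (forall i j, (i < I)%N -> (j < J)%N -> geo (f i j)) ->
  nr 0 (fun w => psum (Pol I J f A B) w =
    \sum_(i < I) \sum_(j < J) psum (f i j) w * (psum A w ^+ i * psum B w ^+ j)).
Proof.
move=> gA gB gf.
pose G i j := conv (f i j) (conv (cpow A i) (cpow B j)).
have T i j : (i < I)%N -> (j < J)%N -> geo (G i j) /\
    nr 0 (fun w => psum (G i j) w = psum (f i j) w * (psum A w ^+ i * psum B w ^+ j)).
  move=> iI jJ; have [g1 n1] := psum_cpow i gA; have [g2 n2] := psum_cpow j gB.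
  have g12 := geo_conv g1 g2; have gij := gf i j iI jJ.
  split; first exact: geo_conv.
  have /nr0 h1 := psumM g1 g2; have /nr0 h2 := psumM gij g12.
  by apply: nrS2 (nrI n1 n2) (nrI h1 h2) => w [e1 e2] [e3 e4]; rewrite /G e4 e3 e1 e2.
have big_nr (K : nat) (P : nat -> C -> Prop) : (forall k, (k < K)%N -> nr 0 (P k)) ->
    nr 0 (fun w => forall k, (k < K)%N -> P k w).
  elim: K => [|K IH] H; first by apply: nrW.
  apply: nrS2 (IH (fun k kK => H k (ltnW kK))) (H K (ltnSn K)) => w h1 h2 k.
  by rewrite ltnS leq_eqVlt => /orP[/eqP ->//|]; exact: h1.
have T2 i : (i < I)%N -> geo (fun n => \sum_(j < J) G i j n) /\
    nr 0 (fun w => psum (fun n => \sum_(j < J) G i j n) w = \sum_(j < J) psum (f i j) w * (psum A w ^+ i * psum B w ^+ j)).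
  move=> iI; have [g1 n1] := psum_sum (fun j jJ => (T i j iI jJ).1); split => //.
  have n2 := big_nr J _ (fun j jJ => (T i j iI jJ).2).
  by apply: nrS2 n1 n2 => w -> h; apply: eq_bigr => j _; exact: h.
have [g1 n1] := psum_sum (F := fun i n => \sum_(j < J) G i j n) (fun i iI => (T2 i iI).1).
have n2 := big_nr I _ (fun i iI => (T2 i iI).2).
by apply: nrS2 n1 n2 => w e h; rewrite /Pol e; apply: eq_bigr => i _; exact: h.
Qed.

(** Multiplying the n-th coefficient by n - e is the operator w d/dw - e; this turns recursions into
    differential equations. *)
Lemma psum_euler (e : C) A : geo A ->
  nr 0 (fun w => psum (fun n => (n%:R - e) * A n) w = w * psum (dcoef A) w - e * psum A w).
Proof.
move=> gA.
have g1 : geo (fun n => n%:R * A n).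
  have [K [r [K0 r0 h]]] := gA; exists K, (2 * r); split => //; first by rewrite mulr_gt0.
  move=> n; rewrite nmM nm_nat exprMn mulrCA; apply: ler_pM; rewrite ?nm_ge0 //.
  by apply: le_trans (natX2 R n); rewrite ler_nat.
have g2 : geo (fun n => - e * A n).
  have [K [r [K0 r0 h]]] := gA; exists (nm e * K), r; split => //; first by rewrite mulr_ge0 ?nm_ge0.
  by move=> n; rewrite nmM nmN -mulrA ler_wpM2l ?nm_ge0.
have /nr0 h1 := psumD 0 g1 g2; have /nr0 h2 := psumS 0 g1.
have /nr0 h3 : exists2 rho : R, 0 < rho & forall w, nm w < rho -> psum (fun n => - e * A n) w = - e * psum A w.
  have [K [r [K0 r0 h]]] := gA; exists r^-1; first by rewrite invr_gt0.
  move=> w hw; have rw : r * nm w < 1 by rewrite mulrC -ltr_pdivlMr // div1r.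
  have [a _] := psum_spec r0 h rw; apply: psum_eq; apply: cvto_eq (cvtoZ (- e) a) => n.
  by rewrite mulr_sumr; apply: eq_bigr => i _; rewrite mulrA.
apply: nrS2 (nrI h1 h2) h3 => w [e1 e2] e3.
have -> : (fun n => (n%:R - e) * A n) = fun n => n%:R * A n + - e * A n.
  by apply/funext => n; rewrite mulrBl mulNr.
by rewrite e1 e2 e3 mul0r add0r mulNr.
Qed.
End Inverse.

(** * Propagation of bounds along a parameter interval *)

Section PathInduction.
Variable R : realType.
Local Notation C := (Cx R).
Implicit Types (a b s t e : R).

Lemma real_induction a b (P : R -> Prop) : a <= b -> P a ->
  (forall t, a <= t -> t < b -> P t -> exists2 e : R, 0 < e & forall s, t < s -> s <= b -> s < t + e -> P s) ->
  (forall t, a < t -> t <= b -> (forall s, a <= s -> s < t -> P s) -> P t) -> P b.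
Proof.
move=> ab Pa step lim.
pose S := [set t | a <= t <= b /\ forall s, a <= s <= t -> P s].
have Sa : S a.
  by split; [rewrite lexx|move=> s /andP[s1 s2]; rewrite (_ : s = a) //; apply: le_anti; rewrite s1 s2].
have Sb : has_sup S by split; [exists a|exists b => t [/andP[]]].
pose c := sup S.
have ac : a <= c by apply: sup_upper_bound.
have cb : c <= b by apply: ge_sup => [|t [/andP[]]]; [exists a|].
have below s : a <= s -> s < c -> P s.
  move=> as_ sc; have e0 : 0 < c - s by lra.
  have [t [_ Ht] st] := sup_adherent e0 Sb.
  by apply: Ht; rewrite as_ /=; rewrite -/c in st; lra.
have Pc : P c.
  have [<-//|ac'] := eqVneq a c.
  by apply: lim => //; rewrite lt_neqAle ac'.
have [<-//|cb'] := eqVneq c b.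
have clt : c < b by rewrite lt_neqAle cb'.
have [e e0 He] := step c ac clt Pc.
pose s := Num.min b (c + e / 2).
have sb : s <= b by rewrite /s ge_min lexx.
have se : s <= c + e / 2 by rewrite /s ge_min lexx orbT.
have cs : c < s by rewrite /s lt_min clt; lra.
have Ss : S s.
  split; first by apply/andP; split; lra.
  move=> x /andP[x1 x2]; have [xc|xc|->//] := ltgtP x c; first exact: below.
  by apply: He; lra.
have : s <= c by apply: sup_upper_bound.
by rewrite leNgt cs.
Qed.

Lemma path_bounded a b (F : R -> R) : a <= b ->
  (forall t, a <= t <= b -> exists K : R, pnr a b t (fun s => F s <= K)) ->
  exists K : R, forall s, a <= s <= b -> F s <= K.
Proof.
move=> ab H.
apply: (@real_induction a b (fun t => exists K : R, forall s, a <= s <= t -> F s <= K)) => //.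
- exists (F a) => s /andP[s1 s2]; rewrite (_ : s = a) //; apply: le_anti; by rewrite s1 s2.
- move=> t a_t tb [K HK]; have [|K' [e e0 He]] := H t; first by rewrite a_t ltW.
  exists e => // s ts sb se; exists (Num.max K K') => x /andP[x1 x2]; rewrite le_max.
  have [xt|xt] := leP x t; first by rewrite HK // x1.
  rewrite He ?orbT //; first by apply/andP; split; lra.
  by rewrite ltr_norml; apply/andP; split; lra.
- move=> t a_t tb HP; have [|K' [e e0 He]] := H t; first by rewrite ltW.
  have [|| K HK] := HP (Num.max a (t - e / 2)); first by rewrite le_max lexx.
    by rewrite gt_max a_t; lra.
  exists (Num.max K K') => x /andP[x1 x2]; rewrite le_max.
  have [xt|xt] := leP x (Num.max a (t - e / 2)); first by rewrite HK // x1.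
  move: xt; rewrite gt_max => /andP[_ xt].
  rewrite He ?orbT //; first by apply/andP; split; lra.
  by rewrite ltr_norml; apply/andP; split; lra.
Qed.

(* u is given near each t by a germ U at g t; the truncation at 1 lets the
   differential inequality be required only where it is needed. *)
Lemma gronwall_germs a b (g : R -> C) V (u1 u2 : R -> C) (K : R) : tame_path a b g V -> 0 <= K ->
  (forall t, a <= t <= b -> exists (U1 U2 : C -> C) (l1 l2 : C),
     [/\ der U1 (g t) l1, der U2 (g t) l2,
       pnr a b t (fun s => u1 s = U1 (g s) /\ u2 s = U2 (g s)) &
       nm (u1 t) + nm (u2 t) <= 1 -> nm l1 + nm l2 <= K * (nm (u1 t) + nm (u2 t))]) ->
  let phi t := Num.min (nm (u1 t) + nm (u2 t)) 1 in
  phi a <= phi b * expR (2 * (K + 1) * (V b - V a)) /\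
  phi b <= phi a * expR (2 * (K + 1) * (V b - V a)).
Proof.
move=> gV K0 H phi.
have p0 t : 0 <= phi t by rewrite /phi le_min ler01 andbT addr_ge0 ?nm_ge0.
have ab : a <= b by case: gV.
have lem c : 0 < c ->
    phi a + c <= (phi b + c) * expR (2 * (K + 1) * (V b - V a)) /\
    phi b + c <= (phi a + c) * expR (2 * (K + 1) * (V b - V a)).
  move=> c0; apply: (path_gronwall gV) => //; first lra.
  move=> t tt; have [U1 [U2 [l1 [l2 [d1 d2 loc small]]]]] := H t tt.
  have loct : u1 t = U1 (g t) /\ u2 t = U2 (g t).
    by case: loc => e e0; apply => //; rewrite subrr normr0.
  (* The slack required by [der_lip], taken proportional to phi + c: twice eta is absorbed by
     raising the Gronwall constant from K to K + 1. *)
  pose eta := (phi t + c) / 2; have eta0 : 0 < eta by rewrite /eta; have := p0 t; lra.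
  have k1 : nm l1 < nm l1 + eta by lra.
  have k2 : nm l2 < nm l2 + eta by lra.
  have [n1|n1] := leP (nm (u1 t) + nm (u2 t)) 1.
    have n2 := small n1.
    have pt : phi t = nm (u1 t) + nm (u2 t) by rewrite /phi min_l.
    apply: pnrS2 (tame_near gV tt (nrI (der_lip d1 k1) (der_lip d2 k2))) loc => s [h1 h2] [e1 e2].
    apply: (@le_trans _ _ ((nm l1 + eta + (nm l2 + eta)) * nm (g s - g t))).
      apply: (@le_trans _ _ (`|(nm (u1 s) + nm (u2 s)) - (nm (u1 t) + nm (u2 t))|)).
        rewrite pt /phi; have [//|h] := leP (nm (u1 s) + nm (u2 s)) 1.
        by rewrite !ger0_norm; lra.
      have -> : nm (u1 s) + nm (u2 s) - (nm (u1 t) + nm (u2 t)) =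
        (nm (u1 s) - nm (u1 t)) + (nm (u2 s) - nm (u2 t)) by ring.
      apply: le_trans (ler_normD _ _) _; rewrite mulrDl.
      apply: lerD; apply: le_trans (nm_dist _ _) _; first by rewrite e1 loct.1.
      by rewrite e2 loct.2.
    apply: ler_wpM2r; first exact: nm_ge0.
    have Kc := mulr_ge0 K0 (ltW c0).
    by rewrite /eta; move: n2; rewrite -pt; lra.
  (* Where the deviation exceeds 1 the truncated function is locally constant, and nothing is asked
     of the derivatives. *)
  have k3 : 0 < (nm (u1 t) + nm (u2 t) - 1) / 2 by lra.
  have c1 := ctn_close (der_ctn d1) k3; have c2 := ctn_close (der_ctn d2) k3.
  apply: pnrS2 (tame_near gV tt (nrI c1 c2)) loc => s [h1 h2] [e1 e2].
  have -> : phi t = 1 by rewrite /phi min_r // ltW.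
  have -> : phi s = 1.
    rewrite /phi min_r //.
    have h3 := nm_sub (u1 t) (u1 s); have h4 := nm_sub (u2 t) (u2 s).
    move: h1 h2; rewrite -e1 -e2 -loct.1 -loct.2 nmBC (nmBC (u2 s)); lra.
  by rewrite subrr normr0 !mulr_ge0 ?nm_ge0 //; lra.
set E := expR _ in lem *; have E0 : 0 < E by exact: expR_gt0.
have lim x y : (forall c, 0 < c -> x + c <= (y + c) * E) -> x <= y * E.
  move=> h; apply/ler_addgt0Pr => e e0.
  have c0 : 0 < e / E by exact: divr_gt0.
  have := h _ c0; rewrite mulrDl divfK ?gt_eqF //; lra.
by split; apply: lim => c /lem[].
Qed.
End PathInduction.

(** * Polynomial systems: uniqueness along segments and the regular Cauchy problem *)

Lemma summand_le5 (R : realType) (k y1 y2 x1 x2 s B : R) : 0 <= x2 -> 0 <= x1 -> 0 <= y2 -> 0 <= y1 -> 0 <= k ->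
  0 <= s -> k + y1 + y2 + x1 + x2 + s <= B -> [/\ y1 <= B, y2 <= B, x1 <= B & x2 <= B].
Proof. by move=> *; split; lra. Qed.

Section PolySystem.
Variable R : realType.
Local Notation C := (Cx R).
Variables (I J : nat).
Implicit Types (F : nat -> nat -> C -> C).

Definition polsum F (z y1 y2 : C) : C := \sum_(i < I) \sum_(j < J) F i j z * (y1 ^+ i * y2 ^+ j).

Lemma ctn_sum (K : nat) (f : nat -> C -> C) w : (forall k, (k < K)%N -> ctn (f k) w) ->
  ctn (fun x => \sum_(k < K) f k x) w.
Proof.
elim: K => [|K IH] H.
  by apply: ctn_ext (ctn_cst 0 w); apply: nrW => x; rewrite big_ord0.
apply: ctn_ext (ctnD (IH (fun k kK => H k (ltnW kK))) (H K (ltnSn K))).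
by apply: nrW => x; rewrite big_ord_recr.
Qed.
Lemma ctnX (f : C -> C) n w : ctn f w -> ctn (fun x => f x ^+ n) w.
Proof.
move=> h; elim: n => [|n IH]; first exact: ctn_cst.
by apply: ctn_ext (ctnM h IH); apply: nrW => x; rewrite exprS.
Qed.
Lemma ctn_punctured (f g : C -> C) w : ctn f w -> ctn g w ->
  nr w (fun x => x != w -> f x = g x) -> f w = g w.
Proof.
move=> cf cg H; apply/eqP; rewrite -subr_eq0 -nm_eq0; apply/eqP/le_anti; rewrite nm_ge0 andbT.
apply/ler_addgt0Pr => e e0; rewrite add0r.
have e2 : 0 < e / 2 by lra.
have [d d0 Hd] := nrI H (nrI (ctn_close cf e2) (ctn_close cg e2)).
pose x := w + rc (d / 2).
have xw : x - w = rc (d / 2) by rewrite /x addrC addKr.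
have nx : nm (x - w) = d / 2 by rewrite xw nm_rc ger0_norm //; lra.
have [|h [h1 h2]] := Hd x; first by rewrite nx; lra.
have ne : x != w by rewrite -subr_eq0 -nm_eq0 nx; lra.
rewrite (h ne) in h1; have := nmD3 (f w) (g x) (g w); rewrite (nmBC (f w) (g x)); lra.
Qed.

Lemma nm_expr_lip (B : R) (x y : C) n : 1 <= B -> nm x <= B -> nm y <= B ->
  nm (x ^+ n - y ^+ n) <= n%:R * B ^+ n * nm (x - y).
Proof.
move=> B1 xB yB; have B0 : 0 <= B by lra.
elim: n => [|n IH]; first by rewrite subrr nm0 !mul0r.
have -> : x ^+ n.+1 - y ^+ n.+1 = x * (x ^+ n - y ^+ n) + (x - y) * y ^+ n by rewrite !exprS; ring.
apply: le_trans (nmD _ _) _; rewrite !nmM nmX.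
have h1 : nm x * nm (x ^+ n - y ^+ n) <= B * (n%:R * B ^+ n * nm (x - y)).
  by apply: ler_pM; rewrite ?nm_ge0.
have h2 : nm (x - y) * nm y ^+ n <= nm (x - y) * B ^+ n.+1.
  apply: ler_wpM2l; first exact: nm_ge0.
  apply: (@le_trans _ _ (B ^+ n)); first by apply: lerXn2r; rewrite ?nnegrE ?nm_ge0.
  by apply: ler_weXn2l.
by rewrite (mulrSr _ n) exprS; rewrite exprS in h2; lra.
Qed.
Lemma polsum_lip (B : R) : 1 <= B -> exists2 K : R, 0 <= K & forall F z y1 y2 x1 x2,
  (forall i j, (i < I)%N -> (j < J)%N -> nm (F i j z) <= B) ->
  nm y1 <= B -> nm y2 <= B -> nm x1 <= B -> nm x2 <= B ->
  nm (polsum F z y1 y2 - polsum F z x1 x2) <= K * (nm (y1 - x1) + nm (y2 - x2)).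
Proof.
move=> B1; have B0 : 0 <= B by lra.
pose k i j : R := B * (i%:R * B ^+ i * B ^+ j + B ^+ i * (j%:R * B ^+ j)).
have k0 i j : 0 <= k i j by rewrite /k !(mulr_ge0, addr_ge0, exprn_ge0).
exists (\sum_(i < I) \sum_(j < J) k i j).
  by apply: sumr_ge0 => i _; apply: sumr_ge0.
move=> F z y1 y2 x1 x2 FB h1 h2 h3 h4.
rewrite /polsum -sumrB mulr_suml; apply: le_trans (nm_sum _ _ _) _.
apply: ler_sum => i _; rewrite -sumrB mulr_suml; apply: le_trans (nm_sum _ _ _) _.
apply: ler_sum => j _; rewrite -mulrBr nmM /k -mulrA.
apply: ler_pM; rewrite ?nm_ge0 //; first exact: FB.
have -> : y1 ^+ i * y2 ^+ j - x1 ^+ i * x2 ^+ j =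
  (y1 ^+ i - x1 ^+ i) * y2 ^+ j + x1 ^+ i * (y2 ^+ j - x2 ^+ j) by ring.
apply: le_trans (nmD _ _) _; rewrite !nmM.
have pB (x : C) n : nm x <= B -> nm (x ^+ n) <= B ^+ n.
  by move=> xB; rewrite nmX; apply: lerXn2r; rewrite ?nnegrE ?nm_ge0.
have e1 : nm (y1 ^+ i - x1 ^+ i) * nm (y2 ^+ j) <= i%:R * B ^+ i * nm (y1 - x1) * B ^+ j.
  by apply: ler_pM; rewrite ?nm_ge0 ?pB // nm_expr_lip.
have e2 : nm (x1 ^+ i) * nm (y2 ^+ j - x2 ^+ j) <= B ^+ i * (j%:R * B ^+ j * nm (y2 - x2)).
  by apply: ler_pM; rewrite ?nm_ge0 ?pB // nm_expr_lip.
have p1 : 0 <= i%:R * B ^+ i * B ^+ j * nm (y2 - x2) by rewrite !mulr_ge0 ?exprn_ge0 ?nm_ge0.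
have p2 : 0 <= B ^+ i * (j%:R * B ^+ j) * nm (y1 - x1) by rewrite !mulr_ge0 ?exprn_ge0 ?nm_ge0.
lra.
Qed.

(* zeta is the (reparametrised) independent variable, zeta' = kap. *)
Lemma segment_uniqueness F1 F2 (zeta kap y1 y2 x1 x2 : C -> C) (w0 w1 : C) :
  (forall s : R, 0 <= s <= 1 -> let w := w0 + rc s * (w1 - w0) in
     [/\ ctn zeta w, ctn kap w,
       forall i j, (i < I)%N -> (j < J)%N -> ctn (F1 i j) (zeta w) /\ ctn (F2 i j) (zeta w),
       der y1 w (kap w * polsum F1 (zeta w) (y1 w) (y2 w)) /\
       der y2 w (kap w * polsum F2 (zeta w) (y1 w) (y2 w)) &
       der x1 w (kap w * polsum F1 (zeta w) (x1 w) (x2 w)) /\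
       der x2 w (kap w * polsum F2 (zeta w) (x1 w) (x2 w))]) ->
  y1 w0 = x1 w0 -> y2 w0 = x2 w0 -> y1 w1 = x1 w1 /\ y2 w1 = x2 w1.
Proof.
move=> H e1 e2.
have gV := segment_tame w0 w1; set g := fun s : R => w0 + rc s * (w1 - w0) in gV.
have g0 : g 0 = w0 by rewrite /g /rc rmorph0 mul0r addr0.
have g1 : g 1 = w1 by rewrite /g /rc rmorph1 mul1r addrC subrK.
pose S (w : C) : R := nm (kap w) + nm (y1 w) + nm (y2 w) + nm (x1 w) + nm (x2 w) +
  \sum_(i < I) \sum_(j < J) (nm (F1 i j (zeta w)) + nm (F2 i j (zeta w))).
(* One bound along the segment for the coefficients, the factor [kap] and all four functions makes
   the system Lipschitz there. *)
have [B HB] : exists B : R, forall s, 0 <= s <= 1 -> S (g s) <= B.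
  apply: (path_bounded ler01) => t tt; have [cz ck cF [dy1 dy2] [dx1 dx2]] := H t tt.
  have bd (f : C -> C) : ctn f (g t) -> nr (g t) (fun w => nm (f w) <= nm (f (g t)) + 1).
    move=> cf; have lt : nm (f (g t)) < nm (f (g t)) + 1 by lra.
    by apply: nrS (ctn_nm_lt cf lt) => w /ltW.
  have bs (K : nat) (f : nat -> C -> R) : (forall k, (k < K)%N -> exists b : R, nr (g t) (fun w => f k w <= b)) ->
      exists b : R, nr (g t) (fun w => \sum_(k < K) f k w <= b).
    elim: K => [|K IH] h; first by exists 0; apply: nrW => w; rewrite big_ord0.
    have [b1 h1] := IH (fun k kK => h k (ltnW kK)); have [b2 h2] := h K (ltnSn K).
    exists (b1 + b2); apply: nrS2 h1 h2 => w h1 h2; rewrite big_ord_recr /=; exact: lerD.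
  have [b hb] : exists b : R, nr (g t) (fun w => \sum_(i < I) \sum_(j < J) (nm (F1 i j (zeta w)) + nm (F2 i j (zeta w))) <= b).
    apply: (bs I (fun i w => \sum_(j < J) (nm (F1 i j (zeta w)) + nm (F2 i j (zeta w))))) => i iI.
    apply: (bs J (fun j w => nm (F1 i j (zeta w)) + nm (F2 i j (zeta w)))) => j jJ.
    have [c1 c2] := cF i j iI jJ.
    exists ((nm (F1 i j (zeta (g t))) + 1) + (nm (F2 i j (zeta (g t))) + 1)).
    by apply: nrS2 (bd _ (ctn_comp cz c1)) (bd _ (ctn_comp cz c2)) => w; exact: lerD.
  exists ((nm (kap (g t)) + 1) + (nm (y1 (g t)) + 1) + (nm (y2 (g t)) + 1) + (nm (x1 (g t)) + 1)
     + (nm (x2 (g t)) + 1) + b).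
  apply: (tame_near gV tt (P := fun w => S w <= _)).
  have := nrI (nrI (nrI (bd _ ck) (bd _ (der_ctn dy1))) (nrI (bd _ (der_ctn dy2)) (bd _ (der_ctn dx1)))) (bd _ (der_ctn dx2)).
  apply: nrS2 hb => w h6 [[[h1 h2] [h3 h4]] h5]; rewrite /S; lra.
pose B' := Num.max B 1.
have B1 : 1 <= B' by rewrite /B' le_max lexx orbT.
have [K K0 HK] := polsum_lip B1.
have S_ge (w : C) : 0 <= \sum_(i < I) \sum_(j < J) (nm (F1 i j (zeta w)) + nm (F2 i j (zeta w))).
  by apply: sumr_ge0 => i _; apply: sumr_ge0 => j _; rewrite addr_ge0 ?nm_ge0.
have SB s : 0 <= s <= 1 -> S (g s) <= B' by move=> /HB h; rewrite /B' le_max h.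
have BK : 0 <= 2 * (B' * K) by rewrite !mulr_ge0 //; lra.
have := @gronwall_germs _ 0 1 g _ (fun s => y1 (g s) - x1 (g s)) (fun s => y2 (g s) - x2 (g s)) _ gV BK.
case=> [t tt|_].
  have [cz ck cF [dy1 dy2] [dx1 dx2]] := H t tt; rewrite -/(g t) in cz ck cF dy1 dy2 dx1 dx2.
  exists (fun w => y1 w - x1 w), (fun w => y2 w - x2 w).
  do 2 eexists; split; [exact: derB dy1 dx1|exact: derB dy2 dx2| |].
    by exists 1.
  move=> _; rewrite -!mulrBr !nmM.
  have := SB t tt; have := S_ge (g t); rewrite /S.
  have := nm_ge0 (kap (g t)); have := nm_ge0 (y1 (g t)); have := nm_ge0 (y2 (g t)).
  have := nm_ge0 (x1 (g t)); have := nm_ge0 (x2 (g t)) => a1 a2 a3 a4 a5 a6 a7.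
  have FB i j : (i < I)%N -> (j < J)%N -> nm (F1 i j (zeta (g t))) <= B' /\ nm (F2 i j (zeta (g t))) <= B'.
    move=> iI jJ.
    have : nm (F1 i j (zeta (g t))) + nm (F2 i j (zeta (g t))) <=
        \sum_(i < I) \sum_(j < J) (nm (F1 i j (zeta (g t))) + nm (F2 i j (zeta (g t)))).
      rewrite (bigD1 (Ordinal iI)) //= (bigD1 (Ordinal jJ)) //= -addrA lerDl addr_ge0 //.
        by apply: sumr_ge0 => k _; rewrite addr_ge0 ?nm_ge0.
      by apply: sumr_ge0 => k _; apply: sumr_ge0 => l _; rewrite addr_ge0 ?nm_ge0.
    have := nm_ge0 (F1 i j (zeta (g t))); have := nm_ge0 (F2 i j (zeta (g t))); lra.
  have L1 := HK F1 (zeta (g t)) (y1 (g t)) (y2 (g t)) (x1 (g t)) (x2 (g t)) (fun i j iI jJ => (FB i j iI jJ).1).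
  have L2 := HK F2 (zeta (g t)) (y1 (g t)) (y2 (g t)) (x1 (g t)) (x2 (g t)) (fun i j iI jJ => (FB i j iI jJ).2).
  have [k1 k2 k3 k4] := summand_le5 a1 a2 a3 a4 a5 a6 a7.
  have {}L1 := L1 k1 k2 k3 k4; have {}L2 := L2 k1 k2 k3 k4.
  set D := nm (y1 (g t) - x1 (g t)) + nm (y2 (g t) - x2 (g t)) in L1 L2 *.
  have kB : nm (kap (g t)) <= B' by lra.
  have m1 := ler_pM (nm_ge0 (kap (g t))) (nm_ge0 _) kB L1.
  have m2 := ler_pM (nm_ge0 (kap (g t))) (nm_ge0 _) kB L2.
  by have -> : 2 * (B' * K) * D = B' * (K * D) + B' * (K * D); [ring|exact: lerD].
rewrite g0 g1 e1 e2 !subrr nm0 addr0 (min_l ler01) mul0r => h.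
have n1 := nm_ge0 (y1 w1 - x1 w1); have n2 := nm_ge0 (y2 w1 - x2 w1).
have z : nm (y1 w1 - x1 w1) + nm (y2 w1 - x2 w1) <= 0.
  by move: h; rewrite ge_min => /orP[//|]; rewrite leNgt ltr01.
split; apply/eqP; rewrite -subr_eq0 -nm_eq0; apply/eqP/le_anti; rewrite nm_ge0 andbT; lra.
Qed.

Definition cshift (c : nat -> C) n : C := if n is n'.+1 then c n' else 0.
Lemma geo_cshift c : geo c -> geo (cshift c).
Proof.
move=> [K [r [K0 r0 h]]]; exists K, (r + 1); split => //; first lra.
have h' : gb K (r + 1) c by apply: gb_mono h => //; lra.
move=> [|n]; first by rewrite nm0 expr0 mulr1.
apply: le_trans (h' n) _; apply: ler_wpM2l => //; apply: ler_weXn2l => //; lra.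
Qed.
Lemma psum_cshift c : geo c -> nr 0 (fun w => psum (cshift c) w = w * psum c w).
Proof.
by move=> /geo_cshift /(psumS 0) /nr0; apply: nrS => w ->; rewrite add0r.
Qed.

(** Multiplied by z - z0 the system is of Briot-Bouquet type. The shifted coefficients vanish at 0,
    so the linear parts are zero and the determinant at level n is n^2: the convergence theorem for
    series at singular points also covers regular ones. *)
Lemma cauchy_regular F1 F2 (z0 b1 b2 : C) :
  (forall i j, (i < I)%N -> (j < J)%N -> ana z0 (F1 i j) /\ ana z0 (F2 i j)) ->
  exists h1 h2 : C -> C, [/\ h1 z0 = b1, h2 z0 = b2 &
    nr z0 (fun z => der h1 z (polsum F1 z (h1 z) (h2 z)) /\ der h2 z (polsum F2 z (h1 z) (h2 z)))].
Proof.
move=> H.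
have /choice[c Hc] : forall ij : nat * nat, exists cc : (nat -> C) * (nat -> C),
    (ij.1 < I)%N -> (ij.2 < J)%N -> [/\ geo cc.1, geo cc.2,
    nr z0 (fun x => F1 ij.1 ij.2 x = psum cc.1 (x - z0)) & nr z0 (fun x => F2 ij.1 ij.2 x = psum cc.2 (x - z0))].
  move=> [i j] /=; case: (ltnP i I) => iI; last by exists (fun=> 0, fun=> 0).
  case: (ltnP j J) => jJ; last by exists (fun=> 0, fun=> 0).
  by have [[c1 g1 n1] [c2 g2 n2]] := H i j iI jJ; exists (c1, c2).
pose f1 i j := cshift (c (i, j)).1; pose f2 i j := cshift (c (i, j)).2.
have l0 (f : nat -> nat -> nat -> C) (a b : C) : (forall i j, f i j 0%N = 0) -> lin1 I J f a b = 0 /\ lin2 I J f a b = 0.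
  by move=> f0; rewrite /lin1 /lin2; split; rewrite big1 // => i _; rewrite big1 // => j _; rewrite f0 mul0r.
have P0 (f : nat -> nat -> nat -> C) (A B : nat -> C) : (forall i j, f i j 0%N = 0) -> Pol I J f A B 0%N = 0.
  by move=> f0; rewrite /Pol big1 // => i _; rewrite big1 // => j _; rewrite conv0 f0 mul0r.
have [||A [B [A0 B0 sol]]] := @bbsol_extend R I J f1 f2 0 0 (fun=> b1) (fun=> b2) 0.
- by move=> n; rewrite leqn0 => /eqP ->; rewrite /bbsol !P0 // subr0 !mul0r.
- move=> n n0; have [p1 q1] := l0 f1 b1 b2 (fun _ _ => erefl); have [p2 q2] := l0 f2 b1 b2 (fun _ _ => erefl).
  rewrite /bbdet p1 q1 p2 q2.
  by rewrite !subr0 mulr0 subr0 mulf_neq0 // pnatr_eq0 -lt0n.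
have gc i j : (i < I)%N -> (j < J)%N -> geo (c (i, j)).1 /\ geo (c (i, j)).2.
  by move=> iI jJ; have [] := Hc (i, j) iI jJ.
have [gA gB] : geo A /\ geo B.
  apply: (@briot_bouquet_converges R I J f1 f2 0 0) => [i j iI jJ|i j iI jJ|n|n].
  - exact: geo_cshift (gc i j iI jJ).1.
  - exact: geo_cshift (gc i j iI jJ).2.
  - exact: (sol n).1.
  - exact: (sol n).2.
have ctnA (c' : nat -> C) : geo c' -> ctn (psum c') 0.
  by move=> /psum_der /nr0 /nr_at /der_ctn.
have main (E : nat -> C) (cc : nat -> nat -> nat -> C) (F : nat -> nat -> C -> C) : geo E ->
    (forall i j, (i < I)%N -> (j < J)%N -> geo (cc i j) /\ nr z0 (fun x => F i j x = psum (cc i j) (x - z0))) ->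
    (forall n, (n%:R - 0) * E n = Pol I J (fun i j => cshift (cc i j)) A B n) ->
    nr z0 (fun z => der (fun x => psum E (x - z0)) z
       (polsum F z (psum A (z - z0)) (psum B (z - z0)))).
  move=> gE hcc eqE.
  pose G w : C := \sum_(i < I) \sum_(j < J) psum (cc i j) w * (psum A w ^+ i * psum B w ^+ j).
  have big_nr (K : nat) (P : nat -> C -> Prop) z : (forall k, (k < K)%N -> nr z (P k)) ->
      nr z (fun w => forall k, (k < K)%N -> P k w).
    elim: K => [|K IH] h; first by apply: nrW.
    apply: nrS2 (IH (fun k kK => h k (ltnW kK))) (h K (ltnSn K)) => w h1 h2 k.
    by rewrite ltnS leq_eqVlt => /orP[/eqP ->//|]; exact: h1.
  have e1 : nr 0 (fun w => w * psum (dcoef E) w = w * G w).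
    have := psum_Pol (f := fun i j => cshift (cc i j)) gA gB (fun i j iI jJ => geo_cshift (hcc i j iI jJ).1).
    have sh : nr 0 (fun w => forall i, (i < I)%N -> forall j, (j < J)%N -> psum (cshift (cc i j)) w = w * psum (cc i j) w).
      apply: (big_nr I (fun i w => forall j, (j < J)%N -> psum (cshift (cc i j)) w = w * psum (cc i j) w)) => i iI.
      apply: (big_nr J (fun j w => psum (cshift (cc i j)) w = w * psum (cc i j) w)) => j jJ.
      exact: psum_cshift (hcc i j iI jJ).1.
    apply: nrS2 (nrI sh (psum_euler 0 gE)) => w [h1 h2] h3.
    have e : (fun n => (n%:R - 0) * E n) = Pol I J (fun i j => cshift (cc i j)) A B by apply/funext => n; exact: eqE.
    rewrite e mul0r subr0 in h2.
    rewrite -h2 h3 /G mulr_sumr; apply: eq_bigr => i _; rewrite mulr_sumr; apply: eq_bigr => j _.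
    by rewrite h1 //; ring.
  have cG : ctn G 0.
    apply: ctn_sum (fun i w => \sum_(j < J) psum (cc i j) w * (psum A w ^+ i * psum B w ^+ j)) _ _ => i iI.
    apply: ctn_sum (fun j w => psum (cc i j) w * (psum A w ^+ i * psum B w ^+ j)) _ _ => j jJ.
    apply: ctnM; first exact: ctnA (hcc i j iI jJ).1.
    by apply: ctnM; apply: ctnX; exact: ctnA.
  (* The factor w is cancelled off 0; continuity of both sides gives the equation at 0. *)
  have e2 : nr 0 (fun w => psum (dcoef E) w = G w).
    have e3 : nr 0 (fun w => w != 0 -> psum (dcoef E) w = G w).
      by apply: nrS e1 => w h w0; exact: (mulfI w0).
    have e0 : psum (dcoef E) 0 = G 0.
      by apply: ctn_punctured e3; [exact: ctnA (geo_dcoef gE)|exact: cG].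
    by apply: nrS e3 => w h; have [->//|] := eqVneq w 0.
  have tr (P : C -> Prop) : nr 0 P -> nr z0 (fun z => P (z - z0)).
    by move=> /nr0[e e0 h]; exact: nr_shift e0 h.
  have /nr0/tr d1 := psum_der gE.
  have ff : nr z0 (fun z => forall i, (i < I)%N -> forall j, (j < J)%N -> F i j z = psum (cc i j) (z - z0)).
    apply: (big_nr I (fun i z => forall j, (j < J)%N -> F i j z = psum (cc i j) (z - z0))) => i iI.
    by apply: (big_nr J (fun j z => F i j z = psum (cc i j) (z - z0))) => j jJ; exact: (hcc i j iI jJ).2.
  apply: nrS2 (nrI d1 (tr _ e2)) ff => z [h1 h2] h3.
  apply: der_eq (der_shift h1); rewrite h2 /G /polsum; apply: eq_bigr => i _; apply: eq_bigr => j _.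
  by rewrite h3.
exists (fun z => psum A (z - z0)), (fun z => psum B (z - z0)); split.
- by rewrite subrr psum0 A0.
- by rewrite subrr psum0 B0.
apply: nrI.
- apply: (main A (fun i j => (c (i, j)).1)) => // [i j iI jJ|n]; last exact: (sol n).1.
  by have [] := Hc (i, j) iI jJ.
- apply: (main B (fun i j => (c (i, j)).2)) => // [i j iI jJ|n]; last exact: (sol n).2.
  by have [] := Hc (i, j) iI jJ.
Qed.
End PolySystem.

(** * Blow-up at the end of the path *)

Section Cluster.
Variable R : realType.
Local Notation C := (Cx R).
Implicit Types (e t T : R).

(** Parameters arbitrarily close to the end of the path; [ends], introduced with the path estimates,
    is the matching notion of eventually. *)
Definition frq (P : R -> Prop) := forall T, T < 1 -> exists t, [/\ T < t, t < 1 & P t].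

(** The cluster value is the upper limit of x along the parameters where S holds. Letting S depend
    on e turns the closeness obtained for one real coordinate into the constraint for the next. *)
Lemma frq_cluster (S : R -> R -> Prop) (x : R -> R) (B : R) :
  (forall e e' t, e <= e' -> S e t -> S e' t) -> (forall e t, S e t -> `|x t| <= B) ->
  (forall e, 0 < e -> frq (S e)) -> exists p, forall e, 0 < e -> frq (fun t => S e t /\ `|x t - p| < e).
Proof.
move=> mono bd fr.
pose A := [set q | forall e, 0 < e -> frq (fun t => S e t /\ q <= x t)].
have A0 : A (- B).
  move=> e e0 T T1; have [t [t1 t2 St]] := fr e e0 T T1; exists t; split=> //; split=> //.
  by have := bd e t St; rewrite ler_norml => /andP[].
have AB : has_sup A.
  split; first by exists (- B).
  exists B => q Aq; have [t [_ _ [St qx]]] := Aq 1 ltr01 0 ltr01.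
  by have := bd 1 t St; rewrite ler_norml => /andP[_]; exact: le_trans.
exists (sup A) => e e0.
have [q Aq qe] := sup_adherent e0 AB.
have : ~ A (sup A + e / 2).
  by move=> h; have := ub_le_sup AB.2 h; lra.
move=> /existsNP[e1 /not_implyP[e10 /existsNP[T1 /not_implyP[T11 H1]]]].
move=> T TT; have m0 : 0 < Num.min e e1 by rewrite lt_min e0.
have mT : Num.max T T1 < 1 by rewrite gt_max TT.
have [t [t1 t2 [St qx]]] := Aq _ m0 _ mT.
move: t1; rewrite gt_max => /andP[t1 t1'].
exists t; split=> //; split; first by apply: mono St; rewrite ge_min lexx.
have xlt : x t < sup A + e / 2.
  rewrite ltNge; apply/negP => h; apply: H1; exists t; split=> //; split=> //.
  by apply: mono St; rewrite ge_min lexx orbT.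
by rewrite ltr_norml; apply/andP; split; lra.
Qed.

Lemma frq_cluster_pair (u1 u2 : R -> C) (B : R) :
  frq (fun t => nm (u1 t) <= B /\ nm (u2 t) <= B) ->
  exists p1 p2 : C, forall e, 0 < e -> frq (fun t => nm (u1 t - p1) < e /\ nm (u2 t - p2) < e).
Proof.
move=> fr.
pose S0 e t := nm (u1 t) <= B /\ nm (u2 t) <= B.
have [a Ha] := @frq_cluster S0 (fun t => complex.Re (u1 t)) B (fun _ _ _ _ h => h)
  (fun _ _ h => le_trans (nmRe _) h.1) (fun _ _ => fr).
pose S1 e t := S0 e t /\ `|complex.Re (u1 t) - a| < e.
have [|b Hb] := @frq_cluster S1 (fun t => complex.Im (u1 t)) B _
  (fun _ _ h => le_trans (nmIm _) h.1.1) Ha.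
  by move=> e e' t ee [h1 h2]; split=> //; exact: lt_le_trans ee.
pose S2 e t := S1 e t /\ `|complex.Im (u1 t) - b| < e.
have [|c Hc] := @frq_cluster S2 (fun t => complex.Re (u2 t)) B _
  (fun _ _ h => le_trans (nmRe _) h.1.1.2) Hb.
  by move=> e e' t ee [[h0 h1] h2]; split; [split=> //|]; exact: lt_le_trans ee.
pose S3 e t := S2 e t /\ `|complex.Re (u2 t) - c| < e.
have [|d Hd] := @frq_cluster S3 (fun t => complex.Im (u2 t)) B _
  (fun _ _ h => le_trans (nmIm _) h.1.1.1.2) Hc.
  by move=> e e' t ee [[[h0 h1] h2] h3]; do 2?split=> //; try split=> //; exact: lt_le_trans ee.
exists (Complex a b), (Complex c d) => e e0.
have e2 : 0 < e / 2 by lra.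
move=> T T1; have [t [t1 t2 [[[[h0 h1] h2] h3] h4]]] := Hd _ e2 T T1.
exists t; split=> //; split.
- apply: le_lt_trans (nm_ReIm _) _.
  by move: h1 h2; case: (u1 t) => x y /=; lra.
- apply: le_lt_trans (nm_ReIm _) _.
  by move: h3 h4; case: (u2 t) => x y /=; lra.
Qed.
End Cluster.

(** * Arc length of the path *)

Section Length.
Variable R : realType.
Local Notation C := (Cx R).
Variable (g : R -> C).
Hypothesis hgc : {within `[0, 1], continuous g}.
Hypothesis hgl : finite_length g.

Lemma path_ctn (t : R) : 0 <= t <= 1 -> forall e : R, 0 < e -> pnr 0 1 t (fun s => nm (g s - g t) < e).
Proof.
move=> tt e e0.
have tI : (`[0, 1]%classic : set R) t by rewrite /= in_itv.
have /subspace_continuousP /(_ t tI) /cvgCP h := hgc.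
have := h e e0; rewrite /within /= => /nbhs_ballP[d d0 Hd].
exists d => // s ss sd; apply: Hd; first by rewrite /ball /= distrC.
by rewrite /= in_itv.
Qed.

Definition partition_length (t : R) : set R := [set x | exists n (s : nat -> R),
  [/\ forall k, (k <= n)%N -> 0 <= s k <= t, forall k, (k < n)%N -> s k <= s k.+1 &
    x = \sum_(k < n) nm (g (s k.+1) - g (s k))]].

Lemma length_tame : exists V : R -> R, tame_path 0 1 g V.
Proof.
have [L HL] := hgl.
have bd t : t <= 1 -> has_sup (partition_length t) \/ t < 0.
  move=> t1; have [t0|] := leP 0 t; last by right.
  left; split.
    exists 0, 0%N, (fun=> 0); split=> //; last by rewrite big_ord0.
    by move=> k _; rewrite lexx.
  exists (complex.Re L) => x [n [s [h1 h2 ->]]].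
  have h3 k : (k <= n)%N -> 0 <= s k <= 1.
    by move=> /h1 /andP[-> h]; exact: le_trans t1.
  have := HL n s h3 h2.
  rewrite (eq_bigr (fun k : 'I_n => rc (nm (g (s k.+1) - g (s k))))); last by [].
  by rewrite /rc -rmorph_sum /= lecE => /andP[_].
exists (fun t => sup (partition_length t)); split=> //; last exact: path_ctn.
move=> s t s0 st t1.
have [hs|] := bd s (le_trans st t1); last by rewrite ltNge s0.
have [ht|] := bd t t1; last by rewrite ltNge (le_trans s0 st).
rewrite lerBrDr addrC -lerBrDr; apply: ge_sup; first by case: hs.
move=> x [n [p [h1 h2 ->]]]; rewrite lerBrDr.
(* The points s and t are appended to a partition inside [0, s], which adds at least the distance
   from g s to g t. *)
pose p' k := if (k <= n)%N then p k else if k == n.+1 then s else t.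
apply: (@le_trans _ _ (\sum_(k < n.+2) nm (g (p' k.+1) - g (p' k)))).
  rewrite big_ord_recr big_ord_recr /= /p' !ltnn ltnNge leqnSn /= eqxx leqnn gtn_eqF //.
  rewrite lerD2r.
  rewrite [X in _ <= X + _](eq_bigr (fun k : 'I_n => nm (g (p k.+1) - g (p k)))).
    by rewrite lerDl nm_ge0.
  by move=> k _; rewrite ltn_ord ltnW.
apply: ub_le_sup; first by case: ht.
exists n.+2, p'; split=> //.
- move=> k _; rewrite /p'; case: ifP => [/h1/andP[-> h]|_]; first exact: le_trans st.
  by case: ifP => _; rewrite ?s0 ?st // ?lexx (le_trans s0 st).
- move=> k; rewrite ltnS => kn; rewrite /p'.
  have [k1|k1] := ltnP k n; first by rewrite ltnW // h2.
  have [k2|k2] := leqP k n.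
    have -> : k = n by apply/eqP; rewrite eqn_leq k1 k2.
    by rewrite eqxx; have /andP[] := h1 n (leqnn n).
  have -> : k = n.+1 by apply/eqP; rewrite eqn_leq kn k2.
  by rewrite eqxx gtn_eqF.
Qed.
End Length.

Lemma close_bounds (R : realType) (D1 D2 a h b k B : R) : D1 + D2 <= 1 -> a - h <= D1 -> b - k <= D2 ->
  0 <= D1 -> 0 <= D2 -> h < B - 1 -> k < B - 1 -> [/\ a <= B, b <= B, h <= B & k <= B].
Proof. by move=> h1 h2 h3 h4 h5 h6 h7; split; lra. Qed.

Section Hamiltonian.
Variable R : realType.
Local Notation C := (Cx R).
Variables (M N : nat) (alpha : nat -> nat -> C -> C).
Local Notation I := M.+2.
Local Notation J := N.+2.

(** The right-hand sides rewritten with one coefficient per monomial: the exponent of the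
    differentiated variable is shifted down by one and the leading term is merged with the sum, so
    that the results on [polsum] apply. *)
Definition coef1 (i j : nat) (z : C) : C :=
  if (i == 0%N) && (j == N) then N.+1%:R * alpha 0%N N.+1 z
  else if inI M N i j.+1 then j.+1%:R * alpha i j.+1 z else 0.
Definition coef2 (i j : nat) (z : C) : C :=
  if (i == M) && (j == 0%N) then - (M.+1%:R * alpha M.+1 0%N z)
  else if inI M N i.+1 j then - (i.+1%:R * alpha i.+1 j z) else 0.

Lemma inI_bound i j : inI M N i j -> (i < M.+1)%N /\ (j < N.+1)%N.
Proof.
rewrite /inI => h; split; rewrite ltnNge; apply/negP => k.
  have : (M.+1 * N.+1 <= i * N.+1)%N by rewrite leq_mul2r k orbT.
  nia.
have : (N.+1 * M.+1 <= j * M.+1)%N by rewrite leq_mul2r k orbT.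
nia.
Qed.

Lemma rhs1E z y1 y2 : rhs1 M N alpha z y1 y2 = polsum I J coef1 z y1 y2.
Proof.
have E i : \sum_(j < J) coef1 i j z * (y1 ^+ i * y2 ^+ j) =
   (if i == 0%N then N.+1%:R * alpha 0%N N.+1 z * y2 ^+ N else 0) +
   \sum_(j < J | inI M N i j) j%:R * alpha i j z * y1 ^+ i * y2 ^+ (j - 1).
  have -> : \sum_(j < J | inI M N i j) j%:R * alpha i j z * y1 ^+ i * y2 ^+ (j - 1) =
      \sum_(j < N.+1) if inI M N i j.+1 then j.+1%:R * alpha i j.+1 z * y1 ^+ i * y2 ^+ j else 0.
    rewrite big_mkcond big_ord_recl /= !mul0r if_same add0r.
    by apply: eq_bigr => j _; rewrite /bump leq0n add1n subn1.
  rewrite [LHS]big_ord_recr /= {2}/coef1 (gtn_eqF (ltnSn N)) andbF.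
  have -> : inI M N i N.+2 = false by apply/negP => /inI_bound[_]; rewrite ltnNge leqnSn.
  rewrite mul0r addr0 (bigD1 (ord_max : 'I_N.+1)) //= [in RHS](bigD1 (ord_max : 'I_N.+1)) //= addrA.
  congr (_ + _).
    rewrite /coef1 eqxx andbT; case: eqP => [->|_].
      have -> : inI M N 0%N N.+1 = false by apply/negP => /inI_bound[_]; rewrite ltnn.
      by rewrite expr0 mul1r addr0.
    by rewrite add0r; case: ifP => _; rewrite ?mul0r // mulrA.
  apply: eq_bigr => j jN; rewrite /coef1.
  have -> : (j == N :> nat) = false by apply: contraNF jN => /eqP h; apply/eqP/val_inj.
  by rewrite andbF; case: ifP => _; rewrite ?mul0r // mulrA.
rewrite /polsum; under [RHS]eq_bigr => i _ do rewrite E.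
rewrite big_split /=; congr (_ + _).
by rewrite big_ord_recl big1 ?addr0.
Qed.

Lemma rhs2E z y1 y2 : rhs2 M N alpha z y1 y2 = polsum I J coef2 z y1 y2.
Proof.
have inIj i j : inI M N i j -> inI M N i j by [].
have E : \sum_(i < I) \sum_(j < J | inI M N i j) i%:R * alpha i j z * y1 ^+ (i - 1) * y2 ^+ j =
  \sum_(i < M.+1) \sum_(j < J | inI M N i.+1 j) i.+1%:R * alpha i.+1 j z * y1 ^+ i * y2 ^+ j.
  rewrite big_ord_recl big1 ?add0r; last by move=> j _; rewrite !mul0r.
  by apply: eq_bigr => i _; apply: eq_bigr => j _; rewrite /= /bump leq0n add1n subn1.
rewrite /rhs2 E /polsum [RHS]big_ord_recr /= [X in _ = _ + X]big1 ?addr0; last first.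
  move=> j _; rewrite /coef2 (gtn_eqF (ltnSn M)) /=.
  have -> : inI M N M.+2 j = false by apply/negP => /inI_bound[]; rewrite ltnNge leqnSn.
  by rewrite mul0r.
have F i : \sum_(j < J) coef2 i j z * (y1 ^+ i * y2 ^+ j) =
  (if i == M then - (M.+1%:R * alpha M.+1 0%N z * y1 ^+ M) else 0) -
  \sum_(j < J | inI M N i.+1 j) i.+1%:R * alpha i.+1 j z * y1 ^+ i * y2 ^+ j.
  rewrite -sumrN [X in _ + X]big_mkcond [in LHS](bigD1 ord0) //= [in RHS](bigD1 (ord0 : 'I_J)) //= addrA.
  congr (_ + _).
    rewrite /coef2 eqxx andbT expr0 !mulr1; case: eqP => [->|_].
      have -> : inI M N M.+1 0%N = false by apply/negP => /inI_bound[]; rewrite ltnn.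
      by rewrite addr0 mulNr.
    by rewrite add0r; case: ifP => _; rewrite ?mul0r // mulNr.
  apply: eq_bigr => j jN; rewrite /coef2.
  have -> : (j == 0%N :> nat) = false by apply: contraNF jN => /eqP h; apply/eqP/val_inj.
  by rewrite andbF; case: ifP => _; rewrite ?mul0r // mulrA !mulNr.
under [RHS]eq_bigr => i _ do rewrite F.
rewrite big_split /= sumrN; congr (_ - _).
rewrite big_ord_recr /= eqxx big1 ?add0r // => i _.
by rewrite (ltn_eqF (ltn_ord i)).
Qed.

Lemma ana_coefs (z : C) : (forall i j, inS M N i j -> ana z (alpha i j)) ->
  forall i j, ana z (coef1 i j) /\ ana z (coef2 i j).
Proof.
move=> H i j; split.
- rewrite /coef1; case: (boolP (_ && _)) => _.
    by apply: anaZ; apply: H; rewrite /inS !eqxx !orbT.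
  case: (boolP (inI _ _ _ _)) => h; last exact: ana_cst.
  by apply: anaZ; apply: H; rewrite /inS h.
- rewrite /coef2; case: (boolP (_ && _)) => _.
    by apply/anaN/anaZ/H; rewrite /inS !eqxx !orbT.
  case: (boolP (inI _ _ _ _)) => h; last exact: ana_cst.
  by apply/anaN/anaZ/H; rewrite /inS h.
Qed.

Lemma solution_der y1 y2 U z : is_solution M N alpha y1 y2 U -> U z ->
  der y1 z (polsum I J coef1 z (y1 z) (y2 z)) /\ der y2 z (polsum I J coef2 z (y1 z) (y2 z)).
Proof. by move=> H /H[/is_derive_der h1 /is_derive_der h2]; rewrite -rhs1E -rhs2E. Qed.

Variables (O : set C) (hO : open O).
Hypothesis halpha : forall i j, inS M N i j -> analytic_on O (alpha i j).

Lemma alpha_ana z i j : O z -> inS M N i j -> ana z (alpha i j).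
Proof. by move=> Oz /halpha /(_ z Oz)[t]; exact: taylor_ana. Qed.
Lemma O_near z : O z -> nr z O.
Proof.
move=> Oz; have : nbhs z O by apply: open_nbhs_nbhs.
by move/nearCP.
Qed.

Variables (g : R -> C) (V : R -> R) (hV : tame_path 0 1 g V).
Hypothesis hgO : forall s, 0 <= s <= 1 -> O (g s).
Variables (r : R -> C) (f1 f2 : R -> C -> C).
Hypothesis hcont : continuation_upto M N alpha O g r f1 f2.

Lemma germ_disk t : 0 <= t < 1 -> 0 < nm (r t) /\ forall z, nm (z - g t) < nm (r t) ->
  [/\ O z, `|z - g t| < r t,
   der (f1 t) z (polsum I J coef1 z (f1 t z) (f2 t z)) &
   der (f2 t) z (polsum I J coef2 z (f1 t z) (f2 t z))].
Proof.
move=> tt; have [r0 dO sol] := hcont.1 t tt.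
have [e e0 re] := lt0C r0; have nr_ : nm (r t) = e by rewrite re nm_rc gtr0_norm.
split; first by rewrite nr_.
move=> z zr; have zd : `|z - g t| < r t by rewrite re nm_lt -nr_.
by split; [exact: dO|exact: zd|exact: (solution_der sol zd).1|exact: (solution_der sol zd).2].
Qed.
Lemma germ_compat t : 0 <= t < 1 -> exists2 del : R, 0 < del & forall s, 0 <= s < 1 -> `|s - t| < del ->
  nm (g s - g t) < nm (r t) /\
  forall z, nm (z - g s) < nm (r s) -> nm (z - g t) < nm (r t) -> f1 s z = f1 t z /\ f2 s z = f2 t z.
Proof.
move=> tt; have [del d0 H] := hcont.2 t tt; exists del => // s ss st.
have [h1 h2] := H s ss st.
have cv u x : 0 <= u < 1 -> (`|x| < r u) = (nm x < nm (r u)).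
  move=> uu; have [r0 _ _] := hcont.1 u uu; have [e e0 re] := lt0C r0.
  by rewrite re nm_lt nm_rc gtr0_norm.
split; first by rewrite -cv.
by move=> z zs zt; apply: h2; rewrite cv.
Qed.
Lemma germ_along t b : 0 <= t -> b < 1 -> forall a, 0 <= a -> a <= t <= b ->
  pnr a b t (fun s => f1 s (g s) = f1 t (g s) /\ f2 s (g s) = f2 t (g s)).
Proof.
move=> t0 b1 a a0 /andP[at_ tb]; have tt : 0 <= t < 1 by rewrite t0 (le_lt_trans tb).
have [del d0 H] := germ_compat tt; exists del => // s /andP[s1 s2] st.
have ss : 0 <= s < 1 by rewrite (le_trans a0 s1) (le_lt_trans s2).
have [h1 h2] := H s ss st; apply: h2 => //.
by rewrite subrr nm0; exact: (germ_disk ss).1.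
Qed.
Lemma path_to_end (e : R) : 0 < e -> exists2 T : R, 0 <= T < 1 & forall s, T <= s <= 1 -> nm (g s - g 1) < e.
Proof.
move=> e0; have [_ _ gc] := hV.
have [|d d0 Hd] := gc 1 _ e e0; first by rewrite ler01 lexx.
exists (Num.max 0 (1 - d / 2)); first by rewrite le_max lexx gt_max ltr01 /=; lra.
move=> s; rewrite ge_max => /andP[/andP[s0 s1] s2].
by apply: Hd; rewrite ?s0 // ltr_norml; apply/andP; split; lra.
Qed.
Lemma V_bound s t : 0 <= s -> s <= t -> t <= 1 -> 0 <= V t - V s <= V 1 - V 0.
Proof.
move=> s0 st t1; have [_ g1 _] := hV.
have m x y : 0 <= x -> x <= y -> y <= 1 -> V x <= V y.
  by move=> x0 xy y1; have := g1 x y x0 xy y1; have := nm_ge0 (g y - g x); lra.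
have := m 0 s (lexx _) s0 (le_trans st t1); have := m s t s0 st t1.
have := m t 1 (le_trans s0 st) t1 (lexx _) => h1 h2 h3; apply/andP; split; lra.
Qed.

(* A finite cluster value of the solution at the end point would give, via the
   regular Cauchy problem there, an analytic continuation. *)
Theorem solution_blows_up : ~ continues_to_end M N alpha O g r f1 f2 ->
  forall B : R, exists2 T : R, 0 <= T < 1 & forall t, T < t -> t < 1 ->
    B < nm (f1 t (g t)) \/ B < nm (f2 t (g t)).
Proof.
move=> hnot B; apply: contrapT => hB; apply: hnot.
have fr : frq (fun t => 0 <= t /\ nm (f1 t (g t)) <= B /\ nm (f2 t (g t)) <= B).
  move=> T T1; apply: contrapT => h; apply: hB; exists (Num.max 0 T).
    by rewrite le_max lexx gt_max ltr01.
  move=> t; rewrite gt_max => /andP[t0 Tt] t1; apply: contrapT => /not_orP[h1 h2].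
  by apply: h; exists t; split=> //; split; [exact: ltW|split; rewrite leNgt; apply/negP].
have fr' : frq (fun t => nm (f1 t (g t)) <= B /\ nm (f2 t (g t)) <= B).
  by move=> T /fr[t [t1 t2 [_ h]]]; exists t.
have [p1 [p2 Hp]] := frq_cluster_pair fr'.
have O1 : O (g 1) by apply: hgO; rewrite ler01 lexx.
have anac := ana_coefs (fun i j => @alpha_ana (g 1) i j O1).
have [h1 [h2 [E1 E2 Hh]]] := @cauchy_regular R I J coef1 coef2 (g 1) p1 p2 (fun i j _ _ => anac i j).
(* The solution h through the cluster point stays below B' - 1, so anything within distance 1 of it
   stays below B', where the Lipschitz constant K is valid; the second entry covers the
   coefficients. *)
pose B' : R := Num.max (nm p1 + nm p2 + 3) (1 + \sum_(i < I) \sum_(j < J) (nm (coef1 i j (g 1)) + nm (coef2 i j (g 1)) + 2)).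
have B1 : 1 <= B'.
  rewrite /B' le_max; apply/orP; left; have := nm_ge0 p1; have := nm_ge0 p2; lra.
have [K K0 HK] := polsum_lip I J B1.
have big_nr (L : nat) (P : nat -> C -> Prop) z : (forall k, (k < L)%N -> nr z (P k)) ->
    nr z (fun w => forall k, (k < L)%N -> P k w).
  elim: L => [|L IH] h; first by apply: nrW.
  apply: nrS2 (IH (fun k kL => h k (ltnW kL))) (h L (ltnSn L)) => w a1 a2 k.
  by rewrite ltnS leq_eqVlt => /orP[/eqP ->//|]; exact: a1.
have coefB : nr (g 1) (fun z => forall i, (i < I)%N -> forall j, (j < J)%N ->
    nm (coef1 i j z) <= B' /\ nm (coef2 i j z) <= B').
  apply: (big_nr I (fun i z => forall j, (j < J)%N -> nm (coef1 i j z) <= B' /\ nm (coef2 i j z) <= B')) => i iI.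
  apply: (big_nr J (fun j z => nm (coef1 i j z) <= B' /\ nm (coef2 i j z) <= B')) => j jJ.
  have S : nm (coef1 i j (g 1)) + nm (coef2 i j (g 1)) + 2 <= B'.
    rewrite /B' le_max; apply/orP; right.
    rewrite (bigD1 (Ordinal iI)) //= (bigD1 (Ordinal jJ)) //=.
    set s1 := \sum_(_ < _ | _) _; set s2 := \sum_(_ < _ | _) _.
    have : 0 <= s1 by apply: sumr_ge0 => l _; have := nm_ge0 (coef1 i l (g 1)); have := nm_ge0 (coef2 i l (g 1)); lra.
    have : 0 <= s2.
      apply: sumr_ge0 => k _; apply: sumr_ge0 => l _.
      by have := nm_ge0 (coef1 k l (g 1)); have := nm_ge0 (coef2 k l (g 1)); lra.
    lra.
  have [a1 a2] := anac i j.
  have l1 : nm (coef1 i j (g 1)) < B' by have := nm_ge0 (coef2 i j (g 1)); lra.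
  have l2 : nm (coef2 i j (g 1)) < B' by have := nm_ge0 (coef1 i j (g 1)); lra.
  by apply: nrS2 (ctn_nm_lt (ana_ctn a1) l1) (ctn_nm_lt (ana_ctn a2) l2) => w /ltW ? /ltW ?.
have [hd1 hd2] := nr_at Hh.
have n1 : nm (h1 (g 1)) < B' - 1.
  rewrite E1 /B'; have := nm_ge0 p2; set s := 1 + _.
  have : nm p1 + nm p2 + 3 <= Num.max (nm p1 + nm p2 + 3) s by rewrite le_max lexx.
  lra.
have n2 : nm (h2 (g 1)) < B' - 1.
  rewrite E2 /B'; have := nm_ge0 p1; set s := 1 + _.
  have : nm p1 + nm p2 + 3 <= Num.max (nm p1 + nm p2 + 3) s by rewrite le_max lexx.
  lra.
have [rho rho0 Hrho] := nrI (nrI (O_near O1) Hh)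
  (nrI coefB (nrI (ctn_nm_lt (der_ctn hd1) n1) (ctn_nm_lt (der_ctn hd2) n2))).
have [T T01 HT] := path_to_end rho0; have /andP[T0 T1] := T01.
pose u1 t := f1 t (g t) - h1 (g t); pose u2 t := f2 t (g t) - h2 (g t).
pose phi t := Num.min (nm (u1 t) + nm (u2 t)) 1.
(* Read backwards: phi at a fixed parameter is controlled by phi at late parameters, where it is
   small whenever the solution is close to the cluster point. *)
have gron a b : T <= a -> a <= b -> b < 1 ->
    phi a <= phi b * expR (2 * ((K + K) + 1) * (V 1 - V 0)).
  move=> Ta ab b1; have a0 : 0 <= a by lra.
  have gV : tame_path a b g V by apply: tame_sub hV => //; exact: ltW.
  have KK : 0 <= K + K by exact: addr_ge0.
  have [|h _] := gronwall_germs (u1 := u1) (u2 := u2) gV KK.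
    move=> t /andP[at_ tb]; have t0 : 0 <= t by lra.
    have tt : 0 <= t < 1 by rewrite t0 (le_lt_trans tb).
    have [rt0 dk] := germ_disk tt; have [|Ot _ df1 df2] := dk (g t); first by rewrite subrr nm0.
    have gt1 : nm (g t - g 1) < rho by apply: HT; rewrite (le_trans Ta at_) (le_trans tb (ltW b1)).
    have [[_ [dh1 dh2]] [cB [b1' b2']]] := Hrho _ gt1.
    exists (fun z => f1 t z - h1 z), (fun z => f2 t z - h2 z); do 2 eexists.
    split; [exact: derB df1 dh1|exact: derB df2 dh2| |].
      have tab : a <= t <= b by rewrite at_.
      by apply: pnrS (germ_along t0 b1 a0 tab) => s [e1 e2]; rewrite /u1 /u2 e1 e2.
    rewrite /u1 /u2 => small.
    have q1 := nm_sub (f1 t (g t)) (h1 (g t)); have q2 := nm_sub (f2 t (g t)) (h2 (g t)).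
    have q3 := nm_ge0 (f1 t (g t) - h1 (g t)); have q4 := nm_ge0 (f2 t (g t) - h2 (g t)).
    have [k1 k2 k3 k4] := close_bounds small q1 q2 q3 q4 b1' b2'.
    have L1 := HK coef1 (g t) (f1 t (g t)) (f2 t (g t)) (h1 (g t)) (h2 (g t)) (fun i j iI jJ => (cB i iI j jJ).1) k1 k2 k3 k4.
    have L2 := HK coef2 (g t) (f1 t (g t)) (f2 t (g t)) (h1 (g t)) (h2 (g t)) (fun i j iI jJ => (cB i iI j jJ).2) k1 k2 k3 k4.
    by rewrite mulrDl; exact: lerD.
  apply: le_trans h _; apply: ler_wpM2l; first by rewrite /phi le_min ler01 andbT addr_ge0 ?nm_ge0.
  rewrite ler_expR; apply: ler_wpM2l; first by apply: mulr_ge0; [exact: ler0n|exact: addr_ge0 KK ler01].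
  by have /andP[] := V_bound a0 ab (ltW b1).
have zero t : T <= t -> t < 1 -> u1 t = 0 /\ u2 t = 0.
  move=> Tt t1; set E := expR _ in gron; have Ep : 0 < E by exact: expR_gt0.
  have small e : 0 < e -> phi t <= e.
    move=> e0; have d0 : 0 < e / E / 4 by rewrite !divr_gt0.
    have [d dp Hd] := nrI (ctn_close (der_ctn hd1) d0) (ctn_close (der_ctn hd2) d0).
    have [T' /andP[T'0 T'1] HT'] := path_to_end dp.
    have mx : Num.max t T' < 1 by rewrite gt_max t1.
    have [b [bt b1 [c1 c2]]] := Hp _ d0 _ mx.
    move: bt; rewrite gt_max => /andP[tb T'b].
    have [k1 k2] := Hd (g b) (HT' b (introT andP (conj (ltW T'b) (ltW b1)))).
    have := gron t b Tt (ltW tb) b1 => /le_trans; apply.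
    rewrite -ler_pdivlMr // /phi ge_min; apply/orP; left.
    rewrite E1 in k1; rewrite E2 in k2.
    have := nmD3 (f1 b (g b)) p1 (h1 (g b)); have := nmD3 (f2 b (g b)) p2 (h2 (g b)).
    rewrite (nmBC p1) (nmBC p2) /u1 /u2; lra.
  have : phi t <= 0.
    by apply/ler_addgt0Pr => e e0; rewrite add0r; exact: small.
  rewrite /phi ge_min [1 <= 0]leNgt ltr01 orbF => z0.
  have q1 := nm_ge0 (u1 t); have q2 := nm_ge0 (u2 t).
  have z1 : nm (u1 t) <= 0 by apply: le_trans z0; rewrite lerDl.
  have z2 : nm (u2 t) <= 0 by apply: le_trans z0; rewrite lerDr.
  by split; apply/eqP; rewrite -nm_eq0 eq_le nm_ge0 andbT.
exists (rc rho), h1, h2; split.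
- by rewrite rc_gt0.
- by move=> z; rewrite /cdisk /= nm_lt => /Hrho[[]].
- move=> z; rewrite /cdisk /= nm_lt => /Hrho[[_ [d1 d2]] _].
  by rewrite rhs1E rhs2E; split; apply/is_derive_der.
exists (1 - T); first lra.
move=> s /andP[s0 s1] Ts; have {}Ts : T <= s by lra.
have ss : 0 <= s < 1 by rewrite s0.
have gs : nm (g s - g 1) < rho by apply: HT; rewrite Ts ltW.
split; first by rewrite nm_lt.
have [rs0 dk] := germ_disk ss.
move=> z zs; rewrite nm_lt => z1.
have {}zs : nm (z - g s) < nm (r s).
  have [r0 _ _] := hcont.1 s ss; have [e e0 re] := lt0C r0.
  by move: zs; rewrite re nm_lt nm_rc gtr0_norm.
have [v1 v2] := zero s Ts s1.
(* Agreement at g s spreads over the intersection of the two disks along the segment from g s to z,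
   which stays in both. *)
apply: (@segment_uniqueness R I J coef1 coef2 id (fun=> 1) _ _ _ _ (g s) z) => [x x01 w||].
- have w1 : nm (w - g 1) < rho by apply: nm_segment_at.
  have ws : nm (w - g s) < nm (r s) by apply: nm_segment_at => //; rewrite subrr nm0.
  have [Ow _ d1 d2] := dk w ws; have [[_ [d3 d4]] _] := Hrho w w1.
  split; [exact: ctn_id|exact: ctn_cst| |by rewrite !mul1r; exact: (conj d1 d2)|by rewrite !mul1r; exact: (conj d3 d4)].
  move=> i j _ _; have [a1 a2] := ana_coefs (fun i j => @alpha_ana w i j Ow) i j.
  by split; exact: ana_ctn.
- by apply/eqP; rewrite -subr_eq0 -/(u1 s) v1.
- by apply/eqP; rewrite -subr_eq0 -/(u2 s) v2.
Qed.
End Hamiltonian.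

(** * Weighted Laurent polynomials in the solution *)

Section Laurent.
Variable R : realType.
Local Notation C := (Cx R).
Variables (M N : nat) (alpha : nat -> nat -> C -> C) (U : C -> Prop).
Local Notation az := (M.+1%:Z).
Local Notation bz := (N.+1%:Z).
Local Notation pz := (M.+1%:Z * N.+1%:Z - M.+1%:Z - N.+1%:Z).
Local Notation al := (alpha M.+1 0%N).
Local Notation be := (alpha 0%N N.+1).
Local Notation rh1 := (rhs1 M N alpha).
Local Notation rh2 := (rhs2 M N alpha).
Hypothesis hU : forall z, U z -> nr z U.
Hypothesis halpha : forall i j, inS M N i j -> forall z, U z -> ana z (alpha i j).
Hypothesis hal : forall z, U z -> al z != 0.
Hypothesis hbe : forall z, U z -> be z != 0.

Implicit Types (F G P Q : C -> C -> C -> C) (f k : C -> C) (i j n m : int).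

Definition anaU f := forall z, U z -> ana z f.
Definition okp (z y1 y2 : C) := [/\ U z, y1 != 0 & y2 != 0].

Lemma anaU_cst (c : C) : anaU (fun=> c). Proof. by move=> z _; exact: ana_cst. Qed.
Lemma anaU_add f k : anaU f -> anaU k -> anaU (fun z => f z + k z).
Proof. by move=> h1 h2 z Uz; apply: anaD; [exact: h1|exact: h2]. Qed.
Lemma anaU_mul f k : anaU f -> anaU k -> anaU (fun z => f z * k z).
Proof. by move=> h1 h2 z Uz; apply: anaM; [exact: h1|exact: h2]. Qed.
Lemma anaU_opp f : anaU f -> anaU (fun z => - f z).
Proof. by move=> h1 z Uz; apply: anaN; exact: h1. Qed.
Lemma anaU_inv f : (forall z, U z -> f z != 0) -> anaU f -> anaU (fun z => (f z)^-1).
Proof. by move=> h0 h1 z Uz; apply: anaV; [exact: h0|exact: h1]. Qed.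
Lemma anaU_dv f : anaU f -> anaU (dv f).
Proof. by move=> h z Uz; exact: (ana_dv (h z Uz)).2. Qed.
Lemma anaU_der f z : anaU f -> U z -> der f z (dv f z).
Proof. by move=> h Uz; exact: nr_at (ana_dv (h z Uz)).1. Qed.
Lemma inS_a : inS M N M.+1 0. Proof. by rewrite /inS !eqxx orbT. Qed.
Lemma inS_b : inS M N 0 N.+1. Proof. by rewrite /inS !eqxx !orbT. Qed.
Lemma anaU_al : anaU al. Proof. exact: halpha inS_a. Qed.
Lemma anaU_be : anaU be. Proof. exact: halpha inS_b. Qed.

Definition wgt i j : int := bz * i + az * j.

(* lau n F: on okp, F is a Laurent polynomial in y1, y2 with coefficients
   analytic on U and of weighted degree at most n. *)
Inductive lau n : (C -> C -> C -> C) -> Prop :=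
| lau_mono f i j : anaU f -> wgt i j <= n -> lau n (fun z y1 y2 => f z * (y1 ^ i * y2 ^ j))
| lau_add F G : lau n F -> lau n G -> lau n (fun z y1 y2 => F z y1 y2 + G z y1 y2)
| lau_ext F G : (forall z y1 y2, okp z y1 y2 -> F z y1 y2 = G z y1 y2) -> lau n F -> lau n G.

Lemma lau_le n m F : n <= m -> lau n F -> lau m F.
Proof.
move=> nm_ h; elim: h => [f i j af h|F1 F2 _ h1 _ h2|F1 F2 e _ h].
- by apply: lau_mono => //; exact: le_trans nm_.
- exact: lau_add.
- exact: lau_ext e h.
Qed.
Lemma lau_zero n : lau n (fun _ _ _ => 0).
Proof.
have [k hk] : exists k : int, bz * k <= n.
  by exists (- `|n|); have := ler_norm (- n); rewrite normrN; nia.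
apply: (@lau_ext n (fun z y1 y2 => (fun=> 0) z * (y1 ^ k * y2 ^ 0))); first by move=> *; rewrite mul0r.
by apply: lau_mono; [exact: anaU_cst|rewrite /wgt mulr0 addr0].
Qed.
Lemma lau_mul n m F G : lau n F -> lau m G -> lau (n + m) (fun z y1 y2 => F z y1 y2 * G z y1 y2).
Proof.
move=> hF hG; elim: hF => [f i j af h|F1 F2 _ h1 _ h2|F1 F2 e _ h].
- elim: hG => [k i' j' ak h'|G1 G2 _ h1 _ h2|G1 G2 e _ h1].
  + apply: (@lau_ext _ (fun z y1 y2 => (f z * k z) * (y1 ^ (i + i') * y2 ^ (j + j')))).
      by move=> z y1 y2 [_ y10 y20]; rewrite !expfzDr //; ring.
    by apply: lau_mono; [exact: anaU_mul|move: h h'; rewrite /wgt; lia].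
  + by apply: lau_ext (lau_add h1 h2) => *; rewrite mulrDr.
  + by apply: lau_ext h1 => z y1 y2 ok; rewrite e.
- by apply: lau_ext (lau_add h1 h2) => *; rewrite mulrDl.
- by apply: lau_ext h => z y1 y2 ok; rewrite e.
Qed.
Lemma lau_mulm n m l F G : n + m <= l -> lau n F -> lau m G -> lau l (fun z y1 y2 => F z y1 y2 * G z y1 y2).
Proof. by move=> h h1 h2; apply: lau_le h _; exact: lau_mul. Qed.
Lemma lau_coef n f F : anaU f -> lau n F -> lau n (fun z y1 y2 => f z * F z y1 y2).
Proof.
move=> af h; have h0 : lau 0 (fun z y1 y2 => f z * (y1 ^ 0 * y2 ^ 0)).
  by apply: lau_mono => //; rewrite /wgt !mulr0.
have := lau_mul h0 h; rewrite add0r; apply: lau_ext => z y1 y2 _.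
by rewrite !expr0z !mulr1.
Qed.
Lemma lau_opp n F : lau n F -> lau n (fun z y1 y2 => - F z y1 y2).
Proof.
move=> /(lau_coef (anaU_cst (-1))); apply: lau_ext => z y1 y2 _; exact: mulN1r.
Qed.
Lemma lau_sub n F G : lau n F -> lau n G -> lau n (fun z y1 y2 => F z y1 y2 - G z y1 y2).
Proof. by move=> h1 /lau_opp; exact: lau_add. Qed.
Lemma lau_sum n (K : nat) (P : pred nat) (F : nat -> C -> C -> C -> C) :
  (forall x, (x < K)%N -> P x -> lau n (F x)) ->
  lau n (fun z y1 y2 => \sum_(x < K | P x) F x z y1 y2).
Proof.
elim: K => [|K IH] H.
  by apply: lau_ext (lau_zero n) => *; rewrite big_ord0.
have h1 := IH (fun x xK => H x (ltnW xK)).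
case PK: (P K).
  have := lau_add h1 (H K (ltnSn K) PK); apply: lau_ext => z y1 y2 _.
  rewrite [RHS]big_mkcond big_ord_recr /= PK -big_mkcond //.
apply: lau_ext h1 => z y1 y2 _.
by rewrite [RHS]big_mkcond big_ord_recr /= PK addr0 -big_mkcond.
Qed.
Lemma lau_nat n f (i j : nat) : anaU f -> wgt i j <= n -> lau n (fun z y1 y2 => f z * (y1 ^+ i * y2 ^+ j)).
Proof. by move=> af h; apply: lau_ext (lau_mono af h) => z y1 y2 _. Qed.

(* F' is the derivative of F along solutions (e1, e2) read in any parameter of which
   z = zeta is a function with zeta' = kap; this covers the branched variable w, z = z0 + w^q. *)
Definition isD F F' := forall (tau : C) (zeta e1 e2 : C -> C) (kap : C),
  der zeta tau kap -> der e1 tau (kap * rh1 (zeta tau) (e1 tau) (e2 tau)) ->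
  der e2 tau (kap * rh2 (zeta tau) (e1 tau) (e2 tau)) -> okp (zeta tau) (e1 tau) (e2 tau) ->
  der (fun t => F (zeta t) (e1 t) (e2 t)) tau (kap * F' (zeta tau) (e1 tau) (e2 tau)).

Lemma okp_near (tau : C) (zeta e1 e2 : C -> C) : ctn zeta tau -> ctn e1 tau -> ctn e2 tau ->
  okp (zeta tau) (e1 tau) (e2 tau) -> nr tau (fun t => okp (zeta t) (e1 t) (e2 t)).
Proof.
move=> c1 c2 c3 [Uz h1 h2].
by apply: nrS2 (ctn_near c1 (hU Uz)) (nrI (ctn_neq0 c2 h1) (ctn_neq0 c3 h2)) => t Ut [].
Qed.
Lemma isD_ext F G F' G' : (forall z y1 y2, okp z y1 y2 -> F z y1 y2 = G z y1 y2) ->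
  (forall z y1 y2, okp z y1 y2 -> F' z y1 y2 = G' z y1 y2) -> isD F F' -> isD G G'.
Proof.
move=> e e' H tau zeta e1 e2 kap d0 d1 d2 ok; rewrite -e' //.
have near_ := okp_near (der_ctn d0) (der_ctn d1) (der_ctn d2) ok.
by apply: der_ext (H tau zeta e1 e2 kap d0 d1 d2 ok); apply: nrS near_ => t; exact: e.
Qed.
Lemma isD_add F G F' G' : isD F F' -> isD G G' ->
  isD (fun z y1 y2 => F z y1 y2 + G z y1 y2) (fun z y1 y2 => F' z y1 y2 + G' z y1 y2).
Proof.
by move=> h1 h2 tau zeta e1 e2 kap d0 d1 d2 ok; rewrite mulrDr; apply: derD; [apply: h1|apply: h2].
Qed.
Lemma isD_zero : isD (fun _ _ _ => 0) (fun _ _ _ => 0).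
Proof. by move=> *; rewrite mulr0; exact: der_cst. Qed.

Lemma isD_mono f i j : anaU f -> isD (fun z y1 y2 => f z * (y1 ^ i * y2 ^ j))
  (fun z y1 y2 => dv f z * (y1 ^ i * y2 ^ j) +
     f z * (i%:~R * (y1 ^ (i - 1) * y2 ^ j) * rh1 z y1 y2 + j%:~R * (y1 ^ i * y2 ^ (j - 1)) * rh2 z y1 y2)).
Proof.
move=> af tau zeta e1 e2 kap d0 d1 d2 [Uz n1 n2].
have df := der_comp d0 (anaU_der af Uz).
have := derM df (derM (derXz i n1 d1) (derXz j n2 d2)).
apply: der_eq; ring.
Qed.

(** The leading terms of the two right-hand sides exceed the weights of y1 and y2 by the same amount
    pz = MN - 1, the weight that one differentiation adds; all other terms are lower. *)
Lemma lau_rh1_low : exists r1, lau (bz + pz - 1) r1 /\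
  forall z y1 y2, rh1 z y1 y2 = N.+1%:R * be z * y2 ^+ N + r1 z y1 y2.
Proof.
exists (fun z y1 y2 => \sum_(i < M.+2) \sum_(j < N.+2 | inI M N i j)
     j%:R * alpha i j z * y1 ^+ i * y2 ^+ (j - 1)); split => //.
apply: (@lau_sum _ M.+2 xpredT (fun (i : nat) z y1 y2 => \sum_(j < N.+2 | inI M N i j)
     j%:R * alpha i j z * y1 ^+ i * y2 ^+ (j - 1))) => i _ _.
apply: (@lau_sum _ N.+2 (fun j : nat => inI M N i j) (fun (j : nat) z y1 y2 => j%:R * alpha i j z * y1 ^+ i * y2 ^+ (j - 1))).
move=> j _ ij; case: j ij => [|j] ij.
  by apply: lau_ext (lau_zero _) => z y1 y2 _; rewrite !mul0r.
apply: (@lau_ext _ (fun z y1 y2 => (j.+1%:R * alpha i j.+1 z) * (y1 ^+ i * y2 ^+ j))).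
  by move=> z y1 y2 _; rewrite subn1 mulrA.
apply: lau_nat; first by apply: anaU_mul; [exact: anaU_cst|apply: halpha; rewrite /inS ij].
by move: ij; rewrite /inI /wgt; lia.
Qed.
Lemma lau_rh2_low : exists r2, lau (az + pz - 1) r2 /\
  forall z y1 y2, rh2 z y1 y2 = - (M.+1%:R * al z * y1 ^+ M) + r2 z y1 y2.
Proof.
exists (fun z y1 y2 => - \sum_(i < M.+2) \sum_(j < N.+2 | inI M N i j)
     i%:R * alpha i j z * y1 ^+ (i - 1) * y2 ^+ j); split => //.
apply: lau_opp.
apply: (@lau_sum _ M.+2 xpredT (fun (i : nat) z y1 y2 => \sum_(j < N.+2 | inI M N i j)
     i%:R * alpha i j z * y1 ^+ (i - 1) * y2 ^+ j)) => i _ _.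
apply: (@lau_sum _ N.+2 (fun j : nat => inI M N i j) (fun (j : nat) z y1 y2 => i%:R * alpha i j z * y1 ^+ (i - 1) * y2 ^+ j)).
move=> j _ ij; case: i ij => [|i] ij.
  by apply: lau_ext (lau_zero _) => z y1 y2 _; rewrite !mul0r.
apply: (@lau_ext _ (fun z y1 y2 => (i.+1%:R * alpha i.+1 j z) * (y1 ^+ i * y2 ^+ j))).
  by move=> z y1 y2 _; rewrite subn1 mulrA.
apply: lau_nat; first by apply: anaU_mul; [exact: anaU_cst|apply: halpha; rewrite /inS ij].
by move: ij; rewrite /inI /wgt; lia.
Qed.
Lemma lau_rh1 : lau (bz + pz) rh1.
Proof.
have [r1 [h e]] := lau_rh1_low.
apply: (@lau_ext _ (fun z y1 y2 => (N.+1%:R * be z) * (y1 ^+ 0 * y2 ^+ N) + r1 z y1 y2)).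
  by move=> z y1 y2 _; rewrite e expr0 mul1r.
apply: lau_add; last by apply: lau_le h; lia.
apply: lau_nat; first by apply: anaU_mul; [exact: anaU_cst|exact: anaU_be].
by rewrite /wgt; lia.
Qed.
Lemma lau_rh2 : lau (az + pz) rh2.
Proof.
have [r2 [h e]] := lau_rh2_low.
apply: (@lau_ext _ (fun z y1 y2 => (- (M.+1%:R * al z)) * (y1 ^+ M * y2 ^+ 0) + r2 z y1 y2)).
  by move=> z y1 y2 _; rewrite e expr0 mulr1 mulNr.
apply: lau_add; last by apply: lau_le h; lia.
apply: lau_nat; last by rewrite /wgt; lia.
by apply: anaU_opp; apply: anaU_mul; [exact: anaU_cst|exact: anaU_al].
Qed.
Lemma lau_isD n F : 0 <= pz -> lau n F -> exists2 F', isD F F' & lau (n + pz) F'.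
Proof.
move=> p0; elim=> [f i j af h|F1 F2 _ [G1 d1 l1] _ [G2 d2 l2]|F1 F2 e _ [G d l]].
- eexists; first exact: isD_mono.
  apply: lau_add.
    by apply: lau_mono; [exact: anaU_dv|move: h; lia].
  apply: lau_coef => //; apply: lau_add.
    apply: (@lau_mulm (n - bz) (bz + pz)); [by lia| |exact: lau_rh1].
    by apply: lau_mono; [exact: anaU_cst|move: h; rewrite /wgt; lia].
  apply: (@lau_mulm (n - az) (az + pz)); [by lia| |exact: lau_rh2].
  by apply: lau_mono; [exact: anaU_cst|move: h; rewrite /wgt; lia].
- by exists (fun z y1 y2 => G1 z y1 y2 + G2 z y1 y2); [exact: isD_add|exact: lau_add].
- by exists G => //; apply: isD_ext d.
Qed.

(** The part of H of top weight (M+1)(N+1). *)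
Definition En (z y1 y2 : C) : C := al z * y1 ^+ M.+1 + be z * y2 ^+ N.+1.
Lemma En_def z y1 y2 : En z y1 y2 = al z * y1 ^+ M.+1 + be z * y2 ^+ N.+1. Proof. by []. Qed.

(** For a monomial of exact weight n, the derivative of y1^(i+1) y2^(j-N) is be (n - pz) y1^i y2^j
    modulo [En] and lower weight, once al y1^(M+1) is rewritten as [En] - be y2^(N+1). Division by n
    - pz is what fails at n = pz. *)
Lemma eliminate n F : 0 < pz -> n != pz -> lau n F -> exists G P Q GD,
  [/\ lau (n - pz) G, lau (n - az * bz) P, lau (n - 1) Q, isD G GD &
   forall z y1 y2, okp z y1 y2 -> F z y1 y2 + GD z y1 y2 = P z y1 y2 * En z y1 y2 + Q z y1 y2].
Proof.
move=> p0 np; elim=> [f i j af h|F1 F2 _ [G1 [P1 [Q1 [D1 [a1 b1 c1 d1 e1]]]]] _ [G2 [P2 [Q2 [D2 [a2 b2 c2 d2 e2]]]]]|F1 F2 e _ [G [P [Q [D [hG hP hQ hD hE]]]]]].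
- have [hlt|hge] := boolP (wgt i j < n).
    exists (fun _ _ _ => 0), (fun _ _ _ => 0), (fun z y1 y2 => f z * (y1 ^ i * y2 ^ j)), (fun _ _ _ => 0).
    split; [exact: lau_zero|exact: lau_zero| |exact: isD_zero|].
      by apply: lau_mono => //; lia.
    by move=> z y1 y2 _; rewrite addr0 mul0r add0r.
  have hn : wgt i j = n by apply/le_anti; rewrite h leNgt.
  pose k z := - (f z / ((n - pz)%:~R * be z)).
  have np0 : (n - pz)%:~R != 0 :> C by rewrite intr_eq0 subr_eq0.
  have ak : anaU k.
    apply: anaU_opp; apply: anaU_mul => //; apply: anaU_inv.
      by move=> z Uz; rewrite mulf_neq0 // hbe.
    by apply: anaU_mul; [exact: anaU_cst|exact: anaU_be].
  have [r1 [l1 E1]] := lau_rh1_low; have [r2 [l2 E2]] := lau_rh2_low.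
  exists (fun z y1 y2 => k z * (y1 ^ (i + 1) * y2 ^ (j - N%:Z))).
  exists (fun z y1 y2 => (- k z * ((j - N%:Z)%:~R * M.+1%:R)) * (y1 ^ i * y2 ^ (j - bz))).
  exists (fun z y1 y2 => dv k z * (y1 ^ (i + 1) * y2 ^ (j - N%:Z)) +
     k z * ((i + 1)%:~R * (y1 ^ i * y2 ^ (j - N%:Z)) * r1 z y1 y2 +
            (j - N%:Z)%:~R * (y1 ^ (i + 1) * y2 ^ (j - N%:Z - 1)) * r2 z y1 y2)).
  have dG := isD_mono (i + 1) (j - N%:Z) ak.
  eexists; split; [ | | |exact: dG|]; last first.
  + move=> z y1 y2 [Uz y10 y20]; rewrite /= E1 E2 /En addrK.
    have q1 : y2 ^ j = y2 ^ (j - N%:Z) * y2 ^+ N by rewrite [y2 ^+ N]exprnP -expfzDr // subrK.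
    have q2 : y2 ^ (j - N%:Z) = y2 ^ (j - bz) * y2.
      have -> : j - N%:Z = j - bz + 1 by lia.
      by rewrite expfzDr // expr1z.
    have q3 : j - N%:Z - 1 = j - bz by lia.
    have q4 : y1 ^ (i + 1) = y1 ^ i * y1 by rewrite expfzDr // expr1z.
    rewrite q3 q4 q1 q2 !exprS.
    have key : f z = - (k z * be z * (n - pz)%:~R).
      have := hbe Uz; rewrite /k; move: ((n - pz)%:~R) np0 (be z) => X X0 B B0.
      by field; rewrite X0 B0.
    rewrite key -hn /wgt.
    have -> : (bz * i + az * j - pz)%:~R = (i + 1)%:~R * N.+1%:R + (j - N%:Z)%:~R * M.+1%:R :> C.
      rewrite -![_.+1%:R]/(_.+1%:~R) -!intrM -intrD; congr (_%:~R); lia.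
    ring.
  + have wz : wgt (i + 1) (j - N%:Z) = n - pz by rewrite -hn /wgt; lia.
    apply: lau_add; first by apply: lau_mono; [exact: anaU_dv|rewrite wz; lia].
    apply: lau_coef => //; apply: lau_add.
      apply: (@lau_mulm (n - bz - pz) (bz + pz - 1)); [by lia| |exact: l1].
      by apply: lau_mono; [exact: anaU_cst|move: wz; rewrite /wgt; lia].
    apply: (@lau_mulm (n - az - pz) (az + pz - 1)); [by lia| |exact: l2].
    by apply: lau_mono; [exact: anaU_cst|move: wz; rewrite /wgt; lia].
  + apply: lau_mono; last by rewrite -hn /wgt; lia.
    by apply: anaU_mul; [exact: anaU_opp|exact: anaU_cst].
  + by apply: lau_mono => //; rewrite -hn /wgt; lia.
- exists (fun z y1 y2 => G1 z y1 y2 + G2 z y1 y2), (fun z y1 y2 => P1 z y1 y2 + P2 z y1 y2),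
   (fun z y1 y2 => Q1 z y1 y2 + Q2 z y1 y2), (fun z y1 y2 => D1 z y1 y2 + D2 z y1 y2).
  split; try exact: lau_add; first exact: isD_add.
  by move=> z y1 y2 ok; rewrite addrACA e1 // e2 //; ring.
- by exists G, P, Q, D; split => // z y1 y2 ok; rewrite -e // hE.
Qed.

Definition Hm (z y1 y2 : C) : C := En z y1 y2 +
  \sum_(i < M.+2) \sum_(j < N.+2 | inI M N i j) alpha i j z * (y1 ^+ i * y2 ^+ j).
Lemma Hm_def z y1 y2 : Hm z y1 y2 = En z y1 y2 +
  \sum_(i < M.+2) \sum_(j < N.+2 | inI M N i j) alpha i j z * (y1 ^+ i * y2 ^+ j).
Proof. by []. Qed.
Definition Hz (z y1 y2 : C) : C := dv al z * y1 ^+ M.+1 + dv be z * y2 ^+ N.+1 +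
  \sum_(i < M.+2) \sum_(j < N.+2 | inI M N i j) dv (alpha i j) z * (y1 ^+ i * y2 ^+ j).

Lemma der_sum (K : nat) (P : pred nat) (F : nat -> C -> C) (l : nat -> C) (tau : C) :
  (forall x, (x < K)%N -> P x -> der (F x) tau (l x)) ->
  der (fun t => \sum_(x < K | P x) F x t) tau (\sum_(x < K | P x) l x).
Proof.
elim: K => [|K IH] H.
  rewrite big_ord0; apply: der_ext (der_cst 0 tau); apply: nrW => t; by rewrite big_ord0.
have h1 := IH (fun x xK => H x (ltnW xK)).
rewrite big_mkcond big_ord_recr /= -big_mkcond.
case PK: (P K); last first.
  rewrite addr0; apply: der_ext h1; apply: nrW => t.
  by rewrite [RHS]big_mkcond big_ord_recr /= PK addr0 -big_mkcond.
apply: der_ext (derD h1 (H K (ltnSn K) PK)); apply: nrW => t.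
by rewrite [RHS]big_mkcond big_ord_recr /= PK -big_mkcond.
Qed.

(* Unlike isD this also covers zeros of e1 and e2. *)
Lemma Hm_der (tau : C) (zeta e1 e2 : C -> C) (kap : C) :
  der zeta tau kap -> der e1 tau (kap * rh1 (zeta tau) (e1 tau) (e2 tau)) ->
  der e2 tau (kap * rh2 (zeta tau) (e1 tau) (e2 tau)) -> U (zeta tau) ->
  der (fun t => Hm (zeta t) (e1 t) (e2 t)) tau (kap * Hz (zeta tau) (e1 tau) (e2 tau)).
Proof.
move=> d0 d1 d2 Uz; set x1 := _ * rh1 _ _ _ in d1; set x2 := _ * rh2 _ _ _ in d2.
set y1 := e1 tau in d1 d2 *; set y2 := e2 tau in d1 d2 *; set z := zeta tau in d1 d2 *.
pose L (i j : nat) := kap * (dv (alpha i j) z * (y1 ^+ i * y2 ^+ j)) +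
  (x1 * (i%:R * alpha i j z * y1 ^+ (i - 1) * y2 ^+ j) + x2 * (j%:R * alpha i j z * y1 ^+ i * y2 ^+ (j - 1))).
have dterm (i j : nat) : inS M N i j ->
    der (fun t => alpha i j (zeta t) * (e1 t ^+ i * e2 t ^+ j)) tau (L i j).
  move=> ij; have := derM (der_comp d0 (anaU_der (halpha ij) Uz)) (derM (derX i d1) (derX j d2)).
  by apply: der_eq; rewrite /L -/z -/y1 -/y2; ring.
have dS : der (fun t => \sum_(i < M.+2) \sum_(j < N.+2 | inI M N i j) alpha i j (zeta t) * (e1 t ^+ i * e2 t ^+ j))
    tau (\sum_(i < M.+2) \sum_(j < N.+2 | inI M N i j) L i j).
  apply: (@der_sum M.+2 xpredT (fun (i : nat) t => \sum_(j < N.+2 | inI M N i j) alpha i j (zeta t) * (e1 t ^+ i * e2 t ^+ j))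
    (fun i : nat => \sum_(j < N.+2 | inI M N i j) L i j)) => i _ _.
  apply: (@der_sum N.+2 (fun j : nat => inI M N i j) (fun (j : nat) t => alpha i j (zeta t) * (e1 t ^+ i * e2 t ^+ j)) (L i)).
  by move=> j _ ij; apply: dterm; rewrite /inS ij.
have dE : der (fun t => En (zeta t) (e1 t) (e2 t)) tau (L M.+1 0%N + L 0%N N.+1).
  apply: der_ext (derD (dterm _ _ inS_a) (dterm _ _ inS_b)).
  by apply: nrW => t; rewrite /En expr0 mulr1 expr0 mul1r.
apply: der_eq (derD dE dS).
have -> : \sum_(i < M.+2) \sum_(j < N.+2 | inI M N i j) L i j =
   kap * (\sum_(i < M.+2) \sum_(j < N.+2 | inI M N i j) dv (alpha i j) z * (y1 ^+ i * y2 ^+ j)) +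
   (x1 * (\sum_(i < M.+2) \sum_(j < N.+2 | inI M N i j) i%:R * alpha i j z * y1 ^+ (i - 1) * y2 ^+ j) +
    x2 * (\sum_(i < M.+2) \sum_(j < N.+2 | inI M N i j) j%:R * alpha i j z * y1 ^+ i * y2 ^+ (j - 1))).
  rewrite !mulr_sumr -!big_split /=; apply: eq_bigr => i _.
  by rewrite !mulr_sumr -!big_split /=.
rewrite /Hz /L /x1 /x2 /rhs1 /rhs2 -/y1 -/y2 -/z.
set S0 := \sum_(i < M.+2) _; set S1 := \sum_(i < M.+2) _; set S2 := \sum_(i < M.+2) _.
rewrite !subn1 /= !expr0 !mul0r; ring.
Qed.

Lemma lau_Hlow : lau (az * bz - 1) (fun z y1 y2 => Hm z y1 y2 - En z y1 y2).
Proof.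
apply: (@lau_ext _ (fun z y1 y2 => \sum_(i < M.+2) \sum_(j < N.+2 | inI M N i j) alpha i j z * (y1 ^+ i * y2 ^+ j))).
  by move=> z y1 y2 _; rewrite /Hm addrAC subrr add0r.
apply: (@lau_sum _ M.+2 xpredT (fun (i : nat) z y1 y2 => \sum_(j < N.+2 | inI M N i j) alpha i j z * (y1 ^+ i * y2 ^+ j))) => i _ _.
apply: (@lau_sum _ N.+2 (fun j : nat => inI M N i j) (fun (j : nat) z y1 y2 => alpha i j z * (y1 ^+ i * y2 ^+ j))) => j _ ij.
apply: lau_nat; first by apply: halpha; rewrite /inS ij.
by move: ij; rewrite /inI /wgt; lia.
Qed.
Lemma lau_En : lau (az * bz) En.
Proof.
apply: (@lau_ext _ (fun z y1 y2 => al z * (y1 ^+ M.+1 * y2 ^+ 0) + be z * (y1 ^+ 0 * y2 ^+ N.+1))).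
  by move=> z y1 y2 _; rewrite !expr0 mulr1 mul1r.
by apply: lau_add; apply: lau_nat; rewrite ?/wgt; [exact: anaU_al|lia|exact: anaU_be|lia].
Qed.
Lemma lau_Hz : lau (az * bz) Hz.
Proof.
apply: lau_add; last first.
  apply: (@lau_sum _ M.+2 xpredT (fun (i : nat) z y1 y2 => \sum_(j < N.+2 | inI M N i j) dv (alpha i j) z * (y1 ^+ i * y2 ^+ j))) => i _ _.
  apply: (@lau_sum _ N.+2 (fun j : nat => inI M N i j) (fun (j : nat) z y1 y2 => dv (alpha i j) z * (y1 ^+ i * y2 ^+ j))) => j _ ij.
  apply: lau_nat; first by apply/anaU_dv/halpha; rewrite /inS ij.
  by move: ij; rewrite /inI /wgt; lia.
apply: (@lau_ext _ (fun z y1 y2 => dv al z * (y1 ^+ M.+1 * y2 ^+ 0) + dv be z * (y1 ^+ 0 * y2 ^+ N.+1))).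
  by move=> z y1 y2 _; rewrite !expr0 mulr1 mul1r.
by apply: lau_add; apply: lau_nat; rewrite ?/wgt; [exact/anaU_dv/anaU_al|lia|exact/anaU_dv/anaU_be|lia].
Qed.
Lemma isD_Hm : isD Hm Hz.
Proof. by move=> tau zeta e1 e2 kap d0 d1 d2 [Uz _ _]; exact: Hm_der. Qed.

(* The auxiliary function W = H + G: all terms of W' - P W of weight above n
   have been removed. *)
Definition reduced n := exists G P Q GD, [/\ lau (az + bz) G, lau 0 P, lau n Q, isD G GD &
  forall z y1 y2, okp z y1 y2 ->
    Hz z y1 y2 + GD z y1 y2 = P z y1 y2 * (Hm z y1 y2 + G z y1 y2) + Q z y1 y2].

Lemma reduced_top : reduced (az * bz).
Proof.
exists (fun _ _ _ => 0), (fun _ _ _ => 0), Hz, (fun _ _ _ => 0).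
split; [exact: lau_zero|exact: lau_zero|exact: lau_Hz|exact: isD_zero|].
by move=> *; rewrite addr0 mul0r add0r.
Qed.
(** [En] is traded for the new W = H + G + G1. The difference W - [En] has weight at most az * bz -
    1, so multiplied by P1 it has weight at most n - 1 and joins the remainder. *)
Lemma reduced_step n : 0 < pz -> 0 < n -> n <= az * bz -> n != pz -> reduced n -> reduced (n - 1).
Proof.
move=> p0 n0 nab np [G [P [Q [GD [lG lP lQ dG e]]]]].
have [G1 [P1 [Q1 [D1 [lG1 lP1 lQ1 dG1 e1]]]]] := eliminate p0 np lQ.
exists (fun z y1 y2 => G z y1 y2 + G1 z y1 y2), (fun z y1 y2 => P z y1 y2 + P1 z y1 y2).
exists (fun z y1 y2 => Q1 z y1 y2 - P z y1 y2 * G1 z y1 y2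
   - P1 z y1 y2 * ((Hm z y1 y2 - En z y1 y2) + (G z y1 y2 + G1 z y1 y2))).
exists (fun z y1 y2 => GD z y1 y2 + D1 z y1 y2).
have lG1' : lau (az + bz) G1 by apply: lau_le lG1; lia.
split.
- exact: lau_add.
- by apply: lau_add => //; apply: lau_le lP1; lia.
- apply: lau_sub; first apply: lau_sub => //.
    by apply: lau_mulm lP lG1; lia.
  apply: (lau_mulm (n := n - az * bz) (m := az * bz - 1)) => //; first by lia.
  apply: lau_add; first exact: lau_Hlow.
  by apply: lau_le (lau_add lG lG1'); lia.
- exact: isD_add.
- move=> z y1 y2 ok; rewrite addrA e //.
  have -> : P z y1 y2 * (Hm z y1 y2 + G z y1 y2) + Q z y1 y2 + D1 z y1 y2 =
    P z y1 y2 * (Hm z y1 y2 + G z y1 y2) + (Q z y1 y2 + D1 z y1 y2) by ring.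
  by rewrite e1 //; ring.
Qed.
End Laurent.

(** * Limits at the branch point and cancellation of poles *)

Section PuncturedLimit.
Variable R : realType.
Local Notation C := (Cx R).
Implicit Types (f g : C -> C) (w l : C).

(* Limit at 0 through nonzero arguments. *)
Definition pto f l := ctn (fun w => if w == 0 then l else f w) 0.

Lemma ptoE f l : pto f l <-> forall e : R, 0 < e -> nr 0 (fun w => w != 0 -> nm (f w - l) < e).
Proof.
rewrite /pto /ctn eqxx; split=> H e e0; apply: nrS (H e e0) => w.
  by move=> + /negbTE w0; rewrite w0.
by have [->|w0] := eqVneq w 0; [rewrite subrr nm0|apply].
Qed.
Lemma pto_ctn f : ctn f 0 -> pto f (f 0).
Proof. by move=> h; apply/ptoE => e e0; apply: nrS (h e e0). Qed.
Lemma pto_ext f g l : nr 0 (fun w => w != 0 -> f w = g w) -> pto f l -> pto g l.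
Proof.
move=> e; apply: ctn_ext; apply: nrS e => w; case: eqP => // /eqP w0 h; exact: h.
Qed.
Lemma ptoD f g l m : pto f l -> pto g m -> pto (fun w => f w + g w) (l + m).
Proof. by move=> h1 h2; apply: ctn_ext (ctnD h1 h2); apply: nrW => w; case: eqP. Qed.
Lemma ptoM f g l m : pto f l -> pto g m -> pto (fun w => f w * g w) (l * m).
Proof. by move=> h1 h2; apply: ctn_ext (ctnM h1 h2); apply: nrW => w; case: eqP. Qed.
Lemma pto_unique f l m : pto f l -> pto f m -> l = m.
Proof.
move=> h1 h2; have := ctn_punctured h1 h2; rewrite eqxx; apply.
by apply: nrW => w; case: eqP.
Qed.
Lemma pto_cst (c : C) : pto (fun=> c) c. Proof. exact: (pto_ctn (ctn_cst c 0)). Qed.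
Lemma pto_id : pto id 0. Proof. exact: (pto_ctn (ctn_id 0)). Qed.

(* w f' = O(w) f + O(1) is incompatible with a pole of f at 0. *)
Lemma pole_cancellation (m : nat) f (f' ep B Rr : C -> C) (Th : C) : ana 0 Rr ->
  nr 0 (fun w => w != 0 -> f w = w ^- m * Rr w) ->
  nr 0 (fun w => w != 0 -> der f w (f' w) /\ w * f' w = ep w * f w + B w) ->
  pto ep 0 -> pto B Th ->
  Th = 0 /\ exists2 R1, ana 0 R1 & nr 0 (fun w => w != 0 -> f w = R1 w).
Proof.
elim: m Rr => [|m IH] Rr aR fR H pe pB.
  have fE : nr 0 (fun w => w != 0 -> f w = Rr w).
    by apply: nrS fR => w h w0; rewrite h // expr0 invr1 mul1r.
  split; last by exists Rr.
  have [dR aR'] := ana_dv aR.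
  have l1 : pto (fun w => w * dv Rr w) (0 * dv Rr 0) by apply: ptoM pto_id (pto_ctn (ana_ctn aR')).
  have l2 := ptoD (ptoM pe (pto_ctn (ana_ctn aR))) pB.
  rewrite mul0r in l1; rewrite mul0r add0r in l2; apply/esym.
  apply: pto_unique l1 _; apply: pto_ext l2.
  apply: nrS2 (nrI dR (nr_nr fE)) (nrI fE H) => w [d1 e1] [e2 H2] w0.
  have [d2 E] := H2 w0; rewrite -e2 // -E; congr (_ * _); apply: der_unique d2 _.
  apply: der_ext d1; have [d d0 Hd] := e1; exists (Num.min d (nm w)); first by rewrite lt_min d0 nm_gt0.
  move=> x; rewrite lt_min => /andP[x1 x2]; rewrite Hd //.
  by apply: contraTneq x2 => ->; rewrite sub0r nmN ltxx.
have [dR aR'] := ana_dv aR.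
(* Multiplied by w^(m+1) the equation reads w R' = (m+1) R + ep R + w^(m+1) B; at w = 0 only (m+1)
   R(0) survives, so the order of the pole drops. *)
have R0 : Rr 0 = 0.
  have l1 : pto (fun w => w * dv Rr w) (0 * dv Rr 0) by apply: ptoM pto_id (pto_ctn (ana_ctn aR')).
  have wm : pto (fun w : C => w ^+ m.+1) 0.
    by have := pto_ctn (ctnX m.+1 (ctn_id 0)); rewrite /= expr0n.
  have l2 := ptoD (ptoD (ptoM (pto_cst m.+1%:R) (pto_ctn (ana_ctn aR))) (ptoM pe (pto_ctn (ana_ctn aR)))) (ptoM wm pB).
  rewrite mul0r in l1; rewrite !mul0r !addr0 in l2.
  have e0 : m.+1%:R * Rr 0 = 0.
    apply: pto_unique l2 _; apply: pto_ext l1.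
    apply: nrS2 dR (nrI (nr_nr fR) (nrI fR H)) => w d1 [e1 [e2 H2]] w0.
    have [d2 E] := H2 w0.
    have wm0 : w ^+ m.+1 != 0 by rewrite expf_neq0.
    have Rf : Rr w = w ^+ m.+1 * f w by rewrite e2 // mulrA divff // mul1r.
    have d3 := derM (derX m.+1 (der_id w)) d2.
    have -> : dv Rr w = m.+1%:R * w ^+ (m.+1 - 1) * 1 * f w + w ^+ m.+1 * f' w.
      apply: der_unique d1 _; apply: der_ext d3.
      have [d d0 Hd] := e1; exists (Num.min d (nm w)); first by rewrite lt_min d0 nm_gt0.
      move=> x; rewrite lt_min => /andP[x1 x2].
      have x0 : x != 0 by apply: contraTneq x2 => ->; rewrite sub0r nmN ltxx.
      by rewrite Hd // mulrA divff ?expf_neq0 // mul1r.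
    rewrite subn1 /= Rf mulrDr [w * (w ^+ m.+1 * f' w)]mulrCA E exprS; ring.
  by apply/eqP; move/eqP: e0; rewrite mulf_eq0 pnatr_eq0.
have [R1 aR1 E1] := ana_div aR R0.
apply: IH H pe pB; first exact: aR1.
apply: nrS2 fR E1 => w h1 h2 w0; rewrite h1 // h2 exprS invfM.
by rewrite mulrACA mulVf // mul1r mulrC.
Qed.
End PuncturedLimit.

(** * Size and variation of weighted Laurent polynomials *)

Section LaurentBounds.
Variable R : realType.
Local Notation C := (Cx R).
Variables (M N : nat) (alpha : nat -> nat -> C -> C) (U : C -> Prop) (z1 : C).
Hypothesis hU : forall z, U z -> nr z U.
Hypothesis Uz1 : U z1.
Implicit Types (F G : C -> C -> C -> C) (f : C -> C) (n i j : int) (c lam : R).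
Local Notation lau := (lau M N U).

(* Both components have the size predicted by their weights at scale lam. *)
Definition reg c lam (y1 y2 : C) := [/\ 1 <= lam, c^-1 * lam ^+ N.+1 <= nm y1 <= c * lam ^+ N.+1 &
  c^-1 * lam ^+ M.+1 <= nm y2 <= c * lam ^+ M.+1].

Lemma reg_neq0 c lam y1 y2 : 1 <= c -> reg c lam y1 y2 -> y1 != 0 /\ y2 != 0.
Proof.
move=> c1 [l1 /andP[h1 _] /andP[h2 _]].
have p (k : nat) : 0 < c^-1 * lam ^+ k by rewrite mulr_gt0 ?invr_gt0 ?exprn_gt0; lra.
by rewrite -!nm_gt0; split; [apply: lt_le_trans h1|apply: lt_le_trans h2].
Qed.
Lemma powz_bound c (l x : R) i : 1 <= c -> 0 < l -> c^-1 * l <= x <= c * l ->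
  0 <= x ^ i <= c ^+ `|i|%N * l ^ i.
Proof.
move=> c1 l0 /andP[x1 x2]; have c0 : 0 < c by lra.
have cl : 0 < c^-1 * l by rewrite mulr_gt0 // invr_gt0.
have x0 : 0 < x by apply: lt_le_trans x1.
apply/andP; split; first by rewrite exprz_ge0 // ltW.
case: i => n; rewrite ?absz_nat.
  rewrite -!exprnP -exprMn; apply: lerXn2r; rewrite ?nnegrE //; first exact: ltW.
  by rewrite mulr_ge0 // ltW.
have h : (c^-1 * l) ^+ n.+1 <= x ^+ n.+1 by apply: lerXn2r; rewrite ?nnegrE ?(ltW x0) ?(ltW cl).
rewrite NegzE abszN absz_nat -!exprnN.
have -> : c ^+ n.+1 * l ^- n.+1 = ((c^-1 * l) ^+ n.+1)^-1 by rewrite exprMn exprVn invfM invrK.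
by rewrite lef_pV2 ?posrE ?exprn_gt0.
Qed.
Lemma ana_lip f : ana z1 f -> exists K rho : R, [/\ 0 <= K, 0 < rho & forall z x : C,
  nm (z - z1) < rho -> nm (x - z1) < rho -> nm (f z) <= K /\ nm (f z - f x) <= K * nm (z - x)].
Proof.
move=> af; have [df adf] := ana_dv af.
pose K : R := nm (f z1) + nm (dv f z1) + 1.
have l1 : nm (f z1) < K by rewrite /K; have := nm_ge0 (dv f z1); lra.
have l2 : nm (dv f z1) < K by rewrite /K; have := nm_ge0 (f z1); lra.
have K0 : 0 <= K by have := nm_ge0 (f z1); lra.
have [rho r0 H] := nrI df (nrI (ctn_nm_lt (ana_ctn af) l1) (ctn_nm_lt (ana_ctn adf) l2)).
exists K, rho; split => // z x hz hx.
split; first by apply: ltW; have [_ []] := H z hz.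
apply: (@mean_value _ f (dv f)) => s s01 /=.
have [h1 [_ h2]] := H _ (nm_segment_at s01 hx hz).
by split => //; exact: ltW.
Qed.
Lemma exprz_lip c i : 1 <= c -> exists2 K : R, 0 <= K & forall rho : C, c^-1 <= nm rho <= c ->
  nm (rho ^ i - 1) <= K * nm (rho - 1).
Proof.
move=> c1; have c0 : 0 < c by lra.
have nat_ (n : nat) (rho : C) : nm rho <= c -> nm (rho ^+ n - 1) <= n%:R * c ^+ n * nm (rho - 1).
  by move=> h; have := @nm_expr_lip R c rho 1 n c1 h; rewrite expr1n nm1; apply.
case: i => n.
  exists (n%:R * c ^+ n); first by rewrite mulr_ge0 // exprn_ge0 // ltW.
  by move=> rho /andP[_ h]; exact: nat_.
exists (c ^+ n.+1 * (n.+1%:R * c ^+ n.+1)); first by rewrite !mulr_ge0 // exprn_ge0 // ltW.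
move=> rho /andP[h1 h2]; have r0 : 0 < nm rho by apply: lt_le_trans h1; rewrite invr_gt0.
have rn : rho ^+ n.+1 != 0 by rewrite expf_neq0 // -nm_gt0.
rewrite NegzE -exprnN.
have -> : rho ^- n.+1 - 1 = - (rho ^- n.+1 * (rho ^+ n.+1 - 1)) by rewrite mulrBr mulVf // mulr1 opprB.
rewrite nmN nmM nmV nmX -mulrA; apply: ler_pM; rewrite ?nm_ge0 //.
- by rewrite invr_ge0 exprn_ge0 // nm_ge0.
- rewrite -exprVn; apply: lerXn2r; rewrite ?nnegrE ?invr_ge0 ?(ltW c0) ?(ltW r0) //.
  by rewrite -[c]invrK lef_pV2 // posrE // invr_gt0.
- exact: nat_.
Qed.
Lemma reg_mono c lam y1 y2 i j n : 1 <= c -> reg c lam y1 y2 -> wgt M N i j <= n ->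
  nm (y1 ^ i * y2 ^ j) <= c ^+ (`|i| + `|j|)%N * lam ^ n.
Proof.
move=> c1 [l1 h1 h2] hn; have l0 : 0 < lam by lra.
rewrite nmM !nmXz.
have /andP[p1 b1] := powz_bound i c1 (exprn_gt0 N.+1 l0) h1.
have /andP[p2 b2] := powz_bound j c1 (exprn_gt0 M.+1 l0) h2.
apply: (le_trans (ler_pM p1 p2 b1 b2)).
rewrite mulrACA -exprD; apply: ler_wpM2l; first by rewrite exprn_ge0 //; lra.
rewrite !exprnP !exprz_exp -expfzDr ?gt_eqF //.
exact: ler_weXz2l.
Qed.

Lemma lau_bound n F c : 1 <= c -> lau n F -> exists K rho : R, [/\ 0 <= K, 0 < rho &
  forall z lam y1 y2, nm (z - z1) < rho -> reg c lam y1 y2 -> nm (F z y1 y2) <= K * lam ^ n].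
Proof.
move=> c1; elim=> [f i j af h|F1 F2 _ [K1 [r1 [k1 p1 b1]]] _ [K2 [r2 [k2 p2 b2]]]|F1 F2 e _ [K [r [k p b]]]].
- have [K [rho [K0 r0 H]]] := ana_lip (af z1 Uz1).
  exists (K * c ^+ (`|i| + `|j|)%N), rho; split => //; first by rewrite mulr_ge0 // exprn_ge0; lra.
  move=> z lam y1 y2 hz rg; rewrite nmM -mulrA; apply: ler_pM; rewrite ?nm_ge0 //.
    by have [] := H z z hz hz.
  exact: reg_mono.
- exists (K1 + K2), (Num.min r1 r2); split; [exact: addr_ge0|by rewrite lt_min p1|].
  move=> z lam y1 y2; rewrite lt_min => /andP[h1 h2] rg.
  by apply: le_trans (nmD _ _) _; rewrite mulrDl; apply: lerD; [apply: b1|apply: b2].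
- have [d d0 Hd] := hU Uz1.
  exists K, (Num.min r d); split => //; first by rewrite lt_min p.
  move=> z lam y1 y2; rewrite lt_min => /andP[h1 h2] rg; rewrite -e; first exact: b.
  by have [] := reg_neq0 c1 rg; split => //; exact: Hd.
Qed.

Lemma lip_arith (K D l L1 L2 Q fd fx m1 m2 u a b dz du dv S : R) :
  0 <= fd -> fd <= K * dz -> 0 <= fx -> fx <= K -> 0 <= m1 -> m1 <= D * l -> 0 <= m2 -> m2 <= D * l ->
  0 <= u -> u <= Q -> 0 <= a -> a <= L1 * du -> 0 <= b -> b <= L2 * dv -> 0 <= dz -> 0 <= du -> 0 <= dv ->
  0 <= S -> S <= u * b + a ->
  0 <= L1 -> 0 <= L2 -> 0 <= K -> 0 <= D -> 0 <= l ->
  fd * m1 + fx * (m2 * S) <= (K * D + K * D * (L1 + Q * L2)) * l * (dz + du + dv).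
Proof.
move=> fd0 fdK fx0 fxK m10 m1D m20 m2D u0 uQ a0 aL b0 bL dz0 du0 dv0 S0 Sb L10 L20 K0 D0 l0.
have Q0 : 0 <= Q by exact: le_trans uQ.
have t : u * b <= Q * (L2 * dv) by apply: ler_pM.
have SB : S <= (L1 + Q * L2) * (du + dv).
  have p1 : 0 <= Q * L2 * du by rewrite !mulr_ge0.
  have p2 : 0 <= L1 * dv by rewrite mulr_ge0.
  have -> : (L1 + Q * L2) * (du + dv) = L1 * du + L1 * dv + Q * L2 * du + Q * (L2 * dv) by ring.
  by move: Sb t aL p1 p2; clear; lra.
have T1 : fd * m1 <= K * dz * (D * l) by apply: ler_pM.
have T2 : fx * (m2 * S) <= K * (D * l * ((L1 + Q * L2) * (du + dv))).
  by apply: ler_pM; rewrite ?mulr_ge0 //; apply: ler_pM.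
apply: le_trans (lerD T1 T2) _.
have s0 : 0 <= K * D * (du + dv) * l by rewrite !mulr_ge0 // addr_ge0.
have s1 : 0 <= K * D * (L1 + Q * L2) * dz * l by rewrite !(mulr_ge0, addr_ge0).
have -> : (K * D + K * D * (L1 + Q * L2)) * l * (dz + du + dv) =
  K * dz * (D * l) + K * (D * l * ((L1 + Q * L2) * (du + dv))) +
  (K * D * (du + dv) * l + K * D * (L1 + Q * L2) * dz * l) by ring.
by rewrite lerDl addr_ge0.
Qed.
(** Variations of y1 and y2 are measured by quotients because both are large: a monomial of weight n
    then varies by lam^n times the relative errors, with one constant for all scales. *)
Lemma lau_lip n F c : 1 <= c -> lau n F -> exists K rho : R, [/\ 0 <= K, 0 < rho &
  forall z x lam y1 y2 x1 x2, nm (z - z1) < rho -> nm (x - z1) < rho ->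
    reg c lam y1 y2 -> reg c lam x1 x2 ->
    nm (F z y1 y2 - F x x1 x2) <= K * lam ^ n * (nm (z - x) + nm (y1 / x1 - 1) + nm (y2 / x2 - 1))].
Proof.
move=> c1; elim=> [f i j af h|F1 F2 _ [K1 [r1 [k1 p1 b1]]] _ [K2 [r2 [k2 p2 b2]]]|F1 F2 e _ [K [r [k p b]]]].
- have [K [rho [K0 r0 H]]] := ana_lip (af z1 Uz1).
  have cc : 1 <= c * c by nra.
  have c0 : 0 < c by lra.
  have [L1 L10 HL1] := exprz_lip i cc; have [L2 L20 HL2] := exprz_lip j cc.
  pose D := c ^+ (`|i| + `|j|)%N; have D0 : 0 <= D by rewrite exprn_ge0 // ltW.
  pose Q := (c * c) ^+ `|i|%N; have Q0 : 0 <= Q by rewrite exprn_ge0 //; lra.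
  exists (K * D + K * D * (L1 + Q * L2)), rho; split => //.
    by rewrite !(addr_ge0, mulr_ge0).
  move=> z x lam y1 y2 x1 x2 hz hx rg rg'.
  have [y10 y20] := reg_neq0 c1 rg; have [x10 x20] := reg_neq0 c1 rg'.
  have [fz fl] := H z x hz hx; have [fx _] := H x x hx hx.
  have ratio (u v : C) (l : R) : 0 < l -> c^-1 * l <= nm u <= c * l -> c^-1 * l <= nm v <= c * l ->
      (c * c)^-1 <= nm (u / v) <= c * c.
    move=> l0 /andP[u1 u2] /andP[v1 v2]; have v0 : 0 < nm v by apply: lt_le_trans v1; rewrite mulr_gt0 // invr_gt0.
    rewrite nmM nmV; apply/andP; split.
      rewrite ler_pdivlMr //; apply: (le_trans _ u1).
      have -> : c^-1 * l = (c * c)^-1 * (c * l) by field; rewrite gt_eqF.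
      by apply: ler_wpM2l => //; rewrite invr_ge0 mulr_ge0 // ltW.
    rewrite ler_pdivrMr //; apply: (le_trans u2).
    have -> : c * l = c * c * (c^-1 * l) by field; rewrite gt_eqF.
    by apply: ler_wpM2l => //; rewrite mulr_ge0 // ltW.
  have [l1 g1 g2] := rg; have [_ g1' g2'] := rg'; have l0 : 0 < lam by lra.
  have R1 := ratio _ _ _ (exprn_gt0 N.+1 l0) g1 g1'.
  have R2 := ratio _ _ _ (exprn_gt0 M.+1 l0) g2 g2'.
  have P1 := HL1 _ R1; have P2 := HL2 _ R2.
  set u := y1 / x1 in R1 P1 *; set v := y2 / x2 in R2 P2 *.
  have uE : y1 = x1 * u by rewrite /u mulrC divfK.
  have vE : y2 = x2 * v by rewrite /v mulrC divfK.
  have ui : y1 ^ i = x1 ^ i * u ^ i by rewrite uE exprzMl // unitfE mulf_neq0 ?invr_eq0.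
  have vj : y2 ^ j = x2 ^ j * v ^ j by rewrite vE exprzMl // unitfE mulf_neq0 ?invr_eq0.
  have -> : f z * (y1 ^ i * y2 ^ j) - f x * (x1 ^ i * x2 ^ j) =
    (f z - f x) * (y1 ^ i * y2 ^ j) + f x * (x1 ^ i * x2 ^ j * (u ^ i * (v ^ j - 1) + (u ^ i - 1))).
    rewrite ui vj; move: (f z) (f x) (x1 ^ i) (x2 ^ j) (u ^ i) (v ^ j) => *; clear; ring.
  have m1 := reg_mono c1 rg h; have m2 := reg_mono c1 rg' h.
  have lm0 : 0 <= lam ^ n by rewrite exprz_ge0 // ltW.
  have bu : nm (u ^ i) <= Q.
    rewrite nmXz; have := @powz_bound (c * c) 1 (nm u) i cc ltr01.
    by rewrite !mulr1 exp1rz mulr1 => /(_ R1)/andP[].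
  apply: le_trans (nmD _ _) _; rewrite !(nmM (f z - f x)) (nmM (f x)) (nmM (x1 ^ i * x2 ^ j)).
  have B2 : nm (u ^ i * (v ^ j - 1) + (u ^ i - 1)) <= nm (u ^ i) * nm (v ^ j - 1) + nm (u ^ i - 1).
    by apply: le_trans (nmD _ _) _; rewrite nmM.
  have := lip_arith (nm_ge0 (f z - f x)) fl (nm_ge0 (f x)) fx (nm_ge0 _) m1 (nm_ge0 _) m2 (nm_ge0 _) bu
    (nm_ge0 _) P1 (nm_ge0 _) P2 (nm_ge0 _) (nm_ge0 _) (nm_ge0 _) (nm_ge0 _) B2 L10 L20 K0 D0 lm0.
  by apply.
- exists (K1 + K2), (Num.min r1 r2); split; [exact: addr_ge0|by rewrite lt_min p1|].
  move=> z x lam y1 y2 x1 x2; rewrite !lt_min => /andP[h1 h2] /andP[h3 h4] rg rg'.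
  have -> : F1 z y1 y2 + F2 z y1 y2 - (F1 x x1 x2 + F2 x x1 x2) =
    (F1 z y1 y2 - F1 x x1 x2) + (F2 z y1 y2 - F2 x x1 x2) by ring.
  by apply: le_trans (nmD _ _) _; rewrite !(mulrDl K1) mulrDl; apply: lerD; [apply: b1|apply: b2].
- have [d d0 Hd] := hU Uz1.
  exists K, (Num.min r d); split => //; first by rewrite lt_min p.
  move=> z x lam y1 y2 x1 x2; rewrite !lt_min => /andP[h1 h2] /andP[h3 h4] rg rg'.
  rewrite -e; first rewrite -e; first exact: b.
  + by have [] := reg_neq0 c1 rg'; split => //; exact: Hd.
  + by have [] := reg_neq0 c1 rg; split => //; exact: Hd.
Qed.

(** On functions with poles of orders b1 and a1 the monomial y1^i y2^j has pole order b1 i + a1 j,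
    its weight divided by d; the bound on n says that this integer is below m+1. *)
Lemma lau_ref (d a1 b1 q m : nat) (A B : C -> C) n F : (0 < q)%N -> M.+1 = (a1 * d)%N -> N.+1 = (b1 * d)%N ->
  ana 0 A -> ana 0 B -> A 0 != 0 -> B 0 != 0 -> n < d%:Z * m.+1%:Z -> lau n F ->
  exists2 Rr : C -> C, ana 0 Rr & nr 0 (fun w => w != 0 ->
    F (z1 + w ^+ q) (w ^- b1 * A w) (w ^- a1 * B w) = w ^- m * Rr w).
Proof.
move=> q0 Md Nd aA aB A0 B0 nm_.
have nrAB := nrI (ctn_neq0 (ana_ctn aA) A0) (ctn_neq0 (ana_ctn aB) B0).
elim=> [f i j af h|F1 F2 _ [R1 g1 e1] _ [R2 g2 e2]|F1 F2 e _ [Rr g h]].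
- have aR : ana 0 (fun w => f (z1 + w ^+ q) * (A w ^ i * B w ^ j)).
    by apply: anaM; [exact: ana_pow q0 (af z1 Uz1)|apply: anaM; exact: anaXz].
  pose ex : int := b1%:Z * i + a1%:Z * j.
  have exm : ex <= m%:Z by move: h nm_; rewrite /wgt Md Nd /ex !PoszM; nia.
  exists (fun w => w ^+ `|m%:Z - ex|%N * (f (z1 + w ^+ q) * (A w ^ i * B w ^ j))).
    by apply: anaM => //; apply/anaX/ana_id.
  apply: nrS nrAB => w [Aw Bw] w0; rewrite !exprzMl ?unitfE ?invr_eq0 ?expf_neq0 //.
  have -> : w ^- m = w ^ (- m%:Z) := exprnN w m.
  have -> : w ^- b1 = w ^ (- b1%:Z) := exprnN w b1.
  have -> : w ^- a1 = w ^ (- a1%:Z) := exprnN w a1.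
  have -> : w ^+ `|m%:Z - ex|%N = w ^ (m%:Z - ex) by rewrite exprnP gez0_abs // subr_ge0.
  rewrite !exprz_exp.
  have : w ^ (- m%:Z) * w ^ (m%:Z - ex) = w ^ (- b1%:Z * i) * w ^ (- a1%:Z * j).
    by rewrite -!expfzDr //; congr (_ ^ _); rewrite /ex; lia.
  move: (w ^ (- m%:Z)) (w ^ (m%:Z - ex)) (w ^ (- b1%:Z * i)) (w ^ (- a1%:Z * j)) (f _) (A w ^ i) (B w ^ j) => W1 W2 W3 W4 X Y Z h1.
  clear -h1; transitivity (W3 * W4 * (X * (Y * Z))); [ring|rewrite -h1; ring].
- exists (fun w => R1 w + R2 w); first exact: anaD.
  by apply: nrS2 e1 e2 => w h1 h2 w0; rewrite h1 // h2 // mulrDr.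
- exists Rr => //.
  have cz : ctn (fun w : C => z1 + w ^+ q) 0 by apply: ctnD; [exact: ctn_cst|exact: ctnX (ctn_id 0)].
  have Un : nr 0 (fun w => U (z1 + w ^+ q)).
    apply: (ctn_near cz); rewrite expr0n; case: (q) q0 => // q' _; rewrite addr0; exact: hU.
  apply: nrS2 h (nrI Un nrAB) => w hw [Uw [Aw Bw]] w0; rewrite -e ?hw //.
  by split => //; rewrite mulf_neq0 // invr_eq0 expf_neq0.
Qed.
End LaurentBounds.

(** * Normal form at weight MN - 1 *)

Section NormalForm.
Variable R : realType.
Local Notation C := (Cx R).
Variables (M N : nat) (alpha : nat -> nat -> C -> C) (U : C -> Prop).
Local Notation az := (M.+1%:Z).
Local Notation bz := (N.+1%:Z).
Local Notation pz := (M.+1%:Z * N.+1%:Z - M.+1%:Z - N.+1%:Z).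
Local Notation al := (alpha M.+1 0%N).
Local Notation be := (alpha 0%N N.+1).
Hypothesis halpha : forall i j, inS M N i j -> forall z, U z -> ana z (alpha i j).
Hypothesis hal : forall z, U z -> al z != 0.
Hypothesis hbe : forall z, U z -> be z != 0.
Variables (d a1 b1 : nat).
Hypotheses (d0 : (0 < d)%N) (Md : M.+1 = (a1 * d)%N) (Nd : N.+1 = (b1 * d)%N) (cop : coprime a1 b1).
Implicit Types (F G P Q : C -> C -> C -> C) (f k : C -> C) (i j n m : int).
Local Notation lau := (lau M N U).
Local Notation anaU := (anaU U).
Local Notation okp := (okp U).
Local Notation En := (En M N alpha).

(* The monomials of weight p = MN - 1, modulo En: the obstructions to a further reduction. *)
Definition res l (y1 y2 : C) := y1 ^ (a1%:Z * l - 1) * y2 ^ (N%:Z - b1%:Z * l).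
Lemma res_def l y1 y2 : res l y1 y2 = y1 ^ (a1%:Z * l - 1) * y2 ^ (N%:Z - b1%:Z * l). Proof. by []. Qed.

(** Expressions that reduce to a function of z on the locus [En] = 0, where y1^(M+1) / y2^(N+1)
    equals -be/al. *)
Definition modE F := exists c P, [/\ anaU c, lau (- (az * bz)) P &
  forall z y1 y2, okp z y1 y2 -> F z y1 y2 = c z + P z y1 y2 * En z y1 y2].

Lemma modE_one : modE (fun _ _ _ => 1).
Proof.
exists (fun=> 1), (fun _ _ _ => 0); split; [exact: anaU_cst|exact: lau_zero|].
by move=> *; rewrite mul0r addr0.
Qed.
Lemma modE_mul F G : modE F -> modE G -> modE (fun z y1 y2 => F z y1 y2 * G z y1 y2).
Proof.
move=> [c [P [ac lP e]]] [c' [P' [ac' lP' e']]].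
exists (fun z => c z * c' z), (fun z y1 y2 => c z * P' z y1 y2 + (c' z * P z y1 y2 + P z y1 y2 * (P' z y1 y2 * En z y1 y2))).
split; first exact: anaU_mul.
  apply: lau_add; first exact: lau_coef.
  apply: lau_add; first exact: lau_coef.
  apply: (@lau_mulm _ _ _ _ (- (az * bz)) 0) => //; first by rewrite addr0.
  by apply: lau_mulm lP' (lau_En halpha); lia.
by move=> z y1 y2 ok; rewrite e // e' //; ring.
Qed.
Lemma modE_exp F (k : nat) : modE F -> modE (fun z y1 y2 => F z y1 y2 ^+ k).
Proof. move=> h; elim: k => [|k [c [P [h1 h2 h3]]]]; first exact: modE_one.
have [c' [P' [h1' h2' h3']]] := modE_mul h (ex_intro _ c (ex_intro _ P (And3 h1 h2 h3))).
by exists c', P'; split => // z y1 y2 ok; rewrite exprS h3'.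
Qed.
Lemma modE_pow (k : int) : modE (fun _ y1 y2 => (y1 ^+ M.+1 * y2 ^- N.+1) ^ k).
Proof.
have X1 : modE (fun _ y1 y2 => y1 ^+ M.+1 * y2 ^- N.+1).
  exists (fun z => - (be z * (al z)^-1)), (fun z y1 y2 => (al z)^-1 * (y1 ^ 0 * y2 ^ (- bz))); split.
  - by apply: anaU_opp; apply: anaU_mul; [exact: (anaU_be halpha)|apply: anaU_inv => //; exact: (anaU_al halpha)].
  - by apply: lau_mono; [apply: anaU_inv => //; exact: (anaU_al halpha)|rewrite /wgt; lia].
  - move=> z y1 y2 [Uz y10 y20]; rewrite En_def expr0z mul1r -exprnN.
    have := expf_neq0 N.+1 y20; have := hal Uz.
    move: (al z) (be z) (y1 ^+ M.+1) (y2 ^+ N.+1) => A B X Y A0 Y0; field; rewrite A0 Y0 //.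
have X2 : modE (fun _ y1 y2 => (y1 ^+ M.+1 * y2 ^- N.+1)^-1).
  exists (fun z => - (al z * (be z)^-1)), (fun z y1 y2 => (be z)^-1 * (y1 ^ (- az) * y2 ^ 0)); split.
  - by apply: anaU_opp; apply: anaU_mul; [exact: (anaU_al halpha)|apply: anaU_inv => //; exact: (anaU_be halpha)].
  - by apply: lau_mono; [apply: anaU_inv => //; exact: (anaU_be halpha)|rewrite /wgt; lia].
  - move=> z y1 y2 [Uz y10 y20]; rewrite En_def expr0z mulr1 -exprnN.
    have := expf_neq0 N.+1 y20; have := expf_neq0 M.+1 y10; have := hbe Uz.
    move: (al z) (be z) (y1 ^+ M.+1) (y2 ^+ N.+1) => A B X Y B0 X0 Y0; field; rewrite B0 X0 Y0 //.
case: k => k; first exact: (modE_exp k X1).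
have [c [P [ac lP e]]] := modE_exp k.+1 X2; exists c, P; split => // z y1 y2 ok.
by rewrite -e // NegzE -exprnN exprVn.
Qed.

(** A monomial of weight MN - 1 satisfies b1 (i+1) = a1 (N-j), hence i+1 = a1 x and N-j = b1 x by
    coprimality. Reducing x modulo d splits off a power of y1^(M+1) / y2^(N+1), a function of z
    modulo [En], and leaves d residual monomials. *)
Lemma normal_form F : lau pz F -> exists (k : nat -> C -> C) P Q,
  [/\ forall l, anaU (k l), lau (pz - az * bz) P, lau (pz - 1) Q &
   forall z y1 y2, okp z y1 y2 -> F z y1 y2 =
     \sum_(l < d) k l z * res l%:Z y1 y2 + (P z y1 y2 * En z y1 y2 + Q z y1 y2)].
Proof.
elim=> [f i j af h|F1 F2 _ [k1 [P1 [Q1 [a1_ b1_ c1 e1]]]] _ [k2 [P2 [Q2 [a2 b2 c2 e2]]]]|F1 F2 e _ [k [P [Q [h1 h2 h3 h4]]]]].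
- have [hlt|hge] := boolP (wgt M N i j < pz).
    exists (fun _ _ => 0), (fun _ _ _ => 0), (fun z y1 y2 => f z * (y1 ^ i * y2 ^ j)).
    split; [by move=> l; exact: anaU_cst|exact: lau_zero| |].
      by apply: lau_mono => //; move: hlt; lia.
    by move=> z y1 y2 _; rewrite big1 ?mul0r ?add0r // => l _; rewrite mul0r.
  have hn : wgt M N i j = pz by apply/le_anti; rewrite h leNgt.
  have hij : b1%:Z * (i + 1) = a1%:Z * (N%:Z - j).
    have dz : d%:Z != 0 by lia.
    apply: (mulfI dz); move: hn; rewrite /wgt Md; have : N%:Z = b1%:Z * d%:Z - 1 by lia.
    rewrite Nd !PoszM => ->; lia.
  have [x hx] : exists x : int, i + 1 = a1%:Z * x.
    have : (a1%:Z %| b1%:Z * (i + 1))%Z by rewrite hij dvdz_mulr.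
    rewrite Gauss_dvdzr; first by case/dvdzP => x ->; exists x; rewrite mulrC.
    by rewrite /coprimez /gcdz /= eqz_nat; exact: cop.
  have a10 : (0 < a1)%N by move: Md; case: (a1).
  have hj : N%:Z - j = b1%:Z * x.
    have az0 : a1%:Z != 0 by lia.
    by apply: (mulfI az0); rewrite -hij hx; lia.
  pose l := `|(x %% d%:Z)%Z|%N; pose t := (x %/ d%:Z)%Z.
  have lE : l%:Z = (x %% d%:Z)%Z by rewrite /l gez0_abs // modz_ge0 //; lia.
  have ld : (l < d)%N by have := @ltz_pmod x d%:Z; rewrite -lE; lia.
  have xE : x = l%:Z + d%:Z * t by rewrite {1}(divz_eq x d%:Z) -lE /t; lia.
  have [c [P [ac lP e]]] := modE_pow t.
  exists (fun l' z => if l' == l then f z * c z else 0).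
  exists (fun z y1 y2 => f z * ((fun=> 1) z * (y1 ^ (a1%:Z * l%:Z - 1) * y2 ^ (N%:Z - b1%:Z * l%:Z)) * P z y1 y2)), (fun _ _ _ => 0).
  split.
  + by move=> l'; case: eqP => _; [exact: anaU_mul|exact: anaU_cst].
  + apply: lau_coef => //; apply: lau_mul lP.
    apply: lau_mono; first exact: anaU_cst.
    have : N%:Z = b1%:Z * d%:Z - 1 by lia.
    by rewrite /wgt Md Nd !PoszM => ->; lia.
  + exact: lau_zero.
  + move=> z y1 y2 ok; rewrite (bigD1 (Ordinal ld)) //= eqxx big1 => [|l' /eqP ne]; last first.
      by case: eqP => [el|]; [case: ne; exact: val_inj|rewrite mul0r].
    rewrite addr0; have := e z y1 y2 ok; have [Uz y10 y20] := ok => eE.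
    have -> : y1 ^ i * y2 ^ j = res l%:Z y1 y2 * (y1 ^+ M.+1 * y2 ^- N.+1) ^ t.
      have -> : i = (a1%:Z * l%:Z - 1) + az * t by rewrite Md PoszM; move: hx; rewrite xE; lia.
      have -> : j = (N%:Z - b1%:Z * l%:Z) + - bz * t by rewrite Nd PoszM; move: hj; rewrite xE; lia.
      have -> : y1 ^+ M.+1 * y2 ^- N.+1 = y1 ^ az * y2 ^ (- bz) by rewrite -exprnN.
      rewrite (expfzDr _ _ y10) (expfzDr _ _ y20) exprzMl ?unitfE ?expfz_neq0 // !exprz_exp /res.
      move: (y1 ^ _) (y1 ^ (az * t)) (y2 ^ _) (y2 ^ (- bz * t)) => *; clear; ring.
    rewrite eE -/(res l%:Z y1 y2).
    move: (f z) (res _ _ _) (c z) (P z y1 y2) (En z y1 y2) => *; clear; ring.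
- exists (fun l z => k1 l z + k2 l z), (fun z y1 y2 => P1 z y1 y2 + P2 z y1 y2), (fun z y1 y2 => Q1 z y1 y2 + Q2 z y1 y2).
  split; [by move=> l; exact: anaU_add|exact: lau_add|exact: lau_add|].
  move=> z y1 y2 ok; rewrite e1 // e2 // addrACA -big_split /=.
  under [in RHS]eq_bigr do rewrite mulrDl.
  by move: (\sum_(l < d) _) => S; ring.
- by exists k, P, Q; split => // z y1 y2 ok; rewrite -e // h4.
Qed.
End NormalForm.

(** * Series solutions at a singular point *)

Section FormalSeries.
Variable R : realType.
Local Notation C := (Cx R).
Implicit Types (c A B : nat -> C) (t : nat -> nat -> nat -> C) (f g : fls R).

(** Coefficients of w^e c(w). *)
Definition shf (e : nat) c (n : nat) : C := if (n < e)%N then 0 else c (n - e)%N.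

Lemma shfS e c : shf e.+1 c = cshift (shf e c).
Proof. by apply/funext => -[|n]; rewrite /shf //= ltnS subSS. Qed.
Lemma shf0 c : shf 0 c = c.
Proof. by apply/funext => n; rewrite /shf ltn0 subn0. Qed.
Lemma geo_shf e c : geo c -> geo (shf e c).
Proof. by move=> h; elim: e => [|e IH]; [rewrite shf0|rewrite shfS; exact: geo_cshift]. Qed.
Lemma psum_shf e c : geo c -> nr 0 (fun w => psum (shf e c) w = w ^+ e * psum c w).
Proof.
move=> h; elim: e => [|e IH]; first by apply: nrW => w; rewrite shf0 expr0 mul1r.
by apply: nrS2 IH (psum_cshift (geo_shf e h)) => w h1 h2; rewrite shfS h2 h1 exprS mulrA.
Qed.
Lemma conv_shf e c A : conv (shf e c) A = shf e (conv c A).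
Proof.
apply/funext => n; rewrite /conv {2}/shf; case: ltnP => ne.
  by rewrite big1 // => k _; rewrite /shf (leq_ltn_trans _ ne) ?mul0r // -ltnS.
rewrite -(big_mkord xpredT (fun k => shf e c k * A (n - k)%N)) (@big_cat_nat _ _ _ e) //=; last exact: leqW.
rewrite big_nat_cond big1 ?add0r => [|k /andP[/andP[_ ke] _]]; last by rewrite /shf ke mul0r.
rewrite -{1}[e]add0n big_addn subSn // big_mkord.
by apply: eq_bigr => k _; rewrite /shf ltnNge leq_addl /= addnK addnC subnDA.
Qed.
Lemma shf_dil d e c : (0 < d)%N -> shf (d * e) (dil d c) = dil d (shf e c).
Proof.
move=> d0; apply/funext => n; rewrite /shf /dil.
case: (boolP (d %| n)%N) => [/dvdnP[k ->]|dn].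
  by rewrite mulnK // [(k * d)%N]mulnC ltn_mul2l d0 /= -mulnBr dvdn_mulr // mulKn.
case: ltnP => // ne; case: ifP => // h; case/negP: dn.
by rewrite -(subnKC ne) dvdn_add ?dvdn_mulr.
Qed.
Lemma dil_dil d q c : (0 < d)%N -> dil (d * q) c = dil d (dil q c).
Proof.
move=> d0; apply/funext => n; rewrite /dil.
case: (boolP (d %| n)%N) => [/dvdnP[k ->]|dn].
  by rewrite mulnK // [(k * d)%N]mulnC dvdn_pmul2l // divnMl.
by case: ifP => // h; case/negP: dn; apply: dvdn_trans h; rewrite dvdn_mulr.
Qed.
Lemma conv_delta c : conv (@cdelta R) c = c.
Proof.
apply/funext => n; rewrite /conv big_ord_recl /cdelta /= subn0 mul1r big1 ?addr0 // => i _.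
by rewrite mul0r.
Qed.
Lemma convZ (a : C) c A n : conv (fun k => a * c k) A n = a * conv c A n.
Proof. by rewrite /conv mulr_sumr; apply: eq_bigr => k _; rewrite mulrA. Qed.

Lemma geoZ (a : C) c : geo c -> geo (fun n => a * c n).
Proof.
move=> [K [r [K0 r0 h]]]; exists (nm a * K), r; split => //; first by rewrite mulr_ge0 ?nm_ge0.
by move=> n; rewrite nmM -mulrA ler_wpM2l ?nm_ge0.
Qed.
Lemma convC c A : conv c A = conv A c.
Proof.
apply/funext => n; rewrite /conv (reindex_inj rev_ord_inj) /=.
by apply: eq_bigr => k _; rewrite subSS subKn 1?mulrC // -ltnS.
Qed.

Lemma fcoef_add f g k : fcoef (fadd f g) k = fcoef f k + fcoef g k.
Proof.
rewrite {1}/fcoef /fadd /=; case E: (k + (maxn f.1 g.1)%:Z) => [n|n].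
  by have -> : n%:Z - (maxn f.1 g.1)%:Z = k by lia.
have neg (h : fls R) : (h.1 <= maxn f.1 g.1)%N -> fcoef h k = 0.
  by move=> hm; rewrite /fcoef; case E': (k + h.1%:Z) => [m|m] //; lia.
by rewrite !neg ?addr0 ?leq_maxl ?leq_maxr.
Qed.
Lemma fcoef_zero k : fcoef (fzero R) k = 0.
Proof. by rewrite /fcoef; case: (_ + _). Qed.
Lemma fcoef_sum (K : nat) (P : pred nat) (F : nat -> fls R) k :
  fcoef (\big[@fadd R/fzero R]_(j < K | P j) F j) k = \sum_(j < K | P j) fcoef (F j) k.
Proof. exact: (big_morph (fun f => fcoef f k) (fun f g => fcoef_add f g k) (fcoef_zero k)). Qed.
Lemma fcoef_scale (a : C) f k : fcoef (fscale a f) k = a * fcoef f k.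
Proof. by rewrite /fcoef /fscale /=; case: (_ + _) => n //; rewrite mulr0. Qed.
Lemma fpowE v c n : fpow (v, c) n = ((n * v)%N, cpow c n).
Proof. by elim: n => [|n IH] //; rewrite /fpow iterS -/(fpow _ n) IH. Qed.
Lemma fcoefE (v w e n : nat) c : (v + e = w)%N -> fcoef (v, c) (n%:Z - w%:Z) = shf e c n.
Proof.
move=> ve; rewrite /fcoef /shf /=.
case: ltnP => h; case E: (n%:Z - w%:Z + v%:Z) => [m|m] //; try lia.
by congr (c _); lia.
Qed.
End FormalSeries.

(** * The recursion for the coefficients of a series solution *)

Section Branch.
Variable R : realType.
Local Notation C := (Cx R).
Variables (M N : nat).
Implicit Types (c A B : nat -> C) (t : nat -> nat -> nat -> C) (X : nat -> nat -> C).

Definition s1 (i j : nat) : C := if inS M N i j.+1 then j.+1%:R else 0.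
Definition s2 (i j : nat) : C := if inS M N i.+1 j then - i.+1%:R else 0.
Lemma coef1E (f : nat -> nat -> C -> C) i j z : coef1 M N f i j z = s1 i j * f i j.+1 z.
Proof.
rewrite /coef1 /s1 /inS andbF /= eqSS; case: ifP => [/andP[/eqP -> /eqP ->]|h].
  by rewrite orbT.
by rewrite orbF; case: ifP => _; rewrite ?mul0r.
Qed.
Lemma coef2E (f : nat -> nat -> C -> C) i j z : coef2 M N f i j z = s2 i j * f i.+1 j z.
Proof.
rewrite /coef2 /s2 /inS eqSS /= orbF; case: ifP => [/andP[/eqP -> /eqP ->]|h].
  by rewrite orbT mulNr.
by rewrite orbF; case: ifP => _; rewrite ?mul0r ?mulNr.
Qed.

(** The regrouping [rhs1E] for an arbitrary array: it is that identity for constant coefficient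
    functions at y1 = y2 = 1. *)
Lemma sel1E X : N.+1%:R * X 0%N N.+1 + \sum_(i < M.+2) \sum_(j < N.+2 | inI M N i j) j%:R * X i j =
  \sum_(i < M.+2) \sum_(j < N.+2) s1 i j * X i j.+1.
Proof.
have := rhs1E M N (fun i j _ => X i j) 0 1 1; rewrite /rhs1 /polsum expr1n mulr1.
under eq_bigr => i _ do under eq_bigr => j _ do rewrite !expr1n !mulr1.
move=> ->; apply: eq_bigr => i _; apply: eq_bigr => j _; by rewrite !expr1n !mulr1 coef1E.
Qed.
Lemma sel2E X : - (M.+1%:R) * X M.+1 0%N + \sum_(i < M.+2) \sum_(j < N.+2 | inI M N i j) - i%:R * X i j =
  \sum_(i < M.+2) \sum_(j < N.+2) s2 i j * X i.+1 j.
Proof.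
have := rhs2E M N (fun i j _ => X i j) 0 1 1; rewrite /rhs2 /polsum expr1n mulr1 mulNr.
under eq_bigr => i _ do under eq_bigr => j _ do rewrite !expr1n !mulr1.
rewrite -sumrN; under eq_bigr => i _ do rewrite -sumrN.
under [in X in _ -> X = _]eq_bigr => i _ do under eq_bigr => j _ do rewrite mulNr.
move=> ->; apply: eq_bigr => i _; apply: eq_bigr => j _; by rewrite !expr1n !mulr1 coef2E.
Qed.
(* The recursion satisfied by the coefficients of w^b1 y1 and w^a1 y2, where z = z0 + w^q. *)
Definition excess (d a1 b1 i j : nat) := (a1 * b1 * d - (b1 * i + a1 * j))%N.
Definition rec1 d a1 b1 q t i j n : C := q%:R * s1 i j * shf (excess d a1 b1 i j.+1) (dil q (t i j.+1)) n.
Definition rec2 d a1 b1 q t i j n : C := q%:R * s2 i j * shf (excess d a1 b1 i.+1 j) (dil q (t i.+1 j)) n.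
Definition brsol d a1 b1 q t A B n :=
  bbsol M.+2 N.+2 (rec1 d a1 b1 q t) (rec2 d a1 b1 q t) b1%:R a1%:R A B n.

Lemma inS_wgt i j : inS M N i j -> (i * N.+1 + j * M.+1 <= M.+1 * N.+1)%N.
Proof.
rewrite /inS /inI => /or3P[h|/andP[/eqP -> /eqP ->]|/andP[/eqP -> /eqP ->]].
- by apply: ltnW; rewrite [(M.+1 * _)%N]mulnC.
- by rewrite addn0.
- by rewrite add0n mulnC.
Qed.
(** Formal solutions are series in s = (z - z0)^(1/(MN-1)), the case d = 1 of the recursion, with
    pole orders N+1 and M+1. The common divisor is brought in by [level_reduce]. *)
Lemma formal_brsol t A B : (2 <= M * N)%N ->
  formal_solution M N (M * N - 1) t (N.+1, A) (M.+1, B) ->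
  forall n, brsol 1 M.+1 N.+1 (M * N - 1) t A B n.
Proof.
move=> MN2 [h1 h2] n; set p := (M * N - 1)%N in h1 h2 *.
have p0 : p%:R != 0 :> C by rewrite pnatr_eq0 /p; lia.
have lhs (v : nat) (D : nat -> C) : fcoef (fderiv p (v, D)) (n%:Z - (v + p)%:Z) = D n * ((n%:R - v%:R) / p%:R).
  rewrite /fderiv (@fcoefE _ (v + p) (v + p) 0 n) ?addn0 // shf0 /=.
  by rewrite rmorphB.
have term (i j e w : nat) (c : nat -> C) : (i * N.+1 + j * M.+1 + e = w)%N ->
    fcoef (fmul (ftaylor p c) (fmul (fpow (N.+1, A) i) (fpow (M.+1, B) j))) (n%:Z - w%:Z) =
    conv (shf e (dil p c)) (conv (cpow A i) (cpow B j)) n.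
  move=> ew; rewrite !fpowE /fmul /= add0n (@fcoefE _ _ _ e) // conv_shf //.
split.
- have := h1 (n%:Z - (N.+1 + p)%:Z); rewrite lhs /frhs1 fcoef_add.
  set X := fun i j => fcoef (fmul (ftaylor p (t i j)) (fmul (fpow (N.+1, A) i) (fpow (M.+1, B) (j - 1)))) (n%:Z - (N.+1 + p)%:Z).
  have -> : fcoef (fscale N.+1%:R (fmul (ftaylor p (t 0%N N.+1)) (fpow (M.+1, B) N))) (n%:Z - (N.+1 + p)%:Z) = N.+1%:R * X 0%N N.+1.
    rewrite fcoef_scale /X subn1 /= !fpowE; congr (_ * fcoef _ _).
    by congr fmul; rewrite /fmul /=; congr pair; rewrite -[LHS]conv_delta.
  rewrite (fcoef_sum M.+2 xpredT (fun i => \big[@fadd R/fzero R]_(j < N.+2 | inI M N i j)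
       fscale j%:R (fmul (ftaylor p (t i j)) (fmul (fpow (N.+1, A) i) (fpow (M.+1, B) (j - 1)))))).
  under eq_bigr => i _.
    rewrite (fcoef_sum N.+2 (fun j => inI M N i j) (fun j => fscale j%:R (fmul (ftaylor p (t i j)) (fmul (fpow (N.+1, A) i) (fpow (M.+1, B) (j - 1)))))).
    under eq_bigr => j _ do rewrite fcoef_scale -/(X i j).
    over.
  rewrite sel1E => e.
  have -> : (n%:R - N.+1%:R) * A n = p%:R * (A n * ((n%:R - N.+1%:R) / p%:R)) by field.
  rewrite e /Pol mulr_sumr; apply: eq_bigr => i _; rewrite mulr_sumr; apply: eq_bigr => j _.
  rewrite /rec1 convZ mulrA /s1; case: ifP => hS; last by rewrite !(mulr0, mul0r).
  congr (_ * _); rewrite /X subn1 /=; apply: term; have := inS_wgt hS; rewrite /excess /p; lia.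
- have := h2 (n%:Z - (M.+1 + p)%:Z); rewrite lhs /frhs2 fcoef_add.
  set X := fun i j => fcoef (fmul (ftaylor p (t i j)) (fmul (fpow (N.+1, A) (i - 1)) (fpow (M.+1, B) j))) (n%:Z - (M.+1 + p)%:Z).
  have -> : fcoef (fscale (- M.+1%:R) (fmul (ftaylor p (t M.+1 0%N)) (fpow (N.+1, A) M))) (n%:Z - (M.+1 + p)%:Z) = - M.+1%:R * X M.+1 0%N.
    rewrite fcoef_scale /X subn1 /= !fpowE; congr (_ * fcoef _ _).
    by congr fmul; rewrite /fmul /= addn0; congr pair; rewrite -[LHS]conv_delta convC.
  rewrite (fcoef_sum M.+2 xpredT (fun i => \big[@fadd R/fzero R]_(j < N.+2 | inI M N i j)
       fscale (- i%:R) (fmul (ftaylor p (t i j)) (fmul (fpow (N.+1, A) (i - 1)) (fpow (M.+1, B) j))))).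
  under eq_bigr => i _.
    rewrite (fcoef_sum N.+2 (fun j => inI M N i j) (fun j => fscale (- i%:R) (fmul (ftaylor p (t i j)) (fmul (fpow (N.+1, A) (i - 1)) (fpow (M.+1, B) j))))).
    under eq_bigr => j _ do rewrite fcoef_scale -/(X i j).
    over.
  rewrite sel2E => e.
  have -> : (n%:R - M.+1%:R) * B n = p%:R * (B n * ((n%:R - M.+1%:R) / p%:R)) by field.
  rewrite e /Pol mulr_sumr; apply: eq_bigr => i _; rewrite mulr_sumr; apply: eq_bigr => j _.
  rewrite /rec2 convZ mulrA /s2; case: ifP => hS; last by rewrite !(mulr0, mul0r).
  congr (_ * _); rewrite /X subn1 /=; apply: term; have := inS_wgt hS; rewrite /excess /p; lia.
Qed.

Lemma sum_pick (I J i0 j0 : nat) (c : C) (G : nat -> nat -> C) (F : nat -> nat -> C) : (i0 < I)%N -> (j0 < J)%N ->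
  (forall i j, F i j = if (i == i0) && (j == j0) then c else 0) ->
  \sum_(i < I) \sum_(j < J) F i j * G i j = c * G i0 j0.
Proof.
move=> hi hj E; rewrite (bigD1 (Ordinal hi)) //= (bigD1 (Ordinal hj)) //= E !eqxx big1 ?addr0 => [|j jj].
  rewrite big1 ?addr0 // => i ii; rewrite big1 // => j _; rewrite E.
  by case: (i =P i0 :> nat) ii => [e|_ _]; [move=> /eqP[]; exact: val_inj|rewrite mul0r].
rewrite E; case: (j =P j0 :> nat) jj => [e|_ _]; first by move=> /eqP[]; exact: val_inj.
by rewrite andbF mul0r.
Qed.

Section Level.
Variables (d a1 b1 q : nat) (t : nat -> nat -> nat -> C).
Hypotheses (MN2 : (2 <= M * N)%N) (Md : M.+1 = (a1 * d)%N) (Nd : N.+1 = (b1 * d)%N) (qd : (M * N - 1 = d * q)%N).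
Local Notation al0 := (t M.+1 0%N 0%N).
Local Notation be0 := (t 0%N N.+1 0%N).
Local Notation f1 := (rec1 d a1 b1 q t).
Local Notation f2 := (rec2 d a1 b1 q t).
Local Notation sol := (brsol d a1 b1 q t).
Local Notation K := (a1 * b1 * d)%N.

(** The relation K = q + a1 + b1 is (M+1)(N+1) = (MN-1) + (M+1) + (N+1) divided by d. *)
Lemma level_pos : [/\ (0 < d)%N, (0 < a1)%N, (0 < b1)%N, (0 < q)%N & [/\ (0 < M)%N, (0 < N)%N & (K = q + a1 + b1)%N]].
Proof.
have d0 : (0 < d)%N by case: (d) Md => //; rewrite muln0.
have a0 : (0 < a1)%N by case: (a1) Md.
have b0 : (0 < b1)%N by case: (b1) Nd.
have q0 : (0 < q)%N by case: (q) qd => // h; lia.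
have M0 : (0 < M)%N by case: (M) MN2.
have N0 : (0 < N)%N by case: (N) MN2; rewrite ?muln0.
split => //; split => //.
apply/eqP; rewrite -(eqn_pmul2l d0); apply/eqP.
have : (M.+1 * N.+1 = d * (q + a1 + b1))%N.
  rewrite !mulnDr -qd [(d * a1)%N]mulnC [(d * b1)%N]mulnC -Md -Nd; nia.
by rewrite Md Nd => <-; nia.
Qed.
Lemma rec1_0 i j : f1 i j 0%N = if (i == 0%N) && (j == N) then q%:R * N.+1%:R * be0 else 0.
Proof.
have [d0 a0 b0 q0 _] := level_pos.
rewrite /rec1 /s1 /shf; case: (boolP ((i == 0%N) && (j == N))) => [/andP[/eqP -> /eqP ->]|/negbTE h].
  rewrite /inS !eqxx !orbT /excess.
  have -> : (a1 * b1 * d - (b1 * 0 + a1 * N.+1) = 0)%N by rewrite Nd; nia.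
  by rewrite ltn0 subn0 /dil dvdn0 div0n.
rewrite /inS andbF /= eqSS h orbF; case: ifP => hI; last by rewrite mulr0 mul0r.
have -> : (0 < excess d a1 b1 i j.+1)%N; last by rewrite mulr0.
move: hI; rewrite /inI /excess subn_gt0 Md Nd => hI.
rewrite -(ltn_pmul2r (_ : 0 < d)%N) //; nia.
Qed.
Lemma rec2_0 i j : f2 i j 0%N = if (i == M) && (j == 0%N) then - (q%:R * M.+1%:R * al0) else 0.
Proof.
have [d0 a0 b0 q0 _] := level_pos.
rewrite /rec2 /s2 /shf; case: (boolP ((i == M) && (j == 0%N))) => [/andP[/eqP -> /eqP ->]|/negbTE h].
  rewrite /inS !eqxx !orbT /excess.
  have -> : (a1 * b1 * d - (b1 * M.+1 + a1 * 0) = 0)%N by rewrite Md; nia.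
  by rewrite ltn0 subn0 /dil dvdn0 div0n mulrN mulNr.
rewrite /inS eqSS h /= orbF; case: ifP => hI; last by rewrite mulr0 mul0r.
have -> : (0 < excess d a1 b1 i.+1 j)%N; last by rewrite mulr0.
move: hI; rewrite /inI /excess subn_gt0 Md Nd => hI.
rewrite -(ltn_pmul2r (_ : 0 < d)%N) //; nia.
Qed.
Lemma Pol_0 (f : nat -> nat -> nat -> C) A B (I J : nat) : Pol I J f A B 0%N =
  \sum_(i < I) \sum_(j < J) f i j 0%N * (A 0%N ^+ i * B 0%N ^+ j).
Proof. by apply: eq_bigr => i _; apply: eq_bigr => j _; rewrite !conv0 !cpow0. Qed.

Lemma sum_rec1 (G : nat -> nat -> C) : \sum_(i < M.+2) \sum_(j < N.+2) f1 i j 0%N * G i j = q%:R * N.+1%:R * be0 * G 0%N N.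
Proof. by rewrite (sum_pick G _ _ rec1_0). Qed.
Lemma sum_rec2 (G : nat -> nat -> C) : \sum_(i < M.+2) \sum_(j < N.+2) f2 i j 0%N * G i j = - (q%:R * M.+1%:R * al0) * G M 0%N.
Proof. by rewrite (sum_pick G _ _ rec2_0). Qed.
Lemma sol_0 A B : sol A B 0%N -> A 0%N = - (d%:R * q%:R * be0 * B 0%N ^+ N) /\ B 0%N = d%:R * q%:R * al0 * A 0%N ^+ M.
Proof.
have [d0 a0 b0 q0 _] := level_pos.
rewrite /brsol /bbsol !Pol_0 (sum_rec1 (fun i j => A 0%N ^+ i * B 0%N ^+ j)) (sum_rec2 (fun i j => A 0%N ^+ i * B 0%N ^+ j)).
rewrite !sub0r expr0 mul1r mulr1 Md Nd !natrM => -[h1 h2].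
have b0' : b1%:R != 0 :> C by rewrite pnatr_eq0 -lt0n.
have a0' : a1%:R != 0 :> C by rewrite pnatr_eq0 -lt0n.
split; [apply: (mulfI b0')|apply: (mulfI a0')]; apply/eqP; rewrite -eqr_opp -mulNr ?h1 ?h2; apply/eqP; ring.
Qed.

(** The indicial polynomial. Its root -q reflects translation in z and is never met; K is the only
    resonance. *)
Definition ldet n : C := (n%:R - K%:R) * (n%:R + q%:R).
Lemma ldet_neq0 n : n != K -> ldet n != 0.
Proof.
have [d0 a0 b0 q0 _] := level_pos.
move=> nK; rewrite /ldet mulf_neq0 //; first by rewrite subr_eq0 eqr_nat.
by rewrite -natrD pnatr_eq0 addn_eq0 negb_and -(lt0n q) q0 orbT.
Qed.
Lemma level_lin A B : sol A B 0%N -> A 0%N != 0 -> B 0%N != 0 ->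
  [/\ lin1 M.+2 N.+2 f1 (A 0%N) (B 0%N) = 0, lin2 M.+2 N.+2 f1 (A 0%N) (B 0%N) = - (b1%:R * N%:R * A 0%N / B 0%N),
     lin1 M.+2 N.+2 f2 (A 0%N) (B 0%N) = - (a1%:R * M%:R * B 0%N / A 0%N) & lin2 M.+2 N.+2 f2 (A 0%N) (B 0%N) = 0].
Proof.
move=> /sol_0[hA hB] A0 B0; have [d0 a0 b0 q0 [M0 N0 _]] := level_pos.
rewrite /lin1 /lin2.
rewrite (sum_rec1 (fun i j => i%:R * A 0%N ^+ (i - 1) * B 0%N ^+ j)) (sum_rec1 (fun i j => A 0%N ^+ i * (j%:R * B 0%N ^+ (j - 1)))).
rewrite (sum_rec2 (fun i j => i%:R * A 0%N ^+ (i - 1) * B 0%N ^+ j)) (sum_rec2 (fun i j => A 0%N ^+ i * (j%:R * B 0%N ^+ (j - 1)))).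
rewrite !mul0r !mulr0 !expr0 mul1r mulr1; split => //.
- rewrite {1}hA; apply: (mulIf B0); rewrite [RHS]mulNr mulfVK // Nd natrM.
  have -> : B 0%N ^+ N = B 0%N ^+ (N - 1) * B 0%N by rewrite -exprSr subn1 prednK.
  ring.
- rewrite {1}hB; apply: (mulIf A0); rewrite [RHS]mulNr mulfVK // Md natrM.
  have -> : A 0%N ^+ M = A 0%N ^+ (M - 1) * A 0%N by rewrite -exprSr subn1 prednK.
  ring.
Qed.
Lemma level_det A B n : sol A B 0%N -> A 0%N != 0 -> B 0%N != 0 ->
  bbdet M.+2 N.+2 f1 f2 b1%:R a1%:R (A 0%N) (B 0%N) n = ldet n.
Proof.
move=> h A0 B0; have [e1 e2 e3 e4] := level_lin h A0 B0; rewrite /bbdet e1 e2 e3 e4 !subr0 /ldet.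
have [d0 a0 b0 q0 [M0 N0 Kq]] := level_pos.
have hK : K%:R = q%:R + a1%:R + b1%:R :> C by rewrite Kq !natrD.
have hM : M%:R * N%:R = d%:R * q%:R + 1 :> C.
  by rewrite -!natrM -qd natrB ?subrK //; lia.
have -> : - (b1%:R * N%:R * A 0%N / B 0%N) * - (a1%:R * M%:R * B 0%N / A 0%N) = a1%:R * b1%:R * (M%:R * N%:R).
  by field; rewrite A0 B0.
have hK2 : K%:R = a1%:R * b1%:R * d%:R :> C by rewrite !natrM.
have -> : a1%:R * b1%:R * (M%:R * N%:R) = K%:R * q%:R + a1%:R * b1%:R :> C by rewrite hM hK2; ring.
rewrite hK; ring.
Qed.

(** At level K the matrix has the kernel spanned by (N [A 0], -M [B 0]). The given solution
    guarantees solvability there; adding kap times the kernel vector gives another solution, which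
    continues without further resonance. *)
Lemma level_family A B : A 0%N != 0 -> B 0%N != 0 -> (forall n, sol A B n) ->
  (forall i j, inS M N i j -> geo (t i j)) -> forall kap : C,
  exists A' B', [/\ forall n, (n < K)%N -> A' n = A n /\ B' n = B n, A' K = A K + kap * (N%:R * A 0%N),
    B' K = B K - kap * (M%:R * B 0%N), forall n, sol A' B' n & geo A' /\ geo B'].
Proof.
move=> A0 B0 h gt kap; have [d0 a0 b0 q0 [M0 N0 Kq]] := level_pos.
have K0 : (0 < K)%N by rewrite Kq addn_gt0 b0 orbT.
pose A1 n := if n == K then A K + kap * (N%:R * A 0%N) else A n.
pose B1 n := if n == K then B K - kap * (M%:R * B 0%N) else B n.
have lt_ n : (n < K)%N -> A1 n = A n /\ B1 n = B n.
  by move=> nK; rewrite /A1 /B1 (ltn_eqF nK).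
have [A10 B10] := lt_ 0%N K0.
have trA : trunc K A1 = trunc K A by apply/funext => n; rewrite /trunc; case: ifP => // /lt_[].
have trB : trunc K B1 = trunc K B by apply/funext => n; rewrite /trunc; case: ifP => // /lt_[].
have [e1 e2 e3 e4] := level_lin (h 0%N) A0 B0.
have solK n : (n <= K)%N -> sol A1 B1 n.
  rewrite leq_eqVlt => /orP[/eqP ->|nK]; last first.
    have [p1 p2] := lt_ n nK; have [h1 h2] := h n; rewrite /brsol /bbsol p1 p2 h1 h2.
    by split; apply: Pol_loc => k kn; have [] := lt_ k (leq_ltn_trans kn nK).
  apply/(bbsol_lin _ _ _ _ _ _ _ _ K0); rewrite A10 B10 trA trB.
  have [<- <-] := (bbsol_lin _ _ _ _ _ _ _ _ K0).1 (h K).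
  rewrite e1 e2 e3 e4 !subr0 !opprK /A1 /B1 eqxx.
  have hKb : K%:R - b1%:R = b1%:R * M%:R :> C.
    have -> : K = (b1 * M + b1)%N by rewrite mulnAC -Md; nia.
    by rewrite natrD natrM addrK.
  have hKa : K%:R - a1%:R = a1%:R * N%:R :> C.
    have -> : K = (a1 * N + a1)%N by rewrite -mulnA -Nd; nia.
    by rewrite natrD natrM addrK.
  rewrite hKb hKa; split.
    move: (A K) (B K) (A 0%N) (B 0%N) A0 B0 => x y u v u0 v0; field; rewrite v0 //.
  move: (A K) (B K) (A 0%N) (B 0%N) A0 B0 => x y u v u0 v0; field; rewrite u0 //.
have [||A' [B' [EA EB hs]]] := @bbsol_extend R M.+2 N.+2 f1 f2 b1%:R a1%:R A1 B1 K; first exact: solK.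
  move=> n Kn; rewrite level_det ?A10 ?B10 //; first by apply: ldet_neq0; rewrite gtn_eqF.
  exact: solK.
exists A', B'; split.
- by move=> n nK; rewrite EA ?EB 1?ltnW //; exact: lt_.
- by rewrite EA // /A1 eqxx.
- by rewrite EB // /B1 eqxx.
- exact: hs.
- apply: (@briot_bouquet_converges _ M.+2 N.+2 f1 f2 b1%:R a1%:R) => [i j _ _|i j _ _|n|n].
  + rewrite /rec1 /s1; case: ifP => [hS|_]; last first.
      by exists 0, 1; split => // n; rewrite mulr0 !mul0r nm0.
    by apply: geoZ; apply/geo_shf/geo_dil => //; exact: gt.
  + rewrite /rec2 /s2; case: ifP => [hS|_]; last first.
      by exists 0, 1; split => // n; rewrite mulr0 !mul0r nm0.
    by apply: geoZ; apply/geo_shf/geo_dil => //; exact: gt.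
  + exact: (hs n).1.
  + exact: (hs n).2.
Qed.
End Level.
End Branch.

(** * Convergent series solutions in the branched variable *)

Section BranchFunction.
Variable R : realType.
Local Notation C := (Cx R).
Variables (M N : nat) (alpha : nat -> nat -> C -> C).
Variables (d a1 b1 q : nat).
Hypotheses (MN2 : (2 <= M * N)%N) (Md : M.+1 = (a1 * d)%N) (Nd : N.+1 = (b1 * d)%N) (qd : (M * N - 1 = d * q)%N).
Local Notation K := (a1 * b1 * d)%N.
Implicit Types (A B : nat -> C) (t : nat -> nat -> nat -> C).

(** The equations are written in w, with z = z0 + w^q and the factor dz/dw on the right, so that no
    determination of the root of z - z0 has to be chosen. *)
Definition is_branch (z0 : C) A B := [/\ geo A, geo B & nr 0 (fun w => w != 0 ->
  let y1 w := w ^- b1 * psum A w in let y2 w := w ^- a1 * psum B w in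
  der y1 w (q%:R * w ^+ (q - 1) * rhs1 M N alpha (z0 + w ^+ q) (y1 w) (y2 w)) /\
  der y2 w (q%:R * w ^+ (q - 1) * rhs2 M N alpha (z0 + w ^+ q) (y1 w) (y2 w)))].

Lemma nr_ord (I : nat) (z : C) (P : nat -> C -> Prop) : (forall k, (k < I)%N -> nr z (P k)) ->
  nr z (fun w => forall k, (k < I)%N -> P k w).
Proof.
elim: I => [|I IH] h; first by apply: nrW.
apply: nrS2 (IH (fun k kK => h k (ltnW kK))) (h I (ltnSn I)) => w h1 h2 k.
by rewrite ltnS leq_eqVlt => /orP[/eqP ->//|]; exact: h1.
Qed.
Lemma Pol_scale (I J : nat) (f : nat -> nat -> nat -> C) (a : C) A B n :
  Pol I J (fun i j n => a * f i j n) A B n = a * Pol I J f A B n.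
Proof.
rewrite /Pol mulr_sumr; apply: eq_bigr => i _; rewrite mulr_sumr; apply: eq_bigr => j _.
exact: convZ.
Qed.

(** The hypothesis provides series in s, the conclusion needs series in w = s^d. The recursion
    involves only powers of s^d, and its single resonance (M+1)(N+1) is a multiple of d; so the
    coefficients off the multiples of d vanish. *)
Lemma level_reduce t A B : A 0%N != 0 -> B 0%N != 0 ->
  (forall n, brsol M N 1 M.+1 N.+1 (M * N - 1) t A B n) ->
  forall m, brsol M N d a1 b1 q t (fun m => A (d * m)%N) (fun m => B (d * m)%N) m.
Proof.
move=> A0 B0 h; have [d0 a0 b0 q0 _] := level_pos MN2 Md Nd qd.
have exE i j : excess 1 M.+1 N.+1 i j = (d * excess d a1 b1 i j)%N.
  rewrite /excess mulnBr Md Nd; congr (_ - _)%N; [ring|ring].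
have E1 : rec1 M N 1 M.+1 N.+1 (M * N - 1) t = fun i j => dil d (fun m => d%:R * rec1 M N d a1 b1 q t i j m).
  apply/funext => i; apply/funext => j; apply/funext => n.
  rewrite /rec1 exE qd dil_dil // shf_dil // natrM {1}/dil [in RHS]/dil.
  by case: ifP => _; rewrite ?mulr0 // -!mulrA.
have E2 : rec2 M N 1 M.+1 N.+1 (M * N - 1) t = fun i j => dil d (fun m => d%:R * rec2 M N d a1 b1 q t i j m).
  apply/funext => i; apply/funext => j; apply/funext => n.
  rewrite /rec2 exE qd dil_dil // shf_dil // natrM {1}/dil [in RHS]/dil.
  by case: ifP => _; rewrite ?mulr0 // -!mulrA.
have Md1 : M.+1 = (M.+1 * 1)%N by rewrite muln1.
have Nd1 : N.+1 = (N.+1 * 1)%N by rewrite muln1.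
have qd1 : (M * N - 1 = 1 * (M * N - 1))%N by rewrite mul1n.
have hD n : ~~ (d %| n)%N -> bbdet M.+2 N.+2 (rec1 M N 1 M.+1 N.+1 (M * N - 1) t)
    (rec2 M N 1 M.+1 N.+1 (M * N - 1) t) N.+1%:R M.+1%:R (A 0%N) (B 0%N) n != 0.
  move=> dn; rewrite (level_det MN2 Md1 Nd1 qd1) //.
  apply: (@ldet_neq0 R M N 1 M.+1 N.+1 (M * N - 1) MN2 Md1 Nd1 qd1).
  by apply: contraNneq dn => ->; rewrite muln1 Md -mulnA dvdn_mull // dvdn_mulr.
have [||eA eB] := @bbsol_support _ d M.+2 N.+2 (fun i j m => d%:R * rec1 M N d a1 b1 q t i j m)
  (fun i j m => d%:R * rec2 M N d a1 b1 q t i j m) N.+1%:R M.+1%:R A B d0.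
- by rewrite -E1 -E2; exact: h.
- by rewrite -E1 -E2; exact: hD.
have PE f m : Pol M.+2 N.+2 (fun i j => dil d (fun m => d%:R * f i j m)) A B (d * m)%N =
    d%:R * Pol M.+2 N.+2 f (fun m => A (d * m)%N) (fun m => B (d * m)%N) m.
  by rewrite {1}eA {1}eB Pol_dil // dilM // Pol_scale.
move=> m; have [] := h (d * m)%N; rewrite E1 E2 !PE => h1 h2.
have dR : d%:R != 0 :> C by rewrite pnatr_eq0 -lt0n.
have Mr : M.+1%:R = a1%:R * d%:R :> C by rewrite Md natrM.
have Nr : N.+1%:R = b1%:R * d%:R :> C by rewrite Nd natrM.
by rewrite Mr Nr natrM in h1 h2; split; apply: (mulfI dR); [rewrite -h1|rewrite -h2]; ring.
Qed.

Lemma der_pole (n : nat) (F : C -> C) (w l : C) : w != 0 -> der F w l ->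
  der (fun x => x ^- n * F x) w (w ^- n.+1 * (w * l - n%:R * F w)).
Proof.
move=> w0 dF; have h := derM (derXz (- n%:Z) w0 (der_id w)) dF.
apply: (der_eq (l := (- n%:Z)%:~R * w ^ (- n%:Z - 1) * 1 * F w + w ^ (- n%:Z) * l)); last first.
  by apply: der_ext h; apply: nrW => x; rewrite exprnN.
rewrite mulr1 -!exprnN.
have -> : - n%:Z - 1 = - n.+1%:Z by lia.
rewrite -exprnN exprS intrN; have := expf_neq0 n w0; move: (w ^+ n) => X X0.
by field; rewrite w0 X0.
Qed.

(** For b = b1 + 1 the balance of exponents is K = q + a1 + b1 applied to the monomial y1^i y2^(j+1)
    of H; for b = a1 + 1 it is applied to y1^(i+1) y2^j. *)
Lemma pole_mono (w x y : C) (i j E b : nat) : w != 0 -> (E + b1 * i + a1 * j = (q - 1) + b)%N ->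
  w ^- b * (w ^+ E * (x ^+ i * y ^+ j)) = w ^+ (q - 1) * ((w ^- b1 * x) ^+ i * (w ^- a1 * y) ^+ j).
Proof.
move=> w0 e; rewrite !exprMn !exprVn -!exprM.
have : w ^+ E * w ^+ (b1 * i) * w ^+ (a1 * j) = w ^+ (q - 1) * w ^+ b by rewrite -!exprD e.
have := expf_neq0 b w0; have := expf_neq0 (b1 * i) w0; have := expf_neq0 (a1 * j) w0.
move: (w ^+ E) (w ^+ (b1 * i)) (w ^+ (a1 * j)) (w ^+ (q - 1)) (w ^+ b) (x ^+ i) (y ^+ j) => W1 W2 W3 W4 W5 X Y n3 n2 n5 h.
apply: (mulfI n5); apply: (mulfI n2); apply: (mulfI n3).
transitivity (W1 * W2 * W3 * X * Y); first by field.
rewrite h; field; by rewrite n2 n3.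
Qed.

Lemma level_ode z0 t A B : (forall i j, inS M N i j -> geo (t i j) /\ nr z0 (fun x => alpha i j x = psum (t i j) (x - z0))) ->
  geo A -> geo B -> (forall n, brsol M N d a1 b1 q t A B n) -> is_branch z0 A B.
Proof.
move=> ht gA gB h; have [d0 a0 b0 q0 [M0 N0 Kq]] := level_pos MN2 Md Nd qd.
split => //.
have tnr i j : inS M N i j -> nr 0 (fun w => psum (shf (excess d a1 b1 i j) (dil q (t i j))) w = w ^+ excess d a1 b1 i j * alpha i j (z0 + w ^+ q)).
  move=> hS; have [gt nt] := ht i j hS.
  have /nr0 h1 := psum_dil q0 gt.
  have h2 := psum_shf (excess d a1 b1 i j) (geo_dil q0 gt).
  have cz : ctn (fun w : C => z0 + w ^+ q) 0 by apply: ctnD; [exact: ctn_cst|exact: ctnX (ctn_id 0)].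
  have h3 : nr 0 (fun w => alpha i j (z0 + w ^+ q) = psum (t i j) (z0 + w ^+ q - z0)).
    by apply: (ctn_near (P := fun x => alpha i j x = psum (t i j) (x - z0)) cz); rewrite /= expr0n (gtn_eqF q0) addr0.
  have h4 : nr 0 (fun w => alpha i j (z0 + w ^+ q) = psum (t i j) (w ^+ q)).
    by apply: nrS h3 => w; have -> : z0 + w ^+ q - z0 = w ^+ q by rewrite addrC addKr.
  apply: nrS2 h1 (nrI h2 h4) => w e1 [e2 e3].
  by apply: (etrans e2); congr (_ * _); exact: (etrans e1 (esym e3)).
have zero_geo : geo (fun _ : nat => 0 : C) by exists 0, 1; split => // n; rewrite nm0 mul0r.
have psumZ (a : C) (c : nat -> C) : geo c -> nr 0 (fun w => psum (fun n => a * c n) w = a * psum c w).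
  move=> [k [r [K0 r0 hc]]]; exists r^-1; first by rewrite invr_gt0.
  move=> w; rewrite subr0 => hw; have rw : r * nm w < 1 by rewrite mulrC -ltr_pdivlMr // div1r.
  have [e _] := psum_spec r0 hc rw; apply: psum_eq; apply: cvto_eq (cvtoZ a e) => n.
  by rewrite mulr_sumr; apply: eq_bigr => i _; rewrite mulrA.
have psum_zero w : psum (fun _ : nat => 0 : C) w = 0.
  by apply: psum_eq => e e0; exists 0%N => n _; rewrite big1 ?subrr ?nm0 // => i _; rewrite mul0r.
have g1 i j : geo (rec1 M N d a1 b1 q t i j) /\ nr 0 (fun w => psum (rec1 M N d a1 b1 q t i j) w =
    q%:R * (s1 R M N i j * (w ^+ excess d a1 b1 i j.+1 * alpha i j.+1 (z0 + w ^+ q)))).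
  rewrite /rec1 /s1; case: ifP => hS.
    have gS : geo (shf (excess d a1 b1 i j.+1) (dil q (t i j.+1))) by apply/geo_shf/geo_dil => //; have [] := ht _ _ hS.
    split; first exact: geoZ.
    by apply: nrS2 (psumZ (q%:R * j.+1%:R) _ gS) (tnr _ _ hS) => w -> ->; rewrite -mulrA.
  have -> : (fun n => q%:R * 0 * shf (excess d a1 b1 i j.+1) (dil q (t i j.+1)) n) = fun=> 0.
    by apply/funext => n; rewrite mulr0 mul0r.
  by split => //; apply: nrW => w; rewrite psum_zero mul0r mulr0.
have g2 i j : geo (rec2 M N d a1 b1 q t i j) /\ nr 0 (fun w => psum (rec2 M N d a1 b1 q t i j) w =
    q%:R * (s2 R M N i j * (w ^+ excess d a1 b1 i.+1 j * alpha i.+1 j (z0 + w ^+ q)))).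
  rewrite /rec2 /s2; case: ifP => hS.
    have gS : geo (shf (excess d a1 b1 i.+1 j) (dil q (t i.+1 j))) by apply/geo_shf/geo_dil => //; have [] := ht _ _ hS.
    split; first exact: geoZ.
    by apply: nrS2 (psumZ (q%:R * - i.+1%:R) _ gS) (tnr _ _ hS) => w -> ->; rewrite -mulrA.
  have -> : (fun n => q%:R * 0 * shf (excess d a1 b1 i.+1 j) (dil q (t i.+1 j)) n) = fun=> 0.
    by apply/funext => n; rewrite mulr0 mul0r.
  by split => //; apply: nrW => w; rewrite psum_zero mul0r mulr0.
have big_nr (P : nat -> nat -> C -> Prop) : (forall i j, nr 0 (P i j)) ->
    nr 0 (fun w => forall i, (i < M.+2)%N -> forall j, (j < N.+2)%N -> P i j w).
  move=> hP; apply: (@nr_ord M.+2 0 (fun i w => forall j, (j < N.+2)%N -> P i j w)) => i _.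
  by apply: nr_ord => j _; exact: hP.
have n1 := nrI (big_nr _ (fun i j => (g1 i j).2)) (big_nr _ (fun i j => (g2 i j).2)).
have P1 := psum_Pol gA gB (fun i j _ _ => (g1 i j).1) (I := M.+2) (J := N.+2).
have P2 := psum_Pol gA gB (fun i j _ _ => (g2 i j).1) (I := M.+2) (J := N.+2).
have E1 := psum_euler b1%:R gA; have E2 := psum_euler a1%:R gB.
have e1 : (fun n => (n%:R - b1%:R) * A n) = Pol M.+2 N.+2 (rec1 M N d a1 b1 q t) A B.
  by apply/funext => n; have [] := h n.
have e2 : (fun n => (n%:R - a1%:R) * B n) = Pol M.+2 N.+2 (rec2 M N d a1 b1 q t) A B.
  by apply/funext => n; have [] := h n.
rewrite e1 in E1; rewrite e2 in E2.
have /nr0 dA := psum_der gA; have /nr0 dB := psum_der gB.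
apply: nrS2 (nrI n1 (nrI P1 P2)) (nrI (nrI E1 E2) (nrI dA dB)) => w [[r1 r2] [p1 p2]] [[q1 q2] [da db]] w0.
have exK i j : inS M N i j -> (excess d a1 b1 i j + (b1 * i + a1 * j) = K)%N.
  move=> /inS_wgt; rewrite /excess Md Nd => hw; apply: subnK; rewrite -(leq_pmul2r d0); nia.
split.
- apply: (der_eq (l := w ^- b1.+1 * (w * psum (dcoef A) w - b1%:R * psum A w))); last exact: der_pole.
  rewrite -q1 p1 rhs1E /polsum !mulr_sumr; apply: eq_bigr => i _; rewrite !mulr_sumr; apply: eq_bigr => j _.
  rewrite (r1 i (ltn_ord i) j (ltn_ord j)) coef1E /s1; case: ifP => hS; last by rewrite !(mul0r, mulr0).
  have e : (excess d a1 b1 i j.+1 + b1 * i + a1 * j = (q - 1) + b1.+1)%N by have := exK _ _ hS; nia.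
  have := pole_mono (psum A w) (psum B w) w0 e.
  move: (w ^- b1.+1) (w ^+ (excess d a1 b1 i j.+1)) (psum A w ^+ i * _) (w ^+ (q - 1)) ((_ * psum A w) ^+ i * _) (alpha _ _ _) => x1 x2 x3 x4 x5 x6 h3.
  transitivity (q%:R * j.+1%:R * x6 * (x1 * (x2 * x3))); [ring|rewrite h3; ring].
- apply: (der_eq (l := w ^- a1.+1 * (w * psum (dcoef B) w - a1%:R * psum B w))); last exact: der_pole.
  rewrite -q2 p2 rhs2E /polsum !mulr_sumr; apply: eq_bigr => i _; rewrite !mulr_sumr; apply: eq_bigr => j _.
  rewrite (r2 i (ltn_ord i) j (ltn_ord j)) coef2E /s2; case: ifP => hS; last by rewrite !(mul0r, mulr0).
  have e : (excess d a1 b1 i.+1 j + b1 * i + a1 * j = (q - 1) + a1.+1)%N by have := exK _ _ hS; nia.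
  have := pole_mono (psum A w) (psum B w) w0 e.
  move: (w ^- a1.+1) (w ^+ (excess d a1 b1 i.+1 j)) (psum A w ^+ i * _) (w ^+ (q - 1)) ((_ * psum A w) ^+ i * _) (alpha _ _ _) => x1 x2 x3 x4 x5 x6 h3.
  transitivity (q%:R * - i.+1%:R * x6 * (x1 * (x2 * x3))); [ring|rewrite h3; ring].
Qed.

Lemma psum_tail (c : nat -> C) (k : nat) : geo c -> geo (fun n => c (n + k)%N) /\ nr 0 (fun w => psum c w = \sum_(i < k) c i * w ^+ i + w ^+ k * psum (fun n => c (n + k)%N) w).
Proof.
move=> gc; elim: k => [|k [g IH]].
  have -> : (fun n => c (n + 0)%N) = c by apply/funext => n; rewrite addn0.
  by split => //; apply: nrW => w; rewrite big_ord0 add0r expr0 mul1r.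
have -> : (fun n => c (n + k.+1)%N) = (fun n => c (n.+1 + k)%N) by apply/funext => n; rewrite addnS.
split; first exact: geoS g.
have /nr0 h := psumS 0 g; apply: nrS2 IH h => w -> ->.
by rewrite big_ord_recr /= add0n exprSr; ring.
Qed.

(* The free parameter kap enters at the resonance n = K, where the recursion is singular. *)
Lemma branches z0 (c1 c2 : C) : c1 != 0 -> c2 != 0 ->
  (forall i j, inS M N i j -> ana z0 (alpha i j)) ->
  (forall t, (forall i j, inS M N i j -> taylor_at (alpha i j) z0 (t i j)) ->
     exists A B, [/\ A 0%N = c1, B 0%N = c2 & formal_solution M N (M * N - 1) t (N.+1, A) (M.+1, B)]) ->
  (forall i j, inS M N i j -> exists u : nat -> C, taylor_at (alpha i j) z0 u) ->
  [/\ c1 = - ((M * N - 1)%:R * alpha 0%N N.+1 z0 * c2 ^+ N), c2 = (M * N - 1)%:R * alpha M.+1 0%N z0 * c1 ^+ M &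
  exists A0 B0 : C -> C, forall kap, exists A B (S T : C -> C), [/\ is_branch z0 A B, A 0%N = c1 /\ B 0%N = c2,
    ana 0 S /\ ana 0 T, S 0 = kap * (N%:R * c1) /\ T 0 = - (kap * (M%:R * c2)) &
    nr 0 (fun w => psum A w = A0 w + w ^+ K * S w /\ psum B w = B0 w + w ^+ K * T w)]].
Proof.
move=> c10 c20 aal hf ht.
have [d0 a0 b0 q0 [M0 N0 Kq]] := level_pos MN2 Md Nd qd.
have /choice[T HT] : forall ij : nat * nat, exists u : nat -> C, inS M N ij.1 ij.2 -> taylor_at (alpha ij.1 ij.2) z0 u.
  move=> [i j] /=; case: (boolP (inS M N i j)) => [/ht[t h]|_]; last by exists (fun=> 0).
  by exists t.
pose t i j := T (i, j).
have tT i j : inS M N i j -> taylor_at (alpha i j) z0 (t i j) by exact: (HT (i, j)).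
have [A [B [A0 B0 fs]]] := hf t tT.
have h1 := formal_brsol MN2 fs.
have A00 : A 0%N != 0 by rewrite A0. have B00 : B 0%N != 0 by rewrite B0.
have h2 := level_reduce A00 B00 h1.
set A' := fun m => A _ in h2; set B' := fun m => B _ in h2.
have A'0 : A' 0%N = c1 by rewrite /A' muln0. have B'0 : B' 0%N = c2 by rewrite /B' muln0.
have tg i j : inS M N i j -> geo (t i j) /\ nr z0 (fun x => alpha i j x = psum (t i j) (x - z0)).
  by move=> /tT /taylor_geo[g [r r0 h]]; split => //; exists r.
have t0 i j : inS M N i j -> t i j 0%N = alpha i j z0.
  by move=> /tg[g /nr_at ->]; rewrite subrr psum0.
have Sa : inS M N M.+1 0 by rewrite /inS !eqxx orbT.
have Sb : inS M N 0 N.+1 by rewrite /inS !eqxx !orbT.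
have [s1_ s2_] := sol_0 MN2 Md Nd qd (h2 0%N).
split.
- by rewrite -{1}A'0 s1_ (t0 _ _ Sb) B'0 qd natrM.
- by rewrite -{1}B'0 s2_ (t0 _ _ Sa) A'0 qd natrM.
(* The part independent of kap: the coefficients of the given solution through level K. The
   perturbation starts at w^K. *)
exists (fun w => \sum_(i < K) A' i * w ^+ i + w ^+ K * (fun=> A' K) w), (fun w => \sum_(i < K) B' i * w ^+ i + w ^+ K * (fun=> B' K) w).
move=> kap.
have A'1 : A' 0%N != 0 by rewrite A'0. have B'1 : B' 0%N != 0 by rewrite B'0.
have [A2 [B2 [e1 e2 e3 e4 [g1 g2]]]] := level_family MN2 Md Nd qd A'1 B'1 h2 (fun i j hS => (tg i j hS).1) kap.
have [gA nA] := psum_tail K g1; have [gB nB] := psum_tail K g2.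
exists A2, B2, (fun w => psum (fun n => A2 (n + K)%N) w - A' K), (fun w => psum (fun n => B2 (n + K)%N) w - B' K).
have ap (c : nat -> C) : geo c -> ana 0 (psum c) by move=> gc; exists c => //; apply: nrW => x; rewrite subr0.
split.
- exact: (level_ode tg).
- by have [] := e1 0%N; [rewrite Kq addn_gt0 b0 orbT|move=> -> ->].
- by split; apply: anaB; rewrite ?ana_cst //; [exact: ap|exact: ana_cst|exact: ap|exact: ana_cst].
- by rewrite !psum0 !add0n e2 e3 A'0 B'0; split; ring.
- apply: nrS2 nA nB => w -> ->; split.
    rewrite (eq_bigr (fun i : 'I_K => A' i * w ^+ i)); first by ring.
    by move=> i _; have [-> _] := e1 i (ltn_ord i).
  rewrite (eq_bigr (fun i : 'I_K => B' i * w ^+ i)); first by ring.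
  by move=> i _; have [_ ->] := e1 i (ltn_ord i).
Qed.
End BranchFunction.

(** * Vanishing of the logarithmic obstruction *)

Section Roots.
Lemma vanishing_on_roots (F : closedFieldType) (d : nat) (c : F) (k : nat -> F) :
  d%:R != 0 :> F -> c != 0 ->
  (forall tau, tau ^+ d = c -> \sum_(l < d) k l * tau ^+ l = 0) -> forall l, (l < d)%N -> k l = 0.
Proof.
move=> dF c0 H; have d0 : (0 < d)%N by case: (d) dF; rewrite ?eqxx.
pose p : {poly F} := 'X^d - c%:P.
have sp : size p = d.+1 by rewrite size_XnsubC.
have mp : p \is monic by rewrite monicXnsubC.
have [r er] := closed_field_poly_normal p.
rewrite (monicP mp) scale1r in er.
have ur : uniq r.
  rewrite -(separable_prod_XsubC r) -er separable_poly.unlock.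
  (* For p = X^d - c one has -c^(-1) p + (c^(-1)/d) X p' = 1, so p has distinct roots. *)
  apply/Bezout_eq1_coprimepP; exists (- c^-1%:P, (c^-1 / d%:R) *: 'X) => /=.
  rewrite /p derivB derivC subr0 derivXn -scaler_nat -scalerAl -[in X in _ + X]scalerAr scalerA divfK // -exprS prednK //.
  by rewrite -mul_polyC mulrBr !mulNr opprK -polyCM mulVf // polyC1 addrAC addNr add0r.
have sr : size r = d.
  by have := size_prod_XsubC r id; rewrite -er sp => -[].
pose P := \poly_(l < d) k l.
have PE tau : P.[tau] = \sum_(l < d) k l * tau ^+ l by rewrite horner_poly.
have P0 : P = 0.
  apply/eqP; apply: contraT => Pn.
  have : (size r < size P)%N.
    apply: max_poly_roots => //; apply/allP => x xr; rewrite /root PE H //.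
    have : root p x by rewrite er root_prod_XsubC.
    by rewrite /root /p !hornerE subr_eq0 => /eqP.
  by rewrite sr ltnNge size_poly.
move=> l ld; have : P`_l = 0 by rewrite P0 coef0.
by rewrite coef_poly ld.
Qed.
End Roots.

Section NoLog.
Variable R : realType.
Local Notation C := (Cx R).
Variables (M N : nat) (alpha : nat -> nat -> C -> C) (U : C -> Prop).
Local Notation az := (M.+1%:Z).
Local Notation bz := (N.+1%:Z).
Local Notation pz := (M.+1%:Z * N.+1%:Z - M.+1%:Z - N.+1%:Z).
Local Notation al := (alpha M.+1 0%N).
Local Notation be := (alpha 0%N N.+1).
Hypothesis hU : forall z, U z -> nr z U.
Hypothesis halpha : forall i j, inS M N i j -> forall z, U z -> ana z (alpha i j).
Hypothesis hal : forall z, U z -> al z != 0.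
Hypothesis hbe : forall z, U z -> be z != 0.
Variables (d a1 b1 q : nat).
Hypotheses (MN2 : (2 <= M * N)%N) (Md : M.+1 = (a1 * d)%N) (Nd : N.+1 = (b1 * d)%N) (qd : (M * N - 1 = d * q)%N).
Hypothesis cop : coprime a1 b1.
Local Notation K := (a1 * b1 * d)%N.
Local Notation lau := (lau M N U).
Local Notation anaU := (anaU U).
Local Notation okp := (okp U).
Local Notation isD := (isD M N alpha U).
Local Notation is_branch := (is_branch M N alpha a1 b1 q).
Local Notation res := (res N a1 b1).
Implicit Types (W P Q : C -> C -> C -> C).

Lemma root_exists (n : nat) (x : C) : (0 < n)%N -> exists c : C, c ^+ n = x.
Proof. by move=> n0; exists (n.-root (x : R[i]))%R; exact: (rootCK n0). Qed.

Lemma pzE : pz = (d * q)%:Z.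
Proof. by rewrite -qd -subzn; lia. Qed.
Lemma pz0 : 0 < pz.
Proof. by rewrite pzE -qd; lia. Qed.

Lemma branch_der z0 A B W W' : U z0 -> is_branch z0 A B -> A 0%N != 0 -> B 0%N != 0 -> isD W W' ->
  nr 0 (fun w => w != 0 -> [/\ okp (z0 + w ^+ q) (w ^- b1 * psum A w) (w ^- a1 * psum B w) &
    der (fun w => W (z0 + w ^+ q) (w ^- b1 * psum A w) (w ^- a1 * psum B w)) w
      (q%:R * w ^+ (q - 1) * W' (z0 + w ^+ q) (w ^- b1 * psum A w) (w ^- a1 * psum B w))]).
Proof.
move=> Uz [gA gB hb] A0 B0 hD; have [d0 a0 b0 q0 _] := level_pos MN2 Md Nd qd.
have cA : ctn (psum A) 0 by apply: ana_ctn; exists A => //; apply: nrW => x; rewrite subr0.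
have cB : ctn (psum B) 0 by apply: ana_ctn; exists B => //; apply: nrW => x; rewrite subr0.
have cz : ctn (fun w : C => z0 + w ^+ q) 0 by apply: ctnD; [exact: ctn_cst|exact: ctnX (ctn_id 0)].
have Un : nr 0 (fun w => U (z0 + w ^+ q)).
  by apply: (ctn_near cz); rewrite expr0n (gtn_eqF q0) addr0; exact: hU.
have nA : nr 0 (fun w => psum A w != 0) by apply: (ctn_neq0 cA); rewrite psum0.
have nB : nr 0 (fun w => psum B w != 0) by apply: (ctn_neq0 cB); rewrite psum0.
apply: nrS2 hb (nrI Un (nrI nA nB)) => w h [Uw [Aw Bw]] w0; have [h1 h2] := h w0.
have ok : okp (z0 + w ^+ q) (w ^- b1 * psum A w) (w ^- a1 * psum B w).
  by split => //; rewrite mulf_neq0 // invr_eq0 expf_neq0.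
split => //; apply: hD => //.
by apply: (der_eq (l := 0 + q%:R * w ^+ (q - 1) * 1)); [rewrite add0r mulr1|apply: derD; [exact: der_cst|exact: derX (der_id w)]].
Qed.

(** On a series solution W has at most a pole in w, whereas the terms of weight MN - 1 contribute a
    constant to w dW/dw, that is, a logarithm in W; [pole_cancellation] makes this constant vanish.
    The same argument shows that W stays finite at the branch point. *)
Lemma branch_W z0 A B W W' P Q (k : nat -> C -> C) : U z0 -> is_branch z0 A B -> A 0%N != 0 -> B 0%N != 0 ->
  isD W W' -> lau (az * bz) W -> lau 0 P -> lau (pz - 1) Q -> (forall l, anaU (k l)) ->
  (forall z y1 y2, okp z y1 y2 -> W' z y1 y2 = P z y1 y2 * W z y1 y2 +
     (\sum_(l < d) k l z * res l%:Z y1 y2 + Q z y1 y2)) ->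
  \sum_(l < d) k l z0 * res l%:Z (A 0%N) (B 0%N) = 0 /\
  exists2 R1, ana 0 R1 & nr 0 (fun w => w != 0 -> W (z0 + w ^+ q) (w ^- b1 * psum A w) (w ^- a1 * psum B w) = R1 w).
Proof.
move=> Uz hb A0 B0 hD lW lP lQ ak E; have [d0 a0 b0 q0 [M0 N0 Kq]] := level_pos MN2 Md Nd qd.
have aA : ana 0 (psum A) by have [gA _ _] := hb; exists A => //; apply: nrW => x; rewrite subr0.
have aB : ana 0 (psum B) by have [_ gB _] := hb; exists B => //; apply: nrW => x; rewrite subr0.
have A00 : psum A 0 != 0 by rewrite psum0. have B00 : psum B 0 != 0 by rewrite psum0.
have [|RW aRW eW] := lau_ref hU Uz (m := K) q0 Md Nd aA aB A00 B00 _ lW; first by rewrite Md Nd; nia.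
have [|RP aRP eP] := lau_ref hU Uz (m := 0) q0 Md Nd aA aB A00 B00 _ lP; first by lia.
have [|RQ aRQ eQ] := lau_ref hU Uz (m := q - 1) q0 Md Nd aA aB A00 B00 _ lQ; first by rewrite pzE; nia.
(* A residual monomial has weight d q, hence a pole of order q in w, which the factor w dz/dw = q
   w^q cancels. *)
pose S w := \sum_(l < d) k l (z0 + w ^+ q) * (psum A w ^ (a1%:Z * l%:Z - 1) * psum B w ^ (N%:Z - b1%:Z * l%:Z)).
pose RB w := q%:R * (S w + w * RQ w).
have aS : ana 0 S.
  apply: ana_sum => l _; apply: anaM; first exact: ana_pow q0 (ak l z0 Uz).
  by apply: anaM; exact: anaXz.
have aRB : ana 0 RB by apply: anaZ; apply: anaD => //; apply: anaM => //; exact: ana_id.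
have resE (w x y : C) (l : nat) : w != 0 -> x != 0 -> y != 0 ->
    w ^+ q * res l%:Z (w ^- b1 * x) (w ^- a1 * y) = x ^ (a1%:Z * l%:Z - 1) * y ^ (N%:Z - b1%:Z * l%:Z).
  move=> w0 x0 y0; rewrite !res_def !exprzMl ?unitfE ?invr_eq0 ?expf_neq0 //.
  have -> : w ^- b1 = w ^ (- b1%:Z) := exprnN w b1.
  have -> : w ^- a1 = w ^ (- a1%:Z) := exprnN w a1.
  rewrite !exprz_exp.
  have e : w ^+ q * w ^ (- b1%:Z * (a1%:Z * l%:Z - 1)) * w ^ (- a1%:Z * (N%:Z - b1%:Z * l%:Z)) = 1.
    rewrite [w ^+ q]exprnP -!expfzDr //.
    have -> : q%:Z + - b1%:Z * (a1%:Z * l%:Z - 1) + - a1%:Z * (N%:Z - b1%:Z * l%:Z) = 0.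
      by move: Kq Nd; nia.
    by rewrite expr0z.
  rewrite -[RHS]mul1r -e; move: (w ^+ q) (w ^ _) (w ^ (- a1%:Z * _)) (x ^ _) (y ^ _) => *; clear; ring.
pose ref (F : C -> C -> C -> C) w := F (z0 + w ^+ q) (w ^- b1 * psum A w) (w ^- a1 * psum B w).
have := @pole_cancellation _ K (ref W) (fun w => q%:R * w ^+ (q - 1) * ref W' w)
   (fun w => q%:R * w ^+ q * ref P w) (fun w => q%:R * w ^+ q * ref (fun z y1 y2 => \sum_(l < d) k l z * res l%:Z y1 y2 + Q z y1 y2) w)
   RW (RB 0) aRW eW.
have h1 := branch_der Uz hb A0 B0 hD.
case.
- apply: nrS h1 => w h w0; have [ok dw] := h w0; split => //.
  have wq : w ^+ q = w * w ^+ (q - 1) by rewrite -exprS subn1 prednK.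
  rewrite /ref E //; move: (\sum_(l < d) _ + _) (P _ _ _) (W _ _ _) => x1 x2 x3; rewrite wq.
  by move: (w ^+ (q - 1)) => x4; clear; ring.
- apply: (@pto_ext _ (fun w => q%:R * w ^+ q * RP w)).
    by apply: nrS eP => w h w0; rewrite /ref h // expr0 invr1 mul1r.
  have := pto_ctn (ana_ctn (anaM (anaZ q%:R (anaX q (ana_id 0))) aRP)).
  by rewrite /= expr0n (gtn_eqF q0) mulr0 mul0r.
- apply: pto_ext (pto_ctn (ana_ctn aRB)).
  have nA : nr 0 (fun w => psum A w != 0) by apply: (ctn_neq0 (ana_ctn aA)).
  have nB : nr 0 (fun w => psum B w != 0) by apply: (ctn_neq0 (ana_ctn aB)).
  apply: nrS2 eQ (nrI nA nB) => w h [Aw Bw] w0; rewrite /RB /ref h // -mulrA; congr (_ * _).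
  rewrite [RHS]mulrDr; congr (_ + _).
    rewrite /S mulr_sumr; apply: eq_bigr => l _; rewrite [RHS]mulrCA; congr (_ * _).
    by rewrite resE.
  have wq : w ^+ q = w * w ^+ (q - 1) by rewrite -exprS subn1 prednK.
  by rewrite wq -[RHS]mulrA mulVKf ?expf_neq0.
move=> R0 [R1 aR1 eR1]; split; last by exists R1.
have qC : q%:R != 0 :> C by rewrite pnatr_eq0 -lt0n.
have S0 : S 0 = 0.
  by apply: (mulfI qC); rewrite mulr0; move: R0; rewrite /RB; move: (S 0) (RQ 0) => x y; rewrite mul0r addr0.
apply: etrans S0; apply: eq_bigr => l _.
by rewrite expr0n (gtn_eqF q0) addr0 !psum0.
Qed.

Definition admissible z0 (c1 c2 : C) := [/\ c1 != 0, c2 != 0,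
  c1 ^+ (M * N - 1) = - (be z0 * al z0 ^+ N * (M * N - 1)%:R ^+ N.+1)^-1 & c2 = (M * N - 1)%:R * al z0 * c1 ^+ M].

(** With X = (MN-1) al(z0), the requirements c2 = X c1^M and c1^a1 = tau c2^b1 amount to c1^q =
    1/(tau X^b1), because M b1 = a1 + q. *)
Lemma admissible_type z0 (tau : C) : U z0 -> tau ^+ d = - be z0 / al z0 ->
  exists c1 c2, admissible z0 c1 c2 /\ c1 ^+ a1 = tau * c2 ^+ b1.
Proof.
move=> Uz ht; have [d0 a0 b0 q0 [M0 N0 Kq]] := level_pos MN2 Md Nd qd.
have A0 := hal Uz; have B0 := hbe Uz.
have p0 : (M * N - 1)%:R != 0 :> C by rewrite pnatr_eq0 qd muln_eq0 negb_or -!lt0n d0.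
have t0 : tau != 0.
  have : tau ^+ d != 0 by rewrite ht mulf_neq0 ?invr_eq0 ?oppr_eq0.
  by apply: contraNneq => ->; rewrite expr0n (gtn_eqF d0).
pose X : C := (M * N - 1)%:R * al z0; have X0 : X != 0 by rewrite mulf_neq0.
have [c1 hc] := root_exists (X ^- b1 / tau) q0.
have c0 : c1 != 0.
  have : c1 ^+ q != 0 by rewrite hc mulf_neq0 ?invr_eq0 ?expf_neq0.
  by apply: contraNneq => ->; rewrite expr0n (gtn_eqF q0).
exists c1, (X * c1 ^+ M); split; first split => //.
- by rewrite mulf_neq0 // expf_neq0.
- rewrite {1}qd mulnC exprM hc exprMn !exprVn -exprM -Nd ht /X exprMn.
  rewrite [al z0 ^+ N.+1]exprS; have := expf_neq0 N A0; have := expf_neq0 N.+1 p0.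
  move: (_ ^+ N.+1) (al z0 ^+ N) (al z0) (be z0) A0 B0 => Y A1 A B A' B' Y' A1'; field.
  by rewrite A' B' Y' A1'.
- rewrite exprMn -exprM.
  have e : (M * b1 = a1 + q)%N by move: Md Kq; nia.
  rewrite e exprD hc; have := expf_neq0 b1 X0; move: (X ^+ b1) (c1 ^+ a1) => Y D Y0; field.
  by rewrite Y0 t0.
Qed.

Hypothesis hbranch : forall z0 c1 c2, U z0 -> admissible z0 c1 c2 ->
  exists A B, [/\ is_branch z0 A B, A 0%N = c1 & B 0%N = c2].

(** The obstruction at z, evaluated on the series solutions there, is a polynomial in tau of degree
    below d with coefficients k_l(z). It vanishes at all d roots of tau^d = -be/al, hence
    identically, and this at every z in U. *)
Lemma reduced_log : reduced M N alpha U pz -> reduced M N alpha U (pz - 1).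
Proof.
have [d0 a0 b0 q0 [M0 N0 Kq]] := level_pos MN2 Md Nd qd.
have hab : az + bz <= az * bz - 1 by have := pz0; lia.
move=> [G [P [Q [GD [lG lP lQ dG e]]]]].
have [k [P1 [Q1 [ak lP1 lQ1 eQ]]]] := normal_form halpha hal hbe d0 Md Nd cop lQ.
pose W z y1 y2 := Hm M N alpha z y1 y2 + G z y1 y2.
pose W' z y1 y2 := Hz M N alpha z y1 y2 + GD z y1 y2.
pose Q2 z y1 y2 := Q1 z y1 y2 - P1 z y1 y2 * ((Hm M N alpha z y1 y2 - En M N alpha z y1 y2) + G z y1 y2).
have lHG : lau (az * bz - 1) (fun z y1 y2 => (Hm M N alpha z y1 y2 - En M N alpha z y1 y2) + G z y1 y2).
  by apply: lau_add; [exact: lau_Hlow|exact: lau_le hab lG].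
have lQ2 : lau (pz - 1) Q2.
  by apply: lau_sub => //; apply: lau_mulm lP1 lHG; lia.
have lW : lau (az * bz) W.
  apply: lau_ext (lau_add (lau_En halpha) (lau_le _ lHG)); last by lia.
  by move=> z y1 y2 _; rewrite /W; ring.
have lPP : lau 0 (fun z y1 y2 => P z y1 y2 + P1 z y1 y2).
  by apply: lau_add => //; apply: lau_le lP1; lia.
have dW : isD W W' by apply: isD_add dG; exact: isD_Hm.
have eW z y1 y2 : okp z y1 y2 -> W' z y1 y2 = (P z y1 y2 + P1 z y1 y2) * W z y1 y2 +
    (\sum_(l < d) k l z * res l%:Z y1 y2 + Q2 z y1 y2).
  move=> ok; rewrite /W' e // eQ // /Q2 /W; move: (\sum_(l < d) _) => S; ring.
have k0 z : U z -> forall l, (l < d)%N -> k l z = 0.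
  move=> Uz; apply: (@vanishing_on_roots R[i] d (- be z / al z)).
  - by rewrite pnatr_eq0 -lt0n.
  - by rewrite mulf_neq0 ?invr_eq0 ?oppr_eq0 ?hal ?hbe.
  move=> tau ht; have [c1 [c2 [ad ct]]] := admissible_type Uz ht.
  have [A [B [hb A0 B0]]] := hbranch Uz ad; have [c10 c20 _ _] := ad.
  rewrite -A0 in c10 ct; rewrite -B0 in c20 ct.
  have [e0 _] := branch_W Uz hb c10 c20 dW lW lPP lQ2 ak eW.
  (* The factor common to the residual monomials on the leading coefficients: [res l] is this factor
     times tau^l. *)
  have X0 : (A 0%N)^-1 * B 0%N ^+ N != 0 by rewrite mulf_neq0 ?invr_eq0 ?expf_neq0.
  apply: (mulfI X0); rewrite mulr0 -[RHS]e0 mulr_sumr; apply: eq_bigr => l _; rewrite mulrCA; congr (_ * _).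
  rewrite !res_def; have -> : tau = A 0%N ^+ a1 * B 0%N ^- b1 by rewrite ct mulfK ?expf_neq0.
  rewrite !expfzDr // -!exprnN !exprM -!exprnP !exprMn expr1 exprVn.
  rewrite ![in RHS]exprM.
  move: (_^-1) (_ ^+ N) (_ ^+ l) (_ ^- l) => *; clear; ring.
exists G, (fun z y1 y2 => P z y1 y2 + P1 z y1 y2), Q2, GD; split => // z y1 y2 ok.
rewrite -/(W' z y1 y2) eW // big1 ?add0r // => l _; have [Uz _ _] := ok.
by rewrite k0 // mul0r.
Qed.

(** Descent by one from the full weight; [reduced_step] performs it everywhere except at MN - 1. *)
Lemma reduced_zero : reduced M N alpha U 0.
Proof.
have h (n m : nat) : reduced M N alpha U m%:Z -> m%:Z <= az * bz -> (n <= m)%N -> reduced M N alpha U n%:Z.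
  elim: m => [|m IH] hm hle; first by rewrite leqn0 => /eqP ->.
  rewrite leq_eqVlt => /orP[/eqP -> //|]; rewrite ltnS; apply: IH; last by lia.
  have -> : m%:Z = m.+1%:Z - 1 by lia.
  have [e|ne] := eqVneq (m.+1%:Z) pz; first by rewrite e; apply: reduced_log; rewrite -e.
  by apply: reduced_step => //; exact: pz0.
have := h 0%N (M.+1 * N.+1)%N; rewrite PoszM; apply => //; exact: reduced_top.
Qed.
End NoLog.

(** * Boundedness of the modified Hamiltonian *)

Section Estimates.
Variable R : realType.
Local Notation C := (Cx R).
Variables (M N : nat) (alpha : nat -> nat -> C -> C) (U : C -> Prop) (z1 : C).
Local Notation az := (M.+1%:Z).
Local Notation bz := (N.+1%:Z).
Local Notation al := (alpha M.+1 0%N).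
Local Notation be := (alpha 0%N N.+1).
Local Notation Hm := (Hm M N alpha).
Local Notation En := (En M N alpha).
Local Notation Hz := (Hz M N alpha).
Hypothesis halpha : forall i j, inS M N i j -> ana z1 (alpha i j).
Hypothesis hal : al z1 != 0.
Hypothesis hbe : be z1 != 0.
Implicit Types (F G : C -> C -> C -> C) (lam : R).

Lemma real_root (n : nat) (x : R) : (0 < n)%N -> 0 <= x -> exists2 l : R, 0 <= l & l ^+ n = x.
Proof.
move=> n0 x0; exists (x `^ (n%:R^-1)); first exact: powR_ge0.
rewrite -powR_mulrn ?powR_ge0 // -powRrM mulVf ?powRr1 //.
by rewrite pnatr_eq0 -lt0n.
Qed.

(** A weighted size that makes sense also where one component is small or zero, in contrast to
    [reg]. *)
Definition scale lam (y1 y2 : C) := 0 <= lam /\ lam ^+ (M.+1 * N.+1) = Num.max (nm y1 ^+ M.+1) (nm y2 ^+ N.+1).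

Lemma scale_exists y1 y2 : exists lam, scale lam y1 y2.
Proof.
have [|l l0 lE] := @real_root (M.+1 * N.+1) (Num.max (nm y1 ^+ M.+1) (nm y2 ^+ N.+1)) isT.
  by rewrite le_max exprn_ge0 ?nm_ge0.
by exists l.
Qed.
Lemma scale_le lam y1 y2 : scale lam y1 y2 -> nm y1 <= lam ^+ N.+1 /\ nm y2 <= lam ^+ M.+1.
Proof.
move=> [l0 lE]; split.
  rewrite -(@ler_pXn2r _ M.+1) ?nnegrE ?nm_ge0 ?exprn_ge0 // -exprM mulnC lE.
  by rewrite le_max lexx.
rewrite -(@ler_pXn2r _ N.+1) ?nnegrE ?nm_ge0 ?exprn_ge0 // -exprM lE.
by rewrite le_max lexx orbT.
Qed.

(** The counterpart of [lau_bound] for true polynomials: nonnegative exponents need only upper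
    bounds, so zeros of y1 or y2 are allowed. *)
Definition polb (n : nat) F := exists K rho : R, [/\ 0 <= K, 0 < rho & forall z lam y1 y2,
  nm (z - z1) < rho -> 1 <= lam -> nm y1 <= lam ^+ N.+1 -> nm y2 <= lam ^+ M.+1 ->
  nm (F z y1 y2) <= K * lam ^+ n].

Lemma polb_add n F G : polb n F -> polb n G -> polb n (fun z y1 y2 => F z y1 y2 + G z y1 y2).
Proof.
move=> [K [r [K0 r0 h]]] [K' [r' [K0' r0' h']]]; exists (K + K'), (Num.min r r'); split.
- exact: addr_ge0.
- by rewrite lt_min r0.
- move=> z lam y1 y2; rewrite lt_min => /andP[z_ z_'] l1 n1 n2.
  by apply: le_trans (nmD _ _) _; rewrite mulrDl; apply: lerD; [apply: h|apply: h'].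
Qed.
Lemma polb_mono n (f : C -> C) (i j : nat) : ana z1 f -> (i * N.+1 + j * M.+1 <= n)%N ->
  polb n (fun z y1 y2 => f z * (y1 ^+ i * y2 ^+ j)).
Proof.
move=> af hn.
have [rho r0 H] := ctn_nm_lt (ana_ctn af) (ltr_pwDr ltr01 (lexx (nm (f z1)))).
exists (nm (f z1) + 1), rho; split => //; first by rewrite addr_ge0 ?nm_ge0.
move=> z lam y1 y2 hz l1 n1 n2; rewrite !nmM !nmX.
apply: ler_pM; rewrite ?mulr_ge0 ?exprn_ge0 ?nm_ge0 //; first exact/ltW/H.
have l0 : 0 <= lam by lra.
apply: (@le_trans _ _ (lam ^+ (N.+1 * i) * lam ^+ (M.+1 * j))).
  by rewrite !exprM; apply: ler_pM; rewrite ?exprn_ge0 ?nm_ge0 //; apply: lerXn2r; rewrite ?nnegrE ?nm_ge0 ?exprn_ge0.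
by rewrite -exprD; apply: ler_weXn2l => //; move: hn; rewrite mulnC [(j * _)%N]mulnC.
Qed.
Lemma polb_zero n : polb n (fun _ _ _ => 0).
Proof.
exists 0, 1; split => // z lam y1 y2 _ l1 _ _.
by rewrite nm0 mul0r.
Qed.
Lemma polb_ext n F G : (forall z y1 y2, F z y1 y2 = G z y1 y2) -> polb n F -> polb n G.
Proof. by move=> e [K [r [K0 r0 h]]]; exists K, r; split => // *; rewrite -e; exact: h. Qed.
Lemma polb_sum n (k : nat) (P : pred nat) (F : nat -> C -> C -> C -> C) :
  (forall x, (x < k)%N -> P x -> polb n (F x)) -> polb n (fun z y1 y2 => \sum_(x < k | P x) F x z y1 y2).
Proof.
elim: k => [|k IH] H.
  by apply: polb_ext (polb_zero n) => *; rewrite big_ord0.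
have h1 := IH (fun x xK => H x (ltnW xK)).
case PK: (P k).
  apply: polb_ext (polb_add h1 (H k (ltnSn k) PK)) => z y1 y2.
  by rewrite [RHS]big_mkcond big_ord_recr /= PK -big_mkcond.
apply: polb_ext h1 => z y1 y2.
by rewrite [RHS]big_mkcond big_ord_recr /= PK addr0 -big_mkcond.
Qed.
Lemma polb_Hlow : polb (M.+1 * N.+1 - 1) (fun z y1 y2 => Hm z y1 y2 - En z y1 y2).
Proof.
apply: (@polb_ext _ (fun z y1 y2 => \sum_(i < M.+2) \sum_(j < N.+2 | inI M N i j) alpha i j z * (y1 ^+ i * y2 ^+ j))).
  by move=> z y1 y2; rewrite Hm_def addrAC subrr add0r.
apply: (@polb_sum _ M.+2 xpredT (fun (i : nat) z y1 y2 => \sum_(j < N.+2 | inI M N i j) alpha i j z * (y1 ^+ i * y2 ^+ j))) => i _ _.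
apply: (@polb_sum _ N.+2 (fun j : nat => inI M N i j) (fun (j : nat) z y1 y2 => alpha i j z * (y1 ^+ i * y2 ^+ j))) => j _ ij.
apply: polb_mono; first by apply: halpha; rewrite /inS ij.
by move: ij; rewrite /inI; lia.
Qed.
Lemma polb_Hz : polb (M.+1 * N.+1) Hz.
Proof.
have ad i j : inS M N i j -> ana z1 (dv (alpha i j)) by move=> /halpha /ana_dv[].
apply: polb_add; last first.
  apply: (@polb_sum _ M.+2 xpredT (fun (i : nat) z y1 y2 => \sum_(j < N.+2 | inI M N i j) dv (alpha i j) z * (y1 ^+ i * y2 ^+ j))) => i _ _.
  apply: (@polb_sum _ N.+2 (fun j : nat => inI M N i j) (fun (j : nat) z y1 y2 => dv (alpha i j) z * (y1 ^+ i * y2 ^+ j))) => j _ ij.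
  apply: polb_mono; first by apply: ad; rewrite /inS ij.
  by move: ij; rewrite /inI; lia.
apply: (@polb_ext _ (fun z y1 y2 => dv al z * (y1 ^+ M.+1 * y2 ^+ 0) + dv be z * (y1 ^+ 0 * y2 ^+ N.+1))).
  by move=> z y1 y2; rewrite !expr0 mulr1 mul1r.
by apply: polb_add; apply: polb_mono; [exact/ad/inS_a|lia|exact/ad/inS_b|lia].
Qed.

(** Here u, v, e stand for |y1|^(M+1), |y2|^(N+1), |En|. If e is small against u the two top terms
    nearly cancel and are comparable; otherwise both are bounded by a multiple of e. *)
Lemma comparable_arith (m Mx u v e : R) (A B : R) : 0 < m -> m <= A <= Mx -> m <= B <= Mx -> 0 <= u -> 0 <= v ->
  B * v <= e + A * u -> A * u <= e + B * v -> 0 <= e ->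
  (e <= m / 2 * u -> u <= 2 * Mx / m * v /\ v <= 2 * Mx / m * u) /\
  (m / 4 * u <= e -> u <= 4 / m * e /\ v <= (1 + 4 * Mx / m) / m * e).
Proof.
move=> m0 /andP[A1 A2] /andP[B1 B2] u0 v0 h1 h2 e0.
have mv : m * v <= B * v by rewrite ler_wpM2r.
have mu : m * u <= A * u by rewrite ler_wpM2r.
have Mv : B * v <= Mx * v by rewrite ler_wpM2r.
have Mu : A * u <= Mx * u by rewrite ler_wpM2r.
have mMu : m * u <= Mx * u by lra.
split=> h.
  split; rewrite mulrAC ler_pdivlMr //; lra.
have ue : u <= 4 / m * e by rewrite mulrAC ler_pdivlMr //; lra.
split => //.
rewrite mulrAC ler_pdivlMr //.
have Mx0 : 0 <= Mx by lra.
have : Mx * u <= Mx * (4 / m * e) by rewrite ler_wpM2l.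
have -> : (1 + 4 * Mx / m) * e = e + Mx * (4 / m * e) by field; rewrite gt_eqF.
lra.
Qed.

(** The two regions overlap between the ratios eps and 2 eps of |En| to |y1|^(M+1), which leaves
    room for a cutoff. Without cancellation [En] is the main part of H, since H - [En] loses a
    factor lam; L is the scale from which this loss is absorbed. *)
Lemma region_estimates : exists eps c rho L K : R, [/\ 0 < eps, 1 <= c, 0 < rho, 1 <= L & 0 < K /\
  forall z lam y1 y2, nm (z - z1) < rho -> scale lam y1 y2 -> L <= lam ->
   [/\ nm (En z y1 y2) <= 2 * eps * nm y1 ^+ M.+1 -> reg M N c lam y1 y2,
     eps * nm y1 ^+ M.+1 <= nm (En z y1 y2) -> lam ^+ (M.+1 * N.+1) <= K * nm (Hm z y1 y2) &
     nm (Hz z y1 y2) <= K * lam ^+ (M.+1 * N.+1)]].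
Proof.
pose m := Num.min (nm (al z1)) (nm (be z1)) / 2; pose Mx := nm (al z1) + nm (be z1) + 1.
have A0 : 0 < nm (al z1) by rewrite nm_gt0. have B0 : 0 < nm (be z1) by rewrite nm_gt0.
have m0 : 0 < m by rewrite divr_gt0 // lt_min A0.
have q1 : Num.min (nm (al z1)) (nm (be z1)) <= nm (al z1) by rewrite ge_min lexx.
have q2 : Num.min (nm (al z1)) (nm (be z1)) <= nm (be z1) by rewrite ge_min lexx orbT.
have m1 : m < nm (al z1) by rewrite /m; lra.
have m2 : m < nm (be z1) by rewrite /m; lra.
have M1 : nm (al z1) < Mx by rewrite /Mx; lra.
have M2 : nm (be z1) < Mx by rewrite /Mx; lra.
have ca := ana_ctn (halpha (inS_a M N)); have cb := ana_ctn (halpha (inS_b M N)).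
have [r1 r10 H1] := nrI (nrI (ctn_nm_gt ca m1) (ctn_nm_lt ca M1)) (nrI (ctn_nm_gt cb m2) (ctn_nm_lt cb M2)).
have [K1 [r2 [K10 r20 H2]]] := polb_Hlow.
have [K2 [r3 [K20 r30 H3]]] := polb_Hz.
pose c := 2 * Mx / m.
have c1 : 1 <= c by rewrite /c ler_pdivlMr //; lra.
pose D := Num.max (4 / m) ((1 + 4 * Mx / m) / m).
have D0 : 0 < D by rewrite lt_max divr_gt0.
exists (m / 4), c, (Num.min r1 (Num.min r2 r3)), (1 + 2 * D * K1), (2 * D + K2); split.
- by rewrite divr_gt0.
- exact: c1.
- by rewrite !lt_min r10 r20.
- by rewrite lerDl !mulr_ge0 // ltW.
split; first by rewrite ltr_wpDr // mulr_gt0.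
move=> z lam y1 y2; rewrite !lt_min => /andP[z_1 /andP[z_2 z_3]] sc Ll.
have l1 : 1 <= lam by apply: le_trans Ll; rewrite lerDl !mulr_ge0 // ltW.
have l0 : 0 < lam by lra.
have [n1 n2] := scale_le sc.
have [[a1 a2] [b1 b2]] := H1 z z_1.
set u := nm y1 ^+ M.+1; set v := nm y2 ^+ N.+1; set e := nm (En z y1 y2).
have u0 : 0 <= u by rewrite exprn_ge0 ?nm_ge0.
have v0 : 0 <= v by rewrite exprn_ge0 ?nm_ge0.
have aE : nm (al z) * u = nm (al z * y1 ^+ M.+1) by rewrite nmM nmX.
have bE : nm (be z) * v = nm (be z * y2 ^+ N.+1) by rewrite nmM nmX.
have [|||||ha hb] := @comparable_arith m Mx u v e (nm (al z)) (nm (be z)) m0 _ _ u0 v0.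
- by rewrite !ltW.
- by rewrite !ltW.
- rewrite aE bE /e En_def; have := nmB (al z * y1 ^+ M.+1 + be z * y2 ^+ N.+1) (al z * y1 ^+ M.+1).
  by rewrite addrAC subrr add0r.
- rewrite aE bE /e En_def; have := nmB (al z * y1 ^+ M.+1 + be z * y2 ^+ N.+1) (be z * y2 ^+ N.+1).
  by rewrite addrK.
- exact: nm_ge0.
have lE : lam ^+ (M.+1 * N.+1) = Num.max u v by have [] := sc.
split.
- have -> : 2 * (m / 4) = m / 2 by field.
  move=> /ha[uv vu]; rewrite -/c in uv vu.
  have c0 : 0 < c by exact: lt_le_trans ltr01 c1.
  have ci0 : 0 <= c^-1 by rewrite invr_ge0 ltW.
  have ci1 : c^-1 <= 1 by rewrite invf_le1.
  have cle (n : nat) : c^-1 ^+ n.+1 <= c^-1 by rewrite exprS; apply: ler_piMr => //; exact: exprn_ile1.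
  have pz (n : nat) : 0 <= c^-1 * lam ^+ n by rewrite mulr_ge0 // exprn_ge0 // ltW.
  have lu : lam ^+ (M.+1 * N.+1) <= c * u by rewrite lE ge_max vu andbT ler_peMl.
  have lv : lam ^+ (M.+1 * N.+1) <= c * v by rewrite lE ge_max uv ler_peMl.
  split => //; apply/andP; split.
  + rewrite -(@ler_pXn2r _ M.+1) ?nnegrE ?nm_ge0 ?pz // exprMn -exprM -/u [(N.+1 * _)%N]mulnC.
    apply: (@le_trans _ _ (c^-1 * lam ^+ (M.+1 * N.+1))); first by rewrite ler_wpM2r ?exprn_ge0 // ltW.
    by rewrite mulrC ler_pdivrMr // mulrC.
  + by apply: le_trans n1 _; rewrite ler_peMl ?exprn_ge0 // ltW.
  + rewrite -(@ler_pXn2r _ N.+1) ?nnegrE ?nm_ge0 ?pz // exprMn -exprM -/v.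
    apply: (@le_trans _ _ (c^-1 * lam ^+ (M.+1 * N.+1))); first by rewrite ler_wpM2r ?exprn_ge0 // ltW.
    by rewrite mulrC ler_pdivrMr // mulrC.
  + by apply: le_trans n2 _; rewrite ler_peMl ?exprn_ge0 // ltW.
- move=> /hb[ue ve].
  have e0 : 0 <= e by exact: nm_ge0.
  have le_ : lam ^+ (M.+1 * N.+1) <= D * e.
    rewrite lE ge_max; apply/andP; split; [apply: le_trans ue _|apply: le_trans ve _];
      by rewrite ler_wpM2r // le_max lexx ?orbT.
  have hl := H2 z lam y1 y2 z_2 l1 n1 n2.
  have eH : e <= nm (Hm z y1 y2) + nm (Hm z y1 y2 - En z y1 y2) by rewrite nmBC addrC /e; have := nmD3 (En z y1 y2) (Hm z y1 y2) 0; rewrite !subr0; lra.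
  set X := lam ^+ _ in le_ hl *; set h := nm (Hm z y1 y2) in eH *; set Y := lam ^+ (_ - _) in hl.
  have XY : X = lam * Y by rewrite /X /Y -exprS subn1.
  have Y0 : 0 <= Y by rewrite exprn_ge0 // ltW.
  have h0 : 0 <= h by exact: nm_ge0.
  have t1 : D * e <= D * (h + K1 * Y) by apply: ler_wpM2l; [exact: ltW|]; apply: le_trans eH _; rewrite lerD2l.
  have t2 : (1 + 2 * D * K1) * Y <= lam * Y by rewrite ler_wpM2r.
  have t3 : 0 <= K2 * h by rewrite mulr_ge0.
  rewrite mulrDl; move: t1 t2 t3 le_; rewrite XY; move: (D * e) => De.
  have -> : (1 + 2 * D * K1) * Y = Y + 2 * (D * (K1 * Y)) by ring.
  have -> : D * (h + K1 * Y) = D * h + D * (K1 * Y) by ring.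
  rewrite -!mulrA; move: (D * h) (D * (K1 * Y)) (lam * Y) (K2 * h) => p1 p2 p3 p4; clear -Y0; lra.
- apply: le_trans (H3 z lam y1 y2 z_3 l1 n1 n2) _.
  by rewrite ler_wpM2r ?exprn_ge0 ?(ltW l0) // lerDr mulr_ge0 // ltW.
Qed.
End Estimates.

(** * The cutoff function *)

Section Cutoff.
Variable R : realType.
Variable eps : R.
Hypothesis eps0 : 0 < eps.

(** Piecewise linear in the ratio e/u, falling from 1 to 0 between eps and 2 eps. The first test
    avoids division: at u = 0, that is at a zero of y1, the value is 0 for e >= 0. *)
Definition chi (e u : R) : R := if 2 * eps * u <= e then 0 else Num.min 1 (2 - e / (eps * u)).

Lemma chi_zero e u : 2 * eps * u <= e -> chi e u = 0.
Proof. by rewrite /chi => ->. Qed.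
Lemma chi_one e u : 0 < u -> e <= eps * u -> chi e u = 1.
Proof.
move=> u0 eu; have eu0 : 0 < eps * u by rewrite mulr_gt0.
rewrite /chi ifF; last by apply/negbTE; rewrite -ltNge; lra.
have : e / (eps * u) <= 1 by rewrite ler_pdivrMr // mul1r.
by move=> h; apply/min_idPl; lra.
Qed.
Lemma chi_clamp e u : 0 < u -> chi e u = Num.max 0 (Num.min 1 (2 - e / u / eps)).
Proof.
move=> u0; have eu0 : 0 < eps * u by rewrite mulr_gt0.
have -> : e / u / eps = e / (eps * u) by field; rewrite !gt_eqF.
rewrite /chi; case: ifPn => h.
  have h2 : 2 <= e / (eps * u) by rewrite ler_pdivlMr // mulrA.
  by apply/esym/max_idPl; rewrite ge_min; apply/orP; right; lra.
have h2 : e / (eps * u) < 2 by rewrite ltr_pdivrMr // mulrA ltNge.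
by apply/esym/max_idPr; rewrite le_min ler01 /=; lra.
Qed.
Lemma chi01 e u : 0 <= u -> 0 <= chi e u <= 1.
Proof.
rewrite le_eqVlt => /orP[/eqP <-|u0]; last first.
  by rewrite chi_clamp // le_max lexx /= ge_max ler01 ge_min lexx.
rewrite /chi !mulr0 invr0 mulr0 subr0; case: ifP => _; first by rewrite lexx ler01.
have -> : Num.min 1 2 = 1 :> R by apply/min_idPl; lra.
by rewrite ler01 lexx.
Qed.
Lemma chi_lip e u e' u' : 0 < u -> 0 < u' -> `|chi e u - chi e' u'| <= eps^-1 * `|e / u - e' / u'|.
Proof.
move=> u0 u0'; rewrite !chi_clamp //.
move: (e / u) (e' / u') => x y.
have step (p q : R) : `|Num.max 0 (Num.min 1 p) - Num.max 0 (Num.min 1 q)| <= `|p - q|.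
  wlog pq : p q / p <= q.
    move=> H; case/orP: (le_total p q) => /H //; by rewrite (distrC q) (distrC (Num.max 0 (Num.min 1 q))).
  rewrite (distrC p) (distrC (Num.max 0 (Num.min 1 p))) [X in _ <= X]ger0_norm ?subr_ge0 //.
  have mono : Num.max 0 (Num.min 1 p) <= Num.max 0 (Num.min 1 q).
    by rewrite ge_max !le_max lexx /= le_min !ge_min lexx pq /= !orbT.
  rewrite ger0_norm ?subr_ge0 //.
  rewrite lerBlDr ge_max; apply/andP; split.
    by rewrite addr_ge0 ?subr_ge0 // le_max lexx.
  case/orP: (le_total 1 p) => p1.
    have -> : Num.min 1 p = 1 by apply/min_idPl.
    have h1 : 1 <= Num.max 0 1 :> R by rewrite le_max lexx orbT.
    have h2 : Num.min 1 q <= 1 by rewrite ge_min lexx.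
    lra.
  have -> : Num.min 1 p = p by apply/min_idPr.
  have h1 : p <= Num.max 0 p by rewrite le_max lexx orbT.
  have h2 : Num.min 1 q <= q by rewrite ge_min lexx orbT.
  lra.
apply: le_trans (step _ _) _.
have -> : 2 - x / eps - (2 - y / eps) = eps^-1 * (y - x) by field; rewrite gt_eqF.
by rewrite normrM (gtr0_norm (_ : 0 < eps^-1)) ?invr_gt0 // distrC.
Qed.
Lemma le_sum3 (x y z : R) : 0 <= x -> 0 <= y -> 0 <= z ->
  x <= x + y + z /\ y <= x + y + z /\ z <= x + y + z.
Proof. by move=> h1 h2 h3; split; [|split]; lra. Qed.
Lemma div_mid (x k m y : R) : 0 < k -> x < m / k -> m < y -> k * x <= y.
Proof. by move=> k0; rewrite ltr_pdivlMr // mulrC => h1 h2; apply: ltW; exact: lt_trans h2. Qed.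
Lemma half_arith (K h k Z X : R) : 0 <= K -> h - k <= Z -> X <= K * h -> 2 * K * k <= X -> 0 <= Z ->
  X <= 2 * K * Z.
Proof.
move=> K0 lower hX hG Z0; have : K * (h - k) <= K * Z by rewrite ler_wpM2l.
by move: hG hX; rewrite mulrBr -!mulrA; move: (K * h) (K * k) (K * Z) => p1 p2 p3; lra.
Qed.
Lemma cutoff_nm (H H' G G' : Cx R) (c c' h k s D e : R) : 0 <= c <= 1 ->
  nm (H - H') <= h * D -> nm (G - G') <= k * D -> `|c - c'| <= e * (s * D) ->
  nm (H + rc c * G - (H' + rc c' * G')) <= (h + k + e * s * nm G') * D.
Proof.
move=> /andP[c0 c1] hH hG hc.
have -> : H + rc c * G - (H' + rc c' * G') = (H - H') + (rc c * (G - G') + rc (c - c') * G').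
  by rewrite /rc rmorphB /=; ring.
apply: le_trans (nmD _ _) _; rewrite !mulrDl -addrA; apply: lerD => //.
apply: le_trans (nmD _ _) _; rewrite !(nmM (rc _)) !nm_rc; apply: lerD.
  by apply: le_trans hG; rewrite ger0_norm // ler_piMl ?nm_ge0.
have -> : e * s * nm G' * D = e * (s * D) * nm G' by ring.
by apply: ler_wpM2r; rewrite ?nm_ge0.
Qed.
Lemma cutoff_lower (H G : Cx R) (c : R) : 0 <= c <= 1 -> nm H - nm G <= nm (H + rc c * G).
Proof.
move=> /andP[c0 c1]; have := nmB (H + rc c * G) (rc c * G); rewrite addrK (nmM (rc c)) nm_rc ger0_norm //.
have : c * nm G <= nm G by rewrite ler_piMl ?nm_ge0.
lra.
Qed.
End Cutoff.

(** * Gronwall estimate for the cut-off Hamiltonian *)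

Section PathBound.
Variable R : realType.
Local Notation C := (Cx R).
Variables (M N : nat) (alpha : nat -> nat -> C -> C) (U : C -> Prop).
Local Notation az := (M.+1%:Z).
Local Notation bz := (N.+1%:Z).
Local Notation pz := (M.+1%:Z * N.+1%:Z - M.+1%:Z - N.+1%:Z).
Local Notation al := (alpha M.+1 0%N).
Local Notation be := (alpha 0%N N.+1).
Local Notation Hm := (Hm M N alpha).
Local Notation En := (En M N alpha).
Local Notation Hz := (Hz M N alpha).
Local Notation lau := (lau M N U).
Local Notation isD := (isD M N alpha U).
Local Notation okp := (okp U).
Local Notation rh1 := (rhs1 M N alpha).
Local Notation rh2 := (rhs2 M N alpha).
Local Notation ab := (M.+1 * N.+1)%N.
Hypothesis MN2 : (2 <= M * N)%N.
Hypothesis hU : forall z, U z -> nr z U.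
Hypothesis halpha : forall i j, inS M N i j -> forall z, U z -> ana z (alpha i j).
Hypothesis hal : forall z, U z -> al z != 0.
Hypothesis hbe : forall z, U z -> be z != 0.
Variables (G P Q GD : C -> C -> C -> C).
Hypotheses (lG : lau (az + bz) G) (lP : lau 0 P) (lQ : lau 0 Q) (dG : isD G GD).
Hypothesis hW : forall z y1 y2, okp z y1 y2 ->
  Hz z y1 y2 + GD z y1 y2 = P z y1 y2 * (Hm z y1 y2 + G z y1 y2) + Q z y1 y2.
Variables (g : R -> C) (V : R -> R) (y1 y2 : R -> C) (f1 f2 : R -> C -> C).
Hypothesis hV : tame_path 0 1 g V.
Hypothesis Ug : U (g 1).
Hypothesis hgerm : forall t, 0 <= t < 1 -> [/\ y1 t = f1 t (g t), y2 t = f2 t (g t),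
  der (f1 t) (g t) (rh1 (g t) (y1 t) (y2 t)) & der (f2 t) (g t) (rh2 (g t) (y1 t) (y2 t))].
Hypothesis halong : forall a b t, 0 <= a -> b < 1 -> a <= t <= b ->
  pnr a b t (fun s => y1 s = f1 t (g s) /\ y2 s = f2 t (g s)).
Hypothesis hblow : forall B : R, exists2 T : R, 0 <= T < 1 & forall t, T < t -> t < 1 ->
  B < nm (y1 t) \/ B < nm (y2 t).
Local Notation z1 := (g 1).

Definition ends (Pr : R -> Prop) := exists2 T : R, 0 <= T < 1 & forall t, T < t -> t < 1 -> Pr t.

Lemma endsI (P1 P2 : R -> Prop) : ends P1 -> ends P2 -> ends (fun t => P1 t /\ P2 t).
Proof.
move=> [T /andP[T0 T1] h] [T' /andP[T0' T1'] h']; exists (Num.max T T').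
  by rewrite le_max T0 gt_max T1.
by move=> t; rewrite gt_max => /andP[t1 t2] tt; split; [exact: h|exact: h'].
Qed.
Lemma endsS (P1 P2 : R -> Prop) : (forall t, 0 <= t < 1 -> P1 t -> P2 t) -> ends P1 -> ends P2.
Proof.
move=> H [T /andP[T0 T1] h]; exists T; first by rewrite T0.
move=> t Tt t1; apply: H; last exact: h.
by rewrite t1 andbT; lra.
Qed.
Lemma ends_near (rho : R) : 0 < rho -> ends (fun t => nm (g t - z1) < rho).
Proof.
move=> r0; have [T T01 H] := path_to_end hV r0; exists T => // t Tt t1.
by apply: H; rewrite !ltW.
Qed.
Lemma ends_scale (L : R) : ends (fun t => forall lam, scale M N lam (y1 t) (y2 t) -> L <= lam).
Proof.
pose B := Num.max 1 L ^+ ab.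
have [T T01 H] := hblow B; exists T => // t Tt t1 lam sc.
have [l0 _] := sc; have [n1 n2] := scale_le sc.
rewrite leNgt; apply/negP => lL.
have m0 : 0 <= Num.max 1 L by rewrite le_max ler01.
have m1 : 1 <= Num.max 1 L by rewrite le_max lexx.
have big (n : nat) : (n <= ab)%N -> lam ^+ n <= B.
  move=> nab; apply: (@le_trans _ _ (Num.max 1 L ^+ n)); last exact: ler_weXn2l.
  by apply: lerXn2r; rewrite ?nnegrE // le_max (ltW lL) orbT.
have b1 := big N.+1 (leq_pmull _ (ltn0Sn M)).
have b2 := big M.+1 (leq_pmulr _ (ltn0Sn N)).
have := H t Tt t1; lra.
Qed.

Definition Wf z x1 x2 := Hm z x1 x2 + G z x1 x2.
(** The quantity whose modulus the cutoff tests. It has weight 0, so its derivative has weight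
    pz. *)
Definition Erel z x1 x2 := En z x1 x2 * (x1 ^+ M.+1)^-1.

Lemma lau_Erel : lau 0 Erel.
Proof.
have h : lau (- (az * bz)) (fun z x1 x2 => (fun=> 1) z * (x1 ^ (- az) * x2 ^ 0)).
  by apply: lau_mono; [exact: anaU_cst|rewrite /wgt; lia].
have := lau_mul (lau_En halpha) h; rewrite subrr; apply: lau_ext => z x1 x2 _.
by rewrite expr0z mulr1 mul1r -exprnN.
Qed.
Lemma pz_ge0 : 0 <= pz. Proof. by move: MN2; lia. Qed.
Lemma lau_W : lau (az * bz) Wf.
Proof.
apply: (@lau_ext _ _ _ _ _ (fun z x1 x2 => En z x1 x2 + ((Hm z x1 x2 - En z x1 x2) + G z x1 x2))).
  by move=> z x1 x2 _; rewrite /Wf; ring.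
apply: lau_add (lau_En halpha) _; apply: lau_add; first by apply: lau_le (lau_Hlow halpha); lia.
by apply: lau_le lG; have := pz_ge0; lia.
Qed.
Lemma lau_W_E : lau (az * bz - 1) (fun z x1 x2 => Wf z x1 x2 - En z x1 x2).
Proof.
apply: (@lau_ext _ _ _ _ _ (fun z x1 x2 => (Hm z x1 x2 - En z x1 x2) + G z x1 x2)).
  by move=> z x1 x2 _; rewrite /Wf; ring.
apply: lau_add; first exact: (lau_Hlow halpha).
by apply: lau_le lG; move: MN2; lia.
Qed.

Lemma germ_D F F' t : 0 <= t < 1 -> isD F F' -> okp (g t) (y1 t) (y2 t) ->
  der (fun z => F z (f1 t z) (f2 t z)) (g t) (F' (g t) (y1 t) (y2 t)).
Proof.
move=> tt hD ok; have [e1 e2 d1 d2] := hgerm tt.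
have := hD (g t) id (f1 t) (f2 t) 1 (der_id _); rewrite !mul1r -!e1 -!e2; exact.
Qed.

(* G is controlled by the scale only where En is small against y1^(M+1); it is cut off
   elsewhere, where H alone dominates its derivative. *)
Definition Zf (eps : R) z x1 x2 := Hm z x1 x2 + rc (chi eps (nm (En z x1 x2)) (nm x1 ^+ M.+1)) * G z x1 x2.

Definition germ_of (F : C -> C -> C -> C) t z := F z (f1 t z) (f2 t z).

Lemma nm_Erel z x1 x2 : nm (Erel z x1 x2) = nm (En z x1 x2) / nm x1 ^+ M.+1.
Proof. by rewrite nmM nmV nmX. Qed.

Lemma Zf_one eps z x1 x2 : x1 != 0 -> nm (En z x1 x2) <= eps * nm x1 ^+ M.+1 -> 0 < eps -> Zf eps z x1 x2 = Wf z x1 x2.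
Proof.
move=> x10 h e0; have u0 : 0 < nm x1 ^+ M.+1 by rewrite exprn_gt0 // nm_gt0.
have c1 := chi_one e0 u0 h; rewrite /Zf /Wf c1; congr (_ + _).
by rewrite /rc rmorph1 mul1r.
Qed.
Lemma Zf_zero eps z x1 x2 : 2 * eps * nm x1 ^+ M.+1 <= nm (En z x1 x2) -> Zf eps z x1 x2 = Hm z x1 x2.
Proof.
move=> h; have c1 := chi_zero h; rewrite /Zf c1 -[RHS]addr0; congr (_ + _).
by rewrite /rc rmorph0 mul0r.
Qed.
Lemma germ_En t : 0 <= t < 1 -> U (g t) -> ctn (germ_of En t) (g t).
Proof.
move=> tt Ut; have [_ _ d1 d2] := hgerm tt.
have ca := ana_ctn (halpha (inS_a M N) Ut); have cb := ana_ctn (halpha (inS_b M N) Ut).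
exact: (ctnD (ctnM ca (ctnX M.+1 (der_ctn d1))) (ctnM cb (ctnX N.+1 (der_ctn d2)))).
Qed.

(** The cutoff is 1 near g t, so Z = W there and W' = P W + Q with P and Q bounded. *)
Lemma Z_lip_in eps t (KP KQ : R) : 0 < eps -> 0 <= t < 1 -> okp (g t) (y1 t) (y2 t) ->
  nm (En (g t) (y1 t) (y2 t)) < eps * nm (y1 t) ^+ M.+1 ->
  nm (P (g t) (y1 t) (y2 t)) <= KP -> nm (Q (g t) (y1 t) (y2 t)) <= KQ ->
  nr (g t) (fun z => `|nm (germ_of (Zf eps) t z) - nm (germ_of (Zf eps) t (g t))| <=
    (KP + KQ + 1) * (nm (germ_of (Zf eps) t (g t)) + 1) * nm (z - g t)).
Proof.
move=> eps0 tt ok hE hP hQ; have [e1 e2 d1 d2] := hgerm tt; have [Ut y10 y20] := ok.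
have dW := germ_D tt (isD_add (isD_Hm halpha) dG) ok.
have [S' dS _] := lau_isD hU halpha pz_ge0 lau_Erel.
have cS := der_ctn (germ_D tt dS ok).
have u0 : 0 < nm (y1 t) ^+ M.+1 by rewrite exprn_gt0 // nm_gt0.
have Sl : nm (Erel (g t) (f1 t (g t)) (f2 t (g t))) < eps by rewrite -e1 -e2 nm_Erel ltr_pdivrMr.
have n1 := ctn_nm_lt cS Sl.
have n2 : nr (g t) (fun z => f1 t z != 0) by apply: (ctn_neq0 (der_ctn d1)); rewrite -e1.
have ZW : nr (g t) (fun z => germ_of (Zf eps) t z = Wf z (f1 t z) (f2 t z)).
  apply: nrS2 n1 n2 => z h1 h2; apply: Zf_one => //.
  by move: h1; rewrite nm_Erel ltr_pdivrMr ?exprn_gt0 ?nm_gt0 // => /ltW.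
have ZWt := nr_at ZW; rewrite -e1 -e2 in ZWt.
pose l := Hz (g t) (y1 t) (y2 t) + GD (g t) (y1 t) (y2 t).
have lk : nm l < nm l + 1 by rewrite ltrDl.
apply: nrS2 ZW (der_lip dW lk) => z -> h; rewrite ZWt.
apply: le_trans (nm_dist _ _) _; rewrite /Wf -e1 -e2 in h *.
apply: le_trans h _; rewrite ler_wpM2r ?nm_ge0 // /l hW //.
set w := Hm _ _ _ + G _ _ _; have w0 := nm_ge0 w.
have b1 : nm (P (g t) (y1 t) (y2 t) * w + Q (g t) (y1 t) (y2 t)) <= KP * nm w + KQ.
  by apply: le_trans (nmD _ _) _; rewrite nmM lerD // ler_wpM2r.
have P0 : 0 <= KP by apply: le_trans hP; exact: nm_ge0.
have Q0 : 0 <= KQ by apply: le_trans hQ; exact: nm_ge0.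
have : 0 <= KQ * nm w by rewrite mulr_ge0.
move: b1; move: (nm (_ + Q _ _ _)) (nm w) w0 => x y y0; nra.
Qed.

(** The cutoff is 0 near g t, so Z = H there, and H' = [Hz] is of the order lam^ab that H itself
    attains where the top terms do not cancel. Zeros of y1 and y2 may occur here, whence [Hm_der] in
    place of [isD]. *)
Lemma Z_lip_out eps t (K X : R) : 0 <= t < 1 -> U (g t) -> 0 < eps ->
  2 * eps * nm (y1 t) ^+ M.+1 < nm (En (g t) (y1 t) (y2 t)) -> 0 <= K ->
  nm (Hz (g t) (y1 t) (y2 t)) <= K * X -> X <= K * nm (Hm (g t) (y1 t) (y2 t)) ->
  nr (g t) (fun z => `|nm (germ_of (Zf eps) t z) - nm (germ_of (Zf eps) t (g t))| <=
    (K * K + 1) * (nm (germ_of (Zf eps) t (g t)) + 1) * nm (z - g t)).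
Proof.
move=> tt Ut eps0 hE K0 hz hX; have [e1 e2 d1 d2] := hgerm tt.
have cE := germ_En tt Ut.
have cu : ctn (fun z => f1 t z ^+ M.+1) (g t) by apply: ctnX; exact: der_ctn d1.
pose mid := (2 * eps * nm (y1 t) ^+ M.+1 + nm (En (g t) (y1 t) (y2 t))) / 2.
have m1 : mid < nm (germ_of En t (g t)) by rewrite /germ_of -e1 -e2 /mid; lra.
have m2 : nm (f1 t (g t) ^+ M.+1) < mid / (2 * eps).
  by rewrite -e1 nmX ltr_pdivlMr ?mulr_gt0 // mulrC /mid (midf_lt hE).1.
have ZH : nr (g t) (fun z => germ_of (Zf eps) t z = Hm z (f1 t z) (f2 t z)).
  apply: nrS2 (ctn_nm_gt cE m1) (ctn_nm_lt cu m2) => z h1 h2.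
  by apply: Zf_zero; apply: (div_mid _ _ h1); rewrite ?mulr_gt0 // -nmX.
have ZHt := nr_at ZH; rewrite -e1 -e2 in ZHt.
have dH : der (fun z => Hm z (f1 t z) (f2 t z)) (g t) (Hz (g t) (y1 t) (y2 t)).
  have := @Hm_der _ _ _ _ _ halpha (g t) id (f1 t) (f2 t) 1 (der_id _).
  by rewrite !mul1r -!e1 -!e2; apply.
have lk : nm (Hz (g t) (y1 t) (y2 t)) < nm (Hz (g t) (y1 t) (y2 t)) + 1 by rewrite ltrDl.
apply: nrS2 ZH (der_lip dH lk) => z -> h; rewrite ZHt.
apply: le_trans (nm_dist _ _) _; rewrite -e1 -e2 in h.
apply: le_trans h _; rewrite ler_wpM2r ?nm_ge0 //.
set w := Hm _ _ _ in hX *; have w0 := nm_ge0 w.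
have : K * X <= K * (K * nm w) by rewrite ler_wpM2l.
have : 0 <= K * K by rewrite mulr_ge0.
move: hz; move: (nm (Hz _ _ _)) (nm w) w0 (K * X) => x y y0 kx; rewrite mulrA; move: (K * K) => k2; nra.
Qed.

(** The derivative of the cutoff, of weight pz, multiplies G, of weight az + bz; the product has
    exactly the top weight, and in this zone H is of that size and G is small against it. *)
Lemma Z_lip_mid eps t (K C3 X : R) (S' : C -> C -> C -> C) : 0 <= t < 1 -> okp (g t) (y1 t) (y2 t) -> 0 < eps ->
  isD Erel S' -> 0 <= K ->
  nm (Hz (g t) (y1 t) (y2 t)) + 1 + (nm (GD (g t) (y1 t) (y2 t)) + 1) +
     eps^-1 * (nm (S' (g t) (y1 t) (y2 t)) + 1) * nm (G (g t) (y1 t) (y2 t)) <= C3 * X -> 0 <= C3 ->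
  X <= K * nm (Hm (g t) (y1 t) (y2 t)) -> 2 * K * nm (G (g t) (y1 t) (y2 t)) <= X ->
  nr (g t) (fun z => `|nm (germ_of (Zf eps) t z) - nm (germ_of (Zf eps) t (g t))| <=
    (2 * K * C3) * (nm (germ_of (Zf eps) t (g t)) + 1) * nm (z - g t)).
Proof.
move=> tt ok eps0 dS K0 hC C30 hX hG; have [e1 e2 d1 d2] := hgerm tt; have [Ut y10 y20] := ok.
have dH := germ_D tt (isD_Hm halpha) ok.
have dG' := germ_D tt dG ok; have dS' := germ_D tt dS ok.
have lk (x : C) : nm x < nm x + 1 by rewrite ltrDl.
have n2 : nr (g t) (fun z => f1 t z != 0) by apply: (ctn_neq0 (der_ctn d1)); rewrite -e1.
apply: nrS2 (nrI n2 (der_lip dH (lk _))) (nrI (der_lip dG' (lk _)) (der_lip dS' (lk _))).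
move=> z [fz lH] [lG' lS]; rewrite -e1 -e2 in lH lG' lS.
have Zt : germ_of (Zf eps) t (g t) = Zf eps (g t) (y1 t) (y2 t) by rewrite /germ_of -e1 -e2.
rewrite Zt; apply: le_trans (nm_dist _ _) _; rewrite /germ_of.
set x1 := f1 t z in fz lH lG' lS *; set x2 := f2 t z in lH lG' lS *.
have u0 : 0 < nm (y1 t) ^+ M.+1 by rewrite exprn_gt0 // nm_gt0.
have u0' : 0 < nm x1 ^+ M.+1 by rewrite exprn_gt0 // nm_gt0.
have cc : `|chi eps (nm (En z x1 x2)) (nm x1 ^+ M.+1) - chi eps (nm (En (g t) (y1 t) (y2 t))) (nm (y1 t) ^+ M.+1)| <=
    eps^-1 * ((nm (S' (g t) (y1 t) (y2 t)) + 1) * nm (z - g t)).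
  apply: le_trans (chi_lip eps0 _ _ u0' u0) _; rewrite -!nm_Erel ler_wpM2l ?invr_ge0 ?(ltW eps0) //.
  by apply: le_trans lS; exact: nm_dist.
have c10 := chi01 eps0 (nm (En z x1 x2)) (ltW u0').
have c20 := chi01 eps0 (nm (En (g t) (y1 t) (y2 t))) (ltW u0).
have lower : nm (Hm (g t) (y1 t) (y2 t)) - nm (G (g t) (y1 t) (y2 t)) <= nm (Zf eps (g t) (y1 t) (y2 t)) := cutoff_lower _ _ c20.
have cut : nm (Zf eps z x1 x2 - Zf eps (g t) (y1 t) (y2 t)) <= _ := cutoff_nm c10 lH lG' cc.
apply: le_trans cut _.
rewrite ler_wpM2r ?nm_ge0 //; apply: le_trans hC _.
have Z0 := nm_ge0 (Zf eps (g t) (y1 t) (y2 t)).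
have XZ := half_arith K0 lower hX hG Z0.
rewrite [2 * K * C3]mulrC -[leRHS]mulrA ler_wpM2l //; apply: le_trans XZ _.
by rewrite ler_wpM2l ?mulr_ge0 // lerDl.
Qed.

(** Since MN >= 2, at least one power of lam separates the weight of G from that of H; a large scale
    makes G negligible against a full-size H. *)
Lemma pow_gap (lam : R) : 1 <= lam -> lam ^ (az + bz) * lam <= lam ^+ ab.
Proof.
move=> l1; rewrite -[X in _ * X <= _]expr1z -expfzDr; last by rewrite gt_eqF; lra.
by rewrite exprnP; apply: ler_weXz2l => //; move: MN2; lia.
Qed.
Lemma pow_pz (lam : R) : 1 <= lam -> 1 <= lam ^ pz /\ lam ^ pz * lam ^ (az + bz) = lam ^+ ab.
Proof.
move=> l1; split; first exact: (@ler_weXz2l _ lam l1 0 pz pz_ge0).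
rewrite -expfzDr; last by rewrite gt_eqF; lra.
by rewrite exprnP; congr (_ ^ _); rewrite PoszM; lia.
Qed.

Section Point.
Variables (eps c K KG KP KQ KW KS : R) (S' : C -> C -> C -> C).
Hypotheses (eps0 : 0 < eps) (c1 : 1 <= c) (K0 : 0 <= K) (KG0 : 0 <= KG) (KP0 : 0 <= KP) (KQ0 : 0 <= KQ) (KW0 : 0 <= KW) (KS0 : 0 <= KS).
Hypothesis dS : isD Erel S'.
(** In units of lam^ab, the local Lipschitz constant of Z in the transition zone: the contributions
    of [Hz], of GD = P W + Q - [Hz], and of the derivative of the cutoff times G. *)
Let C3 := (K + 1) + (KP * KW + KQ + K + 1) + eps^-1 * ((KS + 1) * KG).
Let Kc := (KP + KQ + 1) + (K * K + 1) + 2 * K * C3.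
Variables (t lam : R).
Hypotheses (tt : 0 <= t < 1) (Ut : U (g t)) (l1 : 1 <= lam) (lG2 : 2 * K * KG <= lam).
Hypotheses (rg : nm (En (g t) (y1 t) (y2 t)) <= 2 * eps * nm (y1 t) ^+ M.+1 -> reg M N c lam (y1 t) (y2 t))
  (hout : eps * nm (y1 t) ^+ M.+1 <= nm (En (g t) (y1 t) (y2 t)) -> lam ^+ ab <= K * nm (Hm (g t) (y1 t) (y2 t)))
  (hHz : nm (Hz (g t) (y1 t) (y2 t)) <= K * lam ^+ ab)
  (hreg : reg M N c lam (y1 t) (y2 t) -> [/\ nm (G (g t) (y1 t) (y2 t)) <= KG * lam ^ (az + bz),
     nm (P (g t) (y1 t) (y2 t)) <= KP, nm (Q (g t) (y1 t) (y2 t)) <= KQ,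
     nm (Wf (g t) (y1 t) (y2 t)) <= KW * lam ^+ ab & nm (S' (g t) (y1 t) (y2 t)) <= KS * lam ^ pz]).

Lemma point_G : reg M N c lam (y1 t) (y2 t) -> 2 * K * nm (G (g t) (y1 t) (y2 t)) <= lam ^+ ab.
Proof.
move=> /hreg[bG _ _ _ _]; apply: le_trans (pow_gap l1).
apply: (@le_trans _ _ (2 * K * (KG * lam ^ (az + bz)))).
  by apply: ler_wpM2l => //; rewrite mulr_ge0.
have p0 : 0 <= lam ^ (az + bz) by apply: exprz_ge0; exact: le_trans l1.
by rewrite mulrA [leRHS]mulrC; apply: ler_wpM2r.
Qed.
Lemma point_lower : eps * nm (y1 t) ^+ M.+1 <= nm (En (g t) (y1 t) (y2 t)) ->
  lam ^+ ab <= 2 * K * nm (Zf eps (g t) (y1 t) (y2 t)).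
Proof.
move=> out; have X := hout out.
have [mid|/ltW out2] := leP (nm (En (g t) (y1 t) (y2 t))) (2 * eps * nm (y1 t) ^+ M.+1); last first.
  rewrite Zf_zero //; apply: le_trans X _; rewrite -mulrA [leRHS]mulr_natl mulr2n lerDl mulr_ge0 ?nm_ge0 //.
have u0 : 0 <= nm (y1 t) ^+ M.+1 by rewrite exprn_ge0 // nm_ge0.
have c20 := chi01 eps0 (nm (En (g t) (y1 t) (y2 t))) u0.
have lower : nm (Hm (g t) (y1 t) (y2 t)) - nm (G (g t) (y1 t) (y2 t)) <= nm (Zf eps (g t) (y1 t) (y2 t)) := cutoff_lower _ _ c20.
exact: half_arith K0 lower X (point_G (rg mid)) (nm_ge0 _).
Qed.
Lemma point_C3 : reg M N c lam (y1 t) (y2 t) ->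
  nm (Hz (g t) (y1 t) (y2 t)) + 1 + (nm (GD (g t) (y1 t) (y2 t)) + 1) +
     eps^-1 * (nm (S' (g t) (y1 t) (y2 t)) + 1) * nm (G (g t) (y1 t) (y2 t)) <= C3 * lam ^+ ab.
Proof.
move=> hr; have [bG bP bQ bW bS] := hreg hr; have [y10 y20] := reg_neq0 c1 hr.
have X1 : 1 <= lam ^+ ab by exact: exprn_ege1.
have ok : okp (g t) (y1 t) (y2 t) by split.
have bGD : nm (GD (g t) (y1 t) (y2 t)) <= (KP * KW + KQ + K) * lam ^+ ab.
  have -> : GD (g t) (y1 t) (y2 t) = (P (g t) (y1 t) (y2 t) * Wf (g t) (y1 t) (y2 t) + Q (g t) (y1 t) (y2 t)) - Hz (g t) (y1 t) (y2 t).
    by rewrite /Wf -hW // addrAC subrr add0r.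
  apply: le_trans (nmB _ _) _; rewrite mulrDl; apply: lerD => //.
  apply: le_trans (nmD _ _) _; rewrite mulrDl nmM; apply: lerD.
    by rewrite -mulrA; apply: ler_pM; rewrite ?nm_ge0.
  by apply: le_trans bQ _; rewrite ler_peMr.
have [p1 pE] := pow_pz l1.
have bSG : (nm (S' (g t) (y1 t) (y2 t)) + 1) * nm (G (g t) (y1 t) (y2 t)) <= (KS + 1) * KG * lam ^+ ab.
  rewrite -pE mulrACA; apply: ler_pM; rewrite ?addr_ge0 ?nm_ge0 //.
  by rewrite mulrDl mul1r; apply: lerD.
rewrite -mulrA /C3 (mulrDl (K + 1 + _)); apply: lerD; last first.
  by rewrite -mulrA; apply: ler_wpM2l; rewrite ?invr_ge0 ?(ltW eps0).
rewrite (mulrDl (K + 1)); apply: lerD; first by rewrite mulrDl mul1r; apply: lerD.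
by rewrite mulrDl mul1r; apply: lerD.
Qed.
Lemma point_lip : nr (g t) (fun z => `|nm (germ_of (Zf eps) t z) - nm (germ_of (Zf eps) t (g t))| <=
    Kc * (nm (germ_of (Zf eps) t (g t)) + 1) * nm (z - g t)).
Proof.
have C30 : 0 <= C3 by rewrite /C3 !(addr_ge0, mulr_ge0) // invr_ge0 ltW.
have [w1 [w2 w3]] : KP + KQ + 1 <= Kc /\ K * K + 1 <= Kc /\ 2 * K * C3 <= Kc.
  have wA : 0 <= KP + KQ + 1 by rewrite !addr_ge0.
  have wB : 0 <= K * K + 1 by rewrite !(addr_ge0, mulr_ge0).
  have wC : 0 <= 2 * K * C3 by rewrite !mulr_ge0.
  exact: le_sum3 wA wB wC.
have weak (k : R) : k <= Kc -> nr (g t) (fun z => `|nm (germ_of (Zf eps) t z) - nm (germ_of (Zf eps) t (g t))| <=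
    k * (nm (germ_of (Zf eps) t (g t)) + 1) * nm (z - g t)) -> nr (g t) (fun z => `|nm (germ_of (Zf eps) t z) - nm (germ_of (Zf eps) t (g t))| <=
    Kc * (nm (germ_of (Zf eps) t (g t)) + 1) * nm (z - g t)).
  by move=> kK; apply: nrS => z /le_trans; apply; rewrite ler_wpM2r ?nm_ge0 // ler_wpM2r // addr_ge0 ?nm_ge0.
have [inn|out] := ltP (nm (En (g t) (y1 t) (y2 t))) (eps * nm (y1 t) ^+ M.+1).
  have u0 : 0 <= eps * nm (y1 t) ^+ M.+1 by apply: le_trans (ltW inn); exact: nm_ge0.
  have hr : reg M N c lam (y1 t) (y2 t).
    by apply: rg; apply: (le_trans (ltW inn)); rewrite -mulrA [leRHS]mulr_natl mulr2n lerDl.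
  have [y10 y20] := reg_neq0 c1 hr; have [bG bP bQ bW bS] := hreg hr.
  by apply: weak w1 _; apply: (Z_lip_in eps0 tt _ inn bP bQ); split.
have X := hout out.
have [mid|out2] := leP (nm (En (g t) (y1 t) (y2 t))) (2 * eps * nm (y1 t) ^+ M.+1); last first.
  by apply: weak w2 _; exact: (Z_lip_out tt Ut eps0 out2 K0 hHz X).
have hr := rg mid; have [y10 y20] := reg_neq0 c1 hr.
have ok : okp (g t) (y1 t) (y2 t) by split.
have hC := point_C3 hr; have hG := point_G hr.
apply: weak w3 _; have h3 := Z_lip_mid tt ok eps0 dS K0 hC C30 X hG; exact: h3.
Qed.
End Point.

Lemma Z_pointwise : exists eps c K Kc : R, [/\ 0 < eps, 1 <= c, 0 <= K, 0 <= Kc & ends (fun t =>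
  nr (g t) (fun z => `|nm (germ_of (Zf eps) t z) - nm (germ_of (Zf eps) t (g t))| <=
    Kc * (nm (germ_of (Zf eps) t (g t)) + 1) * nm (z - g t)) /\
  forall lam, scale M N lam (y1 t) (y2 t) -> 1 <= lam /\
    (nm (En (g t) (y1 t) (y2 t)) <= 2 * eps * nm (y1 t) ^+ M.+1 -> reg M N c lam (y1 t) (y2 t)) /\
    (eps * nm (y1 t) ^+ M.+1 <= nm (En (g t) (y1 t) (y2 t)) -> lam ^+ ab <= K * nm (Zf eps (g t) (y1 t) (y2 t))))].
Proof.
have [eps [c [r0 [L [K [eps0 c1 r00 L1 [K0 He]]]]]]] := region_estimates (fun i j h => halpha h Ug) (hal Ug) (hbe Ug).
have [KG [r1 [KG0 r10 HG]]] := lau_bound hU Ug c1 lG.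
have [KP [r2 [KP0 r20 HP]]] := lau_bound hU Ug c1 lP.
have [KQ [r3 [KQ0 r30 HQ]]] := lau_bound hU Ug c1 lQ.
have [KW [r4 [KW0 r40 HW]]] := lau_bound hU Ug c1 lau_W.
have [S' dS lS] := lau_isD hU halpha pz_ge0 lau_Erel.
have [KS [r5 [KS0 r50 HS]]] := lau_bound hU Ug c1 lS.
have [rU rU0 HU] := hU Ug.
have K0' := ltW K0.
exists eps, c, (2 * K), ((KP + KQ + 1) + (K * K + 1) + 2 * K * ((K + 1) + (KP * KW + KQ + K + 1) + eps^-1 * ((KS + 1) * KG))).
split => //; first by rewrite mulr_ge0.
  by rewrite !(addr_ge0, mulr_ge0) // invr_ge0 ltW.
have := endsI (endsI (ends_near r00) (endsI (ends_near r10) (ends_near r20)))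
   (endsI (endsI (ends_near r30) (ends_near r40)) (endsI (ends_near r50) (endsI (ends_near rU0) (ends_scale (L + 2 * K * KG))))).
apply: endsS => t tt [[h0 [h1 h2]] [[h3 h4] [h5 [/HU Ut hs]]]].
have hL lam : scale M N lam (y1 t) (y2 t) -> L <= lam /\ 2 * K * KG <= lam.
  move=> /hs h; have p0 : 0 <= 2 * K * KG by rewrite !mulr_ge0.
  by split; apply: le_trans h; [rewrite lerDl|rewrite lerDr; lra].
have hreg lam : reg M N c lam (y1 t) (y2 t) -> [/\ nm (G (g t) (y1 t) (y2 t)) <= KG * lam ^ (az + bz),
     nm (P (g t) (y1 t) (y2 t)) <= KP, nm (Q (g t) (y1 t) (y2 t)) <= KQ,
     nm (Wf (g t) (y1 t) (y2 t)) <= KW * lam ^+ ab & nm (S' (g t) (y1 t) (y2 t)) <= KS * lam ^ pz].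
  move=> rg; split; first exact: HG h1 rg.
  - by have := HP _ _ _ _ h2 rg; rewrite expr0z mulr1.
  - by have := HQ _ _ _ _ h3 rg; rewrite expr0z mulr1.
  - by have := HW _ _ _ _ h4 rg; rewrite -PoszM -exprnP.
  - by have := HS _ _ _ _ h5 rg; rewrite add0r.
split.
  have [lam sc] := scale_exists M N (y1 t) (y2 t); have [lL1 lL2] := hL lam sc.
  have [E1 E2 E3] := He (g t) lam (y1 t) (y2 t) h0 sc lL1.
  exact: (point_lip eps0 c1 K0' KG0 KP0 KQ0 KW0 KS0 dS tt Ut (le_trans L1 lL1) lL2 E1 E2 E3 (hreg lam)).
move=> lam sc; have [lL1 lL2] := hL lam sc; split; first exact: le_trans lL1.
have [E1 E2 E3] := He (g t) lam (y1 t) (y2 t) h0 sc lL1; split; first exact: E1.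
exact: (point_lower eps0 K0' (le_trans L1 lL1) lL2 E1 E2 (hreg lam)).
Qed.

(** Gronwall bounds Z along the path. Where |En| is not below eps |y1|^(M+1), lam^ab is at most K
    |Z|, which is impossible once the scale exceeds 1 + K B. So eventually Z = W and both components
    have full size. *)
Lemma W_bounded : exists B c : R, 1 <= c /\ ends (fun t => forall lam, scale M N lam (y1 t) (y2 t) ->
  reg M N c lam (y1 t) (y2 t) /\ nm (Wf (g t) (y1 t) (y2 t)) <= B).
Proof.
have [eps [c [K [Kc [eps0 c1 K0 Kc0 hE]]]]] := Z_pointwise.
have [T T01 HT] := hE; have /andP[T0 T1] := T01.
pose T2 := (T + 1) / 2.
have T2' : T < T2 by rewrite /T2; lra.
have T2'' : T2 < 1 by rewrite /T2; lra.
have T20 : 0 <= T2 by lra.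
pose phi t := nm (Zf eps (g t) (y1 t) (y2 t)).
have gron t : T2 <= t -> t < 1 -> phi t + 1 <= (phi T2 + 1) * expR (2 * Kc * (V 1 - V 0)).
  move=> Tt t1; have gV : tame_path T2 t g V by apply: tame_sub hV => //; lra.
  have [|x xx|_ h] := path_gronwall (phi := phi) gV Kc0 ltr01.
  - by move=> x _; exact: nm_ge0.
  - move: xx => /andP[x1 x2]; have xt : 0 <= x < 1 by apply/andP; split; lra.
    have xab : T2 <= x <= t by rewrite x1.
    have [e1 e2 _ _] := hgerm xt.
    have Tx : T < x by lra.
    have [gx _] := HT x Tx (proj2 (andP xt)).
    apply: pnrS2 (tame_near gV xab gx) (halong T20 t1 xab) => s h [e3 e4].
    by rewrite /phi e3 e4 e1 e2.
  apply: le_trans h _; apply: ler_wpM2l; first by rewrite addr_ge0 ?nm_ge0.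
  rewrite ler_expR; apply: ler_wpM2l; first by rewrite mulr_ge0.
  by have /andP[] := V_bound hV T20 Tt (ltW t1).
pose B := (phi T2 + 1) * expR (2 * Kc * (V 1 - V 0)).
exists B, c; split => //.
have late : ends (fun t => T2 < t) by exists T2; rewrite ?T20.
apply: endsS (endsI (endsI late (ends_scale (1 + K * B))) hE) => t tt [[Tt hs2] [_ hs]] lam sc.
have [l1 [hr hl]] := hs lam sc.
have ZB : phi t <= B by have := gron t (ltW Tt) (proj2 (andP tt)); rewrite -/B; lra.
have inn : nm (En (g t) (y1 t) (y2 t)) <= eps * nm (y1 t) ^+ M.+1.
  rewrite leNgt; apply/negP => /ltW/hl X.
  have Xl : lam <= lam ^+ ab by apply: ler_eXnr.
  have lB := hs2 lam sc.
  have : K * phi t <= K * B by rewrite ler_wpM2l.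
  by rewrite -/(phi t) in X; lra.
have u0 : 0 <= eps * nm (y1 t) ^+ M.+1 by apply: le_trans inn; exact: nm_ge0.
have rg : reg M N c lam (y1 t) (y2 t).
  by apply: hr; apply: (le_trans inn); rewrite -mulrA [leRHS]mulr_natl mulr2n lerDl.
split => //; have [y10 _] := reg_neq0 c1 rg.
by rewrite -(Zf_one y10 inn eps0).
Qed.
End PathBound.

(** * Matching with a series solution *)

Section FamilyValue.
Variable R : realType.
Local Notation C := (Cx R).
Variables (M N : nat) (alpha : nat -> nat -> C -> C) (U : C -> Prop) (z1 : C).
Local Notation az := (M.+1%:Z).
Local Notation bz := (N.+1%:Z).
Local Notation al := (alpha M.+1 0%N).
Local Notation be := (alpha 0%N N.+1).
Local Notation En := (En M N alpha).
Hypothesis hU : forall z, U z -> nr z U.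
Hypothesis Uz1 : U z1.
Hypothesis halpha : forall i j, inS M N i j -> forall z, U z -> ana z (alpha i j).
Variables (d a1 b1 q : nat).
Hypotheses (MN2 : (2 <= M * N)%N) (Md : M.+1 = (a1 * d)%N) (Nd : N.+1 = (b1 * d)%N) (qd : (M * N - 1 = d * q)%N).
Local Notation K := (a1 * b1 * d)%N.
Local Notation lau := (lau M N U).
Local Notation reg := (reg M N).
Implicit Types (A B S T : C -> C) (W F : C -> C -> C -> C).

Definition rf A B F w := F (z1 + w ^+ q) (w ^- b1 * A w) (w ^- a1 * B w).

Lemma reg_le (c c' lam : R) y1 y2 : 1 <= c -> c <= c' -> reg c lam y1 y2 -> reg c' lam y1 y2.
Proof.
move=> c1 cc [l1 /andP[h1 h2] /andP[h3 h4]].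
have c0 : 0 < c by lra. have c0' : 0 < c' by lra.
have p (k : nat) : c'^-1 * lam ^+ k <= c^-1 * lam ^+ k.
  by apply: ler_wpM2r; [rewrite exprn_ge0 //; lra|rewrite lef_pV2].
have p' (k : nat) : c * lam ^+ k <= c' * lam ^+ k by apply: ler_wpM2r => //; rewrite exprn_ge0 //; lra.
by split => //; apply/andP; split; [apply: le_trans h1|apply: le_trans h2 _|apply: le_trans h3|apply: le_trans h4 _].
Qed.
Lemma ctn_two_sided A : ctn A 0 -> A 0 != 0 -> exists2 k : R, 1 <= k & nr 0 (fun w => k^-1 <= nm (A w) <= k).
Proof.
move=> cA A0; have n0 : 0 < nm (A 0) by rewrite nm_gt0.
pose k := 2 * nm (A 0) + 2 / nm (A 0) + 1.
have p1 : 0 < 2 / nm (A 0) by rewrite divr_gt0.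
have k0 : 0 < k by rewrite /k; lra.
have h1 : nm (A 0) < k by rewrite /k; lra.
have h2 : k^-1 < nm (A 0).
  rewrite -[nm _]invrK ltf_pV2 ?posrE ?invr_gt0 // /k; have : (nm (A 0))^-1 <= 2 / nm (A 0) by rewrite ler_peMl ?invr_ge0 ?nm_ge0 //; lra.
  lra.
exists k; first by rewrite /k; lra.
by apply: nrS2 (ctn_nm_lt cA h1) (ctn_nm_gt cA h2) => w l1 l2; rewrite !ltW.
Qed.
Lemma ref_reg A B (e : R) : 1 <= e -> ctn A 0 -> ctn B 0 -> A 0 != 0 -> B 0 != 0 ->
  exists2 c : R, 1 <= c & nr 0 (fun w => w != 0 -> forall lam, 1 <= lam -> e^-1 <= lam ^+ d * nm w <= e ->
    reg c lam (w ^- b1 * A w) (w ^- a1 * B w)).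
Proof.
move=> e1 cA cB A0 B0.
have [k k1 hA] := ctn_two_sided cA A0; have [k' k1' hB] := ctn_two_sided cB B0.
have e0 : 0 < e by lra. have k0 : 0 < k by lra. have k0' : 0 < k' by lra.
have en (n : nat) : 1 <= e ^+ n by exact: exprn_ege1.
pose c := e ^+ b1 * k + e ^+ a1 * k'.
have kpos (n : nat) (x : R) : 1 <= x -> 1 <= e ^+ n * x.
  by move=> x1; apply: (le_trans x1); rewrite ler_peMl //; lra.
have q1 := kpos b1 k k1; have q2 := kpos a1 k' k1'.
exists c; first by rewrite /c; lra.
have main (n : nat) (x lam u : R) (v : nat) (X : R) (w : C) : w != 0 -> 1 <= lam -> e^-1 <= lam ^+ d * nm w <= e ->
   1 <= x -> e ^+ n * x <= X -> x^-1 <= u <= x -> (v = n * d)%N ->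
   X^-1 * lam ^+ v <= nm (w ^- n) * u <= X * lam ^+ v.
  move=> w0 l1 /andP[y1 y2] x1 xX /andP[u1 u2] ->.
  have x0 : 0 < x by lra. have l0 : 0 < lam by lra.
  have X0 : 0 < X by apply: lt_le_trans xX; have := kpos n x x1; lra.
  have nw : 0 < nm w by rewrite nm_gt0.
  set y := lam ^+ d * nm w in y1 y2.
  have y0 : 0 < y by rewrite mulr_gt0 // exprn_gt0.
  have E : nm (w ^- n) = y ^- n * lam ^+ (n * d).
    rewrite nmV nmX /y exprMn -exprM mulnC invfM mulrAC mulVf ?mul1r //.
    by rewrite expf_neq0 // gt_eqF.
  have b1' : e ^- n <= y ^- n.
    by rewrite lef_pV2 ?posrE ?exprn_gt0 //; apply: lerXn2r; rewrite ?nnegrE ?(ltW y0) ?(ltW e0).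
  have b2' : y ^- n <= e ^+ n.
    rewrite -exprVn; apply: lerXn2r; rewrite ?nnegrE ?invr_ge0 ?(ltW e0) ?(ltW y0) //.
    by rewrite -[e]invrK lef_pV2 ?posrE ?invr_gt0.
  have L0 : 0 <= lam ^+ (n * d) by rewrite exprn_ge0 // ltW.
  have yn0 : 0 <= y ^- n by rewrite invr_ge0 exprn_ge0 // ltW.
  rewrite E mulrAC; apply/andP; split; apply: ler_wpM2r => //.
    apply: (@le_trans _ _ (e ^- n * x^-1)).
      by rewrite -invfM lef_pV2 ?posrE // mulr_gt0 // exprn_gt0.
    by apply: ler_pM => //; rewrite ?invr_ge0 ?exprn_ge0 // ltW.
  apply: le_trans xX; apply: ler_pM => //.
  by apply: le_trans u1; rewrite invr_ge0 ltW.
apply: nrS2 hA hB => w hA hB w0 lam l1 hl; split => //; rewrite nmM.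
  by apply: (main b1 k lam) hl _ _ hA Nd => //; rewrite /c; lra.
by apply: (main a1 k' lam) hl _ _ hB Md => //; rewrite /c; lra.
Qed.

Lemma lam_exists (w : C) : w != 0 -> nm w < 1 -> exists2 lam : R, 1 <= lam & lam ^+ d * nm w = 1.
Proof.
move=> w0 w1; have d0 : (0 < d)%N by case: (d) Md => //; rewrite muln0.
have nw : 0 < nm w by rewrite nm_gt0.
have [|lam l0 lE] := @real_root R d (nm w)^-1 d0; first by rewrite invr_ge0 ltW.
exists lam; last by rewrite lE mulVf // gt_eqF.
rewrite leNgt; apply/negP => l1.
have := exprn_ile1 d l0 (ltW l1).
by rewrite lE leNgt invf_gt1 // w1.
Qed.

Lemma lam_pow (w : C) (lam : R) : 0 < lam -> lam ^+ d * nm w = 1 -> lam ^ (az * bz - 1) * nm w ^+ K = lam^-1.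
Proof.
move=> l0 lE.
have wl : nm w = lam ^- d by rewrite -[nm w]mul1r -(mulVf (_ : lam ^+ d != 0)) ?expf_neq0 ?gt_eqF // -mulrA lE mulr1.
rewrite wl -exprVn -exprM exprVn.
have -> : az * bz - 1 = (d * K)%:Z + -1 by rewrite Md Nd; lia.
rewrite expfzDr ?gt_eqF // -exprnP mulrAC divff ?mul1r //.
by rewrite expf_neq0 // gt_eqF.
Qed.

(* W - E has weight below that of E, so only E contributes to the dependence of
   the limit of W on the free parameter. *)
Lemma family_value W A B A' B' S T (v v' : C) : lau (az * bz - 1) (fun z y1 y2 => W z y1 y2 - En z y1 y2) ->
  [/\ ctn A 0, ctn B 0, ctn A' 0 & ctn B' 0] -> A 0 = A' 0 -> B 0 = B' 0 -> A 0 != 0 -> B 0 != 0 ->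
  ctn S 0 -> ctn T 0 -> nr 0 (fun w => A w - A' w = w ^+ K * S w /\ B w - B' w = w ^+ K * T w) ->
  pto (rf A B W) v -> pto (rf A' B' W) v' ->
  v - v' = al z1 * (M.+1%:R * A 0 ^+ M * S 0) + be z1 * (N.+1%:R * B 0 ^+ N * T 0).
Proof.
move=> lWE [cA cB cA' cB'] eA eB A0 B0 cS cT hd hv hv'.
have [d0 a0 b0 q0 [M0 N0 Kq]] := level_pos MN2 Md Nd qd.
have A0' : A' 0 != 0 by rewrite -eA. have B0' : B' 0 != 0 by rewrite -eB.
have [c c1 rg] := ref_reg (lexx 1) cA cB A0 B0; have [c' c1' rg'] := ref_reg (lexx 1) cA' cB' A0' B0'.
have C1 : 1 <= Num.max c c' by rewrite le_max c1.
have [KL [rho [KL0 r0 HL]]] := lau_lip hU Uz1 C1 lWE.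
have cz : ctn (fun w : C => z1 + w ^+ q) 0 by apply: ctnD; [exact: ctn_cst|exact: ctnX (ctn_id 0)].
have z0q : z1 + 0 ^+ q = z1 :> C by rewrite expr0n (gtn_eqF q0) addr0.
have nz : nr 0 (fun w => nm (z1 + w ^+ q - z1) < rho).
  by have := cz rho r0; rewrite z0q.
pose rAB w := A w / A' w - 1; pose rBB w := B w / B' w - 1.
(* The branches differ by relative errors O(w^K), and W - [En] has size lam^((M+1)(N+1)-1). With
   lam^d |w| = 1 and d K = (M+1)(N+1) the difference is O(1/lam). *)
have small : pto (fun w => rf A B (fun z y1 y2 => W z y1 y2 - En z y1 y2) w - rf A' B' (fun z y1 y2 => W z y1 y2 - En z y1 y2) w) 0.
  pose kk := nm (S 0) + nm (T 0) + 1.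
  have nS : nm (S 0) < kk by rewrite /kk; have := nm_ge0 (T 0); lra.
  have nT : nm (T 0) < kk by rewrite /kk; have := nm_ge0 (S 0); lra.
  have [k k1 hA] := ctn_two_sided cA' A0'; have [k' k1' hB] := ctn_two_sided cB' B0'.
  apply/ptoE => e e0.
  pose D := KL * (kk * k + kk * k') + 1.
  have kk0 : 0 <= kk by rewrite /kk !addr_ge0 ?nm_ge0.
  have k00 : 0 <= k by exact: le_trans ler01 k1.
  have k00' : 0 <= k' by exact: le_trans ler01 k1'.
  have D0 : 0 < D by rewrite ltr_wpDl //; apply: mulr_ge0 => //; apply: addr_ge0; apply: mulr_ge0.
  have ed0 : 0 < (e / D) ^+ d by rewrite exprn_gt0 // divr_gt0.
  have near1 := nrI (nrI (@nr_lt _ 0 _ ltr01) (@nr_lt _ 0 _ ed0)) (nrI (nrI rg rg') (nrI nz hd)).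
  apply: nrS2 near1 (nrI (nrI (ctn_nm_lt cS nS) (ctn_nm_lt cT nT)) (nrI hA hB)).
  move=> w [[w1 we] [[h h'] [wz [dA dB]]]] [[hS hT] [/andP[hA1 _] /andP[hB1 _]]] w0; rewrite subr0 in w1 we; rewrite subr0.
  have [lam l1 lE] := lam_exists w0 w1.
  have one : (1 : R)^-1 <= lam ^+ d * nm w <= 1 by rewrite lE invr1 lexx.
  have g1 := reg_le c1 (_ : c <= Num.max c c') (h w0 lam l1 one).
  have g2 := reg_le c1' (_ : c' <= Num.max c c') (h' w0 lam l1 one).
  have := HL _ _ lam _ _ _ _ wz wz (g1 _) (g2 _); rewrite !le_max !lexx orbT => /(_ isT isT).
  rewrite (subrr (z1 + w ^+ q)) nm0 add0r => /le_lt_trans; apply.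
  have Aw : A' w != 0 by rewrite -nm_gt0; apply: lt_le_trans hA1; rewrite invr_gt0; exact: lt_le_trans ltr01 k1.
  have Bw : B' w != 0 by rewrite -nm_gt0; apply: lt_le_trans hB1; rewrite invr_gt0; exact: lt_le_trans ltr01 k1'.
  have rat (n : nat) (x y s : C) (k2 : R) : y != 0 -> 1 <= k2 -> k2^-1 <= nm y -> x - y = w ^+ K * s -> nm s < kk ->
     nm ((w ^- n * x) / (w ^- n * y) - 1) <= nm w ^+ K * (kk * k2).
    move=> y0 k21 ky xy sk.
    have -> : (w ^- n * x) / (w ^- n * y) - 1 = (x - y) * y^-1.
      by have := expf_neq0 n w0; move: (w ^+ n) => X X0; field; rewrite y0 X0.
    rewrite xy !nmM nmX nmV -mulrA ler_wpM2l ?exprn_ge0 ?nm_ge0 //; apply: ler_pM; rewrite ?nm_ge0 ?invr_ge0 ?nm_ge0 //; first exact: ltW.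
    by rewrite -[k2]invrK lef_pV2 ?posrE ?nm_gt0 // invr_gt0; exact: lt_le_trans ltr01 k21.
  have r1 := rat b1 _ _ _ _ Aw k1 hA1 dA hS; have r2 := rat a1 _ _ _ _ Bw k1' hB1 dB hT.
  have l0 : 0 < lam by exact: lt_le_trans ltr01 l1.
  have lK := lam_pow l0 lE.
  have L0 : 0 <= KL * lam ^ (az * bz - 1) by rewrite mulr_ge0 // exprz_ge0 // ltW.
  apply: le_lt_trans (ler_wpM2l L0 (lerD r1 r2)) _.
  have -> : KL * lam ^ (az * bz - 1) * (nm w ^+ K * (kk * k) + nm w ^+ K * (kk * k')) = (KL * (kk * k + kk * k')) * (lam ^ (az * bz - 1) * nm w ^+ K).
    by move: (lam ^ _) (nm w ^+ K) => *; clear; ring.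
  rewrite lK ltr_pdivrMr //.
  apply: (@lt_le_trans _ _ D); first by rewrite /D ltrDl.
  rewrite leNgt -ltr_pdivlMl // mulrC; apply/negP => lD.
  have : lam ^+ d * nm w < (D / e) ^+ d * (e / D) ^+ d.
    apply: (@le_lt_trans _ _ ((D / e) ^+ d * nm w)).
      rewrite ler_wpM2r ?nm_ge0 //; apply: lerXn2r; rewrite ?nnegrE ?(ltW l0) ?(ltW lD) //.
      by rewrite divr_ge0 // ltW.
    by rewrite ltr_pM2l // exprn_gt0 // divr_gt0.
  by rewrite lE -exprMn mulrA divfK ?gt_eqF // divff ?gt_eqF // expr1n ltxx.
(* The differences of A and of B are divisible by w^K while [En] carries w^(-K); what remains has as
   limit the derivative of the top part in the direction (S 0, T 0). *)
pose EA w := al (z1 + w ^+ q) * (S w * \sum_(i < M.+1) A w ^+ (M - i) * A' w ^+ i) +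
   be (z1 + w ^+ q) * (T w * \sum_(i < N.+1) B w ^+ (N - i) * B' w ^+ i).
have cal : ctn (fun w : C => al (z1 + w ^+ q)) 0.
  by apply: (ctn_comp cz); rewrite z0q; exact: ana_ctn (halpha (inS_a M N) Uz1).
have cbe : ctn (fun w : C => be (z1 + w ^+ q)) 0.
  by apply: (ctn_comp cz); rewrite z0q; exact: ana_ctn (halpha (inS_b M N) Uz1).
have cEA : ctn EA 0.
  apply: ctnD; (apply: ctnM; first by []); apply: ctnM => //.
    apply: (@ctn_sum _ M.+1 (fun i w => A w ^+ (M - i) * A' w ^+ i)) => i _; by apply: ctnM; apply: ctnX.
  apply: (@ctn_sum _ N.+1 (fun i w => B w ^+ (N - i) * B' w ^+ i)) => i _; by apply: ctnM; apply: ctnX.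
have EA0 : EA 0 = al z1 * (M.+1%:R * A 0 ^+ M * S 0) + be z1 * (N.+1%:R * B 0 ^+ N * T 0).
  have sm (n : nat) (x : C) : \sum_(i < n.+1) x ^+ (n - i) * x ^+ i = n.+1%:R * x ^+ n.
    rewrite (eq_bigr (fun=> x ^+ n)) ?sumr_const ?card_ord ?mulr_natl // => i _.
    by rewrite -exprD subnK // -ltnS.
  by rewrite /EA z0q -eA -eB !sm; ring.
have hE : pto (fun w => rf A B En w - rf A' B' En w) (EA 0).
  apply: pto_ext (pto_ctn cEA); apply: nrS hd => w [dA dB] w0.
  rewrite /EA /rf !En_def.
  have pw (n : nat) (k : nat) (x : C) : (n * k = K)%N -> (w ^- n * x) ^+ k = w ^- K * x ^+ k.
    by move=> nk; rewrite exprMn exprVn -exprM nk.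
  have e1 : (b1 * M.+1 = K)%N by rewrite Md; ring.
  have e2 : (a1 * N.+1 = K)%N by rewrite Nd; ring.
  rewrite !(pw b1) // !(pw a1) //.
  have wK : w ^+ K != 0 by rewrite expf_neq0.
  have h1 : A w ^+ M.+1 - A' w ^+ M.+1 = w ^+ K * (S w * \sum_(i < M.+1) A w ^+ (M - i) * A' w ^+ i).
    by rewrite subrXX dA -mulrA.
  have h2 : B w ^+ N.+1 - B' w ^+ N.+1 = w ^+ K * (T w * \sum_(i < N.+1) B w ^+ (N - i) * B' w ^+ i).
    by rewrite subrXX dB -mulrA.
  move: (S w * _) (T w * _) h1 h2 wK (al _) (be _) => X Y h1 h2.
  move: (A w ^+ _) (A' w ^+ _) (B w ^+ _) (B' w ^+ _) (w ^+ K) h1 h2 => x x' y y' k h1 h2 k0 a b.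
  have -> : a * (k^-1 * x) + b * (k^-1 * y) - (a * (k^-1 * x') + b * (k^-1 * y')) = k^-1 * (a * (x - x') + b * (y - y')) by ring.
  by rewrite h1 h2; field.
have hneg : pto (fun w => - rf A' B' W w) (- v').
  have := ptoM (pto_cst (-1 : C)) hv'; rewrite mulN1r; apply: pto_ext; apply: nrW => w _.
  by rewrite mulN1r.
rewrite -EA0; apply: (pto_unique (ptoD hv hneg)).
have := ptoD hE small; rewrite addr0; apply: pto_ext; apply: nrW => w _.
by rewrite /rf; move: (W _ _ _) (W _ _ _) (En _ _ _) (En _ _ _) => *; ring.
Qed.
End FamilyValue.

(** * Exponent algebra of the two monomials *)

Section MatchingAlgebra.
Variables (F : fieldType) (m n : int) (a1 b1 : nat).
Hypothesis bez : b1%:Z * m + a1%:Z * n = 1.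

Lemma monomial_unit (x y : F) : x != 0 -> y != 0 -> x ^ m * y ^ n * (x ^ (- m) * y ^ (- n)) = 1.
Proof. by move=> x0 y0; rewrite mulrACA -!expfzDr // !subrr !expr0z mulr1. Qed.
Lemma monomial_pole (k w x y : F) : w != 0 -> x != 0 -> y != 0 ->
  k * ((w ^- b1 * x) ^ (- m) * (w ^- a1 * y) ^ (- n)) = w * (k * (x ^ (- m) * y ^ (- n))).
Proof.
move=> w0 x0 y0; rewrite !exprzMl ?unitfE ?invr_eq0 ?expf_neq0 //.
have -> : w ^- b1 = w ^ (- b1%:Z) := exprnN w b1.
have -> : w ^- a1 = w ^ (- a1%:Z) := exprnN w a1.
rewrite !exprz_exp !mulrNN.
have e : w ^ (b1%:Z * m) * w ^ (a1%:Z * n) = w by rewrite -expfzDr // bez expr1z.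
rewrite -[w in RHS]e; ring.
Qed.
(** By the Bezout relation the exponents (-m, -n) and (a1, -b1) form a unimodular matrix, so a point
    is recovered from the two monomials. If the first agrees at both points, their quotients are
    powers of rho, the quotient of the second. *)
Lemma rho_algebra (u1 u2 v1 v2 : F) : u1 != 0 -> u2 != 0 -> v1 != 0 -> v2 != 0 ->
  u1 ^ (- m) * u2 ^ (- n) = v1 ^ (- m) * v2 ^ (- n) ->
  let rho := (u1 ^+ a1 / u2 ^+ b1) / (v1 ^+ a1 / v2 ^+ b1) in
  u1 / v1 = rho ^ n /\ u2 / v2 = rho ^ (- m).
Proof.
move=> u10 u20 v10 v20 e rho.
pose r1 := u1 / v1; pose r2 := u2 / v2.
have r10 : r1 != 0 by rewrite mulf_neq0 // invr_eq0.
have r20 : r2 != 0 by rewrite mulf_neq0 // invr_eq0.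
have rE : rho = r1 ^ a1%:Z * r2 ^ (- b1%:Z).
  rewrite /rho /r1 /r2 -exprnP -exprnN !exprMn !exprVn.
  have := expf_neq0 a1 v10; have := expf_neq0 b1 v20; have := expf_neq0 b1 u20.
  move: (u1 ^+ a1) (u2 ^+ b1) (v1 ^+ a1) (v2 ^+ b1) => x y z w y0 w0 z0; field.
  by rewrite y0 z0 w0.
have u1E : u1 = r1 * v1 by rewrite /r1 divfK.
have u2E : u2 = r2 * v2 by rewrite /r2 divfK.
have h1 : r1 ^ (- m) * r2 ^ (- n) = 1.
  have k0 : v1 ^ (- m) * v2 ^ (- n) != 0 by rewrite mulf_neq0 // expfz_neq0.
  have E1 : u1 ^ (- m) = r1 ^ (- m) * v1 ^ (- m) by rewrite u1E exprzMl ?unitfE.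
  have E2 : u2 ^ (- n) = r2 ^ (- n) * v2 ^ (- n) by rewrite u2E exprzMl ?unitfE.
  by apply: (mulIf k0); rewrite mul1r -[RHS]e E1 E2 mulrACA.
have h2 : r1 ^ m = r2 ^ (- n).
  by apply: (mulfI (expfz_neq0 (- m) r10)); rewrite h1 -expfzDr // addNr expr0z.
have h3 : r2 ^ n = r1 ^ (- m).
  by apply: (mulIf (expfz_neq0 (- n) r20)); rewrite h1 -expfzDr // subrr expr0z.
rewrite -/r1 -/r2 rE; split.
- rewrite exprzMl ?unitfE ?expfz_neq0 // !exprz_exp.
  have -> : - b1%:Z * n = - n * b1%:Z by lia.
  rewrite -(exprz_exp r2) -h2 exprz_exp -expfzDr //.
  have -> : a1%:Z * n + m * b1%:Z = 1 by move: bez; lia.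
  by rewrite expr1z.
- rewrite exprzMl ?unitfE ?expfz_neq0 // !exprz_exp.
  have -> : a1%:Z * - m = - m * a1%:Z by lia.
  rewrite -(exprz_exp r1) -h3 exprz_exp -expfzDr //.
  have -> : n * a1%:Z + - b1%:Z * - m = 1 by move: bez; lia.
  by rewrite expr1z.
Qed.
Lemma theta_algebra (d : nat) (y1 y2 x1 x2 r : F) : r != 0 -> x1 != 0 -> x2 != 0 ->
  y1 / x1 = r ^ n -> y2 / x2 = r ^ (- m) ->
  y1 ^+ (a1 * d) * y2 ^- (b1 * d) = x1 ^+ (a1 * d) * x2 ^- (b1 * d) * r ^+ d.
Proof.
move=> r0 x10 x20 e1 e2.
have -> : y1 = r ^ n * x1 by rewrite -e1 divfK.
have -> : y2 = r ^ (- m) * x2 by rewrite -e2 divfK.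
have E : (r ^ n) ^+ (a1 * d) * (r ^ (- m)) ^- (b1 * d) = r ^+ d.
  have -> : (r ^ (- m)) ^- (b1 * d) = (r ^ (- m)) ^ (- (b1 * d)%N%:Z) := exprnN _ _.
  have -> : (r ^ n) ^+ (a1 * d) = (r ^ n) ^ ((a1 * d)%N%:Z) by rewrite -exprnP.
  rewrite !exprz_exp -expfzDr // exprnP; congr (_ ^ _).
  rewrite mulNr mulrN opprK !PoszM -[RHS]mul1r -bez; ring.
rewrite !exprMn invfM -E; move: (_ ^+ _) (_ ^- _) (_ ^+ _) (_ ^- _) => *; ring.
Qed.
End MatchingAlgebra.

Lemma nm_sub5 (R : realType) (p1 p2 p3 p4 p5 : Cx R) (k1 k2 k3 k4 k5 : R) : nm p1 <= k1 -> nm p2 <= k2 ->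
  nm p3 <= k3 -> nm p4 <= k4 -> nm p5 <= k5 -> nm (p1 - p2 - p3 - p4 - p5) <= k1 + k2 + k3 + k4 + k5.
Proof.
move=> h1 h2 h3 h4 h5.
have := nmB (p1 - p2 - p3 - p4) p5; have := nmB (p1 - p2 - p3) p4; have := nmB (p1 - p2) p3; have := nmB p1 p2.
lra.
Qed.

Lemma nm_le0 (R : realType) (x : Cx R) : (nm x <= 0) = (x == 0).
Proof. by rewrite -nm_eq0 eq_le nm_ge0 andbT. Qed.
Lemma step_bound (R : realType) (s f x : Cx R) (k K L D : R) : 0 <= K -> 0 <= D -> nm s * L <= k -> 1 / 2 < nm f ->
  nm x <= K * L * D -> nm (s * (f^-1 * x)) <= k * (2 * (K * D)).
Proof.
move=> K0 D0 h1 h2 h3; have f0 : 0 < nm f by apply: lt_trans h2; rewrite divr_gt0.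
have hv : (nm f)^-1 <= 2 by rewrite -[2]invrK lef_pV2 ?posrE ?invr_gt0 // -div1r ltW.
rewrite !nmM nmV; apply: (@le_trans _ _ (nm s * (2 * (K * L * D)))).
  by apply: ler_wpM2l; rewrite ?nm_ge0 //; apply: ler_pM; rewrite ?invr_ge0 ?nm_ge0.
have -> : nm s * (2 * (K * L * D)) = nm s * L * (2 * (K * D)) by ring.
by apply: ler_wpM2r => //; do 2!apply: mulr_ge0 => //.
Qed.
(** The derivative of [xi] grows at most like lam^(d q - d), and q w^(q-1) decays at this rate
    because |w| is of order lam^(-d). *)
Lemma pole_scale (R : realType) (d q : nat) (l x e : R) : (0 < q)%N -> 0 <= l -> 0 <= x -> l ^+ d * x <= e ->
  q%:R * x ^+ (q - 1) * l ^ (- d%:Z + (d * q)%N%:Z) <= q%:R * e ^+ (q - 1).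
Proof.
move=> q_gt0 l0 x0 h; rewrite -mulrA; apply: ler_wpM2l; first exact: ler0n.
have -> : l ^ (- d%:Z + (d * q)%N%:Z) = (l ^+ d) ^+ (q - 1).
  by rewrite -exprM exprnP; congr (_ ^ _); case: q q_gt0 => // k _; rewrite subn1 /= mulnS; lia.
rewrite mulrC -exprMn; apply: lerXn2r => //; rewrite nnegrE.
  by apply: mulr_ge0 => //; exact: exprn_ge0.
by apply: le_trans h; apply: mulr_ge0 => //; exact: exprn_ge0.
Qed.
Lemma germ_bound (R : realType) (Py Px Wy Rw Qy Qx l : Cx R) (KP KQ BP BQ BR B k D : R) : 0 <= BP -> 0 <= BR ->
  nm (Py - Px) <= KP * D -> nm (Qy - Qx) <= KQ * D -> nm Px <= BP -> nm Qx <= BQ -> nm Wy <= B -> nm Rw <= BR ->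
  nm (Wy - Rw) <= D -> nm l <= k * D ->
  nm (Py * Wy + Qy - (Px * Rw + Qx) * (1 - l)) <= (KP * B + BP + KQ + (BP * BR + BQ) * k) * D.
Proof.
move=> BP0 BR0 h1 h2 h3 h4 h5 h6 h7 h8.
have -> : Py * Wy + Qy - (Px * Rw + Qx) * (1 - l) =
  (Py - Px) * Wy + Px * (Wy - Rw) + (Qy - Qx) + (Px * Rw + Qx) * l by ring.
have -> : (KP * B + BP + KQ + (BP * BR + BQ) * k) * D = KP * D * B + BP * D + KQ * D + (BP * BR + BQ) * (k * D) by ring.
apply: le_trans (nmD _ _) _; apply: lerD; last first.
  rewrite nmM; apply: ler_pM; rewrite ?nm_ge0 //; apply: le_trans (nmD _ _) _; apply: lerD => //.
  by rewrite nmM; apply: ler_pM; rewrite ?nm_ge0.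
apply: le_trans (nmD _ _) _; apply: lerD => //; apply: le_trans (nmD _ _) _; apply: lerD.
  by rewrite nmM; apply: ler_pM; rewrite ?nm_ge0.
by rewrite nmM; apply: ler_pM; rewrite ?nm_ge0.
Qed.

(** * Deviation of the solution from the selected series *)

Section Matching.
Variable R : realType.
Local Notation C := (Cx R).
Variables (M N : nat) (alpha : nat -> nat -> C -> C) (U : C -> Prop).
Local Notation az := (M.+1%:Z).
Local Notation bz := (N.+1%:Z).
Local Notation pz := (M.+1%:Z * N.+1%:Z - M.+1%:Z - N.+1%:Z).
Local Notation al := (alpha M.+1 0%N).
Local Notation be := (alpha 0%N N.+1).
Local Notation Hm := (Hm M N alpha).
Local Notation En := (En M N alpha).
Local Notation Hz := (Hz M N alpha).
Local Notation lau := (lau M N U).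
Local Notation isD := (isD M N alpha U).
Local Notation okp := (okp U).
Local Notation rh1 := (rhs1 M N alpha).
Local Notation rh2 := (rhs2 M N alpha).
Local Notation ab := (M.+1 * N.+1)%N.
Local Notation reg := (reg M N).
Hypothesis MN2 : (2 <= M * N)%N.
Hypothesis hU : forall z, U z -> nr z U.
Hypothesis halpha : forall i j, inS M N i j -> forall z, U z -> ana z (alpha i j).
Hypothesis hal : forall z, U z -> al z != 0.
Hypothesis hbe : forall z, U z -> be z != 0.
Variables (W W' P Q : C -> C -> C -> C).
Hypotheses (lP : lau 0 P) (lQ : lau 0 Q) (dW : isD W W')
  (lWE : lau (az * bz - 1) (fun z y1 y2 => W z y1 y2 - En z y1 y2)).
Hypothesis hW : forall z y1 y2, okp z y1 y2 -> W' z y1 y2 = P z y1 y2 * W z y1 y2 + Q z y1 y2.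
Variables (d a1 b1 q : nat).
Hypotheses (Md : M.+1 = (a1 * d)%N) (Nd : N.+1 = (b1 * d)%N) (qd : (M * N - 1 = d * q)%N).
Variables (m n : int).
Hypothesis bez : b1%:Z * m + a1%:Z * n = 1.

Variables (g : R -> C) (V : R -> R) (y1 y2 : R -> C) (f1 f2 : R -> C -> C).
Hypothesis hV : tame_path 0 1 g V.
Hypothesis Ug : U (g 1).
Local Notation z1 := (g 1).
Hypothesis hgerm : forall t, 0 <= t < 1 -> [/\ y1 t = f1 t (g t), y2 t = f2 t (g t),
  der (f1 t) (g t) (rh1 (g t) (y1 t) (y2 t)) & der (f2 t) (g t) (rh2 (g t) (y1 t) (y2 t))].
Hypothesis halong : forall a b t, 0 <= a -> b < 1 -> a <= t <= b ->
  pnr a b t (fun s => y1 s = f1 t (g s) /\ y2 s = f2 t (g s)).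

Variables (A B : nat -> C) (R1 : C -> C) (tau0 : C).
Hypothesis hb : is_branch M N alpha a1 b1 q z1 A B.
Hypotheses (A00 : A 0%N != 0) (B00 : B 0%N != 0) (htau0 : A 0%N ^+ a1 = tau0 * B 0%N ^+ b1).
Hypothesis aR1 : ana 0 R1.
Local Notation rf := (rf z1 a1 b1 q (psum A) (psum B)).
Hypothesis hR1 : nr 0 (fun w => w != 0 -> rf W w = R1 w).

Variables (lam : R -> R) (c B0 : R).
Hypothesis c1 : 1 <= c.
Hypothesis hreg : ends (fun t => reg c (lam t) (y1 t) (y2 t) /\ nm (W (g t) (y1 t) (y2 t)) <= B0).
Hypothesis hlam : forall L, ends (fun t => L <= lam t).
Hypothesis htype : forall e, 0 < e -> ends (fun t => nm (y1 t ^+ a1 / y2 t ^+ b1 - tau0) < e).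
Hypothesis hcl : forall e, 0 < e -> frq (fun t => nm (W (g t) (y1 t) (y2 t) - R1 0) < e).

(* A monomial of weight -d, normalised to be w (1 + O(w)) on the series; Xf is its value there. *)
Definition xi (z x1 x2 : C) : C := A 0%N ^ m * B 0%N ^ n * (x1 ^ (- m) * x2 ^ (- n)).
Definition Xf (w : C) : C := w * (A 0%N ^ m * B 0%N ^ n * (psum A w ^ (- m) * psum B w ^ (- n))).

Lemma ana_A : ana 0 (psum A).
Proof. by have [gA _ _] := hb; exists A => //; apply: nrW => x; rewrite subr0. Qed.
Lemma ana_B : ana 0 (psum B).
Proof. by have [_ gB _] := hb; exists B => //; apply: nrW => x; rewrite subr0. Qed.
Lemma psumA_neq0 : psum A 0 != 0. Proof. by rewrite psum0. Qed.
Lemma psumB_neq0 : psum B 0 != 0. Proof. by rewrite psum0. Qed.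
Lemma d_gt0 : (0 < d)%N. Proof. by have [] := level_pos MN2 Md Nd qd. Qed.
Lemma q_gt0 : (0 < q)%N. Proof. by have [] := level_pos MN2 Md Nd qd. Qed.

Lemma pz_dq : pz = (d * q)%N%:Z.
Proof. by rewrite -qd -subzn; lia. Qed.

Lemma Xf_facts : [/\ ana 0 Xf, Xf 0 = 0 & dv Xf 0 = 1].
Proof.
have aY : ana 0 (fun w => A 0%N ^ m * B 0%N ^ n * (psum A w ^ (- m) * psum B w ^ (- n))).
  by apply: anaZ; apply: anaM; [exact: anaXz psumA_neq0 ana_A|exact: anaXz psumB_neq0 ana_B].
split; [by apply: anaM aY; exact: ana_id|by rewrite /Xf mul0r|].
have [/nr_at dY _] := ana_dv aY.
have e := monomial_unit m n A00 B00.
apply: dvE; apply: (der_eq (l := 1 * (A 0%N ^ m * B 0%N ^ n * (psum A 0 ^ (- m) * psum B 0 ^ (- n))) +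
  0 * dv (fun w => A 0%N ^ m * B 0%N ^ n * (psum A w ^ (- m) * psum B w ^ (- n))) 0)); last exact: derM (der_id 0) dY.
by rewrite mul0r addr0 mul1r !psum0.
Qed.
Lemma rf_xi w : w != 0 -> psum A w != 0 -> psum B w != 0 -> rf xi w = Xf w.
Proof. exact: monomial_pole. Qed.
Lemma lau_xi : lau (- d%:Z) xi.
Proof.
apply: (@lau_mono _ _ _ _ _ (fun=> A 0%N ^ m * B 0%N ^ n) (- m) (- n)); first exact: anaU_cst.
by move: bez; rewrite /wgt Md Nd !PoszM; nia.
Qed.
Lemma lau_xiV : lau d%:Z (fun z x1 x2 => (A 0%N ^ m * B 0%N ^ n)^-1 * (x1 ^ m * x2 ^ n)).
Proof.
apply: (@lau_mono _ _ _ _ _ (fun=> (A 0%N ^ m * B 0%N ^ n)^-1) m n); first exact: anaU_cst.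
by move: bez; rewrite /wgt Md Nd !PoszM; nia.
Qed.

Section Inverse.
Variables (om : C -> C) (sig rho1 : R).
Hypotheses (sig0 : 0 < sig) (rho10 : 0 < rho1)
  (hX : forall w, nm w < rho1 -> der Xf w (dv Xf w) /\ dv Xf w != 0)
  (hom : forall x, nm x < sig -> [/\ nm (om x) < rho1, nm (om x) <= 2 * nm x, nm x <= 2 * nm (om x),
    Xf (om x) = x & der om x (dv Xf (om x))^-1]).

(** The branch parameter attached to the point reached at t; x1, x2 and zt denote the series
    solution at that parameter. *)
Definition wt_ t := om (xi (g t) (y1 t) (y2 t)).
Local Notation w_ := wt_.
Local Notation x1 t := (w_ t ^- b1 * psum A (w_ t)).
Local Notation x2 t := (w_ t ^- a1 * psum B (w_ t)).
Local Notation zt t := (z1 + w_ t ^+ q).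
Definition u1_ t := g t - zt t.
Definition u2_ t := W (g t) (y1 t) (y2 t) - R1 (w_ t).
Definition rho_ t := (y1 t ^+ a1 / y2 t ^+ b1) / (x1 t ^+ a1 / x2 t ^+ b1).
Definition del_ t : R := nm (u1_ t) + nm (u2_ t).

Lemma ends_reg : ends (fun t => reg c (lam t) (y1 t) (y2 t)).
Proof. by apply: endsS hreg => t _ []. Qed.
Lemma ends_nr (Pr : C -> Prop) : nr z1 Pr -> ends (fun t => Pr (g t)).
Proof. by move=> [e e0 H]; apply: endsS (ends_near hV e0) => t _; exact: H. Qed.

(** [xi] and its reciprocal are Laurent monomials of weights -d and d; the upper bound for the
    reciprocal is the lower bound for [xi]. *)
Lemma xi_size : exists2 e : R, 1 <= e & ends (fun t =>
  let x := xi (g t) (y1 t) (y2 t) in x != 0 /\ e^-1 <= lam t ^+ d * nm x <= e).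
Proof.
have [K [r [K0 r0 HK]]] := lau_bound hU Ug c1 lau_xi.
have [K' [r' [K0' r0' HK']]] := lau_bound hU Ug c1 lau_xiV.
exists (K + K' + 1); first lra.
apply: endsS (endsI (endsI (ends_near hV r0) (ends_near hV r0')) ends_reg) => t _ [[g1 g2] rg] x.
have b1_ := HK _ _ _ _ g1 rg; have b2_ := HK' _ _ _ _ g2 rg.
have [y10 y20] := reg_neq0 c1 rg; have [l1 _ _] := rg; have l0 : 0 < lam t by lra.
have xV : (A 0%N ^ m * B 0%N ^ n)^-1 * (y1 t ^ m * y2 t ^ n) = x^-1.
  by rewrite /x /xi !invfM !invr_expz !opprK.
have x0 : x != 0 by rewrite /x /xi !mulf_neq0 ?expfz_neq0.
split => //; rewrite xV nmV in b2_; rewrite -/x in b1_.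
have ld : 0 < lam t ^+ d by exact: exprn_gt0.
have e0 : 0 < K + K' + 1 by lra.
have nx : 0 < nm x by rewrite nm_gt0.
apply/andP; split.
  rewrite -[lam t ^+ d]invrK -[nm x]invrK -invfM lef_pV2 ?posrE ?mulr_gt0 ?invr_gt0 //.
  rewrite mulrC ler_pdivrMr //; apply: (le_trans b2_); rewrite -exprnP.
  by apply: ler_wpM2r; [exact: ltW|lra].
rewrite -ler_pdivlMl //; apply: (le_trans b1_); rewrite -exprnN mulrC.
by apply: ler_wpM2l; [rewrite invr_ge0 ltW|lra].
Qed.
Lemma lam_pow_ge (k : nat) : (0 < k)%N -> forall L, ends (fun t => 1 <= lam t /\ L <= lam t ^+ k).
Proof.
move=> k0 L; apply: endsS (endsI (hlam 1) (hlam L)) => t _ [h1 h2]; split => //.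
by apply: le_trans h2 _; apply: ler_eXnr.
Qed.
Lemma ends_xi_small e : 0 < e -> ends (fun t => nm (xi (g t) (y1 t) (y2 t)) < e).
Proof.
move=> e0; have [k k1 H] := xi_size.
apply: endsS (endsI H (lam_pow_ge d_gt0 (2 * k / e))) => t _ [[_ /andP[_ h]] [l1 hl]].
have l0 : 0 < lam t ^+ d by rewrite exprn_gt0 //; lra.
have : 2 * k <= lam t ^+ d * e by rewrite -ler_pdivrMr.
move: h; rewrite -(ltr_pM2l l0); lra.
Qed.
Lemma w_facts : exists2 e : R, 1 <= e & ends (fun t => [/\ nm (xi (g t) (y1 t) (y2 t)) < sig,
  w_ t != 0, Xf (w_ t) = xi (g t) (y1 t) (y2 t) & e^-1 <= lam t ^+ d * nm (w_ t) <= e]).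
Proof.
have [k k1 H] := xi_size; exists (2 * k); first lra.
apply: endsS (endsI H (endsI (ends_xi_small sig0) (hlam 1))) => t _ [[x0 /andP[h1 h2]] [hs l1]].
have [_ h3 h4 h5 _] := hom hs; rewrite -/(w_ t) in h3 h4 h5.
have nx : 0 < nm (xi (g t) (y1 t) (y2 t)) by rewrite nm_gt0.
have nw : 0 < nm (w_ t) by lra.
split => //; first by rewrite -nm_gt0.
have ld : 0 < lam t ^+ d by rewrite exprn_gt0 //; lra.
have p3 : lam t ^+ d * nm (w_ t) <= lam t ^+ d * (2 * nm (xi (g t) (y1 t) (y2 t))) by rewrite ler_pM2l.
have p4 : lam t ^+ d * nm (xi (g t) (y1 t) (y2 t)) <= lam t ^+ d * (2 * nm (w_ t)) by rewrite ler_pM2l.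
rewrite mulrCA in p3; rewrite mulrCA in p4; rewrite invfM.
by apply/andP; split; lra.
Qed.
Lemma ends_w (Pr : C -> Prop) : nr 0 Pr -> ends (fun t => Pr (w_ t)).
Proof.
move=> [e e0 H]; have e2 : 0 < e / 2 by lra.
apply: endsS (endsI (ends_xi_small e2) (ends_xi_small sig0)) => t _ [h1 h2].
by have [_ h3 _ _ _] := hom h2; apply: H; rewrite subr0 /wt_; lra.
Qed.

Lemma both_reg : exists2 c' : R, 1 <= c' & ends (fun t => reg c' (lam t) (y1 t) (y2 t) /\
  reg c' (lam t) (x1 t) (x2 t)).
Proof.
have [e e1 H] := w_facts.
have [c' c1' rg] := ref_reg Md Nd e1 (ana_ctn ana_A) (ana_ctn ana_B) psumA_neq0 psumB_neq0.
exists (Num.max c c'); first by rewrite le_max c1.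
apply: endsS (endsI ends_reg (endsI H (endsI (hlam 1) (ends_w rg)))) => t _ [h1 [[_ w0 _ he] [l1 h2]]].
split; [apply: reg_le h1 => //|apply: reg_le (h2 w0 _ l1 he) => //]; by rewrite le_max lexx ?orbT.
Qed.
Lemma ends_z (r : R) : 0 < r -> ends (fun t => nm (g t - z1) < r /\ nm (zt t - z1) < r).
Proof.
move=> r0; apply: endsI; first exact: (ends_near hV).
have cz : ctn (fun w : C => z1 + w ^+ q) 0 by apply: ctnD; [exact: ctn_cst|exact: ctnX (ctn_id 0)].
by have := ends_w (cz r r0); rewrite expr0n (gtn_eqF q_gt0) addr0.
Qed.

Lemma ref_okp : ends (fun t => okp (g t) (y1 t) (y2 t) /\ okp (zt t) (x1 t) (x2 t)).
Proof.
have [c' c1' H] := both_reg; have [r r0 HU] := hU Ug.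
apply: endsS (endsI H (ends_z r0)) => t _ [[h1 h2] [h3 h4]].
have [p1 p2] := reg_neq0 c1' h1; have [p3 p4] := reg_neq0 c1' h2.
by split; split => //; exact: HU.
Qed.

Lemma rho_facts : ends (fun t => y1 t / x1 t = rho_ t ^ n /\ y2 t / x2 t = rho_ t ^ (- m)).
Proof.
have [e e1 H] := w_facts.
have nA : nr 0 (fun w => psum A w != 0) by exact: ctn_neq0 (ana_ctn ana_A) psumA_neq0.
have nB : nr 0 (fun w => psum B w != 0) by exact: ctn_neq0 (ana_ctn ana_B) psumB_neq0.
apply: endsS (endsI (endsI H ref_okp) (endsI (ends_w nA) (ends_w nB))) => t _ [[[_ w0 Xx _] [[_ y10 y20] [_ x10 x20]]] [Aw Bw]].
have k0 : A 0%N ^ m * B 0%N ^ n != 0 by apply: mulf_neq0; [exact: expfz_neq0 A00|exact: expfz_neq0 B00].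
have E : y1 t ^ (- m) * y2 t ^ (- n) = x1 t ^ (- m) * x2 t ^ (- n).
  apply: (mulfI k0); have := rf_xi w0 Aw Bw; rewrite Xx => E; exact: esym E.
exact: (rho_algebra bez y10 y20 x10 x20 E).
Qed.
(** The quotient y1^a1 / y2^b1 tends to tau0 both on the solution, by [htype], and on the series, by
    the choice of its leading coefficients. *)
Lemma rho_to_1 e : 0 < e -> ends (fun t => nm (rho_ t - 1) < e).
Proof.
move=> e0.
have t0 : tau0 != 0 by apply: contraNneq (expf_neq0 a1 A00) => t0; rewrite htau0 t0 mul0r.
have n0 : 0 < nm tau0 by rewrite nm_gt0.
pose s w := psum A w ^+ a1 / psum B w ^+ b1.
have sE : s 0 = tau0 by rewrite /s !psum0 htau0 mulfK // expf_neq0.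
have cs : ctn s 0.
  by apply: ctnM; [exact: ctnX (ana_ctn ana_A)|apply: ctnV; [rewrite expf_neq0 // psumB_neq0|exact: ctnX (ana_ctn ana_B)]].
pose e' := Num.min (e * nm tau0 / 8) (nm tau0 / 2).
have e'0 : 0 < e' by rewrite lt_min !divr_gt0 // mulr_gt0.
have := ends_w (cs e' e'0); rewrite sE => H1.
have [k k1 H] := w_facts.
apply: endsS (endsI (endsI H1 (htype e'0)) H) => t _ [[h1 h2] [_ w0 _ _]].
have h3 : e' <= e * nm tau0 / 8 by rewrite ge_min lexx.
have h4 : e' <= nm tau0 / 2 by rewrite ge_min lexx orbT.
have xs : x1 t ^+ a1 / x2 t ^+ b1 = s (w_ t).
  rewrite /s !exprMn !exprVn -!exprM [(a1 * b1)%N]mulnC; have := expf_neq0 (b1 * a1) w0; have := @mulVf C.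
  move: (psum A _ ^+ a1) (psum B _ ^+ b1) (w_ t ^+ _) => x y z _ z0; rewrite invfM invrK.
  by rewrite mulrACA mulVf // mul1r.
rewrite /rho_ xs; move: (y1 t ^+ a1 / y2 t ^+ b1) (s (w_ t)) h1 h2 => u v h1 h2.
have v0 : 0 < nm v by have := nm_sub tau0 v; rewrite (nmBC tau0); lra.
have vl : nm tau0 / 2 <= nm v by have := nm_sub tau0 v; rewrite (nmBC tau0); lra.
have -> : u / v - 1 = (u - v) / v by rewrite mulrBl divff // -nm_gt0.
rewrite nmM nmV ltr_pdivrMr //.
have : nm (u - v) <= nm (u - tau0) + nm (v - tau0) by rewrite (nmBC v); exact: nmD3.
have : e * (nm tau0 / 2) <= e * nm v by rewrite ler_pM2l.
have p : 0 < e * nm tau0 by rewrite mulr_gt0.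
rewrite mulrA; lra.
Qed.
Lemma rho_pow (i : int) : exists2 L : R, 0 <= L & ends (fun t => nm (rho_ t ^ i - 1) <= L * nm (rho_ t - 1)).
Proof.
have c2 : 1 <= 2 :> R by lra.
have [L L0 HL] := exprz_lip i c2; exists L => //.
have h : 0 < 1 / 2 :> R by lra.
apply: endsS (rho_to_1 h) => t _ ht; apply: HL.
have := nm_sub (rho_ t) 1; have := nm_sub 1 (rho_ t); rewrite nm1 (nmBC 1) => p1 p2.
have -> : 2^-1 = 1 / 2 :> R by rewrite div1r.
by apply/andP; split; lra.
Qed.

Lemma compare_rho l F : lau l F -> exists2 K : R, 0 <= K & ends (fun t =>
  nm (F (g t) (y1 t) (y2 t) - F (zt t) (x1 t) (x2 t)) <= K * lam t ^ l * (nm (u1_ t) + nm (rho_ t - 1))).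
Proof.
move=> lF; have [c' c1' H] := both_reg.
have [K [r [K0 r0 HK]]] := lau_lip hU Ug c1' lF.
have [L L0 HL] := rho_pow n; have [L' L0' HL'] := rho_pow (- m).
exists (K * (1 + L + L')); first by rewrite !(mulr_ge0, addr_ge0).
apply: endsS (endsI (endsI H (ends_z r0)) (endsI rho_facts (endsI HL HL'))).
move=> t _ [[[r1 r2] [z_1 z_2]] [[e1 e2] [l1 l2]]].
have := HK _ _ _ _ _ _ _ z_1 z_2 r1 r2; rewrite e1 e2 => /le_trans; apply.
have lm : 0 <= lam t ^ l by have [h _ _] := r1; rewrite exprz_ge0 //; lra.
rewrite -!mulrA; apply: ler_wpM2l => //; rewrite mulrCA; apply: ler_wpM2l => //.
rewrite -/(u1_ t); have := nm_ge0 (u1_ t); have := nm_ge0 (rho_ t - 1) => q1 q2.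
move: l1 l2; move: (nm (rho_ t ^ n - 1)) (nm (rho_ t ^ (- m) - 1)) => s1 s2 l1 l2.
have : 0 <= L * nm (u1_ t) by rewrite mulr_ge0.
have : 0 <= L' * nm (u1_ t) by rewrite mulr_ge0.
rewrite !mulrDl !mul1r !mulrDr; move: (L * _) (L' * _) (L * _) (L' * _) l1 l2 => *; lra.
Qed.

Lemma rho_power_lower : ends (fun t => nm (rho_ t - 1) <= 2 * nm (rho_ t ^+ d - 1)).
Proof.
have cS : ctn (fun x : C => \sum_(i < d) x ^+ i) 1.
  by apply: (@ctn_sum _ d (fun i x => x ^+ i)) => i _; apply: ctnX; exact: ctn_id.
have S1 : 1 / 2 < nm (\sum_(i < d) (1 : C) ^+ i).
  rewrite (eq_bigr (fun=> 1)) => [|i _]; last by rewrite expr1n.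
  rewrite sumr_const card_ord nm_nat; apply: (@lt_le_trans _ _ 1); first by lra.
  by rewrite ler1n d_gt0.
have [r r0 H] := ctn_nm_gt cS S1.
apply: endsS (rho_to_1 r0) => t _ /H; move: (rho_ t) => x h.
have -> : x ^+ d - 1 = (x - 1) * \sum_(i < d) x ^+ i by rewrite subrX1.
rewrite nmM; have := nm_ge0 (x - 1) => p; have := ler_wpM2l p (ltW h); lra.
Qed.

Lemma rho_identity (al1 al2 be1 be2 th1 th2 w1 w2 Y1 Y2 L1 L2 rd r2 : C) : al2 != 0 -> th2 != 0 ->
  w1 * Y1 = al1 * th1 + be1 + L1 -> w2 * Y2 = al2 * th2 + be2 + L2 -> th1 = th2 * rd -> Y2 = Y1 * r2 ->
  rd - 1 = (al2 * th2)^-1 * ((w1 - w2) * Y1 - w2 * Y1 * (r2 - 1) - (L1 - L2) - (al1 - al2) * th1 - (be1 - be2)).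
Proof.
move=> a0 t0 h1 h2 h3 h4; have k0 : al2 * th2 != 0 by rewrite mulf_neq0.
apply: (mulfI k0); rewrite mulrA divff // mul1r.
have -> : (w1 - w2) * Y1 - w2 * Y1 * (r2 - 1) = w1 * Y1 - w2 * Y2 by rewrite h4; ring.
by rewrite h1 h2 h3; ring.
Qed.

(** X stands for |rho - 1|. Its occurrences on the right carry a factor 1/l and amount to at most
    X/2 beyond the threshold for l. *)
Lemma absorb (X Kv cb L BR KL Ka Kb Th l u1 u2 : R) : 0 <= X -> 0 <= Kv -> 0 <= cb -> 0 <= L -> 0 <= BR -> 0 <= KL -> 0 <= Ka -> 0 <= Kb ->
  0 <= Th -> 1 <= l -> 0 <= u1 -> 0 <= u2 -> 4 * Kv * (BR * cb * L + KL) <= l ->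
  X <= 2 * (Kv * (u2 * cb + BR * (cb / l) * (L * X) + KL / l * (u1 + X) + Ka * u1 * Th + Kb * u1)) ->
  X <= 4 * Kv * (cb + KL + Ka * Th + Kb) * (u1 + u2).
Proof.
move=> X0 Kv0 cb0 L0 BR0 KL0 Ka0 Kb0 Th0 l1 u10 u20 hl h.
have l0 : 0 < l by lra.
have il : l^-1 <= 1 by rewrite invf_le1.
have e1 : Kv * (BR * (cb / l) * (L * X) + KL / l * X) <= X / 4.
  have -> : Kv * (BR * (cb / l) * (L * X) + KL / l * X) = Kv * (BR * cb * L + KL) * X / l by ring.
  rewrite ler_pdivrMr //; have := ler_wpM2r X0 hl; lra.
have e2 : KL / l * u1 <= KL * u1.
  by apply: ler_wpM2r => //; rewrite ler_piMr.
have e3 : Kv * (KL / l * u1) <= Kv * (KL * u1) by rewrite ler_wpM2l.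
have p (x y : R) : 0 <= x -> 0 <= y -> 0 <= Kv * (x * y) by move=> x0 y0; rewrite !mulr_ge0.
have := p _ _ cb0 u10; have := p _ _ KL0 u20; have := p _ _ Kb0 u20.
have := p _ _ (mulr_ge0 Ka0 Th0) u20.
move: h e1 e3.
have -> : Kv * (u2 * cb + BR * (cb / l) * (L * X) + KL / l * (u1 + X) + Ka * u1 * Th + Kb * u1) =
  Kv * (cb * u2) + Kv * (BR * (cb / l) * (L * X) + KL / l * X) + Kv * (KL / l * u1) + Kv * (Ka * Th * u1) + Kv * (Kb * u1) by ring.
have -> : 4 * Kv * (cb + KL + Ka * Th + Kb) * (u1 + u2) = 4 * (Kv * (cb * u1) + Kv * (KL * u1) + Kv * (Ka * Th * u1) + Kv * (Kb * u1)
   + (Kv * (cb * u2) + Kv * (KL * u2) + Kv * (Ka * Th * u2) + Kv * (Kb * u2))) by ring.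
have := p _ _ (mulr_ge0 Ka0 Th0) u10; have := p _ _ Kb0 u10; have := p _ _ KL0 u10; have := p _ _ cb0 u20.
move: (Kv * (cb * u1)) (Kv * (cb * u2)) (Kv * (KL * u1)) (Kv * (KL * u2)) (Kv * (Kb * u1)) (Kv * (Kb * u2)) (Kv * (Ka * Th * u1)) (Kv * (Ka * Th * u2)).
move: (Kv * (_ + KL / l * X)) (Kv * (KL / l * u1)) => *; lra.
Qed.

Definition lowf z (v1 v2 : C) := (W z v1 v2 - En z v1 v2) * v2 ^- N.+1.
Lemma lau_lowf : lau (-1) lowf.
Proof.
have h : lau (- (az * bz)) (fun z v1 v2 => (fun=> 1) z * (v1 ^ 0 * v2 ^ (- bz))).
  by apply: lau_mono; [exact: anaU_cst|rewrite /wgt; lia].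
have := lau_mul lWE h.
have -> : az * bz - 1 + - (az * bz) = -1 by lia.
by apply: lau_ext => z v1 v2 _; rewrite expr0z !mul1r /lowf exprnN.
Qed.
Lemma lau_theta : lau 0 (fun z v1 v2 => v1 ^+ M.+1 * v2 ^- N.+1).
Proof.
have h : lau 0 (fun z v1 v2 => (fun=> 1) z * (v1 ^ az * v2 ^ (- bz))).
  by apply: lau_mono; [exact: anaU_cst|rewrite /wgt; lia].
by apply: lau_ext h => z v1 v2 _; rewrite mul1r -exprnP -exprnN.
Qed.
Lemma lau_thetaV : lau 0 (fun z v1 v2 => (al z * (v1 ^+ M.+1 * v2 ^- N.+1))^-1).
Proof.
have h : lau 0 (fun z v1 v2 => (al z)^-1 * (v1 ^ (- az) * v2 ^ bz)).
  by apply: lau_mono; [apply: anaU_inv hal _; exact: (anaU_al halpha)|rewrite /wgt; lia].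
by apply: lau_ext h => z v1 v2 _; rewrite -exprnP -exprnN !invfM invrK.
Qed.
Lemma lau_y2V : lau (- (az * bz)) (fun z v1 v2 => v2 ^- N.+1).
Proof.
have h : lau (- (az * bz)) (fun z v1 v2 => (fun=> 1) z * (v1 ^ 0 * v2 ^ (- bz))).
  by apply: lau_mono; [exact: anaU_cst|rewrite /wgt; lia].
by apply: lau_ext h => z v1 v2 _; rewrite expr0z !mul1r exprnN.
Qed.
Lemma lowfE z v1 v2 : v2 != 0 -> W z v1 v2 * v2 ^- N.+1 = al z * (v1 ^+ M.+1 * v2 ^- N.+1) + be z + lowf z v1 v2.
Proof.
move=> v20; have k0 := expf_neq0 N.+1 v20; rewrite /lowf En_def.
by move: (v2 ^+ N.+1) k0 (v1 ^+ M.+1) (W _ _ _) => y y0 x w0; field.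
Qed.

(** rho is no independent unknown: dividing W by y2^(N+1) expresses al y1^(M+1) / y2^(N+1), hence
    rho^d, through z, W and terms of weight -1. These terms bring rho - 1 back only with a factor
    1/lam, absorbed for large lam. *)
Lemma rho_bound : exists2 K : R, 0 <= K & ends (fun t => nm (rho_ t - 1) <= K * del_ t).
Proof.
have [c' c1' H] := both_reg.
have [KL KL0 HL] := compare_rho lau_lowf.
have [Th [r1 [Th0 r10 HTh]]] := lau_bound hU Ug c1' lau_theta.
have [Kv [r2 [Kv0 r20 HKv]]] := lau_bound hU Ug c1' lau_thetaV.
have [cb [r3 [cb0 r30 Hcb]]] := lau_bound hU Ug c1' lau_y2V.
have [Ka [r4 [Ka0 r40 HKa]]] := ana_lip (anaU_al halpha Ug).
have [Kb [r5 [Kb0 r50 HKb]]] := ana_lip (anaU_be halpha Ug).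
have [L L0 HrL] := rho_pow (- m * bz).
have [_ [BR [BR0 hBR]]] : True /\ exists BR : R, 0 <= BR /\ nr 0 (fun w => nm (R1 w) <= BR).
  split=> //; exists (nm (R1 0) + 1); split; first by rewrite addr_ge0 ?nm_ge0.
  have h : nm (R1 0) < nm (R1 0) + 1 by rewrite ltrDl.
  by apply: nrS (ctn_nm_lt (ana_ctn aR1) h) => w /ltW.
exists (4 * Kv * (cb + KL + Ka * Th + Kb)); first by rewrite !(mulr_ge0, addr_ge0).
pose Lb := 4 * Kv * (BR * cb * L + KL).
have near_z := endsI (endsI (ends_z r10) (ends_z r20)) (endsI (ends_z r30) (endsI (ends_z r40) (ends_z r50))).
have [e e1 Hw] := w_facts.
apply: endsS (endsI (endsI (endsI H ref_okp) (endsI HL (endsI rho_facts HrL))) (endsI (endsI near_z (endsI rho_power_lower Hw)) (endsI (endsI (ends_w hBR) (ends_w hR1)) (endsI (hlam 1) (hlam Lb))))).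
move=> t _ [[[[rg rg'] [ok ok']] [hL [[e1_ e2] hrL]]] [[nz [hpow [_ w0 _ _]]] [[bR eR] [l1 lL]]]].
have [[[z11 z12] [z21 z22]] [[z31 z32] [[z41 z42] [z51 z52]]]] := nz.
have [Uz y10 y20] := ok; have [Uz' x10 x20] := ok'.
have l0 : 0 < lam t by exact: lt_le_trans ltr01 l1.
have bTh := HTh _ _ _ _ z11 rg; rewrite expr0z mulr1 in bTh.
have bKv := HKv _ _ _ _ z22 rg'; rewrite expr0z mulr1 in bKv.
have bcb := Hcb _ _ _ _ z31 rg.
have [_ bKa] := HKa _ _ z41 z42; have [_ bKb] := HKb _ _ z51 z52.
have lab : lam t ^ (- (az * bz)) <= (lam t)^-1.
  by rewrite -exprN1; apply: ler_weXz2l => //; move: MN2; lia.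
have lab1 : (lam t)^-1 <= 1 by rewrite invf_le1.
have cb1 : nm (y2 t ^- N.+1) <= cb / lam t by apply: le_trans bcb _; apply: ler_wpM2l.
have cb2 : nm (y2 t ^- N.+1) <= cb by apply: le_trans cb1 _; rewrite ler_piMr.
have r0 : rho_ t != 0 by rewrite /rho_ !mulf_neq0 ?invr_eq0 ?mulf_neq0 ?expf_neq0 ?invr_eq0 ?expf_neq0.
have th_ : y1 t ^+ M.+1 * y2 t ^- N.+1 = x1 t ^+ M.+1 * x2 t ^- N.+1 * rho_ t ^+ d.
  rewrite Md Nd; exact: (theta_algebra bez d r0 x10 x20 e1_ e2).
have Y2_ : x2 t ^- N.+1 = y2 t ^- N.+1 * (rho_ t ^ (- m * bz)).
  rewrite -exprz_exp -e2.
  have -> : (y2 t / x2 t) ^ bz = y2 t ^+ N.+1 * x2 t ^- N.+1 by rewrite -exprnP exprMn exprVn.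
  by rewrite mulrA mulVf ?mul1r ?expf_neq0.
have al0 := hal Uz'.
have th0 : x1 t ^+ M.+1 * x2 t ^- N.+1 != 0 by rewrite mulf_neq0 ?invr_eq0 ?expf_neq0.
have id := rho_identity al0 th0 (lowfE (g t) (y1 t) y20) (lowfE (zt t) (x1 t) x20) th_ Y2_.
apply: (absorb _ Kv0 cb0 L0 BR0 KL0 Ka0 Kb0 Th0 l1 _ _ lL); try exact: nm_ge0.
apply: le_trans hpow _; apply: ler_wpM2l => //.
rewrite id nmM; apply: ler_pM; rewrite ?nm_ge0 //.
have -> : W (zt t) (x1 t) (x2 t) = R1 (w_ t) by exact: eR.
apply: nm_sub5.
- by rewrite nmM; apply: ler_wpM2l; rewrite ?nm_ge0.
- rewrite !nmM; apply: ler_pM => //; rewrite ?mulr_ge0 ?nm_ge0 //.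
  by apply: ler_pM; rewrite ?nm_ge0.
- by move: hL; rewrite exprN1.
- by rewrite nmM; apply: ler_pM; rewrite ?nm_ge0.
- exact: bKb.
Qed.

Lemma compare l F : lau l F -> exists2 K : R, 0 <= K & ends (fun t =>
  nm (F (g t) (y1 t) (y2 t) - F (zt t) (x1 t) (x2 t)) <= K * lam t ^ l * del_ t).
Proof.
move=> lF; have [K K0 H] := compare_rho lF; have [K' K0' H'] := rho_bound.
exists (K * (1 + K')); first by rewrite mulr_ge0 // addr_ge0.
apply: endsS (endsI (endsI H H') (hlam 1)) => t _ [[h1 h2] l1]; apply: (le_trans h1).
have lm : 0 <= lam t ^ l by rewrite exprz_ge0 // (le_trans ler01).
rewrite mulrAC -!mulrA ler_wpM2l // mulrCA mulrA [_ * lam t ^ l]mulrC -mulrA ler_wpM2l // mulrDl mul1r lerD //.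
by rewrite /del_ lerDl nm_ge0.
Qed.

Lemma ref_derivatives W0 W0' F : isD W0 W0' -> ana 0 F -> nr 0 (fun w => w != 0 -> rf W0 w = F w) ->
  nr 0 (fun w => w != 0 -> dv F w = q%:R * w ^+ (q - 1) * rf W0' w).
Proof.
move=> dW0 aF hF; have [dF _] := ana_dv aF.
have hB := branch_der hU MN2 Md Nd qd Ug hb A00 B00 dW0.
have hF2 := nr_nr hF.
apply: nrS2 (nrI dF hB) (nrI hF2 (nr_nr (@nrW _ 0 (fun=> True) (fun _ => I)))) => w [dFw hBw] [hFw _] w0.
have [_ hd] := hBw w0.
have nw : nr w (fun x : C => x != 0) by exact: ctn_neq0 (ctn_id w) w0.
apply: (der_unique dFw); apply: der_ext hd; apply: nrS2 hFw nw => x h x0.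
exact: h.
Qed.

(** Both deviations vanish identically on the series, so their derivatives are differences of the
    same expressions at the solution and at the series point; [compare] bounds these differences by
    the deviations themselves. *)
Lemma u_germs : exists2 Kt : R, 0 <= Kt & ends (fun t => exists (U1 U2 : C -> C) (l1 l2 : C),
  [/\ der U1 (g t) l1, der U2 (g t) l2, forall a b, 0 <= a -> b < 1 -> a <= t <= b ->
     pnr a b t (fun s => u1_ s = U1 (g s) /\ u2_ s = U2 (g s)) & nm l1 + nm l2 <= Kt * del_ t]).
Proof.
have pz0 : 0 <= pz by move: MN2; lia.
have [xi' dxi lxi'] := lau_isD hU halpha pz0 lau_xi.
have [aX X0 X1] := Xf_facts; have [_ adX] := ana_dv aX.
have hXf : nr 0 (fun w => w != 0 -> rf xi w = Xf w).
  have nA : nr 0 (fun w => psum A w != 0) by exact: ctn_neq0 (ana_ctn ana_A) psumA_neq0.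
  have nB : nr 0 (fun w => psum B w != 0) by exact: ctn_neq0 (ana_ctn ana_B) psumB_neq0.
  by apply: nrS2 nA nB => w Aw Bw w0; exact: rf_xi.
have rX := ref_derivatives dxi aX hXf.
have rR := ref_derivatives dW aR1 hR1.
have [Kx Kx0 Hx] := compare lxi'; have [KP KP0 HP] := compare lP; have [KQ KQ0 HQ] := compare lQ.
have [c' c1' Hreg] := both_reg.
have [BP [r2 [BP0 r20 HBP]]] := lau_bound hU Ug c1' lP.
have [BQ [r3 [BQ0 r30 HBQ]]] := lau_bound hU Ug c1' lQ.
pose BR := nm (R1 0) + 1.
have BR0 : 0 <= BR by rewrite addr_ge0 ?nm_ge0.
have hBR : nr 0 (fun w => nm (R1 w) <= BR).
  have h : nm (R1 0) < nm (R1 0) + 1 by rewrite ltrDl.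
  by apply: nrS (ctn_nm_lt (ana_ctn aR1) h) => w /ltW.
have hX1 : nr 0 (fun w => 1 / 2 < nm (dv Xf w)).
  by apply: (ctn_nm_gt (ana_ctn adX)); rewrite X1 nm1; lra.
have [e e1 Hw] := w_facts.
pose k1 := 2 * (q%:R * e ^+ (q - 1)) * Kx.
have e0 : 0 <= e by exact: le_trans ler01 e1.
have k10 : 0 <= k1 by rewrite /k1 !mulr_ge0 ?exprn_ge0.
have B00' : 0 <= `|B0| by [].
exists (k1 + (KP * `|B0| + BP + KQ + (BP * BR + BQ) * k1)).
  have p1 : 0 <= KP * `|B0| by apply: mulr_ge0.
  have p2 : 0 <= (BP * BR + BQ) * k1 by apply: mulr_ge0 => //; apply: addr_ge0 => //; apply: mulr_ge0.
  by apply: addr_ge0 => //; apply: addr_ge0 => //; apply: addr_ge0 => //; apply: addr_ge0.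
have [dR1 _] := ana_dv aR1.
have H1 := endsI (endsI Hw (endsI (hlam 1) hreg)) (endsI (endsI Hx HP) (endsI HQ Hreg)).
have H2 := endsI (endsI (ends_w rX) (ends_w rR)) (endsI (ends_w hR1) (endsI (ends_w hBR) (ends_w hX1))).
have H3 := endsI (endsI (ends_w dR1) ref_okp) (endsI (ends_z r20) (ends_z r30)).
apply: endsS (endsI H1 (endsI H2 H3)) => t t01.
move=> [[[[xs w0 Xw wb] [l1 [_ WB]]] [[hx hP] [hQ [rg rg']]]] [[[eX eR] [rW [bR X2]]] [[dRw [ok ok']] [[_ z2] [_ z3]]]]].
have [_ _ _ eXw dom] := hom xs; rewrite -/(w_ t) in eXw dom.
have dX : der (fun z => xi z (f1 t z) (f2 t z)) (g t) (xi' (g t) (y1 t) (y2 t)) := germ_D hgerm t01 dxi ok.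
have dWg : der (fun z => W z (f1 t z) (f2 t z)) (g t) (W' (g t) (y1 t) (y2 t)) := germ_D hgerm t01 dW ok.
have [y1E y2E _ _] := hgerm t01.
pose omz z := om (xi z (f1 t z) (f2 t z)).
have omzE : omz (g t) = w_ t by rewrite /omz -y1E -y2E.
pose w' := (dv Xf (w_ t))^-1 * xi' (g t) (y1 t) (y2 t).
have dw : der omz (g t) w'.
  apply: (der_comp (f := fun z => xi z (f1 t z) (f2 t z)) (g := om)); first exact: dX.
  by rewrite -y1E -y2E.
pose s := q%:R * w_ t ^+ (q - 1).
pose ll := 1 - (0 + q%:R * omz (g t) ^+ (q - 1) * w').
have X0' : dv Xf (w_ t) != 0.
  by rewrite -nm_gt0; apply: lt_trans X2; rewrite divr_gt0.
(* Along the series dw/dz times q w^(q-1) is 1; subtracting this turns [ll] into a difference of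
   [xi'] at the two points. *)
have one : s * ((dv Xf (w_ t))^-1 * xi' (zt t) (x1 t) (x2 t)) = 1.
  by rewrite mulrCA -(eX w0) mulVf.
have sw : s * w' = 1 - ll by rewrite /ll add0r omzE opprB addrC subrK.
have llE : ll = s * ((dv Xf (w_ t))^-1 * (xi' (zt t) (x1 t) (x2 t) - xi' (g t) (y1 t) (y2 t))).
  by rewrite !mulrBr one -/w' sw opprB addrC subrK.
have llk : nm ll <= k1 * del_ t.
  have D0 : 0 <= del_ t by rewrite addr_ge0 ?nm_ge0.
  have -> : k1 * del_ t = q%:R * e ^+ (q - 1) * (2 * (Kx * del_ t)) by rewrite /k1; ring.
  have hs : nm s * lam t ^ (- d%:Z + pz) <= q%:R * e ^+ (q - 1).
    rewrite pz_dq nmM nm_nat nmX; have /andP[_ we] := wb.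
    exact: pole_scale q_gt0 (le_trans ler01 l1) (nm_ge0 _) we.
  rewrite nmBC in hx; rewrite llE; exact: (step_bound Kx0 D0 hs X2 hx).
rewrite -/(w_ t) in z2 z3.
have hP' : nm (P (g t) (y1 t) (y2 t) - P (zt t) (x1 t) (x2 t)) <= KP * del_ t by move: hP; rewrite expr0z mulr1.
have hQ' : nm (Q (g t) (y1 t) (y2 t) - Q (zt t) (x1 t) (x2 t)) <= KQ * del_ t by move: hQ; rewrite expr0z mulr1.
have bP := HBP _ _ _ _ z2 rg'; rewrite expr0z mulr1 in bP.
have bQ := HBQ _ _ _ _ z3 rg'; rewrite expr0z mulr1 in bQ.
have WB' : nm (W (g t) (y1 t) (y2 t)) <= `|B0| by apply: le_trans WB _; exact: ler_norm.
exists (fun z => z - (z1 + omz z ^+ q)), (fun z => W z (f1 t z) (f2 t z) - R1 (omz z)), ll,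
  (W' (g t) (y1 t) (y2 t) - dv R1 (w_ t) * w'); split.
- exact: derB (der_id _) (derD (der_cst _ _) (derX q dw)).
- apply: derB dWg _; rewrite -omzE in dRw *; exact: der_comp dw dRw.
- move=> a b a0 b1_ tab; apply: pnrS (halong a0 b1_ tab) => s' [e1' e2'].
  rewrite /u1_ /u2_ /wt_ e1' e2'; split; reflexivity.
have -> : dv R1 (w_ t) * w' = W' (zt t) (x1 t) (x2 t) * (1 - ll).
  rewrite -sw (eR w0) -/s [RHS]mulrCA [RHS]mulrA; reflexivity.
have hu2 : nm (W (g t) (y1 t) (y2 t) - R1 (w_ t)) <= del_ t by rewrite /del_ lerDr; exact: nm_ge0.
have rW' : W (zt t) (x1 t) (x2 t) = R1 (w_ t) := rW w0.
rewrite (hW ok) (hW ok') rW' [leRHS]mulrDl.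
exact: (lerD llk (germ_bound BP0 BR0 hP' hQ' bP bQ WB' bR hu2 llk)).
Qed.
Lemma deviation_zero : ends (fun t => u1_ t = 0 /\ u2_ t = 0).
Proof.
have [Kt Kt0 [T T01 HT]] := u_germs; have /andP[T0 T1] := T01.
pose phi t := Num.min (nm (u1_ t) + nm (u2_ t)) 1.
pose E := expR (2 * (Kt + 1) * (V 1 - V 0)).
have gron a b : T < a -> a <= b -> b < 1 -> phi a <= phi b * E.
  move=> Ta ab_ b1_; have a0 : 0 <= a by exact: le_trans T0 (ltW Ta).
  have gV : tame_path a b g V by apply: tame_sub hV => //; exact: ltW.
  have [|h _] := gronwall_germs (u1 := u1_) (u2 := u2_) gV Kt0.
    move=> t /andP[at_ tb].
    have [||U1 [U2 [l1 [l2 [D1 D2 ha hl]]]]] := HT t; [exact: lt_le_trans at_|exact: le_lt_trans tb b1_|].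
    by exists U1, U2, l1, l2; split => //; apply: ha => //; rewrite at_.
  apply: le_trans h _; apply: ler_wpM2l; first by rewrite /phi le_min ler01 andbT addr_ge0 ?nm_ge0.
  rewrite ler_expR; apply: ler_wpM2l; first by rewrite mulr_ge0 //; apply: addr_ge0.
  by have /andP[] := V_bound hV a0 ab_ (ltW b1_).
have E0 : 0 < E by exact: expR_gt0.
exists T => // t Tt t1.
have small e : 0 < e -> phi t <= e.
  move=> e0; have d0_ : 0 < e / E / 4 by rewrite !divr_gt0.
  have near0 : ends (fun s => nm (R1 (w_ s) - R1 0) < e / E / 4) by exact: (ends_w (ctn_close (ana_ctn aR1) d0_)).
  have [T' /andP[T'0 T'1] HT'] := endsI (ends_z d0_) near0.
  have mx : Num.max t T' < 1 by rewrite gt_max t1.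
  (* Here the adjustment of the free parameter is used: at b, W is close to R1 0, and so is R1 at
     the branch parameter, which tends to 0. *)
  have [b [bt b1_ hb_]] := hcl d0_ mx.
  move: bt; rewrite gt_max => /andP[tb T'b].
  have [[k1 k2] k3] := HT' b T'b b1_.
  apply: le_trans (gron t b Tt (ltW tb) b1_) _.
  rewrite -ler_pdivlMr // /phi ge_min; apply/orP; left.
  have := nmD3 (W (g b) (y1 b) (y2 b)) (R1 0) (R1 (w_ b)); have := nmD3 (g b) z1 (zt b).
  rewrite -/(u1_ b) -/(u2_ b) (nmBC z1) (nmBC (R1 0)); move: (e / E) hb_ k1 k2 k3 => x; lra.
have : phi t <= 0 by apply/ler_addgt0Pr => e e0; rewrite add0r; exact: small.
rewrite /phi ge_min => /orP[|]; last by rewrite ler10.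
have := nm_ge0 (u1_ t); have := nm_ge0 (u2_ t) => n2 n1 h.
have z_1 : nm (u1_ t) <= 0 by lra. have z_2 : nm (u2_ t) <= 0 by lra.
by split; apply/eqP; rewrite -nm_le0.
Qed.
Lemma on_branch r : 0 < r -> ends (fun t => exists w, [/\ w != 0, nm w < r, g t = z1 + w ^+ q,
  y1 t = w ^- b1 * psum A w & y2 t = w ^- a1 * psum B w]).
Proof.
move=> r0; have [K K0 HK] := rho_bound; have [e e1 Hw] := w_facts.
have hr : nr 0 (fun w : C => nm w < r) by apply: nrS (@nr_lt _ 0 _ r0) => x; rewrite subr0.
apply: endsS (endsI (endsI HK Hw) (endsI (endsI deviation_zero (ends_w hr)) (endsI rho_facts ref_okp))).
move=> t _ [[h [_ w0 _ _]] [[[e1_ e2_] wr] [[r1 r2] [_ [_ x10 x20]]]]].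
exists (w_ t); split => //.
- by apply/eqP; rewrite -subr_eq0; apply/eqP.
- move: h; rewrite /del_ e1_ e2_ nm0 addr0 mulr0 nm_le0 subr_eq0 => /eqP h.
  by move: r1; rewrite h exp1rz => /eqP; rewrite -subr_eq0 -(inj_eq (mulIf x10)) mul0r mulrBl divfK // mul1r subr_eq0 => /eqP.
- move: h; rewrite /del_ e1_ e2_ nm0 addr0 mulr0 nm_le0 subr_eq0 => /eqP h.
  by move: r2; rewrite h exp1rz => /eqP; rewrite -subr_eq0 -(inj_eq (mulIf x20)) mul0r mulrBl divfK // mul1r subr_eq0 => /eqP.
Qed.
End Inverse.

Lemma ends_on_branch r : 0 < r -> ends (fun t => exists w, [/\ w != 0, nm w < r, g t = z1 + w ^+ q,
  y1 t = w ^- b1 * psum A w & y2 t = w ^- a1 * psum B w]).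
Proof.
have [aX X0 X1] := Xf_facts.
have [rho1 [sig [om [rho10 sig0 hX hom]]]] := inverse_function aX X0 X1.
by move=> r0; apply: (on_branch (om := om) (sig := sig) (rho1 := rho1)).
Qed.
End Matching.

(** * Selection of the series solution *)

(** x^d - tau0^d is x - tau0 times a factor that tends to d tau0^(d-1), which is nonzero. *)
Lemma power_isolated (R : realType) (d : nat) (tau0 : Cx R) : (0 < d)%N -> tau0 != 0 -> exists (K r : R), [/\ 0 < K, 0 < r &
  forall x, nm (x - tau0) < r -> nm (x - tau0) <= K * nm (x ^+ d - tau0 ^+ d)].
Proof.
move=> d0 t0.
pose S x : Cx R := \sum_(i < d) x ^+ (d.-1 - i) * tau0 ^+ i.
have cS : ctn S tau0.
  apply: (@ctn_sum _ d (fun i x => x ^+ (d.-1 - i) * tau0 ^+ i)) => i _.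
  by apply: ctnM; [apply: ctnX; exact: ctn_id|exact: ctn_cst].
have S0 : S tau0 != 0.
  have -> : S tau0 = d%:R * tau0 ^+ d.-1.
    rewrite /S (eq_bigr (fun=> tau0 ^+ d.-1)) ?sumr_const ?card_ord ?mulr_natl // => i _.
    by rewrite -exprD subnK // -ltnS prednK.
  by rewrite mulf_neq0 ?expf_neq0 // -nm_gt0 nm_nat ltr0n.
have n0 : 0 < nm (S tau0) by rewrite nm_gt0.
have h : nm (S tau0) / 2 < nm (S tau0) by lra.
have [r r0 H] := ctn_nm_gt cS h.
exists (2 / nm (S tau0)), r; split => //; first by rewrite divr_gt0.
move=> x /H hx; rewrite subrXX nmM -/(S x).
have h2 : 1 <= 2 / nm (S tau0) * nm (S x).
  move: n0 hx; move: (nm (S tau0)) (nm (S x)) => u v u0 uv; rewrite mulrAC ler_pdivlMr // mul1r; lra.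
rewrite mulrCA; have := ler_wpM2l (nm_ge0 (x - tau0)) h2; rewrite mulr1; exact.
Qed.
(** No distance to z lies between e and r; as e <= r/2, a step shorter than r/2 cannot cross this
    gap. *)
Lemma clopen (R : realType) (x y z : Cx R) (r e : R) : nm (x - y) < r / 2 ->
  (nm (x - z) < r -> nm (x - z) < e) -> (nm (y - z) < r -> nm (y - z) < e) -> e <= r / 2 ->
  (nm (x - z) < r) = (nm (y - z) < r).
Proof.
move=> xy hx hy er; have h1 := nmD3 x y z; have h2 := nmD3 y x z; rewrite (nmBC y x) in h2.
by apply/idP/idP => h; [have := hx h|have := hy h]; lra.
Qed.
Lemma low_power (R : realType) (l : R) (k : int) : l ^ (k - 1 + - k) = l^-1.
Proof. by rewrite -exprN1; congr (_ ^ _); lia. Qed.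

(** * Convergence of the type of the solution *)

Section TypeLimit.
Variable R : realType.
Local Notation C := (Cx R).
Variables (M N : nat) (alpha : nat -> nat -> C -> C) (U : C -> Prop).
Local Notation az := (M.+1%:Z).
Local Notation bz := (N.+1%:Z).
Local Notation al := (alpha M.+1 0%N).
Local Notation be := (alpha 0%N N.+1).
Local Notation En := (En M N alpha).
Local Notation lau := (lau M N U).
Local Notation okp := (okp U).
Local Notation rh1 := (rhs1 M N alpha).
Local Notation rh2 := (rhs2 M N alpha).
Local Notation reg := (reg M N).
Hypothesis MN2 : (2 <= M * N)%N.
Hypothesis hU : forall z, U z -> nr z U.
Hypothesis halpha : forall i j, inS M N i j -> forall z, U z -> ana z (alpha i j).
Hypothesis hal : forall z, U z -> al z != 0.
Hypothesis hbe : forall z, U z -> be z != 0.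
Variables (W : C -> C -> C -> C).
Hypotheses (lWE : lau (az * bz - 1) (fun z y1 y2 => W z y1 y2 - En z y1 y2)).
Variables (d a1 b1 : nat).
Hypotheses (Md : M.+1 = (a1 * d)%N) (Nd : N.+1 = (b1 * d)%N).
Variables (g : R -> C) (V : R -> R) (y1 y2 : R -> C) (f1 f2 : R -> C -> C).
Hypothesis hV : tame_path 0 1 g V.
Hypothesis Ug : U (g 1).
Local Notation z1 := (g 1).
Hypothesis hgerm : forall t, 0 <= t < 1 -> [/\ y1 t = f1 t (g t), y2 t = f2 t (g t),
  der (f1 t) (g t) (rh1 (g t) (y1 t) (y2 t)) & der (f2 t) (g t) (rh2 (g t) (y1 t) (y2 t))].
Hypothesis halong : forall a b t, 0 <= a -> b < 1 -> a <= t <= b ->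
  pnr a b t (fun s => y1 s = f1 t (g s) /\ y2 s = f2 t (g s)).
Variables (lam : R -> R) (c B0 : R).
Hypothesis c1 : 1 <= c.
Hypothesis hreg : ends (fun t => reg c (lam t) (y1 t) (y2 t) /\ nm (W (g t) (y1 t) (y2 t)) <= B0).
Hypothesis hlam : forall L, ends (fun t => L <= lam t).

Definition tau_ t := y1 t ^+ a1 / y2 t ^+ b1.
Local Notation c0 := (- (be z1 / al z1)).

Lemma ends_frq (P1 P2 : R -> Prop) : ends P1 -> frq P2 -> frq (fun t => P1 t /\ P2 t).
Proof.
move=> [T /andP[T0 T1] h] fr T' T1'.
have mx : Num.max T T' < 1 by rewrite gt_max T1.
have [t [t1 t2 P2t]] := fr _ mx; move: t1; rewrite gt_max => /andP[t1 t3].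
by exists t; split => //; split => //; exact: h.
Qed.
Lemma frqT : frq (fun _ : R => True).
Proof. by move=> T T1; exists ((T + 1) / 2); split => //; lra. Qed.
Lemma frqS (P1 P2 : R -> Prop) : (forall t, P1 t -> P2 t) -> frq P1 -> frq P2.
Proof. by move=> H fr T /fr[t [t1 t2 p]]; exists t; split => //; exact: H. Qed.

Lemma tau_pow t : tau_ t ^+ d = y1 t ^+ M.+1 * y2 t ^- N.+1.
Proof. by rewrite /tau_ exprMn exprVn -!exprM Md Nd. Qed.
Lemma tau_bounded : exists K, ends (fun t => nm (tau_ t) <= K).
Proof.
have h : lau 0 (fun z v1 v2 => (fun=> 1) z * (v1 ^ a1%:Z * v2 ^ (- b1%:Z))).
  by apply: lau_mono; [exact: anaU_cst|rewrite /wgt Md Nd !PoszM; nia].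
have [K [r [K0 r0 HK]]] := lau_bound hU Ug c1 h.
exists K; apply: endsS (endsI (ends_near hV r0) hreg) => t _ [h1 [h2 _]].
have := HK _ _ _ _ h1 h2; by rewrite expr0z mulr1 mul1r -exprnP -exprnN.
Qed.
(** W is bounded and y2 tends to infinity, so W / y2^(N+1) tends to 0, as do its terms below top
    weight; what is left is al tau^d + be. *)
Lemma tau_power_limit e : 0 < e -> ends (fun t => nm (tau_ t ^+ d - c0) < e).
Proof.
move=> e0.
have ai : anaU U (fun z => (al z)^-1) by apply: anaU_inv hal _; exact: (anaU_al halpha).
have h1 : lau (- (az * bz)) (fun z v1 v2 => (al z)^-1 * (v1 ^ 0 * v2 ^ (- bz))).
  by apply: lau_mono => //; rewrite /wgt; lia.
have [K1 [r1 [K10 r10 H1]]] := lau_bound hU Ug c1 h1.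
have [K2 [r2 [K20 r20 H2]]] := lau_bound hU Ug c1 (lau_mul lWE h1).
have cq : ctn (fun z => be z / al z) z1.
  by apply: ctnM; [exact: ana_ctn (anaU_be halpha Ug)|exact: ana_ctn (ai _ Ug)].
have e2 : 0 < e / 2 by lra.
have Uz : nr z1 U := hU Ug.
pose L := Num.max 1 (2 * (K1 * `|B0| + K2) / e + 1).
apply: endsS (endsI (endsI (ends_near hV r10) (ends_near hV r20)) (endsI (endsI hreg (hlam L)) (endsI (ends_nr hV (cq _ e2)) (ends_nr hV Uz)))).
move=> t _ [[z11 z12] [[[rg WB] lL] [hq Ut]]].
have [y10 y20] := reg_neq0 c1 rg.
have l1 : 1 <= lam t by apply: le_trans lL; rewrite le_max lexx.
have lL2 : 2 * (K1 * `|B0| + K2) / e + 1 <= lam t by apply: le_trans lL; rewrite le_max lexx orbT.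
have l0 : 0 < lam t by exact: lt_le_trans ltr01 l1.
have b1_ := H1 _ _ _ _ z11 rg; have b2_ := H2 _ _ _ _ z12 rg.
have p1 : lam t ^ (- (az * bz)) <= (lam t)^-1.
  by rewrite -exprN1; apply: ler_weXz2l => //; move: MN2; lia.
have p2 : lam t ^ (az * bz - 1 + - (az * bz)) = (lam t)^-1.
  exact: low_power.
rewrite p2 in b2_; rewrite !expr0z !mul1r -!exprnN in b1_ b2_.
have key : tau_ t ^+ d - c0 = W (g t) (y1 t) (y2 t) * ((al (g t))^-1 / y2 t ^+ N.+1) -
   (W (g t) (y1 t) (y2 t) - En (g t) (y1 t) (y2 t)) * ((al (g t))^-1 / y2 t ^+ N.+1) -
   (be (g t) / al (g t) - be z1 / al z1).
  rewrite tau_pow En_def; have := hal Ut; have := expf_neq0 N.+1 y20; have := hal Ug.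
  move: (y1 t ^+ _) (y2 t ^+ _) (al (g t)) (be (g t)) (al z1) (be z1) (W _ _ _) => x y a b a' b' w a0' y0 a0.
  by field; rewrite a0 a0' y0.
have m1 : nm (W (g t) (y1 t) (y2 t) * ((al (g t))^-1 / y2 t ^+ N.+1)) <= `|B0| * (K1 / lam t).
  rewrite nmM; apply: ler_pM; rewrite ?nm_ge0 //; first by apply: le_trans WB _; exact: ler_norm.
  by apply: le_trans b1_ _; apply: ler_wpM2l.
have m3 : `|B0| * (K1 / lam t) + K2 / lam t < e / 2.
  have -> : `|B0| * (K1 / lam t) + K2 / lam t = (K1 * `|B0| + K2) / lam t by ring.
  rewrite ltr_pdivrMr //; move: lL2; rewrite -lerBrDr ler_pdivrMr //; lra.
rewrite key; have := nmB (W (g t) (y1 t) (y2 t) * ((al (g t))^-1 / y2 t ^+ N.+1) - (W (g t) (y1 t) (y2 t) - En (g t) (y1 t) (y2 t)) * ((al (g t))^-1 / y2 t ^+ N.+1)) (be (g t) / al (g t) - be z1 / al z1).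
have := nmB (W (g t) (y1 t) (y2 t) * ((al (g t))^-1 / y2 t ^+ N.+1)) ((W (g t) (y1 t) (y2 t) - En (g t) (y1 t) (y2 t)) * ((al (g t))^-1 / y2 t ^+ N.+1)).
move: b2_ m1 m3 hq; move: (nm (W _ _ _ * _ - _ - _)) (nm (W _ _ _ * _ - _)) (nm (W _ _ _ * _)) (nm ((W _ _ _ - _) * _)) (nm (be _ / _ - _)).
move: (`|B0| * _) (K2 / _) => x1 x2 u1 u2 u3 u4 u5; lra.
Qed.

Lemma tau_close t e : 0 <= t < 1 -> y2 t != 0 -> 0 < e -> forall a b, 0 <= a -> b < 1 -> a <= t <= b ->
  pnr a b t (fun s => nm (tau_ s - tau_ t) < e).
Proof.
move=> tt y20 e0 a b a0 b1_ tab; have [E1 E2 D1 D2] := hgerm tt.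
have ct : ctn (fun z => f1 t z ^+ a1 / f2 t z ^+ b1) (g t).
  apply: ctnM; first exact: ctnX (der_ctn D1).
  by apply: ctnV; [rewrite -E2 expf_neq0|exact: ctnX (der_ctn D2)].
have hV' : tame_path a b g V by have /andP[h1 h2] := tab; apply: tame_sub hV => //; [exact: le_trans h2|exact: ltW].
apply: (pnrS2 _ (tame_near hV' tab (ct e e0)) (halong a0 b1_ tab)) => s h1 [h2 h3].
by rewrite /tau_ h2 h3 E1 E2.
Qed.

Lemma type_limit : exists tau0 Winf : C, [/\ tau0 ^+ d = c0,
  forall e, 0 < e -> ends (fun t => nm (tau_ t - tau0) < e) &
  forall e, 0 < e -> frq (fun t => nm (W (g t) (y1 t) (y2 t) - Winf) < e)].
Proof.
have [K HK] := tau_bounded.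
have [|tau0 [Winf Hc]] := @frq_cluster_pair R tau_ (fun t => W (g t) (y1 t) (y2 t)) (Num.max K B0).
  apply: frqS (ends_frq (endsI HK hreg) frqT) => t [[h1 [_ h2]] _].
  by rewrite !le_max h1 h2 orbT.
have d0 : (0 < d)%N by case: (d) Md => //; rewrite muln0.
have t0E : tau0 ^+ d = c0.
  apply/eqP; rewrite -subr_eq0 -nm_eq0 eq_le nm_ge0 andbT; apply/ler_addgt0Pr => e e0; rewrite add0r.
  have e2 : 0 < e / 2 by lra.
  have cX : ctn (fun x : C => x ^+ d) tau0 by apply: ctnX; exact: ctn_id.
  have [r r0 Hr] := cX _ e2.
  have [t [_ _ [h1 [h2 _]]]] := ends_frq (tau_power_limit e2) (Hc r r0) ltr01.
  rewrite (splitr e); apply: le_trans (nmD3 _ (tau_ t ^+ d) _) _; rewrite (nmBC (tau0 ^+ d)).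
  by apply: ltW; apply: ltrD; [exact: Hr|].
exists tau0, Winf; split => //; last by move=> e e0; apply: frqS (Hc e e0) => t [].
have t00 : tau0 != 0.
  apply: contra_neq (_ : c0 != 0); last by rewrite oppr_eq0 mulf_neq0 ?invr_eq0 ?hbe ?hal.
  by rewrite -t0E => ->; rewrite expr0n (gtn_eqF d0).
have [Ki [r [Ki0 r0 Hi]]] := power_isolated d0 t00.
move=> e e0; pose e' := Num.min e (r / 2).
have e'0 : 0 < e' by rewrite lt_min e0 divr_gt0.
have [e'1 e'2] : e' <= e /\ e' <= r / 2 by rewrite /e' !ge_min !lexx orbT.
have eK : 0 < e' / Ki by rewrite divr_gt0.
have [T /andP[T0 T1] HT] := endsI (tau_power_limit eK) hreg.
have near_ t : T < t -> t < 1 -> nm (tau_ t - tau0) < r -> nm (tau_ t - tau0) < e'.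
  move=> Tt t1 hr; have [hp _] := HT t Tt t1; apply: le_lt_trans (Hi _ hr) _.
  by rewrite t0E mulrC -ltr_pdivlMr.
have [t0 [t01 t02 [h0 _]]] := Hc r r0 T T1.
have t0p : 0 <= t0 by exact: le_trans T0 (ltW t01).
exists t0; first by rewrite t0p.
move=> b tb b1_.
(* The indicator of the disk of radius r around tau0 is locally constant along the path by [clopen];
   [path_lip] with V = 0 makes it constant. *)
pose Psi t : R := (nat_of_bool (nm (tau_ t - tau0) < r))%:R.
have : `|Psi b - Psi t0| <= 0 - 0.
  apply: (@path_lip _ t0 b Psi (fun=> 0)) => //; first exact: ltW.
  move=> t /andP[t1 t2]; have tt : 0 <= t < 1 by rewrite (le_trans t0p t1) (le_lt_trans t2 b1_).
  have Tt : T < t by exact: lt_le_trans t1.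
  have [_ [rg _]] := HT t Tt (le_lt_trans t2 b1_); have [_ y20] := reg_neq0 c1 rg.
  have r2 : 0 < r / 2 by lra.
  have tab : t0 <= t <= b by rewrite t1.
  have [e1 e10 He] := tau_close tt y20 r2 t0p b1_ tab.
  exists e1 => // s ss st; have hs := He s ss st; have /andP[s1 s2] := ss.
  have cl := clopen hs (near_ s (lt_le_trans t01 s1) (le_lt_trans s2 b1_)) (near_ t Tt (le_lt_trans t2 b1_)) e'2.
  have e2 : Psi s = Psi t by rewrite /Psi cl.
  by rewrite e2 subrr normr0 normr_ge0.
rewrite subr0 normr_le0 subr_eq0 => /eqP hP.
apply: lt_le_trans e'1; apply: near_; [exact: lt_trans tb|exact: b1_|].
apply: contraT => hn; have /eqP := oner_neq0 R; case.
by rewrite -[LHS]/(true%:R) -h0 -/(Psi t0) -hP /Psi (negbTE hn).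
Qed.
End TypeLimit.

(** From (M+1)(N+1) = (MN-1) + (M+1) + (N+1), the gcd of M+1 and N+1 already divides MN - 1, so it
    equals d. *)
Lemma exponents (M N : nat) (d := gcdn (gcdn M.+1 N.+1) (M * N - 1)) : (2 <= M * N)%N ->
  [/\ M.+1 = (M.+1 %/ d * d)%N, N.+1 = (N.+1 %/ d * d)%N, (M * N - 1 = d * ((M * N - 1) %/ d))%N &
    coprime (M.+1 %/ d) (N.+1 %/ d)].
Proof.
move=> MN2; set g := gcdn M.+1 N.+1 in d *.
have g0 : (0 < g)%N by rewrite gcdn_gt0.
have gM : (g %| M.+1)%N := dvdn_gcdl _ _. have gN : (g %| N.+1)%N := dvdn_gcdr _ _.
have gp : (g %| M * N - 1)%N.
  have e : (M.+1 * N.+1 = (M * N - 1) + (M.+1 + N.+1))%N by lia.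
  by have := dvdn_mulr N.+1 gM; rewrite e dvdn_addl // dvdn_add.
have dg : d = g by apply/gcdn_idPl.
split; rewrite dg; [by rewrite divnK|by rewrite divnK|by rewrite (mulnC g) divnK|].
by rewrite /coprime -(eqn_pmul2r g0) mul1n muln_gcdl !divnK.
Qed.
Lemma bezout_int (a b : nat) : coprime a b -> exists m n : int, b%:Z * m + a%:Z * n = 1.
Proof.
move=> cop; have : coprimez b a by rewrite coprimezE /= coprime_sym.
by case/coprimezP=> -[u v] /= e; exists u, v; rewrite mulrC (mulrC a%:Z).
Qed.
(** The relations between c1 and c2 turn both summands into nonnegative rational multiples of c1 c2,
    the second one nonzero, so they cannot cancel. *)
Lemma slope_neq0 (F : numFieldType) (M N p : nat) (a b c1 c2 : F) : (0 < M)%N -> (0 < p)%N ->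
  c1 != 0 -> c2 != 0 -> c1 = - (p%:R * b * c2 ^+ N) -> c2 = p%:R * a * c1 ^+ M ->
  a * (M.+1%:R * c1 ^+ M * (N%:R * c1)) + b * (N.+1%:R * c2 ^+ N * (- (M%:R * c2))) != 0.
Proof.
move=> M0 p0 c10 c20 e1 e2.
have p0' : p%:R != 0 :> F by rewrite pnatr_eq0 -lt0n.
have -> : a * (M.+1%:R * c1 ^+ M * (N%:R * c1)) + b * (N.+1%:R * c2 ^+ N * (- (M%:R * c2))) =
  ((p%:R * a * c1 ^+ M) * (M.+1%:R * N%:R * c1) + (- (p%:R * b * c2 ^+ N)) * (N.+1%:R * M%:R * c2)) / p%:R.
  by move: (c1 ^+ M) (c2 ^+ N) => x y; field.
rewrite -e1 -e2.
have -> : c2 * (M.+1%:R * N%:R * c1) + c1 * (N.+1%:R * M%:R * c2) = c1 * c2 * (M.+1 * N + N.+1 * M)%:R.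
  by rewrite natrD !natrM; ring.
rewrite !mulf_neq0 ?invr_eq0 // pnatr_eq0 addn_eq0 !muln_eq0 /= negb_and.
by rewrite (gtn_eqF M0) orbT.
Qed.

Section SelectBranch.
Variable R : realType.
Local Notation C := (Cx R).
Variables (M N : nat) (alpha : nat -> nat -> C -> C) (U : C -> Prop).
Local Notation az := (M.+1%:Z).
Local Notation bz := (N.+1%:Z).
Local Notation al := (alpha M.+1 0%N).
Local Notation be := (alpha 0%N N.+1).
Local Notation En := (En M N alpha).
Local Notation lau := (lau M N U).
Local Notation okp := (okp U).
Local Notation isD := (isD M N alpha U).
Hypothesis MN2 : (2 <= M * N)%N.
Hypothesis hU : forall z, U z -> nr z U.
Hypothesis halpha : forall i j, inS M N i j -> forall z, U z -> ana z (alpha i j).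
Hypothesis hal : forall z, U z -> al z != 0.
Hypothesis hbe : forall z, U z -> be z != 0.
Variables (d a1 b1 q : nat).
Hypotheses (Md : M.+1 = (a1 * d)%N) (Nd : N.+1 = (b1 * d)%N) (qd : (M * N - 1 = d * q)%N).
Hypothesis cop : coprime a1 b1.
Hypothesis htaylor : forall i j, inS M N i j -> forall z, U z -> exists u, taylor_at (alpha i j) z u.
Hypothesis hformal : forall z0 c1 c2, U z0 -> admissible M N alpha z0 c1 c2 ->
  forall t : nat -> nat -> nat -> C, (forall i j, inS M N i j -> taylor_at (alpha i j) z0 (t i j)) ->
  exists A B : nat -> C, [/\ A 0%N = c1, B 0%N = c2 & formal_solution M N (M * N - 1) t (N.+1, A) (M.+1, B)].

Lemma branch_family z0 c1 c2 : U z0 -> admissible M N alpha z0 c1 c2 ->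
  [/\ c1 = - ((M * N - 1)%:R * be z0 * c2 ^+ N), c2 = (M * N - 1)%:R * al z0 * c1 ^+ M &
  exists A0 B0 : C -> C, forall kap : C, exists (A B : nat -> C) (S T : C -> C),
    [/\ is_branch M N alpha a1 b1 q z0 A B, A 0%N = c1 /\ B 0%N = c2, ana 0 S /\ ana 0 T,
     S 0 = kap * (N%:R * c1) /\ T 0 = - (kap * (M%:R * c2)) &
     nr 0 (fun w => psum A w = A0 w + w ^+ (a1 * b1 * d) * S w /\ psum B w = B0 w + w ^+ (a1 * b1 * d) * T w)]].
Proof.
move=> Uz adm; have [c10 c20 _ _] := adm.
apply: (branches MN2 Md Nd qd c10 c20 _ (hformal Uz adm)) => i j h; [exact: halpha|exact: htaylor].
Qed.
Lemma branch_exists z0 c1 c2 : U z0 -> admissible M N alpha z0 c1 c2 ->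
  exists A B : nat -> C, [/\ is_branch M N alpha a1 b1 q z0 A B, A 0%N = c1 & B 0%N = c2].
Proof.
move=> Uz adm; have [_ _ [A0 [B0 H]]] := branch_family Uz adm.
by have [A [B [S [T [h [e1 e2] _ _ _]]]]] := H 0; exists A, B.
Qed.

Variables (W W' P Q : C -> C -> C -> C) (z1 tau Winf : C).
Hypotheses (lW : lau (az * bz) W) (lP : lau 0 P) (lQ : lau 0 Q) (dW : isD W W')
  (lWE : lau (az * bz - 1) (fun z y1 y2 => W z y1 y2 - En z y1 y2)).
Hypothesis hW : forall z y1 y2, okp z y1 y2 -> W' z y1 y2 = P z y1 y2 * W z y1 y2 + Q z y1 y2.
Hypothesis Uz1 : U z1.
Hypothesis htau : tau ^+ d = - (be z1 / al z1).

Lemma select_branch : exists (A B : nat -> C) (R1 : C -> C),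
  [/\ is_branch M N alpha a1 b1 q z1 A B, A 0%N != 0 /\ B 0%N != 0, A 0%N ^+ a1 = tau * B 0%N ^+ b1,
    ana 0 R1 /\ R1 0 = Winf & nr 0 (fun w => w != 0 -> rf z1 a1 b1 q (psum A) (psum B) W w = R1 w)].
Proof.
have htau' : tau ^+ d = - be z1 / al z1 by rewrite htau mulNr.
have [c1 [c2 [adm ct]]] := admissible_type hal hbe MN2 Md Nd qd cop Uz1 htau'.
have [c10 c20 _ _] := adm.
have [e1 e2 [A0 [B0 fam]]] := branch_family Uz1 adm.
have value A B : is_branch M N alpha a1 b1 q z1 A B -> A 0%N = c1 -> B 0%N = c2 ->
   exists2 R1 : C -> C, ana 0 R1 & nr 0 (fun w => w != 0 -> rf z1 a1 b1 q (psum A) (psum B) W w = R1 w).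
  move=> hb eA eB; have A00 : A 0%N != 0 by rewrite eA. have B00 : B 0%N != 0 by rewrite eB.
  have lQ' : lau (az * bz - az - bz - 1) Q by apply: lau_le lQ; move: MN2; lia.
  have [] := branch_W hU MN2 Md Nd qd cop (k := fun _ _ => 0) Uz1 hb A00 B00 dW lW lP lQ' => //.
    by move=> l; exact: anaU_cst.
  by move=> z x y ok; rewrite hW // big1 ?add0r // => l _; rewrite mul0r.
have ca A B : is_branch M N alpha a1 b1 q z1 A B -> ctn (psum A) 0 /\ ctn (psum B) 0.
  by move=> [gA gB _]; split; apply: ana_ctn; [exists A|exists B] => //; apply: nrW => x; rewrite subr0.
have [A [B [S [T [hb [eA eB] [aS aT] [eS eT] hp]]]]] := fam 0.
have [R1 aR1 hR1] := value _ _ hb eA eB.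
(* The derivative with respect to kap of the limit of W on the family, from [family_value] with S 0
   = kap N c1 and T 0 = -kap M c2. *)
pose sl := al z1 * (M.+1%:R * c1 ^+ M * (N%:R * c1)) + be z1 * (N.+1%:R * c2 ^+ N * (- (M%:R * c2))).
have sl0 : sl != 0.
  by apply: slope_neq0 e1 e2 => //; move: MN2; case: (M) => // k; lia.
(* The parameter solves the affine equation for the value Winf, with kap = 0 as origin. *)
have [A' [B' [S' [T' [hb' [eA' eB'] [aS' aT'] [eS' eT'] hp']]]]] := fam ((Winf - R1 0) / sl).
have [R1' aR1' hR1'] := value _ _ hb' eA' eB'.
exists A', B', R1'; split; rewrite ?eA' ?eB' //; split => //.
have [cA cB] := ca _ _ hb; have [cA' cB'] := ca _ _ hb'.
have h : nr 0 (fun w => psum A' w - psum A w = w ^+ (a1 * b1 * d) * (S' w - S w) /\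
   psum B' w - psum B w = w ^+ (a1 * b1 * d) * (T' w - T w)).
  apply: nrS2 hp hp' => w [h1 h2] [h3 h4]; rewrite h1 h2 h3 h4; move: (w ^+ _) => x; split; ring.
have lim X Y F : nr 0 (fun w => w != 0 -> rf z1 a1 b1 q X Y W w = F w) -> ana 0 F -> pto (rf z1 a1 b1 q X Y W) (F 0).
  by move=> hF aF; apply: pto_ext (pto_ctn (ana_ctn aF)); apply: nrS hF => w H w0; rewrite H.
have p0 (X : nat -> C) x : X 0%N = x -> psum X 0 = x by rewrite psum0.
have E := family_value hU Uz1 halpha MN2 Md Nd qd lWE (And4 cA' cB' cA cB)
  (etrans (p0 _ _ eA') (esym (p0 _ _ eA))) (etrans (p0 _ _ eB') (esym (p0 _ _ eB)))
  (eq_ind_r (fun x => x != 0) c10 (p0 _ _ eA')) (eq_ind_r (fun x => x != 0) c20 (p0 _ _ eB'))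
  (ctnB (ana_ctn aS') (ana_ctn aS)) (ctnB (ana_ctn aT') (ana_ctn aT)) h (lim _ _ _ hR1' aR1') (lim _ _ _ hR1 aR1).
move: E; rewrite !psum0 eA' eB'.
rewrite eS eT eS' eT' !mul0r subr0 oppr0 subr0 => E.
have : R1' 0 - R1 0 = (Winf - R1 0) / sl * sl by rewrite E /sl; ring.
by rewrite divfK // => /addIr.
Qed.
End SelectBranch.

(** * From values along the path to germs, and the conclusion *)

Section Extension.
Variable R : realType.
Local Notation C := (Cx R).
Variables (M N : nat) (alpha : nat -> nat -> C -> C) (O : set C).
Hypothesis hO : open O.
Hypothesis halpha : forall i j, inS M N i j -> analytic_on O (alpha i j).

(** The matching argument yields equality only at the point g t. Read in w both sides solve the same
    system, so uniqueness along segments from w0 extends the equality to a neighbourhood. *)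
Lemma germ_on_branch (f1 f2 : C -> C) (z1 zt w0 : C) (rt : R) (q : nat) (X1 X2 : C -> C) (e : R) :
  (0 < q)%N -> 0 < rt -> z1 + w0 ^+ q = zt -> w0 != 0 -> nm w0 < e ->
  (forall z, nm (z - zt) < rt -> [/\ O z, der f1 z (rhs1 M N alpha z (f1 z) (f2 z)) &
     der f2 z (rhs2 M N alpha z (f1 z) (f2 z))]) ->
  (forall w, nm w < e -> w != 0 ->
    der X1 w (q%:R * w ^+ (q - 1) * rhs1 M N alpha (z1 + w ^+ q) (X1 w) (X2 w)) /\
    der X2 w (q%:R * w ^+ (q - 1) * rhs2 M N alpha (z1 + w ^+ q) (X1 w) (X2 w))) ->
  f1 zt = X1 w0 -> f2 zt = X2 w0 ->
  exists2 eps : R, 0 < eps & forall w, nm (w - w0) < eps -> [/\ nm (z1 + w ^+ q - zt) < rt,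
    f1 (z1 + w ^+ q) = X1 w & f2 (z1 + w ^+ q) = X2 w].
Proof.
move=> q0 rt0 zE w00 w0e hf hb E1 E2.
have cz w : ctn (fun w : C => z1 + w ^+ q) w by apply: ctnD; [exact: ctn_cst|exact: ctnX (ctn_id _)].
have n1 : nr w0 (fun w => nm (z1 + w ^+ q - zt) < rt) by have := cz w0 _ rt0; rewrite zE.
have n2 : nr w0 (fun w => w != 0) := ctn_neq0 (ctn_id w0) w00.
have n3 : nr w0 (fun w => nm w < e) := ctn_nm_lt (ctn_id w0) w0e.
have [eps eps0 H] := nrI n1 (nrI n2 n3); exists eps; first exact: eps0.
move=> w1 hw1.
split; first by have [] := H _ hw1.
all: have [] := @segment_uniqueness R M.+2 N.+2 (coef1 M N alpha) (coef2 M N alpha)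
   (fun w => z1 + w ^+ q) (fun w => q%:R * w ^+ (q - 1)) (fun w => f1 (z1 + w ^+ q)) (fun w => f2 (z1 + w ^+ q))
   X1 X2 w0 w1; rewrite ?zE //.
all: move=> s s01 w.
all: have [h1 [h2 h3]] : nm (z1 + w ^+ q - zt) < rt /\ w != 0 /\ nm w < e
  by (apply: H; apply: nm_segment_at => //; rewrite subrr nm0).
all: have [Oz D1 D2] := hf _ h1; have [B1 B2] := hb _ h3 h2.
all: have dz : der (fun w : C => z1 + w ^+ q) w (q%:R * w ^+ (q - 1)) by
  (apply: (der_eq (l := 0 + q%:R * w ^+ (q - 1) * 1)); [rewrite add0r mulr1|exact: derD (der_cst _ _) (derX q (der_id w))]).
all: split; [exact: cz|exact: ctnM (ctn_cst _ _) (ctnX _ (ctn_id _))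
  |by move=> i j _ _; have [k1 k2] := ana_coefs (fun i j h => alpha_ana halpha Oz h) i j; split; apply: ana_ctn
  |by rewrite -rhs1E -rhs2E; split; rewrite mulrC; apply: der_comp
  |by rewrite -rhs1E -rhs2E; exact: (conj B1 B2)].
Qed.
End Extension.

Section Representation.
Variable R : realType.
Local Notation C := (Cx R).
Variables (M N : nat) (O : set C) (alpha : nat -> nat -> C -> C).
Hypothesis MN2 : (2 <= M * N)%N.
Hypothesis hO : open O.
Hypothesis halpha : forall i j, inS M N i j -> analytic_on O (alpha i j).
Local Notation al := (alpha M.+1 0%N).
Local Notation be := (alpha 0%N N.+1).
(** The points of Omega off Phi. *)
Definition regular_point (z : C) := [/\ O z, al z != 0 & be z != 0].
Local Notation U := regular_point.
Hypothesis hformal : forall z0 c1 c2, U z0 -> admissible M N alpha z0 c1 c2 ->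
  forall t : nat -> nat -> nat -> C, (forall i j, inS M N i j -> taylor_at (alpha i j) z0 (t i j)) ->
  exists A B : nat -> C, [/\ A 0%N = c1, B 0%N = c2 & formal_solution M N (M * N - 1) t (N.+1, A) (M.+1, B)].

Lemma regular_ana i j : inS M N i j -> forall z, U z -> ana z (alpha i j).
Proof. by move=> h z [Oz _ _]; exact: (alpha_ana halpha Oz h). Qed.
Lemma regular_near z : U z -> nr z U.
Proof.
move=> Uz; have [Oz az bz] := Uz.
have n1 := ctn_neq0 (ana_ctn (regular_ana (inS_a M N) Uz)) az.
have n2 := ctn_neq0 (ana_ctn (regular_ana (inS_b M N) Uz)) bz.
by apply: nrS2 (O_near hO Oz) (nrI n1 n2) => w h [h1 h2].
Qed.
Lemma regular_al z : U z -> al z != 0. Proof. by case. Qed.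
Lemma regular_be z : U z -> be z != 0. Proof. by case. Qed.
Lemma regular_taylor i j : inS M N i j -> forall z, U z -> exists u, taylor_at (alpha i j) z u.
Proof. by move=> h z [Oz _ _]; exact: halpha h _ Oz. Qed.

Variables (g : R -> C) (V : R -> R) (hV : tame_path 0 1 g V).
Hypothesis hgO : forall s, 0 <= s <= 1 -> O (g s).
Variables (r : R -> C) (f1 f2 : R -> C -> C).
Hypothesis hcont : continuation_upto M N alpha O g r f1 f2.
Hypothesis hnot : ~ continues_to_end M N alpha O g r f1 f2.
Hypothesis Ug : U (g 1).
Variables (d a1 b1 q : nat).
Hypotheses (Md : M.+1 = (a1 * d)%N) (Nd : N.+1 = (b1 * d)%N) (qd : (M * N - 1 = d * q)%N).
Hypothesis cop : coprime a1 b1.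
Local Notation y1 := (fun t => f1 t (g t)).
Local Notation y2 := (fun t => f2 t (g t)).

Lemma end_branch : exists A B : nat -> C, is_branch M N alpha a1 b1 q (g 1) A B /\
  forall e : R, 0 < e -> ends (fun t => exists w, [/\ w != 0, nm w < e, g t = g 1 + w ^+ q,
    f1 t (g t) = w ^- b1 * psum A w & f2 t (g t) = w ^- a1 * psum B w]).
Proof.
have hb := branch_exists MN2 regular_ana Md Nd qd regular_taylor hformal.
have [G [P [Q [GD [lG lP lQ dG hW]]]]] :=
  reduced_zero regular_near regular_ana regular_al regular_be MN2 Md Nd qd cop hb.
have hgerm t : 0 <= t < 1 -> [/\ y1 t = f1 t (g t), y2 t = f2 t (g t),
    der (f1 t) (g t) (rhs1 M N alpha (g t) (y1 t) (y2 t)) & der (f2 t) (g t) (rhs2 M N alpha (g t) (y1 t) (y2 t))].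
  move=> tt; have [rt0 H] := germ_disk hcont tt.
  have [|Oz _ D1 D2] := H (g t); first by rewrite subrr nm0.
  by split => //; rewrite ?rhs1E ?rhs2E.
have halong a b t : 0 <= a -> b < 1 -> a <= t <= b ->
    pnr a b t (fun s => y1 s = f1 t (g s) /\ y2 s = f2 t (g s)).
  by move=> a0 b1_ /andP[at_ tb]; apply: (germ_along hcont (le_trans a0 at_) b1_ a0); rewrite at_.
have hblow := solution_blows_up hO halpha hV hgO hcont hnot.
(* A choice of the scale at each parameter; the bounds above hold for every value satisfying
   [scale]. *)
pose lam t := sval (cid (scale_exists M N (y1 t) (y2 t))).
have lamP t : scale M N (lam t) (y1 t) (y2 t) := svalP (cid (scale_exists M N (y1 t) (y2 t))).
have [B0 [c [c1 hbound]]] := W_bounded MN2 regular_near regular_ana regular_al regular_be lG lP lQ dG hW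
  hV Ug hgerm halong hblow.
have hreg : ends (fun t => reg M N c (lam t) (y1 t) (y2 t) /\ nm (Wf M N alpha G (g t) (y1 t) (y2 t)) <= B0).
  by apply: endsS hbound => t _; apply.
have hlam L : ends (fun t => L <= lam t).
  have [T T01 H] := @ends_scale R M N y1 y2 hblow L; exists T; first exact: T01.
  by move=> t Tt t1; exact: (H t Tt t1 _ (lamP t)).
have lWE := lau_W_E MN2 regular_ana lG; have lW := lau_W MN2 regular_ana lG.
have dW := isD_add (isD_Hm regular_ana) dG.
have [tau0 [Winf [ht htype hcl]]] := type_limit MN2 regular_near regular_ana regular_al regular_be lWE Md Nd
  hV Ug hgerm halong c1 hreg hlam.
have [A [B [R1 [hbr [A0 B0'] hAB [aR1 eR1] hR1]]]] := select_branch MN2 regular_near regular_ana regular_al regular_be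
  Md Nd qd cop regular_taylor hformal Winf lW lP lQ dW lWE hW Ug ht.
exists A, B; split => // e e0.
have [m [n bez]] := bezout_int cop.
rewrite -eR1 in hcl.
exact: (ends_on_branch MN2 regular_near regular_ana regular_al lP lQ dW lWE hW Md Nd qd bez hV Ug hgerm halong
  hbr A0 B0' hAB aR1 hR1 c1 hreg hlam htype hcl e0).
Qed.
End Representation.

Unset Implicit Arguments.

(** A branch of (z - g 1)^(1/q) near g t is encoded by a root w0 and the map sending w to g 1 + w^q
    near w0, so the expansion is in integer powers of w. The coefficient sequences are common to all
    late t; index n of [C1] belongs to the exponent n - (N+1)/d of w. *)
Theorem theorem1 (M N : nat) (hM : (0 < M)%N) (hN : (0 < N)%N)
  (hMN : (2 <= M * N)%N)
  (R : realType) (O : set (Cx R)) (hO : cdomain O)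
  (alpha : nat -> nat -> Cx R -> Cx R)
  (halpha : forall i j, inS M N i j -> analytic_on O (alpha i j))
  (hformal : forall z0 : Cx R, O z0 ->
     alpha M.+1 0%N z0 != 0 -> alpha 0%N N.+1 z0 != 0 ->
     forall t : nat -> nat -> nat -> Cx R,
       (forall i j, inS M N i j -> taylor_at (alpha i j) z0 (t i j)) ->
     forall c1 c2 : Cx R,
       c1 ^+ (M * N - 1) = - (alpha 0%N N.+1 z0 * alpha M.+1 0%N z0 ^+ N
                                * (M * N - 1)%:R ^+ N.+1)^-1 ->
       c2 = (M * N - 1)%:R * alpha M.+1 0%N z0 * c1 ^+ M ->
       exists A B : nat -> Cx R, [/\ A 0%N = c1, B 0%N = c2 &
         formal_solution M N (M * N - 1) t (N.+1, A) (M.+1, B)])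
  (g : R -> Cx R) (hgc : {within `[0, 1], continuous g})
  (hgl : finite_length g) (hgO : forall s, 0 <= s <= 1 -> O (g s))
  (hend1 : alpha M.+1 0%N (g 1) != 0) (hend2 : alpha 0%N N.+1 (g 1) != 0)
  (r : R -> Cx R) (f1 f2 : R -> Cx R -> Cx R)
  (hcont : continuation_upto M N alpha O g r f1 f2)
  (hnot : ~ continues_to_end M N alpha O g r f1 f2) :
  let p := (M * N - 1)%N in
  let d := gcdn (gcdn M.+1 N.+1) p in
  let q := (p %/ d)%N in
  exists (C1 C2 : nat -> Cx R) (rho : Cx R),
    [/\ 0 < rho,
      (forall w : Cx R, 0 < `|w| < rho ->
         cvgn (series (fun n => C1 n * w ^+ n)) /\
         cvgn (series (fun n => C2 n * w ^+ n))) &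
      exists2 t0 : R, t0 < 1 & forall t, 0 <= t -> t0 < t -> t < 1 ->
        exists w0 : Cx R, [/\ w0 ^+ q = g t - g 1, 0 < `|w0| < rho &
          exists2 eps : Cx R, 0 < eps & forall w : Cx R, `|w - w0| < eps ->
            [/\ `|g 1 + w ^+ q - g t| < r t,
                f1 t (g 1 + w ^+ q) =
                  w ^- (N.+1 %/ d) * limn (series (fun n => C1 n * w ^+ n)) &
                f2 t (g 1 + w ^+ q) =
                  w ^- (M.+1 %/ d) * limn (series (fun n => C2 n * w ^+ n))]]].
Proof.
move=> p d q.
have [hOo _ _] := hO.
have [V hV] := length_tame hgc hgl.
have [Md Nd qd cop] := exponents hMN; rewrite -/p -/d in Md Nd qd cop.
have g1O : O (g 1) by apply: hgO; rewrite ler01 lexx.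
have Ug : regular_point M N O alpha (g 1) by [].
have hfor z0 c1 c2 : regular_point M N O alpha z0 -> admissible M N alpha z0 c1 c2 ->
    forall t : nat -> nat -> nat -> Cx R, (forall i j, inS M N i j -> taylor_at (alpha i j) z0 (t i j)) ->
    exists A B : nat -> Cx R, [/\ A 0%N = c1, B 0%N = c2 & formal_solution M N (M * N - 1) t (N.+1, A) (M.+1, B)].
  by move=> [Oz az bz] [_ _ e1 e2] t ht; exact: hformal Oz az bz t ht c1 c2 e1 e2.
have [A [B [[[KA [rA [KA0 rA0 gA]]] [KB [rB [KB0 rB0 gB]]] [e e0 hb]] hend]]] :=
  end_branch hMN hOo halpha hfor hV hgO hcont hnot Ug Md Nd qd cop.
have q0 : (0 < q)%N by have [] := level_pos hMN Md Nd qd.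
(* Inside the disk where the differential equations hold and inside both radii of convergence. *)
pose rho := Num.min e (Num.min rA^-1 rB^-1).
have rho0 : 0 < rho by rewrite !lt_min e0 !invr_gt0 rA0.
have [re [ra rb]] : rho <= e /\ rho <= rA^-1 /\ rho <= rB^-1 by rewrite /rho !ge_min !lexx !orbT.
have small (w : Cx R) : 0 < `|w| < rc rho -> w != 0 /\ nm w < rho.
  by rewrite normr_gt0 nm_lt => /andP[].
have cvg_at (K s : R) c (w : Cx R) : 0 < s -> gb K s c -> rho <= s^-1 -> nm w < rho -> cvgn (series (fun n => c n * w ^+ n)).
  move=> s0 hc rs wr; have sw : s * nm w < 1 by rewrite -ltr_pdivlMl // mulr1; exact: lt_le_trans rs.
  exact: psum_cvgn s0 hc sw.
exists A, B, (rc rho); split; first by rewrite rc_gt0.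
  move=> w /small[_ wr]; split; [exact: cvg_at rA0 gA ra wr|exact: cvg_at rB0 gB rb wr].
have [T /andP[T0 T1] HT] := hend rho rho0.
exists T => // t t0 Tt t1; have [w0 [w00 w0r gE F1 F2]] := HT t Tt t1.
have tt : 0 <= t < 1 by rewrite t0.
have [rt0 hf] := germ_disk hcont tt.
have [] := @germ_on_branch R M N alpha O halpha (f1 t) (f2 t) (g 1) (g t) w0 (nm (r t)) q
  (fun w => w ^- (N.+1 %/ d) * psum A w) (fun w => w ^- (M.+1 %/ d) * psum B w) e q0 rt0 (esym gE) w00 (lt_le_trans w0r re).
- by move=> z /hf[Oz _ D1 D2]; split; rewrite ?rhs1E ?rhs2E.
- by move=> w we wn0; apply: hb => //; rewrite subr0.
- exact: F1.
- exact: F2.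
move=> eps eps0 Heps; exists w0; split.
- by rewrite gE [g 1 + _]addrC addrK.
- by rewrite normr_gt0 w00 nm_lt.
exists (rc eps); first by rewrite rc_gt0.
move=> w; rewrite nm_lt => /Heps[h1 h2 h3]; split; [|exact: h2|exact: h3].
by have [_ h _ _] := hf _ h1.
Qed.
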